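(* Let $F$ be a closed, orientable surface of genus $g\ge 1$ and let $I$ be a closed interval. Then the complexity of $F\times I$ is $$c(F\times I)=10g-4.$$
   Context: The complexity $c(M)$ of a compact 3-manifold $M$ is the minimal number of tetrahedra in a semi-simplicial triangulation of $M$. Here a (semi-simplicial, or singular) triangulation of $M$ consists of a finite disjoint union of 3-simplices together with pairings of some of their faces whose quotient is (homeomorphic to) $M$, where the quotient map is injective on the interior of each simplex of each dimension; unpaired faces form $\partial M$. Surfaces are connected. *)

(* Defs.v *)
From HB Require Import structures.
From mathcomp Require Import all_boot all_order all_fingroup all_algebra.
From mathcomp Require Import all_classical all_reals all_analysis.
From Stdlib Require Import Relation_Operators.

Set Implicit Arguments.
Unset Strict Implicit.
Unset Printing Implicit Defensive.

Import Order.TTheory GRing.Theory Num.Theory.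
Import numFieldNormedType.Exports.

Local Open Scope classical_set_scope.
Local Open Scope ring_scope.
Local Open Scope quotient_scope.

Definition homeomorphism (X Y : topologicalType) (f : X -> Y) : Prop :=
  continuous f /\
  exists g : Y -> X, [/\ continuous g, cancel f g & cancel g f].

Definition homeomorphic (X Y : topologicalType) : Prop :=
  exists f : X -> Y, homeomorphism f.

Definition locally_euclidean_at (R : realType) (d : nat)
    (M : topologicalType) (x : M) : Prop :=
  exists (U : set M) (V : set 'rV[R]_d),
    [/\ open U, U x, open V & homeomorphic (set_type U) (set_type V)].

Definition manifold_boundary (R : realType) (d : nat) (M : topologicalType) :
    set M :=
  [set x | ~ locally_euclidean_at R d x].

Arguments manifold_boundary : clear implicits.

(* The standard d-simplex, in barycentric coordinates. *)
Definition simplex (R : realType) (d : nat) : set 'rV[R]_d.+1 :=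
  [set p | (forall i, 0 <= p 0 i) /\ \sum_i p 0 i = 1].

Arguments simplex : clear implicits.

(* Pairings of some of the facets of n disjoint d-simplices, each with vertices
   'I_d.+1.  Facet i of a simplex is the one opposite its vertex i, and
   [pairing t i = Some (t', s)] says that facet i of simplex t is glued to facet
   s i of simplex t' by the affine map sending vertex j to vertex s j (j != i);
   [None] marks an unpaired facet.  A facet is never paired with itself. *)
Record face_pairing (d n : nat) := FacePairing {
  pairing :> 'I_n -> 'I_d.+1 -> option ('I_n * 'S_d.+1);
  pairing_sym : forall t i t' s, pairing t i = Some (t', s) ->
    pairing t' (s i) = Some (t, s^-1%g);
  pairing_irr : forall t i t' s, pairing t i = Some (t', s) ->
    (t', s i) <> (t, i) }.

Section Realization.
Variables (R : realType) (d n : nat) (T : face_pairing d n).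

Definition simplices : topologicalType :=
  {t : 'I_n & set_type (simplex R d)}.

Definition bary (x : simplices) : 'rV[R]_d.+1 := set_val (tagged x).

Definition glued (x y : simplices) : Prop :=
  exists (i : 'I_d.+1) (s : 'S_d.+1),
    [/\ T (tag x) i = Some (tag y, s), bary x 0 i = 0
      & forall j, bary y 0 (s j) = bary x 0 j].

Definition glue_rel (x y : simplices) : bool :=
  `[< clos_refl_sym_trans simplices glued x y >].

Lemma glue_rel_refl : reflexive glue_rel.
Proof. by move=> x; apply/asboolP/rst_refl. Qed.

Lemma glue_rel_sym : symmetric glue_rel.
Proof. by move=> x y; apply/asboolP/asboolP => ?; exact: rst_sym. Qed.

Lemma glue_rel_trans : transitive glue_rel.
Proof.
by move=> y x z /asboolP xy /asboolP yz; apply/asboolP/(rst_trans _ _ _ y).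
Qed.

Definition glue_equiv :=
  EquivRel glue_rel glue_rel_refl glue_rel_sym glue_rel_trans.

Definition realization : topologicalType :=
  quotient_topology {eq_quot glue_equiv}.

Definition to_realization (x : simplices) : realization :=
  \pi_({eq_quot glue_equiv})%qT x.

(* Two points of one simplex lie in the interior of the same face (of any
   dimension) iff the same barycentric coordinates vanish at both. *)
Definition injective_on_interiors : Prop :=
  forall x y : simplices, tag x = tag y ->
    (forall i, (bary x 0 i == 0) = (bary y 0 i == 0)) ->
    to_realization x = to_realization y -> x = y.

Definition unpaired_points : set simplices :=
  [set x | exists i, T (tag x) i = None /\ bary x 0 i = 0].

Definition triangulates (M : topologicalType) : Prop :=
  injective_on_interiors /\
  exists h : realization -> M, homeomorphism h /\
    [set h (to_realization x) | x in unpaired_points] = manifold_boundary R d M.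

End Realization.

Definition is_complexity (R : realType) (M : topologicalType) (c : nat) : Prop :=
  (exists T : face_pairing 3 c, triangulates R T M) /\
  (forall (n : nat) (T : face_pairing 3 n), triangulates R T M -> (c <= n)%N).

Section Combinatorics.
Variables (d n : nat) (T : face_pairing d n).

(* A face of one of the n simplices is a pair (simplex, set of vertices). *)
Definition face_glued (a b : 'I_n * {set 'I_d.+1}) : bool :=
  [exists i, exists s : 'S_d.+1,
    [&& i \notin a.2, T a.1 i == Some (b.1, s) & b.2 == s @: a.2]].

(* The number of k-simplices after gluing. *)
Definition num_faces (k : nat) : nat :=
  n_comp face_glued [pred a : 'I_n * {set 'I_d.+1} | #|a.2| == k.+1].

Definition euler_char : int :=
  \sum_(k < d.+1) (-1) ^+ k * (num_faces k)%:Z.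

(* Coherent orientations: o t says whether simplex t carries the orientation of
   its vertex ordering.  The identity pairing of two simplices along a facet is
   a reflection, so it must reverse o; in general o is reversed exactly by the
   even permutations. *)
Definition orientable : Prop :=
  exists o : 'I_n -> bool,
    forall t i t' (s : 'S_d.+1), T t i = Some (t', s) ->
      o t (+) o t' = ~~ odd_perm s.

End Combinatorics.

(* Surfaces are connected (and nonempty).  Orientability and the genus, given by
   euler_char = 2 - 2g, are read off a triangulation of the surface. *)
Definition closed_surface (R : realType) (F : topologicalType) : Prop :=
  [/\ [set: F] !=set0, connected [set: F], compact [set: F],
      hausdorff_space F & manifold_boundary R 2 F = set0].

Definition closed_orientable_surface (R : realType) (g : nat)
    (F : topologicalType) : Prop :=
  closed_surface R F /\
  exists (n : nat) (T : face_pairing 2 n),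
    [/\ triangulates R T F, orientable T & euler_char T = 2 - 2 * g%:Z].

(* Main.v *)
(* Cutting a triangulation of F into flags and cancelling dipoles gives a map on F with one vertex and
   one face, hence 2g edges.

   Upper bound: cut the face into 4g - 2 triangles without new vertices and join each triangle, on the
   lower end of F x I, to the centre of the face on the upper end; do the same for the dual map with
   the two ends exchanged; join each edge of the map to its dual edge.  At height s the three families
   of tetrahedra fill the flag coordinates y with y2 >= s, with y0 >= 1 - s, and the remaining ones.

   Lower bound: label the vertices of a tetrahedron by whether they lie on a chosen end of F x I.  The
   bases of the tetrahedra with three vertices on the end form a mod 2 cycle which, by a Sperner count,
   has odd degree over F.  An odd cycle does not lift to the double cover given by a non-zero class of
   H^1(F; Z/2); so a minimal odd cycle carries all 2g classes and has at least 4g - 2 triangles, and a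
   non-zero class cannot vanish on all tetrahedra with two vertices on the end, of which there are
   therefore at least 2g.  The two ends give 2(4g - 2) + 2g different tetrahedra. *)
Require Import Defs.
From HB Require Import structures.
From mathcomp Require Import all_boot all_order all_fingroup all_algebra.
From mathcomp Require Import all_classical all_reals all_analysis.
From mathcomp Require Import zify ring lra.
From Stdlib Require Import Relation_Operators Operators_Properties.
Import Order.TTheory GRing.Theory Num.Theory.
Import numFieldNormedType.Exports.
Set Implicit Arguments.
Unset Strict Implicit.
Unset Printing Implicit Defensive.
Local Open Scope classical_set_scope.
Local Open Scope ring_scope.

(** * Simplices and realizations *)

Section SimplexTopology.
Variable R : realType.

(** Genus and orientability are given only through one triangulation of F, while the tetrahedra of F
    x I project to F by arbitrary continuous maps. The surface is therefore handled as a gem: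
    triangles with coloured vertices, glued by three involutions, together with maps onto F whose
    fibres are exactly the orbits. Every move on gems carries such maps along, so the space F itself
    is never replaced. Cohomology enters as boolean functions on lists of points. A point of a
    tetrahedron is labelled by a nearby vertex of a fine gem of F, and cochains of F are summed over
    iterated barycentric subdivisions of the tetrahedra. A map with one vertex and one face serves
    both bounds. Every boolean function on its 2g edges closes up around the only vertex and defines
    a double cover, connected unless the function is 0, which gives 2g independent classes; and its
    only face is a polygon with 4g sides, cut into 4g - 2 triangles, in the map as in its dual. *)

Lemma continuous_row n (X : topologicalType) (f : X -> 'I_n -> R) :
  (forall i, continuous (f ^~ i)) -> continuous (fun x => \row_i f x i : 'rV[R]_n).
Proof.
move=> cf x; apply/cvgrPdist_lt => e e0.
have : \forall y \near x, forall i, `|f x i - f y i| < e.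
  by apply: filter_forall => i; move/cvgrPdist_lt: (cf i x); apply.
apply: filterS => y H; rewrite /Num.norm /= mx_normrE.
apply: bigmax_lt => // -[i j] _; rewrite !mxE; exact: H.
Qed.

Lemma continuous_coord n (i : 'I_n) : continuous (fun v : 'rV[R]_n => v 0 i).
Proof. exact: coord_continuous. Qed.

Lemma continuous_coordP n (X : topologicalType) (f : X -> 'rV[R]_n) :
  (forall i, continuous (fun x => f x 0 i)) -> continuous f.
Proof.
move=> cf; rewrite (_ : f = fun x => \row_i f x 0 i).
  exact: continuous_row.
by apply/funext => x; apply/rowP => i; rewrite mxE.
Qed.

Lemma coord_norm n (v : 'rV[R]_n) i : `|v 0 i| <= `|v|.
Proof.
rewrite [X in _ <= X]/Num.norm /= mx_normrE.
by apply/bigmax_geP; right; exists (0, i).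
Qed.

Lemma rV_norm_lt n (v : 'rV[R]_n) e : 0 < e -> (forall i, `|v 0 i| < e) -> `|v| < e.
Proof.
move=> e0 H; rewrite /Num.norm /= mx_normrE.
by apply: bigmax_lt => // -[i j] _ /=; rewrite (ord1 i).
Qed.

Lemma rV_norm_le n (v : 'rV[R]_n) e : 0 <= e -> (forall i, `|v 0 i| <= e) -> `|v| <= e.
Proof.
move=> e0 H; rewrite /Num.norm /= mx_normrE.
by apply: bigmax_le => // -[i j] _ /=; rewrite (ord1 i).
Qed.

Lemma continuous_bigsum (X : topologicalType) (I : Type) (r : seq I) (f : X -> I -> R) :
  (forall i, continuous (f ^~ i)) -> continuous (fun x => \sum_(i <- r) f x i).
Proof.
move=> cf; elim: r => [|i r IH].
  rewrite (_ : (fun _ => _) = cst 0); first by move=> x; apply: cvg_cst.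
  by apply/funext => x; rewrite big_nil.
rewrite (_ : (fun _ => _) = fun x => f x i + \sum_(j <- r) f x j).
  by move=> x; apply: cvgD; [exact: cf | exact: IH].
by apply/funext => x; rewrite big_cons.
Qed.

Lemma continuous_const (X Y : topologicalType) (c : Y) : continuous (fun _ : X => c).
Proof. exact: cst_continuous. Qed.

Lemma continuous_maxr (X : topologicalType) (f g : X -> R) :
  continuous f -> continuous g -> continuous (fun x => Num.max (f x) (g x)).
Proof. by move=> cf cg x; apply: (@continuous_max R X f g x); [exact: cf|exact: cg]. Qed.

Lemma continuous_addr (X : topologicalType) (f g : X -> R) :
  continuous f -> continuous g -> continuous (fun x => f x + g x).
Proof. by move=> cf cg x; apply: cvgD; [exact: cf|exact: cg]. Qed.

Lemma continuous_subr (X : topologicalType) (f g : X -> R) :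
  continuous f -> continuous g -> continuous (fun x => f x - g x).
Proof. by move=> cf cg x; apply: cvgB; [exact: cf|exact: cg]. Qed.

Lemma continuous_mulr (X : topologicalType) (f g : X -> R) :
  continuous f -> continuous g -> continuous (fun x => f x * g x).
Proof. by move=> cf cg x; apply: cvgM; [exact: cf|exact: cg]. Qed.

Lemma continuous_minr (X : topologicalType) (f g : X -> R) :
  continuous f -> continuous g -> continuous (fun x => Num.min (f x) (g x)).
Proof.
move=> cf cg; rewrite (_ : (fun _ => _) = fun x => f x + g x - Num.max (f x) (g x)).
  by apply: continuous_subr (continuous_maxr cf cg); apply: continuous_addr.
by apply/funext => x; rewrite -(addr_max_min (f x) (g x)) addrAC subrr add0r.
Qed.

Lemma simplex_le1 d (v : 'rV[R]_d.+1) i : simplex R d v -> v 0 i <= 1.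
Proof.
move=> [v0 <-]; rewrite (bigD1 i) //= lerDl.
by apply: sumr_ge0 => j _; apply: v0.
Qed.

Lemma closed_preim (X Y : topologicalType) (f : X -> Y) (D : set Y) :
  continuous f -> closed D -> closed (f @^-1` D).
Proof. by move=> /continuous_closedP; apply. Qed.

Lemma simplex_closed d : closed (simplex R d).
Proof.
rewrite (_ : simplex R d = (\bigcap_(i in [set: 'I_d.+1])
   ((fun v : 'rV[R]_d.+1 => v 0 i) @^-1` [set x | 0 <= x])) `&`
   ((fun v : 'rV[R]_d.+1 => \sum_i v 0 i) @^-1` [set x | x = 1])).
  apply: closedI; last first.
    apply: closed_preim (@closed_eq R 1); apply: continuous_bigsum => i; exact: continuous_coord.
  apply: closed_bigI => i _; apply: closed_preim (@closed_ge R 0); exact: continuous_coord.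
apply/seteqP; split => v /=; first by move=> [H1 H2]; split => // i _; apply: H1.
by move=> [H1 H2]; split => // i; apply: H1.
Qed.

Lemma simplex_compact d : compact (simplex R d).
Proof.
apply: bounded_closed_compact; last exact: simplex_closed.
exists 1; split => // M M1 v Sv; apply: rV_norm_le; first by rewrite (le_trans _ (ltW M1)).
by move=> i; rewrite ger0_norm ?(le_trans (simplex_le1 _ Sv)) ?(ltW M1) //; case: Sv.
Qed.

Section Clamp.
Variable d : nat.

Definition clamp_mass (v : 'rV[R]_d.+1) : R := Num.max (\sum_i Num.max (v 0 i) 0) 1.

(** A continuous retraction of the whole space onto the simplex, so that maps on simplices can be
    total functions of row vectors. Negative coordinates are cut off, mass above 1 is scaled down,
    and missing mass is added at vertex 0. *)
Definition clamp (v : 'rV[R]_d.+1) : 'rV[R]_d.+1 :=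
  \row_i (Num.max (v 0 i) 0 / clamp_mass v
    + (i == 0)%:R * (1 - (\sum_j Num.max (v 0 j) 0) / clamp_mass v)).

Lemma clamp_simplex v : simplex R d (clamp v).
Proof.
have m0 : 0 < clamp_mass v by rewrite lt_max ltr01 orbT.
have p0 i : 0 <= Num.max (v 0 i) 0 by rewrite le_max lexx orbT.
have s0 : 0 <= \sum_j Num.max (v 0 j) 0 by apply: sumr_ge0.
have q1 : (\sum_j Num.max (v 0 j) 0) / clamp_mass v <= 1.
  by rewrite ler_pdivrMr // mul1r le_max lexx.
split=> [i|].
  rewrite mxE addr_ge0 ?divr_ge0 ?(ltW m0) //.
  by rewrite mulr_ge0 ?ler0n // subr_ge0.
under eq_bigr do rewrite mxE.
rewrite big_split /= -mulr_suml -[X in _ + X]mulr_suml.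
rewrite [X in _ + X * _](bigD1 0) //= [X in _ + (_ + X) * _]big1 => [|i /negbTE -> //].
by rewrite addr0 mul1r addrCA subrr addr0.
Qed.

Lemma clamp_id v : simplex R d v -> clamp v = v.
Proof.
move=> [v0 v1]; apply/rowP => i; rewrite mxE /clamp_mass.
rewrite (eq_bigr (fun i => v 0 i)) => [|j _]; last by rewrite max_l.
by rewrite v1 maxxx !divr1 subrr mulr0 addr0 max_l.
Qed.

Lemma clamp_continuous : continuous clamp.
Proof.
have cp i : continuous (fun v : 'rV[R]_d.+1 => Num.max (v 0 i) 0).
  by apply: continuous_maxr; [exact: continuous_coord|exact: continuous_const].
have cs : continuous (fun v : 'rV[R]_d.+1 => \sum_i Num.max (v 0 i) 0).
  exact: continuous_bigsum.
have cm : continuous (fun v => (clamp_mass v)^-1).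
  move=> v; apply: (@continuous_comp _ _ _ (@clamp_mass) GRing.inv).
    by apply: continuous_maxr => //; exact: continuous_const.
  by apply: inv_continuous; rewrite gt_eqF // lt_max ltr01 orbT.
apply: continuous_row => i; apply: continuous_addr; first exact: continuous_mulr.
apply: continuous_mulr; first by exact: continuous_const.
by apply: continuous_subr; [exact: continuous_const|exact: continuous_mulr].
Qed.

End Clamp.

Lemma compact_image_closed (X M : topologicalType) (K C : set X) (f : X -> M) :
  hausdorff_space M -> continuous f -> compact K -> closed C -> closed (f @` (K `&` C)).
Proof.
move=> hM cf cK cC; apply: compact_closed => //.
apply: continuous_compact; first exact: continuous_subspaceT.
exact: compact_closedI.
Qed.
End SimplexTopology.

(** * Maps on a simplex assembled from finitely many pieces *)

Section Factor.
Variables (R : realType) (M : topologicalType) (d e : nat) (I : finType).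
Variables (E : I -> 'rV[R]_d.+1 -> 'rV[R]_e.+1) (p : I -> 'rV[R]_d.+1 -> M).
Hypothesis cE : forall i, continuous (E i).
Hypothesis cp : forall i, continuous (p i).
Hypothesis E_simplex : forall i v, simplex R d v -> simplex R e (E i v).
Hypothesis E_surj : forall z, simplex R e z -> exists i v, simplex R d v /\ E i v = z.
Hypothesis E_p : forall i j v w, simplex R d v -> simplex R d w ->
  E i v = E j w -> p i v = p j w.

(* A map on a simplex glued from finitely many closed pieces is continuous,
   because a continuous surjection of compact Hausdorff spaces is a quotient
   map. *)
Lemma factor_simplex : exists P : 'rV[R]_e.+1 -> M, continuous P /\
  forall i v, simplex R d v -> P (E i v) = p i v.
Proof.
have [s Hs] : exists s : 'rV[R]_e.+1 -> I * 'rV[R]_d.+1, forall z, simplex R e z ->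
    simplex R d (s z).2 /\ E (s z).1 (s z).2 = z.
  suff /choice[s Hs] : forall z, exists u : I * 'rV[R]_d.+1, simplex R e z ->
    simplex R d u.2 /\ E u.1 u.2 = z by exists s.
  move=> z.
  have [Sz|nz] := pselect (simplex R e z).
    by have [i [v [Sv Ev]]] := E_surj Sz; exists (i, v).
  have [i _] := E_surj (clamp_simplex 0).
  by exists (i, 0).
exists (fun z => p (s (clamp z)).1 (s (clamp z)).2); split; last first.
  move=> i v Sv; have SE := E_simplex i Sv; rewrite (clamp_id SE).
  by have [H1 H2] := Hs _ SE; apply: E_p.
apply/continuous_closedP => C cC.
set P := fun z => _.
have -> : P @^-1` C = @clamp R e @^-1`
    \bigcup_(i in [set: I]) (E i @` (simplex R d `&` (p i @^-1` C))).
  apply/seteqP; split => z /=; rewrite /P; have [H1 H2] := Hs _ (clamp_simplex z).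
    by move=> HC; exists (s (clamp z)).1 => //; exists (s (clamp z)).2.
  by move=> [i _ [v [Sv Cv] Ev]]; rewrite -(@E_p i _ v) ?Ev.
apply: closed_preim; first exact: clamp_continuous.
apply: closed_bigcup => [|i _]; first exact: finite_finset.
  apply: (@compact_image_closed _ 'rV[R]_e.+1).
- exact: norm_hausdorff.
- exact: cE.
- exact: simplex_compact.
- exact: closed_preim.
Qed.

End Factor.

(** * Homeomorphisms from a realization, given simplex by simplex *)

Section Realize.
Variables (R : realType) (d n : nat) (T : face_pairing d n).

Definition point_of (t : 'I_n) (v : 'rV[R]_d.+1) : simplices R d n :=
  existT _ t (exist _ (clamp v) (mem_set (clamp_simplex v))).

Lemma point_of_continuous t : continuous (point_of t).
Proof.
pose c (v : 'rV[R]_d.+1) : set_type (simplex R d) :=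
  exist _ (clamp v) (mem_set (clamp_simplex v)).
have cc : continuous c by apply: continuous_comp_initial => w; exact: clamp_continuous.
move=> v; apply: (@continuous_comp _ _ _ c (existT _ t)); first exact: cc.
exact: (@existT_continuous 'I_n (fun=> set_type (simplex R d))).
Qed.

Lemma tag_point_of t v : tag (point_of t v) = t. Proof. by []. Qed.

Lemma bary_point_of t v : simplex R d v -> bary (point_of t v) = v.
Proof. by move=> Sv; rewrite /bary /= set_valE /= clamp_id. Qed.

Lemma bary_simplex (x : simplices R d n) : simplex R d (bary x).
Proof. by case: x => t [v]; rewrite /bary set_valE /= => /set_mem. Qed.

Lemma point_of_bary (x : simplices R d n) : point_of (tag x) (bary x) = x.
Proof.
case: x => t v; rewrite /point_of /=; congr existT; apply: val_inj => /=.
by rewrite clamp_id //; exact: (bary_simplex (existT _ t v)).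
Qed.

Lemma to_realization_continuous : continuous (@to_realization R d n T).
Proof. exact: pi_continuous. Qed.

Lemma to_realizationP (x y : simplices R d n) :
  to_realization T x = to_realization T y <-> glue_rel T x y.
Proof.
rewrite /to_realization; split => [/eqquotP //|H].
by apply/eqquotP.
Qed.

Lemma to_realization_surj (r : realization R T) : exists x, to_realization T x = r.
Proof.
by exists (generic_quotient.repr (r : {eq_quot glue_equiv R T}%qT)); exact: reprK.
Qed.

Lemma glue_relP (x y : simplices R d n) :
  glue_rel T x y <-> clos_refl_sym_trans _ (@glued R d n T) x y.
Proof. by split => /asboolP. Qed.

Variables (M : topologicalType) (psi : 'I_n -> 'rV[R]_d.+1 -> M).
Hypothesis hM : hausdorff_space M.
Hypothesis cpsi : forall t, continuous (psi t).
Hypothesis psi_surj : forall m, exists t v, simplex R d v /\ psi t v = m.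
Hypothesis psi_glue : forall x y : simplices R d n,
  psi (tag x) (bary x) = psi (tag y) (bary y) <-> glue_rel T x y.

(** The inverse is continuous because the image of a closed set is a finite union of images of
    compact pieces of simplices, closed in the Hausdorff space [M]. A triangulation is thus a family
    of maps [psi] whose fibres are exactly the gluing classes. *)
Lemma realization_homeomorphism : exists h : realization R T -> M,
  homeomorphism h /\ forall x, h (to_realization T x) = psi (tag x) (bary x).
Proof.
pose h0 (x : simplices R d n) := psi (tag x) (bary x).
have /choice[rp rpK] := to_realization_surj.
pose h (r : realization R T) := h0 (rp r).
have hE x : h (to_realization T x) = h0 x.
  apply/psi_glue/to_realizationP; exact: rpK.
have ch0 : continuous h0.
  rewrite (_ : h0 = unstable.sigT_fun (fun t (v : set_type (simplex R d)) => psi t (set_val v))).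
    apply: sigT_continuous => t v; apply: continuous_comp; last exact: cpsi.
    exact: initial_continuous.
  by apply/funext => -[].
have ch : continuous h.
  by apply/quotient_continuous; rewrite (_ : h \o _ = h0) //; apply/funext => x; exact: hE.
exists h; split => //; split => //.
have [g Hg] : exists g : M -> realization R T, forall m, h (g m) = m.
  suff /choice[g Hg] : forall m, exists r, h r = m by exists g.
  move=> m; have [t [v [Sv <-]]] := psi_surj m.
  by exists (to_realization T (point_of t v)); rewrite hE /h0 bary_point_of.
have hg : cancel h g.
  move=> r; rewrite -[RHS]rpK -[LHS]rpK; apply/to_realizationP/psi_glue.
  exact: (Hg (h r)).
exists g; split => //.
apply/continuous_closedP => C cC.
have -> : g @^-1` C = \bigcup_(t in [set: 'I_n]) (psi t @` (simplex R d `&`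
    ((fun v => to_realization T (point_of t v)) @^-1` C))).
  apply/seteqP; split => [m /= Cm|m /= [t _ [v [Sv /= Cv] <-]]].
    have [t [v [Sv vm]]] := psi_surj m; exists t => //; exists v => //; split => //=.
    suff -> : to_realization T (point_of t v) = g m by [].
    by rewrite -(hg (to_realization _ _)) hE /h0 bary_point_of // vm.
  suff -> : g (psi t v) = to_realization T (point_of t v) by [].
  by rewrite -(hg (to_realization _ _)) hE /h0 bary_point_of.
apply: closed_bigcup => [|t _]; first exact: finite_finset.
  apply: compact_image_closed => //.
- exact: simplex_compact.
apply: closed_preim => //= v; apply: continuous_comp; first exact: point_of_continuous.
exact: to_realization_continuous.
Qed.

End Realize.

(** * Gems of surfaces *)

Notation o0 := (@Ordinal 3 0 isT).
Notation o1 := (@Ordinal 3 1 isT).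
Notation o2 := (@Ordinal 3 2 isT).

Lemma I3P (P : 'I_3 -> Prop) : P o0 -> P o1 -> P o2 -> forall i, P i.
Proof.
move=> P0 P1 P2 [[|[|[|//]]] Hi].
- by rewrite (_ : Ordinal Hi = o0) //; apply: val_inj.
- by rewrite (_ : Ordinal Hi = o1) //; apply: val_inj.
- by rewrite (_ : Ordinal Hi = o2) //; apply: val_inj.
Qed.

Lemma sum3 (V : zmodType) (f : 'I_3 -> V) : \sum_i f i = f o0 + f o1 + f o2.
Proof.
rewrite !big_ord_recl big_ord0 addr0 addrA; congr (f _ + f _ + f _); exact: val_inj.
Qed.

Lemma simplex2P (R : realType) (y : 'rV[R]_3) : simplex R 2 y <->
  [/\ 0 <= y 0 o0, 0 <= y 0 o1, 0 <= y 0 o2 & y 0 o0 + y 0 o1 + y 0 o2 = 1].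
Proof.
split=> [[H1 H2]|[H1 H2 H3 H4]]; first by rewrite -sum3; split => //; exact: H1.
by split; [apply: I3P|rewrite sum3].
Qed.

Lemma row3P (R : realType) (y z : 'rV[R]_3) :
  y 0 o0 = z 0 o0 -> y 0 o1 = z 0 o1 -> y 0 o2 = z 0 o2 -> y = z.
Proof. by move=> *; apply/rowP; apply: I3P. Qed.

Definition row3 (R : realType) (a b c : R) : 'rV[R]_3 :=
  \row_i (if i == o0 then a else if i == o1 then b else c).

Lemma row3E (R : realType) (a b c : R) :
  (row3 a b c 0 o0 = a) * (row3 a b c 0 o1 = b) * (row3 a b c 0 o2 = c).
Proof. by rewrite !mxE. Qed.

Section Gem.
Variables (G : finType) (tau : 'I_3 -> G -> G).

Definition is_gem := forall i, involutive (tau i) /\ forall a, tau i a <> a.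

Definition gstep (Z : 'I_3 -> bool) : rel G :=
  [rel a b | [exists i, Z i && (b == tau i a)]].

(** The orbit relation of the involutions with colour in [Z]. If [Z] omits only i, its orbits are
    the vertices of colour i; if [Z] consists of the vanishing coordinates of a point, they are the
    triangles that contain this point. *)
Definition reach (Z : 'I_3 -> bool) : rel G := connect (gstep Z).

Lemma reach_refl Z a : reach Z a a. Proof. exact: connect0. Qed.

Lemma reach_step (Z : 'I_3 -> bool) i a : Z i -> reach Z a (tau i a).
Proof. by move=> Zi; apply: connect1; apply/existsP; exists i; rewrite Zi /=. Qed.

Lemma reach_trans Z a b c : reach Z a b -> reach Z b c -> reach Z a c.
Proof. exact: connect_trans. Qed.

Lemma reach_ind (Z : 'I_3 -> bool) (P : G -> Prop) a b :
  (forall i c, Z i -> P c -> P (tau i c)) -> reach Z a b -> P a -> P b.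
Proof.
move=> HP /connectP[p + ->]; elim: p a => [|c p IH] a //=.
case/andP=> /existsP[i /andP[Zi /eqP ->]] Hp Pa; apply: IH Hp _.
exact: HP.
Qed.

Lemma reach_sym (Z : 'I_3 -> bool) a b : is_gem -> reach Z a b -> reach Z b a.
Proof.
move=> gem H; apply: (reach_ind (P := fun c => reach Z c a)) H _; last exact: reach_refl.
move=> i c Zi; apply: reach_trans; have [tK _] := gem i.
by rewrite -[X in reach _ _ X](tK c); exact: reach_step.
Qed.

Lemma reach_sub (Z Z' : 'I_3 -> bool) a b :
  (forall i, Z i -> Z' i) -> reach Z a b -> reach Z' a b.
Proof.
move=> sub H; apply: (reach_ind (P := fun c => reach Z' a c)) H _; last exact: reach_refl.
by move=> i c Zi; move/reach_trans; apply; apply: reach_step; exact: sub.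
Qed.

Definition zero (R : realType) (y : 'rV[R]_3) : 'I_3 -> bool := fun i => y 0 i == 0.

(* F is the surface obtained from triangles indexed by G, with vertices coloured
   by 'I_3, gluing a to [tau i a] along the edge opposite colour i by the
   colour-preserving map. *)
Definition gempres (R : realType) (F : topologicalType) (q : G -> 'rV[R]_3 -> F) :=
  [/\ forall a, continuous (q a),
      forall x, exists a y, simplex R 2 y /\ q a y = x
    & forall a b y z, simplex R 2 y -> simplex R 2 z ->
        (q a y = q b z <-> y = z /\ reach (zero y) a b)].

End Gem.

(** * Barycentric subdivision of a glued surface *)

Section Triangles.
Variables (R : realType) (F : topologicalType) (I : finType).
Variable g : I -> 'I_3 -> I * 'S_3.
Hypothesis g_sym : forall t i t' s, g t i = (t', s) -> g t' (s i) = (t, s^-1%g).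
Hypothesis g_irr : forall t i t' s, g t i = (t', s) -> (t', s i) <> (t, i).

Definition tstep (u v : I * 'rV[R]_3) : Prop := exists i,
  [/\ u.2 0 i = 0, v.1 = (g u.1 i).1 & forall j, v.2 0 ((g u.1 i).2 j) = u.2 0 j].

Definition tripres (p : I -> 'rV[R]_3 -> F) :=
  [/\ forall t, continuous (p t),
      forall x, exists t y, simplex R 2 y /\ p t y = x
    & forall t t' y y', simplex R 2 y -> simplex R 2 y' ->
        (p t y = p t' y' <-> clos_refl_trans _ tstep (t, y) (t', y'))].

(** A triangle of the subdivision is a flag (t, pi): the vertex [pi o0], the side from [pi o0] to
    [pi o1], and t. Colour k changes the k-dimensional member only; for k = 2 this crosses the side
    opposite [pi o2]. *)
Definition sd_tau (k : 'I_3) (a : I * 'S_3) : I * 'S_3 :=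
  if k == o0 then (a.1, (tperm o0 o1 * a.2)%g) else
  if k == o1 then (a.1, (tperm o1 o2 * a.2)%g) else
  ((g a.1 (a.2 o2)).1, (a.2 * (g a.1 (a.2 o2)).2)%g).

Lemma sd_gem : is_gem sd_tau.
Proof.
have g2 a : exists t' s, g a.1 (a.2 o2) = (t', s) by case: (g _ _) => t' s; exists t', s.
apply: I3P; rewrite /sd_tau /=; split.
- by move=> [t p] /=; rewrite mulgA tperm2 mul1g.
- by move=> [t p] [] /(congr1 (fun u : 'S_3 => (u * p^-1) o0)%g); rewrite mulgK mulgV perm1 tpermL.
- by move=> [t p] /=; rewrite mulgA tperm2 mul1g.
- by move=> [t p] [] /(congr1 (fun u : 'S_3 => (u * p^-1) o1)%g); rewrite mulgK mulgV perm1 tpermL.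
- move=> [t p] /=; case E: (g t (p o2)) => [t' s] /=.
  by rewrite permM (g_sym E) /= mulgK.
- move=> [t p] /=; case E: (g t (p o2)) => [t' s] /= [t'E sE].
  apply: (g_irr E); rewrite t'E; congr pair.
  by rewrite -[in LHS]permM sE.
Qed.

Definition sd_coord (k : 'I_3) (y : 'rV[R]_3) : R :=
  if k == o0 then y 0 o0 + y 0 o1 / 2 + y 0 o2 / 3 else
  if k == o1 then y 0 o1 / 2 + y 0 o2 / 3 else y 0 o2 / 3.

(* Barycentric subdivision: the vertices of the small triangle [pi] are the
   barycentres of the faces {pi 0}, {pi 0, pi 1} and {pi 0, pi 1, pi 2}. *)
Definition sd_map (pi : 'S_3) (y : 'rV[R]_3) : 'rV[R]_3 :=
  \row_v sd_coord (pi^-1%g v) y.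

Lemma sd_mapE pi y k : sd_map pi y 0 (pi k) = sd_coord k y.
Proof. by rewrite mxE permK. Qed.

Lemma sd_map_simplex pi y : simplex R 2 y -> simplex R 2 (sd_map pi y).
Proof.
move=> /simplex2P[H0 H1 H2 H3]; split=> [i|].
  rewrite -(permKV pi i) sd_mapE; move: (pi^-1%g i); apply: I3P; rewrite /sd_coord /=; lra.
rewrite (reindex_inj (@perm_inj _ pi)) /=; under eq_bigr do rewrite sd_mapE.
rewrite sum3 /sd_coord /=; lra.
Qed.

Lemma sd_map_continuous pi : continuous (sd_map pi).
Proof.
apply: continuous_row => v; move: (pi^-1%g v); apply: I3P; rewrite /sd_coord /=.
- apply: continuous_addr; first apply: continuous_addr; first exact: continuous_coord.
    by apply: continuous_mulr; [exact: continuous_coord|exact: continuous_const].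
  by apply: continuous_mulr; [exact: continuous_coord|exact: continuous_const].
- apply: continuous_addr.
    by apply: continuous_mulr; [exact: continuous_coord|exact: continuous_const].
  by apply: continuous_mulr; [exact: continuous_coord|exact: continuous_const].
- by apply: continuous_mulr; [exact: continuous_coord|exact: continuous_const].
Qed.

Lemma sd_map_surj x : simplex R 2 x -> exists pi y, simplex R 2 y /\ sd_map pi y = x.
Proof.
move=> Sx; suff [pi [H01 H12]] : exists pi : 'S_3, x 0 (pi o1) <= x 0 (pi o0) /\ x 0 (pi o2) <= x 0 (pi o1).
  exists pi, (row3 (x 0 (pi o0) - x 0 (pi o1)) (2 * (x 0 (pi o1) - x 0 (pi o2))) (3 * x 0 (pi o2))).
  case: Sx => x0 x1; have := x1; rewrite (reindex_inj (@perm_inj _ pi)) sum3 /= => s1.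
  have := x0 (pi o2); split.
    apply/simplex2P; rewrite !row3E; split; lra.
  apply/rowP => i; rewrite -(permKV pi i) sd_mapE; move: (pi^-1%g i).
  apply: I3P; rewrite /sd_coord /= !row3E; lra.
have [h01|h01] := leP (x 0 o1) (x 0 o0); have [h12|h12] := leP (x 0 o2) (x 0 o1);
  have [h02|h02] := leP (x 0 o2) (x 0 o0); try lra.
- by exists 1%g; rewrite !perm1.
- by exists (tperm o1 o2); rewrite !permE /=; lra.
- by exists (tperm o0 o2 * tperm o0 o1)%g; rewrite !permM !permE /=; lra.
- by exists (tperm o0 o1); rewrite !permE /=; lra.
- by exists (tperm o0 o1 * tperm o0 o2)%g; rewrite !permM !permE /=; lra.
- by exists (tperm o0 o2); rewrite !permE /=; lra.
Qed.

Lemma perm3P (s t : 'S_3) : s o0 = t o0 -> s o1 = t o1 -> s = t.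
Proof.
move=> H0 H1; apply/permP; apply: I3P => //.
have : [/\ s o2 != s o0, s o2 != s o1, t o2 != t o0, t o2 != t o1 & t o0 != t o1].
  by rewrite !(inj_eq perm_inj).
rewrite H0 H1; move: (t o0) (t o1) (t o2) (s o2) => [a ?] [b ?] [c ?] [d ?].
by rewrite -!val_eqE /= => -[*]; apply: val_inj => /=; lia.
Qed.

(** The coordinates of [sd_map pi y] decrease along [pi], and consecutive ones are equal exactly
    where the coordinate of [y] between them vanishes. Two orderings with the same point therefore
    differ by exchanges of equal coordinates, which are colours in [zero y]. *)
Lemma sd_map_inj pi rho y z t : simplex R 2 y -> simplex R 2 z ->
  sd_map pi y = sd_map rho z -> y = z /\ reach sd_tau (zero y) (t, pi) (t, rho).
Proof.
move=> /simplex2P[y0 y1 y2 ys] /simplex2P[z0 z1 z2 zs] E.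
pose kap := (pi * rho^-1)%g.
have Ek k : sd_coord k y = sd_coord (kap k) z.
  by rewrite -(sd_mapE pi) E mxE permM.
have Erho : rho = (kap^-1 * pi)%g by rewrite /kap invMg invgK mulgKV.
have := Ek o0; have := Ek o1; have := Ek o2.
have S0 p : y 0 o0 = 0 -> reach sd_tau (zero y) (t, p) (t, (tperm o0 o1 * p)%g).
  by move=> H; apply: (@reach_step _ sd_tau _ o0); rewrite /zero H eqxx.
have S1 p : y 0 o1 = 0 -> reach sd_tau (zero y) (t, p) (t, (tperm o1 o2 * p)%g).
  by move=> H; apply: (@reach_step _ sd_tau _ o1); rewrite /zero H eqxx.
have : [/\ kap o0 != kap o1, kap o0 != kap o2 & kap o1 != kap o2].
  by rewrite !(inj_eq perm_inj).
have K (p : 'S_3) : p o0 = kap o0 -> p o1 = kap o1 -> rho = (p^-1 * pi)%g.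
  by move=> p0 p1; rewrite Erho (perm3P p0 p1).
move: K.
have [e0 e1 e2] : [/\ exists u, u = kap o0, exists u, u = kap o1 & exists u, u = kap o2].
  by split; eexists.
case: e0 e1 e2 => [u <-] [v <-] [w <-].
have YZ : y 0 o0 = z 0 o0 -> y 0 o1 = z 0 o1 -> y 0 o2 = z 0 o2 -> y = z.
  exact: row3P.
have t0 := tperm2 o0 o1; have t1 := tperm2 o1 o2.
(* Of the 27 triples of values of [kap] the six injective ones remain; each is a product of adjacent
   transpositions whose coordinates vanish. *)
move: u v w; do 3! apply: I3P; move=> K [] // _ _ _; rewrite /sd_coord /= => E2 E1 E0.
- split; first by apply: YZ; lra.
  rewrite (K 1%g) ?perm1 // invg1 mul1g; exact: reach_refl.
- split; first by apply: YZ; lra.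
  rewrite (K (tperm o1 o2)) ?permE //= tpermV; apply: S1; lra.
- split; first by apply: YZ; lra.
  rewrite (K (tperm o0 o1)) ?permE //= tpermV; apply: S0; lra.
- split; first by apply: YZ; lra.
  rewrite (K (tperm o1 o2 * tperm o0 o1)%g) ?permM ?permE //= invMg !tpermV -mulgA.
  apply: reach_trans (S0 _ _); first by apply: S1; lra.
  lra.
- split; first by apply: YZ; lra.
  rewrite (K (tperm o0 o1 * tperm o1 o2)%g) ?permM ?permE //= invMg !tpermV -mulgA.
  apply: reach_trans (S1 _ _); first by apply: S0; lra.
  lra.
- split; first by apply: YZ; lra.
  rewrite (K (tperm o0 o1 * tperm o1 o2 * tperm o0 o1)%g) ?permM ?permE //= !invMg !tpermV -!mulgA.
  apply: reach_trans (S0 _ _); last by lra.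
  apply: reach_trans (S1 _ _); last by lra.
  by apply: S0; lra.
Qed.

Lemma sd_map_swap pi y k l : sd_coord k y = sd_coord l y ->
  sd_map (tperm k l * pi)%g y = sd_map pi y.
Proof.
move=> E; apply/rowP => v; rewrite -(permKV pi v) sd_mapE.
move: (pi^-1%g v) => m; have -> : pi m = (tperm k l * pi)%g (tperm k l m).
  by rewrite permM tpermK.
by rewrite sd_mapE; case: tpermP => [->|->|].
Qed.

(** The coordinate at position 0 is the largest and cannot vanish. If the one at position 1
    vanishes, so does the last one, and exchanging the two puts the crossed side into the last
    position, where colour 2 crosses it. *)
Lemma tstep_sd t x rho y v : simplex R 2 y -> x = sd_map rho y -> tstep (t, x) v ->
  exists rho', v.2 = sd_map rho' y /\ reach sd_tau (zero y) (t, rho) (v.1, rho').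
Proof.
move=> Sy -> [i [/=]]; rewrite -(permKV rho i); set k := (rho^-1)%g i.
rewrite sd_mapE => k0 v1 v2; have /simplex2P[y0 y1 y2 ys] := Sy.
have step (r : 'S_3) : r o2 = rho k -> sd_map r y = sd_map rho y -> y 0 o2 = 0 ->
    reach sd_tau (zero y) (t, rho) (t, r) ->
    exists rho', v.2 = sd_map rho' y /\ reach sd_tau (zero y) (t, rho) (v.1, rho').
  move=> rk Er z2 Hr; exists (r * (g t (r o2)).2)%g; split; last first.
    apply: reach_trans Hr _; have /= := @reach_step _ sd_tau (zero y) o2 (t, r).
    by rewrite /sd_tau /= v1 rk; apply; rewrite /zero z2 eqxx.
  apply/rowP => j; rewrite -(permKV (g t (r o2)).2 j) rk v2 -Er.
  move: ((g t (rho k)).2^-1%g j) => l; have [l' ->] : exists l', l = r l' by exists (r^-1%g l); rewrite permKV.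
  by rewrite -[X in _ = sd_map _ _ _ X]permM sd_mapE sd_mapE.
move: k0 step v1 v2; move: k; apply: I3P; rewrite /sd_coord /= => k0 step v1 v2; first lra.
  apply: (step (tperm o1 o2 * rho)%g).
  - by rewrite permM tpermR.
  - by apply: sd_map_swap; rewrite /sd_coord /=; lra.
  - lra.
  - have /= := @reach_step _ sd_tau (zero y) o1 (t, rho); apply; apply/eqP; lra.
by apply: (step rho) => //; [lra | exact: reach_refl].
Qed.

Lemma sd_tau_map k a y : simplex R 2 y -> zero y k ->
  clos_refl_trans _ tstep (a.1, sd_map a.2 y) ((sd_tau k a).1, sd_map (sd_tau k a).2 y).
Proof.
move=> Sy; move: k; apply: I3P; rewrite /zero /sd_tau /= => /eqP y0.
- rewrite sd_map_swap; first exact: rt_refl.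
  by rewrite /sd_coord /=; lra.
- rewrite sd_map_swap; first exact: rt_refl.
  by rewrite /sd_coord /=; lra.
- apply: rt_step; exists (a.2 o2) => /=; split=> //.
    by rewrite sd_mapE /sd_coord /=; lra.
  move=> j; have [l ->] : exists l, j = a.2 l by exists (a.2^-1%g j); rewrite permKV.
  by rewrite -[X in sd_map _ _ _ X]permM sd_mapE sd_mapE.
Qed.

(** Colours of the subdivision are realised by gluings ([sd_tau_map]) and every gluing lifts to
    colours ([tstep_sd]); at the end of a lifted chain two orderings of one point are compared by
    [sd_map_inj]. *)
Theorem sd_gempres p : tripres p ->
  gempres sd_tau (fun a y => p a.1 (sd_map a.2 y)).
Proof.
move=> [cp ps pf]; split.
- by move=> a y; apply: continuous_comp; [exact: sd_map_continuous|exact: cp].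
- move=> x; have [t [v [Sv <-]]] := ps x.
  by have [pi [y [Sy <-]]] := sd_map_surj Sv; exists (t, pi), y.
move=> [t pi] [t' pi'] y z Sy Sz /=; split; last first.
  move=> [<- {Sz} H]; apply/pf; try exact: sd_map_simplex.
  apply: (reach_ind (P := fun c => clos_refl_trans _ tstep (t, sd_map pi y) (c.1, sd_map c.2 y))) H _.
    by move=> i c Zi Hc; apply: rt_trans Hc _; exact: sd_tau_map.
  exact: rt_refl.
move/pf => /(_ (sd_map_simplex _ Sy) (sd_map_simplex _ Sz)) H.
suff [rho [E Hr]] : exists rho, sd_map pi' z = sd_map rho y /\ reach sd_tau (zero y) (t, pi) (t', rho).
  have [yz H'] := sd_map_inj t' Sy Sz (esym E).
  by split=> //; apply: reach_trans H'.
suff W w : clos_refl_trans _ tstep (t, sd_map pi y) w -> exists rho,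
    w.2 = sd_map rho y /\ reach sd_tau (zero y) (t, pi) (w.1, rho) by exact: (W _ H).
move=> /clos_rt_rtn1_iff; elim=> [|v1 v2 {}H _ [rho [E Hr]]].
  by exists pi; split=> //; exact: reach_refl.
case: v1 H E Hr => t1 x1 /= H E Hr.
have [rho' [E' H']] := tstep_sd Sy E H.
by exists rho'; split=> //; apply: reach_trans H'.
Qed.

End Triangles.

(** Triangles of a gem are glued by identity permutations. In this form the subdivision applies to a
    gem again and can be iterated. *)
Lemma gem_tripres (R : realType) (F : topologicalType) (G : finType)
    (tau : 'I_3 -> G -> G) (q : G -> 'rV[R]_3 -> F) :
  gempres tau q -> tripres (fun a i => (tau i a, 1%g)) q.
Proof.
move=> [cq qs qf]; split=> // a b y z Sy Sz; split.
  move/qf => /(_ Sy Sz)[<- H].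
  apply: (reach_ind (P := fun c => clos_refl_trans _ (tstep (fun a i => (tau i a, 1%g))) (a, y) (c, y))) H _.
    move=> i c /eqP Zi Hc; apply: rt_trans Hc _; apply: rt_step; exists i; split=> //= j.
    by rewrite perm1.
  exact: rt_refl.
move=> H; apply/qf => //.
suff W w : clos_refl_trans _ (tstep (fun a i => (tau i a, 1%g))) (a, y) w ->
    y = w.2 /\ reach tau (zero y) a w.1 by exact: (W _ H).
move=> /clos_rt_rtn1_iff; elim=> [|v1 v2 [i [H1 H2 H3]] _ [E Hr]].
  by split=> //; exact: reach_refl.
split; first by rewrite E; apply/rowP => j; rewrite -H3 /= perm1.
by apply: reach_trans Hr _; rewrite H2 /=; apply: reach_step; rewrite /zero E; apply/eqP.
Qed.

(** * From a triangulation of a closed surface to a presentation by triangles *)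

Section SurfaceTriangulation.
Variables (R : realType) (F : topologicalType) (n : nat) (T : face_pairing 2 n).
Hypothesis closedF : manifold_boundary R 2 F = set0.
Hypothesis triF : triangulates R T F.

Lemma closed_paired t i : exists u, T t i = Some u.
Proof.
case E: (T t i) => [u|]; first by exists u.
have [_ [h [_ H]]] := triF; move: H; rewrite closedF => H.
(* Vertex k lies on the unpaired side i, so its image would be a boundary point. *)
pose k : 'I_3 := if i == o0 then o1 else o0.
pose v : 'rV[R]_3 := \row_j (j == k)%:R.
have Sv : simplex R 2 v.
  split=> [j|]; first by rewrite mxE ler0n.
  by rewrite (bigD1 k) //= big1 ?addr0 ?mxE ?eqxx // => j /negbTE jk; rewrite mxE jk.
have : [set h (to_realization T x) | x in @unpaired_points R _ _ T] (h (to_realization T (point_of t v))).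
  exists (point_of t v) => //; exists i; split=> //.
  rewrite bary_point_of // mxE /k; case: ifP => [/eqP ->|i0] //.
  by rewrite i0.
by rewrite H.
Qed.

Definition tri_glue (t : 'I_n) (i : 'I_3) : 'I_n * 'S_3 := odflt (t, 1%g) (T t i).

Lemma tri_glueE t i : T t i = Some (tri_glue t i).
Proof. by rewrite /tri_glue; have [u ->] := closed_paired t i. Qed.

Lemma glued_sym d m (T' : face_pairing d m) (x y : simplices R d m) : glued T' x y -> glued T' y x.
Proof.
move=> [i [s [H1 H2 H3]]]; exists (s i), s^-1%g; split.
- exact: pairing_sym.
- by rewrite H3.
- by move=> j; rewrite -[in RHS](permKV s j) H3.
Qed.

Lemma surface_tripres : exists p, tripres tri_glue (p : 'I_n -> 'rV[R]_3 -> F).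
Proof.
have [_ [h [[ch [h' [ch' hK h'K]]] _]]] := triF.
exists (fun t v => h (to_realization T (point_of t v))); split.
- move=> t v; apply: (@continuous_comp _ _ _ (fun v => to_realization T (point_of t v)) h); last exact: ch.
  by apply: continuous_comp; [exact: point_of_continuous|exact: to_realization_continuous].
- move=> x; have [y Ey] := to_realization_surj (h' x).
  exists (tag y), (bary y); split; first exact: bary_simplex.
  by rewrite point_of_bary Ey h'K.
move=> t t' y y' Sy Sy'; split; last first.
  move=> H; congr h; apply/to_realizationP/glue_relP.
  suff: forall u v, clos_refl_trans _ (tstep tri_glue) u v -> simplex R 2 u.2 -> simplex R 2 v.2 /\
      clos_refl_sym_trans _ (@glued R 2 n T) (point_of u.1 u.2) (point_of v.1 v.2).
    by move/(_ _ _ H Sy) => [].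
  move=> u v /clos_rt_rtn1_iff H' Su; elim: H' => [|v1 v2 [i [H1 H2 H3]] _ [Sv1 Hr]].
    by split=> //; exact: rst_refl.
  have Sv2 : simplex R 2 v2.2.
    case: Sv1 => p1 s1; split=> [j|].
      by rewrite -(permKV (tri_glue v1.1 i).2 j) H3.
    by rewrite (reindex_inj (@perm_inj _ (tri_glue v1.1 i).2)); under eq_bigr do rewrite H3.
  split=> //; apply: rst_trans Hr _; apply: rst_step; exists i, (tri_glue v1.1 i).2; split.
  - by rewrite !tag_point_of H2 -surjective_pairing tri_glueE.
  - by rewrite bary_point_of.
  - by move=> j; rewrite !bary_point_of // H3.
move=> E; have {E} : to_realization T (point_of t y) = to_realization T (point_of t' y').
  by rewrite -(hK (to_realization T _)) E hK.
move/to_realizationP/glue_relP.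
suff H : forall u v, clos_refl_sym_trans _ (@glued R 2 n T) u v ->
    clos_refl_trans _ (tstep tri_glue) (tag u, bary u) (tag v, bary v).
  by move/H; rewrite !bary_point_of.
move=> u v /clos_rst_rst1n_iff; elim=> [w|w1 w2 w3 H _ IH]; first exact: rt_refl.
have {H} [i [s [H1 H2 H3]]] : glued T w1 w2 by case: H => // /glued_sym.
apply: rt_trans IH; apply: rt_step; exists i; rewrite /=.
by have := tri_glueE (tag w1) i; rewrite H1 => -[<-].
Qed.

End SurfaceTriangulation.

(** * Cancelling dipoles *)

Section Walk.
Variables (G : finType) (u v : G -> G) (sg : G -> bool).
Hypotheses (uK : involutive u) (vK : involutive v).
Hypotheses (sgu : forall a, sg (u a) = ~~ sg a) (sgv : forall a, sg (v a) = ~~ sg a).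

(** The orbit of a under two involutions, run through alternately and starting with [u]. As both
    change [sg], it is a closed path of even length [period a], twice the order of [v \o u]. *)
Fixpoint walk (a : G) (l : nat) : G :=
  if l is l'.+1 then (if odd l' then v else u) (walk a l') else a.

Definition period (a : G) : nat := (fingraph.order (v \o u) a).*2.

Lemma vu_inj : injective (v \o u).
Proof. exact: inj_comp (inv_inj vK) (inv_inj uK). Qed.

Lemma walk_double a l : walk a l.*2 = iter l (v \o u) a.
Proof. by elim: l => //= l ->; rewrite odd_double. Qed.

Lemma walk_doubleS a l : walk a l.*2.+1 = u (iter l (v \o u) a).
Proof. by rewrite /= odd_double /= walk_double. Qed.

Lemma walk_sg a l : sg (walk a l) = sg a (+) odd l.
Proof.
elim: l => [|l IH] /=; first by rewrite addbF.
by rewrite addbN -IH; case: ifP => _; rewrite ?sgu ?sgv.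
Qed.

Lemma period_gt1 a : (1 < period a)%N.
Proof. by rewrite /period (leq_double 1) fingraph.order_gt0. Qed.

Lemma period_even a : ~~ odd (period a). Proof. by rewrite odd_double. Qed.

Lemma walk_period a : walk a (period a) = a.
Proof. by rewrite walk_double iter_order //; exact: vu_inj. Qed.

(** The parity of the position is read off [sg]. Positions of equal parity are compared as iterates
    of [v \o u], after cancelling one [u] if they are odd. *)
Lemma walk_inj a l l' : (l < period a)%N -> (l' < period a)%N -> walk a l = walk a l' -> l = l'.
Proof.
have half x : (x < period a)%N -> (x./2 < fingraph.order (v \o u) a)%N.
  by rewrite /period => H; rewrite ltn_half_double.
have itj x y : (x < fingraph.order (v \o u) a)%N -> (y < fingraph.order (v \o u) a)%N ->
    iter x (v \o u) a = iter y (v \o u) a -> x = y.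
  by move=> Hx Hy E; rewrite -(findex_iter Hx) E findex_iter.
move=> Hl Hl' E; have := congr1 sg E; rewrite !walk_sg => /addbI ol.
move: E; rewrite -(odd_double_half l) -(odd_double_half l') ol.
case: (odd l'); rewrite ?add0n ?add1n.
  by rewrite !walk_doubleS => /(inv_inj uK)/(itj _ _ (half _ Hl) (half _ Hl')) ->.
by rewrite !walk_double => /(itj _ _ (half _ Hl) (half _ Hl')) ->.
Qed.

Lemma walk_u a l : u (walk a l) = if odd l then walk a l.-1 else walk a l.+1.
Proof.
case: ifP => [|ol]; last by rewrite /= ol.
by case: l => // l /= /negbTE ->; rewrite uK.
Qed.

Lemma walk_v a l : v (walk a l) =
  if odd l then walk a l.+1 else if l == 0%N then walk a (period a).-1 else walk a l.-1.
Proof.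
case: ifP => [ol|ol]; first by rewrite /= ol.
case: l ol => [_|l] /=; last by move/negbFE => ->; rewrite vK.
have := walk_period a; have := period_even a; have := period_gt1 a.
by case: (period a) => // p _ /= /negbNE -> E; rewrite -{1}E vK.
Qed.

Lemma walk_closed a l : exists2 l', (l' < period a)%N & walk a l' = walk a l.
Proof.
elim: l => [|l [l' Hl' E]]; first by exists 0%N => //; exact: ltnW (period_gt1 a).
have [H|H] := ltnP l'.+1 (period a).
  have := congr1 sg E; rewrite !walk_sg => /addbI ol.
  by exists l'.+1; rewrite //= E ol.
have Ep : l'.+1 = period a by apply/eqP; rewrite eqn_leq Hl' H.
exists 0%N; first exact: ltnW (period_gt1 a).
have := congr1 sg E; rewrite !walk_sg => /addbI ol.
by rewrite /= -ol -E -[RHS]/(walk a l'.+1) Ep walk_period.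
Qed.

Lemma walk_uv_closed a b :
  (exists2 l, (l < period a)%N & b = walk a l) ->
  (exists2 l, (l < period a)%N & u b = walk a l) /\ (exists2 l, (l < period a)%N & v b = walk a l).
Proof.
move=> [l _ ->]; split.
  by rewrite walk_u; case: ifP => _; set w := (X in walk a X); have [l' ? <-] := walk_closed a w; exists l'.
by rewrite walk_v; do 2?case: ifP => _; set w := (X in walk a X); have [l' ? <-] := walk_closed a w; exists l'.
Qed.

End Walk.

(** * A segment divided into K equal parts *)

Section SegmentModel.
Variable R : realType.
Implicit Types (K l : nat) (al be t : R).

(** [segA] and [segB] are the weights at the ends A and B of the point with weight al at the l-th
    and be at the (l+1)-st of the points dividing AB into K equal parts, where the 0-th point is
    A. *)
Definition segB K l al be : R := ((al + be) * l%:R + be) / K%:R.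
Definition segA K l al be : R := al + be - segB K l al be.

Lemma seg_cover K t x : (0 < K)%N -> 0 <= t -> 0 <= x -> x <= t * K%:R ->
  exists2 l, (l < K)%N & t * l%:R <= x <= t * l.+1%:R.
Proof.
elim: K => // K IH _ t0 x0 H; case: K IH H => [_ H|K IH H].
  by exists 0%N => //; rewrite mulr0 x0.
have [h|h] := leP x (t * K.+1%:R); last by exists K.+1; rewrite // H (ltW h).
have [l Hl Hx] := IH isT t0 x0 h; exists l => //; exact: ltnW.
Qed.

Lemma seg_bounds K l al be : (l < K)%N -> 0 <= al -> 0 <= be ->
  0 <= segA K l al be /\ 0 <= segB K l al be.
Proof.
move=> lK a0 b0; have K0 : 0 < K%:R :> R by rewrite ltr0n (leq_trans _ lK).
split.
  rewrite /segA /segB subr_ge0 ler_pdivrMr //.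
  have : (l.+1%:R <= K%:R :> R) by rewrite ler_nat.
  rewrite -natr1 => H; have := ler_wpM2l (addr_ge0 a0 b0) H; lra.
by rewrite /segB divr_ge0 ?(ltW K0) // addr_ge0 // mulr_ge0 ?addr_ge0.
Qed.

Lemma seg_surj K s x : (0 < K)%N -> 0 <= s -> 0 <= x ->
  exists l al be, [/\ (l < K)%N, 0 <= al, 0 <= be, segA K l al be = s & segB K l al be = x].
Proof.
move=> K0 s0 x0; have K0' : 0 < K%:R :> R by rewrite ltr0n.
have t0 : 0 <= s + x by exact: addr_ge0.
have [||l lK /andP[H1 H2]] := @seg_cover K (s + x) (x * K%:R) K0 t0.
- by rewrite mulr_ge0 ?(ltW K0').
- by rewrite ler_wpM2r ?(ltW K0') // lerDr.
have : segB K l ((s + x) * l.+1%:R - x * K%:R) (x * K%:R - (s + x) * l%:R) = x.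
  by rewrite /segB -natr1; apply: (mulIf (lt0r_neq0 K0')); rewrite divfK ?lt0r_neq0 //; ring.
move=> E; exists l, ((s + x) * l.+1%:R - x * K%:R), (x * K%:R - (s + x) * l%:R).
split=> //; rewrite ?subr_ge0 // /segA E -natr1; ring.
Qed.

Lemma seg_inj K l l' al be al' be' : (l < K)%N -> (l' < K)%N ->
  0 <= al -> 0 <= be -> 0 <= al' -> 0 <= be' ->
  segA K l al be = segA K l' al' be' -> segB K l al be = segB K l' al' be' ->
  [\/ [/\ al = 0, be = 0, al' = 0 & be' = 0],
      [/\ l = l', al = al' & be = be'],
      [/\ l' = l.+1, al = 0, be' = 0 & be = al'] |
      [/\ l = l'.+1, al' = 0, be = 0 & be' = al]].
Proof.
move=> lK lK' a0 b0 a0' b0'; rewrite /segA => EA EB; rewrite EB in EA.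
have K0 : K%:R != 0 :> R by rewrite pnatr_eq0 -lt0n (leq_trans _ lK).
have Es : al + be = al' + be' by lra.
move: EB; rewrite /segB => /(mulIf (invr_neq0 K0)); rewrite -Es.
have [s0 _|s0] := eqVneq (al + be) 0; first by constructor 1; split; lra.
have sp : 0 < al + be by rewrite lt0r s0 addr_ge0.
have [E|NE] := eqVneq l l'; first by rewrite -E => H; constructor 2; split=> //; lra.
case: (ltngtP l l') NE => // H _ E.
  have [E'|NE] := eqVneq l' l.+1.
    by move: E; rewrite E' -natr1 => E; constructor 3; split=> //; nra.
  have : (l.+2%:R <= l'%:R :> R) by rewrite ler_nat ltn_neqAle eq_sym NE.
  by rewrite -!natr1 => h; exfalso; nra.
have [E'|NE] := eqVneq l l'.+1.
  by move: E; rewrite E' -natr1 => E; constructor 4; split=> //; nra.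
have : (l'.+2%:R <= l%:R :> R) by rewrite ler_nat ltn_neqAle eq_sym NE.
by rewrite -!natr1 => h; exfalso; nra.
Qed.

Lemma continuous_seg (X : topologicalType) K l (a b : X -> R) :
  continuous a -> continuous b ->
  continuous (fun x => segB K l (a x) (b x)) /\ continuous (fun x => segA K l (a x) (b x)).
Proof.
move=> ca cb; have cB : continuous (fun x => segB K l (a x) (b x)).
  apply: continuous_mulr; last exact: continuous_const.
  apply: continuous_addr => //; apply: continuous_mulr; last exact: continuous_const.
  exact: continuous_addr.
by split=> //; apply: continuous_subr => //; exact: continuous_addr.
Qed.

Lemma continuous_row3 (X : topologicalType) (a b c : X -> R) :
  continuous a -> continuous b -> continuous c -> continuous (fun x => row3 (a x) (b x) (c x)).
Proof.
move=> ca cb cc; apply: continuous_row => i.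
by case: (i == o0) => //; case: (i == o1).
Qed.

End SegmentModel.

(** * Intersections of the two bent triangles of a dipole *)

Section Kite.
Variables (R : realType) (u0 u1 u2 v0 v1 v2 : R).
Hypotheses (U0 : 0 <= u0) (U1 : 0 <= u1) (U2 : 0 <= u2).
Hypotheses (V0 : 0 <= v0) (V1 : 0 <= v1) (V2 : 0 <= v2).
Local Notation m := (Num.min u0 u1).
Local Notation n := (Num.min v0 v1).

Lemma kite_phi : m + (u2 + m) / 3 = n + (v2 + n) / 3 ->
  u1 - m + (u2 + m) / 3 = v1 - n + (v2 + n) / 3 ->
  u0 - m + (u2 + m) / 3 = v0 - n + (v2 + n) / 3 -> [/\ u0 = v0, u1 = v1 & u2 = v2].
Proof. by move: U0 U1 U2 V0 V1 V2 => ? ? ? ? ? ?; case: leP => H1; case: leP => H2 E0 E1 E2; split; lra. Qed.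

Lemma kite_psi : u2 + m + m / 3 = v2 + n + n / 3 ->
  u1 - m + m / 3 = v1 - n + n / 3 ->
  u0 - m + m / 3 = v0 - n + n / 3 -> [/\ u0 = v0, u1 = v1 & u2 = v2].
Proof. by move: U0 U1 U2 V0 V1 V2 => ? ? ? ? ? ?; case: leP => H1; case: leP => H2 E0 E1 E2; split; lra. Qed.

Lemma kite_phi_psi : m + (u2 + m) / 3 = v2 + n + n / 3 ->
  u1 - m + (u2 + m) / 3 = v1 - n + n / 3 ->
  u0 - m + (u2 + m) / 3 = v0 - n + n / 3 -> [/\ u0 = v0, u1 = v1, u2 = 0 & v2 = 0].
Proof. by move: U0 U1 U2 V0 V1 V2 => ? ? ? ? ? ?; case: leP => H1; case: leP => H2 E0 E1 E2; split; lra. Qed.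

Lemma kite_path_phi a b t : 0 <= a -> 0 <= b -> t / 3 = n + (v2 + n) / 3 ->
  a + t / 3 = v1 - n + (v2 + n) / 3 -> b + t / 3 = v0 - n + (v2 + n) / 3 ->
  v0 = 0 \/ v1 = 0.
Proof. by move: V0 V1 V2 => ? ? ? a0 b0; case: leP => H E0 E1 E2; [left|right]; lra. Qed.

Lemma kite_path_psi a b t : 0 <= a -> 0 <= b -> t / 3 = v2 + n + n / 3 ->
  a + t / 3 = v1 - n + n / 3 -> b + t / 3 = v0 - n + n / 3 -> v2 = 0.
Proof. by move: V0 V1 V2 => ? ? ? a0 b0; case: leP => H E0 E1 E2; lra. Qed.

End Kite.

(** * Cancelling a dipole of colour 2 *)

Section Dipole.
Variables (R : realType) (F : topologicalType).
Variables (G : finType) (tau : 'I_3 -> G -> G) (sg : G -> bool) (q : G -> 'rV[R]_3 -> F).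
Hypothesis tauK : forall i, involutive (tau i).
Hypothesis sgt : forall i a, sg (tau i a) = ~~ sg a.
Hypothesis pres : gempres tau q.
Variable phi : G.
Local Notation psi := (tau o2 phi).
Local Notation side := (fun c : 'I_3 => c != o2).
Hypothesis distinct : ~~ reach tau side phi psi.

(** [s] runs once through the M triangles around the colour 2 vertex of [phi], starting at [phi];
    the K others survive the cancellation. [c l] is the colour of the side between [s l] and
    [s l.+1]. *)
Let s := walk (tau o0) (tau o1) phi.
Let M := period (tau o0) (tau o1) phi.
Let K := M.-1.
Let c l := if odd l then o1 else o0.
Let O := [pred a | reach tau side phi a].

Lemma bip_gem : is_gem tau.
Proof. by move=> i; split=> // a E; have := sgt i a; rewrite E; case: (sg a). Qed.

Let M_gt1 : (1 < M)%N. Proof. exact: period_gt1. Qed.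
Let K_gt0 : (0 < K)%N. Proof. by move: M_gt1; rewrite /K; case: M => [|[]]. Qed.
Let M_K : M = K.+1. Proof. by move: M_gt1; rewrite /K; case: M. Qed.
Let K_odd : odd K.
Proof. by have := @period_even _ (tau o0) (tau o1) phi; rewrite -/M M_K /= => /negbNE. Qed.
Let K_neq0 : K%:R != 0 :> R. Proof. by rewrite pnatr_eq0 -lt0n. Qed.

Let s_S l : s l.+1 = tau (c l) (s l). Proof. by rewrite /s /= /c; case: ifP. Qed.
Let s0 : s 0%N = phi. Proof. by []. Qed.
Let sM : s M = phi. Proof. exact: walk_period. Qed.

Let O_s l : s l \in O.
Proof.
elim: l => [|l IH]; first exact: reach_refl.
by rewrite s_S; apply: reach_trans IH _; apply: reach_step; rewrite /c; case: ifP.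
Qed.

Let OP a : a \in O -> exists2 l, (l < M)%N & a = s l.
Proof.
move=> H; apply: (reach_ind (P := fun a => exists2 l, (l < M)%N & a = s l)) H _.
  move=> i b; have H := @walk_uv_closed _ _ _ _ (tauK o0) (tauK o1) (sgt o0) (sgt o1) phi b.
  by move: i; apply: I3P => // _ /H[].
by exists 0%N => //; exact: ltnW.
Qed.

Let s_inj l l' : (l < M)%N -> (l' < M)%N -> s l = s l' -> l = l'.
Proof. exact: walk_inj. Qed.

Let psiO : (psi \in O) = false. Proof. exact/negbTE. Qed.

Let O_tau i a : i != o2 -> a \in O -> tau i a \in O.
Proof. by move=> Hi H; apply: reach_trans H _; exact: reach_step. Qed.

Let O_tauC i a : i != o2 -> a \notin O -> tau i a \notin O.
Proof. by move=> Hi; apply: contra => /(O_tau Hi); rewrite tauK. Qed.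

Definition dipole_idx a := index a [seq s l | l <- iota 0 M].

Let idx_s l : (l < M)%N -> dipole_idx (s l) = l.
Proof.
move=> lM; rewrite /dipole_idx.
have {1}-> : s l = nth phi [seq s l | l <- iota 0 M] l.
  by rewrite (nth_map 0%N) ?size_iota // nth_iota.
rewrite index_uniq ?size_map ?size_iota // map_inj_in_uniq ?iota_uniq //.
by move=> x y; rewrite !mem_iota /= !add0n; exact: s_inj.
Qed.

(** The triangles around the colour 2 vertex of [phi], together with [psi], form a disc, drawn here
    in one triangle. That vertex is the barycentre, the colour 2 vertex of [psi] is corner 0, and
    the outer sides of [s 1], ..., [s K] divide the side from corner 1 to corner 2. [phi] and [psi]
    are bent along y0 = y1: their common side goes from corner 1 to corner 2 through (2/3, 1/6,
    1/6), midway between the barycentre and corner 0. *)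
Definition cell a (y : 'rV[R]_3) : 'rV[R]_3 :=
  let mu := Num.min (y 0 o0) (y 0 o1) in
  if a == phi then row3 (mu + (y 0 o2 + mu) / 3) (y 0 o1 - mu + (y 0 o2 + mu) / 3)
                        (y 0 o0 - mu + (y 0 o2 + mu) / 3)
  else if a == psi then row3 (y 0 o2 + mu + mu / 3) (y 0 o1 - mu + mu / 3) (y 0 o0 - mu + mu / 3)
  else let l := dipole_idx a in
    row3 (y 0 o2 / 3) (segA K l.-1 (y 0 (c l)) (y 0 (c l.+1)) + y 0 o2 / 3)
         (segB K l.-1 (y 0 (c l)) (y 0 (c l.+1)) + y 0 o2 / 3).

(** The disc after cancelling, in the same triangle: the surviving path is coned from corner 0, the
    former colour 2 vertex of [psi]. *)
Definition newcell a (y : 'rV[R]_3) : 'rV[R]_3 :=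
  let l := dipole_idx a in
  row3 (y 0 o2) (segA K l.-1 (y 0 (c l)) (y 0 (c l.+1))) (segB K l.-1 (y 0 (c l)) (y 0 (c l.+1))).

Let s_path l : (l.+1 < M)%N -> (s l.+1 == phi) = false /\ (s l.+1 == psi) = false.
Proof.
move=> lM; split; apply/negbTE/negP => /eqP E.
  by have := s_inj lM (ltnW M_gt1) E.
by have := O_s l.+1; rewrite E psiO.
Qed.

Let cell_phi y : cell phi y = let mu := Num.min (y 0 o0) (y 0 o1) in
  row3 (mu + (y 0 o2 + mu) / 3) (y 0 o1 - mu + (y 0 o2 + mu) / 3) (y 0 o0 - mu + (y 0 o2 + mu) / 3).
Proof. by rewrite /cell eqxx. Qed.

Let cell_psi y : cell psi y = let mu := Num.min (y 0 o0) (y 0 o1) in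
  row3 (y 0 o2 + mu + mu / 3) (y 0 o1 - mu + mu / 3) (y 0 o0 - mu + mu / 3).
Proof. by rewrite /cell eqxx ifN //; apply/eqP; have [_] := bip_gem o2; apply. Qed.

Let cell_path l y : (l.+1 < M)%N -> cell (s l.+1) y =
  row3 (y 0 o2 / 3) (segA K l (y 0 (c l.+1)) (y 0 (c l)) + y 0 o2 / 3)
         (segB K l (y 0 (c l.+1)) (y 0 (c l)) + y 0 o2 / 3).
Proof.
by move=> lM; have [p1 p2] := s_path lM; rewrite /cell p1 p2 idx_s //= /c /= negbK.
Qed.

Let newcell_path l y : (l.+1 < M)%N -> newcell (s l.+1) y =
  row3 (y 0 o2) (segA K l (y 0 (c l.+1)) (y 0 (c l))) (segB K l (y 0 (c l.+1)) (y 0 (c l))).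
Proof. by move=> lM; rewrite /newcell idx_s //= /c /= negbK. Qed.

Let c_sum l (y : 'rV[R]_3) : y 0 (c l.+1) + y 0 (c l) = y 0 o0 + y 0 o1.
Proof. by rewrite /c /=; case: (odd l) => //=; rewrite addrC. Qed.

Let c_ge0 l (y : 'rV[R]_3) : simplex R 2 y -> 0 <= y 0 (c l).
Proof. by case. Qed.

Let cellI a : a \in O -> a = phi \/ exists2 l, (l.+1 < M)%N & a = s l.+1.
Proof. by move/OP => [[|l] lM ->]; [left | right; exists l]. Qed.

Lemma newcell_simplex a y : a \in O -> a != phi -> simplex R 2 y -> simplex R 2 (newcell a y).
Proof.
move=> /cellI[-> /eqP//|[l lM ->] _ Sy]; rewrite newcell_path //.
have lK : (l < K)%N by rewrite -ltnS -M_K.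
have [H1 H2] := seg_bounds lK (c_ge0 l.+1 Sy) (c_ge0 l Sy).
have := c_sum l y; move: Sy => /simplex2P[y0 y1 y2 ys] E; apply/simplex2P; rewrite !row3E.
split=> //; rewrite /segA; lra.
Qed.

Lemma cell_simplex a y : (a \in O) || (a == psi) -> simplex R 2 y -> simplex R 2 (cell a y).
Proof.
move=> /orP[|/eqP ->] => [/cellI[->|[l lM ->]]|] Sy; have /simplex2P[y0 y1 y2 ys] := Sy.
- rewrite cell_phi /=; apply/simplex2P; rewrite !row3E.
  by have [H|H] := leP (y 0 o0) (y 0 o1); split; lra.
- rewrite cell_path //; have lK : (l < K)%N by rewrite -ltnS -M_K.
  have [H1 H2] := seg_bounds lK (c_ge0 l.+1 Sy) (c_ge0 l Sy).
  have := c_sum l y => E; apply/simplex2P; rewrite !row3E.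
  by split; rewrite /segA in H1 *; lra.
- rewrite cell_psi /=; apply/simplex2P; rewrite !row3E.
  by have [H|H] := leP (y 0 o0) (y 0 o1); split; lra.
Qed.

Lemma path_point l t al be : (l < K)%N -> exists y : 'rV[R]_3,
  [/\ y 0 o2 = t, y 0 (c l.+1) = al, y 0 (c l) = be & y 0 o0 + y 0 o1 = al + be].
Proof.
move=> _; rewrite /c /=; case: (odd l) => /=.
  by exists (row3 al be t); rewrite !row3E.
by exists (row3 be al t); rewrite !row3E; split=> //; rewrite addrC.
Qed.

Lemma cell_surj z : simplex R 2 z -> exists a y,
  [/\ (a \in O) || (a == psi), simplex R 2 y & cell a y = z].
Proof.
move=> /simplex2P[z0 z1 z2 zs].
set m := Num.min (z 0 o1) (z 0 o2).
have m0 : 0 <= m by rewrite le_min z1 z2.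
have m1 : m <= z 0 o1 by rewrite ge_min lexx.
have m2 : m <= z 0 o2 by rewrite ge_min lexx orbT.
have mE : m = z 0 o1 \/ m = z 0 o2 by rewrite /m; case: leP; [left|right].
(* The path fills z0 <= m. The common side of [phi] and [psi] is z0 = 4 m, because it passes through
   (2/3, 1/6, 1/6). *)
have [h|h] := leP (z 0 o0) m.
  have [||l [al [be [lK a0 b0 EA EB]]]] := @seg_surj R K (z 0 o1 - z 0 o0) (z 0 o2 - z 0 o0) K_gt0.
  - lra.
  - lra.
  have [y [y2 ya yb ys]] := path_point (3 * z 0 o0) al be lK.
  have lM : (l.+1 < M)%N by rewrite M_K ltnS.
  have Es : al + be = z 0 o1 + z 0 o2 - 2 * z 0 o0 by rewrite /segA in EA; lra.
  exists (s l.+1), y; split; first by rewrite O_s.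
    have [Y0 Y1] : 0 <= y 0 o0 /\ 0 <= y 0 o1.
      by move: ya yb; rewrite /c /=; case: (odd l) => /= -> ->.
    by apply/simplex2P; split=> //; lra.
  by rewrite cell_path // ya yb y2 EA EB; apply: row3P; rewrite !row3E; lra.
have [h'|h'] := leP (z 0 o0) (4 * m).
  exists phi, (row3 (z 0 o2 - m + (z 0 o0 - m)) (z 0 o1 - m + (z 0 o0 - m)) (4 * m - z 0 o0)).
  split; first by rewrite -{1}s0 O_s.
    by apply/simplex2P; rewrite !row3E; case: mE => e; split; lra.
  rewrite cell_phi /= !row3E; set w := Num.min _ _.
  have -> : w = z 0 o0 - m by rewrite /w; case: mE => e; case: leP; lra.
  by apply: row3P; rewrite !row3E; lra.
exists psi, (row3 (z 0 o2 - m + 3 * m) (z 0 o1 - m + 3 * m) (z 0 o0 - 4 * m)).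
split; first by rewrite eqxx orbT.
  by apply/simplex2P; rewrite !row3E; case: mE => e; split; lra.
rewrite cell_psi /= !row3E; set w := Num.min _ _.
have -> : w = 3 * m by rewrite /w; case: mE => e; case: leP; lra.
by apply: row3P; rewrite !row3E; lra.
Qed.

Let path_fib l l' (y z : 'rV[R]_3) : (l.+1 < M)%N -> (l'.+1 < M)%N ->
  simplex R 2 y -> simplex R 2 z -> y 0 o2 = z 0 o2 ->
  segA K l (y 0 (c l.+1)) (y 0 (c l)) = segA K l' (z 0 (c l'.+1)) (z 0 (c l')) ->
  segB K l (y 0 (c l.+1)) (y 0 (c l)) = segB K l' (z 0 (c l'.+1)) (z 0 (c l')) ->
  y = z /\ [\/ y 0 o0 = 0 /\ y 0 o1 = 0, l = l', l' = l.+1 /\ y 0 (c l.+1) = 0 |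
               l = l'.+1 /\ y 0 (c l'.+1) = 0].
Proof.
move=> lM lM' Sy Sz E2; have lK : (l < K)%N by rewrite -ltnS -M_K.
have lK' : (l' < K)%N by rewrite -ltnS -M_K.
have cE x (w v : 'rV[R]_3) : w 0 (c x.+1) = v 0 (c x.+1) -> w 0 (c x) = v 0 (c x) ->
    w 0 o2 = v 0 o2 -> w = v.
  by rewrite /c /=; case: (odd x) => /= *; apply: row3P.
have cS x : c x.+2 = c x by rewrite /c /= negbK.
move=> /(seg_inj lK lK' (c_ge0 _ Sy) (c_ge0 _ Sy) (c_ge0 _ Sz) (c_ge0 _ Sz)) H /H{H}.
case=> [[a0 b0 a0' b0']|[E a0 b0]|[E a0 b0 e]|[E a0 b0 e]].
- have [Y0 Y1] : y 0 o0 = 0 /\ y 0 o1 = 0.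
    by move: a0 b0; rewrite /c /=; case: (odd l).
  have [Z0 Z1] : z 0 o0 = 0 /\ z 0 o1 = 0.
    by move: a0' b0'; rewrite /c /=; case: (odd l').
  by split; [apply: row3P; lra | constructor 1].
- by subst l'; split; [exact: (cE l) | constructor 2].
- subst l'; split; last by constructor 3.
  by move: b0 e; rewrite cS => b0 e; apply: (cE l) => //; rewrite a0 b0.
- subst l; split; last by constructor 4; split=> //; move: b0; rewrite /c.
  by move: a0 b0 e; rewrite cS => a0 b0 e; apply: (cE l') => //; rewrite ?b0 ?e ?a0.
Qed.

Let q_pres : forall a b y z, simplex R 2 y -> simplex R 2 z ->
  (q a y = q b z <-> y = z /\ reach tau (zero y) a b).
Proof. by case: pres. Qed.

Let q_step i a (y : 'rV[R]_3) : simplex R 2 y -> y 0 i = 0 -> q (tau i a) y = q a y.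
Proof.
move=> Sy yi; apply/esym/q_pres => //; split=> //.
by apply: reach_step; rewrite /zero yi.
Qed.

Let path_q l l' (y z : 'rV[R]_3) : (l.+1 < M)%N -> (l'.+1 < M)%N ->
  simplex R 2 y -> simplex R 2 z -> y 0 o2 = z 0 o2 ->
  segA K l (y 0 (c l.+1)) (y 0 (c l)) = segA K l' (z 0 (c l'.+1)) (z 0 (c l')) ->
  segB K l (y 0 (c l.+1)) (y 0 (c l)) = segB K l' (z 0 (c l'.+1)) (z 0 (c l')) ->
  q (s l.+1) y = q (s l'.+1) z.
Proof.
move=> lM lM' Sy Sz E2 EA EB; have [<- H] := path_fib lM lM' Sy Sz E2 EA EB.
case: H => [[y0 y1]|->//|[-> y0]|[-> y0]].
- apply/q_pres => //; split=> //; apply: (@reach_sub _ _ side).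
    by apply: I3P; rewrite /zero ?y0 ?y1 ?eqxx.
  apply: (reach_trans _ (O_s l'.+1)); apply: reach_sym; first exact: bip_gem.
  exact: (O_s l.+1).
- by rewrite (s_S l.+1) q_step.
- by rewrite (s_S l'.+1) q_step.
Qed.

(** Two pieces of the drawing meet only along common sides. A point there is moved across the side
    by [q_step] until both flags are equal or lie on the path, where [path_q] applies. *)
Lemma cell_fib a b y z : (a \in O) || (a == psi) -> (b \in O) || (b == psi) ->
  simplex R 2 y -> simplex R 2 z -> cell a y = cell b z -> q a y = q b z.
Proof.
have PP l l' u v : (l.+1 < M)%N -> (l'.+1 < M)%N -> simplex R 2 u -> simplex R 2 v ->
    cell (s l.+1) u = cell (s l'.+1) v -> q (s l.+1) u = q (s l'.+1) v.
  move=> lM lM' Su Sv; rewrite !cell_path // => E.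
  have E0 := congr1 (fun w : 'rV[R]_3 => w 0 o0) E; have E1 := congr1 (fun w : 'rV[R]_3 => w 0 o1) E.
  have E2 := congr1 (fun w : 'rV[R]_3 => w 0 o2) E; move: E0 E1 E2; rewrite !row3E => E0 E1 E2.
  by apply: path_q => //; lra.
have phi1 u : simplex R 2 u -> u 0 o0 = 0 -> q phi u = q (s 1) u.
  by move=> Su u0; rewrite (s_S 0) q_step.
have phiK u : simplex R 2 u -> u 0 o1 = 0 -> q phi u = q (s K) u.
  by move=> Su u1; rewrite -{1}sM M_K s_S q_step // /c K_odd.
have PH l u v : (l.+1 < M)%N -> simplex R 2 u -> simplex R 2 v ->
    cell (s l.+1) u = cell phi v -> q (s l.+1) u = q phi v.
  move=> lM Su Sv E; have lK : (l < K)%N by rewrite -ltnS -M_K.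
  have [HA HB] := seg_bounds lK (c_ge0 l.+1 Su) (c_ge0 l Su).
  have /simplex2P[v0 v1 v2 vs] := Sv.
  move: (E); rewrite cell_path // cell_phi /= => E'.
  have E0 := congr1 (fun w : 'rV[R]_3 => w 0 o0) E'; have E1 := congr1 (fun w : 'rV[R]_3 => w 0 o1) E'.
  have E2 := congr1 (fun w : 'rV[R]_3 => w 0 o2) E'; move: E0 E1 E2; rewrite !row3E.
  (* The path meets [phi] only on its sides towards [s 1] and [s K]; the point of [phi] is moved to
     the path across that side. *)
  move=> E0 E1 E2; have [v00|v11] := kite_path_phi v0 v1 v2 HA HB E0 E1 E2.
    rewrite phi1 //; apply: PP => //.
    rewrite E cell_phi cell_path // /c /= v00 min_l //.
    by apply: row3P; rewrite !row3E /segA /segB; lra.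
  have [k Ek] : exists k, K = k.+1 by move: K_gt0; case: K => // k _; exists k.
  rewrite phiK // Ek; apply: PP => //; first by rewrite M_K Ek.
  rewrite E cell_phi cell_path; last by rewrite M_K Ek.
  have : odd k.+1 by rewrite -Ek.
  rewrite /c /= => ok; rewrite ok (negbTE ok) /= v11 min_r //.
  have kE : k%:R = K%:R - 1 :> R by rewrite Ek -natr1; lra.
  have EB : segB K k 0 (v 0 o0) = v 0 o0.
    by rewrite /segB kE; apply: (mulIf K_neq0); rewrite divfK //; ring.
  by apply: row3P; rewrite !row3E /segA ?EB; lra.
have PSI l u v : (l.+1 < M)%N -> simplex R 2 u -> simplex R 2 v ->
    cell (s l.+1) u = cell psi v -> q (s l.+1) u = q psi v.
  move=> lM Su Sv E; have lK : (l < K)%N by rewrite -ltnS -M_K.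
  have [HA HB] := seg_bounds lK (c_ge0 l.+1 Su) (c_ge0 l Su).
  have /simplex2P[v0 v1 v2 vs] := Sv.
  move: (E); rewrite cell_path // cell_psi /= => E'.
  have E0 := congr1 (fun w : 'rV[R]_3 => w 0 o0) E'; have E1 := congr1 (fun w : 'rV[R]_3 => w 0 o1) E'.
  have E2 := congr1 (fun w : 'rV[R]_3 => w 0 o2) E'; move: E0 E1 E2; rewrite !row3E => E0 E1 E2.
  have v22 := kite_path_psi v0 v1 v2 HA HB E0 E1 E2.
  rewrite q_step //; apply: PH => //; rewrite E cell_psi cell_phi /= v22.
  by apply: row3P; rewrite !row3E; lra.
have HH u v : simplex R 2 u -> simplex R 2 v -> cell phi u = cell phi v -> q phi u = q phi v.
  move=> /simplex2P[u0 u1 u2 us] /simplex2P[v0 v1 v2 vs]; rewrite !cell_phi /= => E.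
  have E0 := congr1 (fun w : 'rV[R]_3 => w 0 o0) E; have E1 := congr1 (fun w : 'rV[R]_3 => w 0 o1) E.
  have E2 := congr1 (fun w : 'rV[R]_3 => w 0 o2) E; move: E0 E1 E2; rewrite !row3E => E0 E1 E2.
  by have [*] := kite_phi u0 u1 u2 v0 v1 v2 E0 E1 E2; congr (q _ _); exact: row3P.
have SS u v : simplex R 2 u -> simplex R 2 v -> cell psi u = cell psi v -> q psi u = q psi v.
  move=> /simplex2P[u0 u1 u2 us] /simplex2P[v0 v1 v2 vs]; rewrite !cell_psi /= => E.
  have E0 := congr1 (fun w : 'rV[R]_3 => w 0 o0) E; have E1 := congr1 (fun w : 'rV[R]_3 => w 0 o1) E.
  have E2 := congr1 (fun w : 'rV[R]_3 => w 0 o2) E; move: E0 E1 E2; rewrite !row3E => E0 E1 E2.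
  by have [*] := kite_psi u0 u1 u2 v0 v1 v2 E0 E1 E2; congr (q _ _); exact: row3P.
have HS u v : simplex R 2 u -> simplex R 2 v -> cell phi u = cell psi v -> q phi u = q psi v.
  move=> Su Sv; have /simplex2P[u0 u1 u2 us] := Su; have /simplex2P[v0 v1 v2 vs] := Sv.
  rewrite cell_phi cell_psi /= => E.
  have E0 := congr1 (fun w : 'rV[R]_3 => w 0 o0) E; have E1 := congr1 (fun w : 'rV[R]_3 => w 0 o1) E.
  have E2 := congr1 (fun w : 'rV[R]_3 => w 0 o2) E; move: E0 E1 E2; rewrite !row3E => E0 E1 E2.
  have [e0 e1 e2 e2'] := kite_phi_psi u0 u1 u2 v0 v1 v2 E0 E1 E2.
  by rewrite q_step //; congr (q _ _); apply: row3P => //; rewrite e2.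
move=> /orP[/cellI[->|[l lM ->]]|/eqP ->] /orP[/cellI[->|[l' lM' ->]]|/eqP ->] Sy Sz E.
- exact: HH.
- exact/esym/PH.
- exact: HS.
- exact: PH.
- exact: PP.
- exact: PSI.
- exact/esym/HS.
- exact/esym/PSI.
- exact: SS.
Qed.

Let K_S : exists k, K = k.+1. Proof. by move: K_gt0; case: K => // k _; exists k. Qed.

Let segK k (b : R) : K = k.+1 -> segB K k 0 b = b /\ segA K k 0 b = 0.
Proof.
move=> Ek; have kE : k%:R = K%:R - 1 :> R by rewrite Ek -natr1 addrK.
have EB : segB K k 0 b = b by rewrite /segB kE; apply: (mulIf K_neq0); rewrite divfK //; ring.
by rewrite /segA EB; split=> //; rewrite add0r subrr.
Qed.

Let seg0 (a : R) : segB K 0 a 0 = 0 /\ segA K 0 a 0 = a.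
Proof.
have EB : segB K 0 a 0 = 0 by rewrite /segB mulr0 addr0 mul0r.
by rewrite /segA EB; split=> //; rewrite addr0 subr0.
Qed.

Let segS l (b : R) : segB K l 0 b = segB K l.+1 b 0 /\ segA K l 0 b = segA K l.+1 b 0.
Proof.
have EB : segB K l 0 b = segB K l.+1 b 0 by rewrite /segB -natr1; congr (_ / _); ring.
by rewrite /segA EB; split=> //; rewrite add0r addr0.
Qed.

Let cell_succ l u : (l < M)%N -> simplex R 2 u -> u 0 (c l) = 0 -> cell (s l) u = cell (s l.+1) u.
Proof.
move=> lM Su; have /simplex2P[u0 u1 u2 us] := Su.
case: l lM => [_ c0|l lM c0].
  rewrite cell_phi cell_path //= (_ : c 0%N = o0) // (_ : c 1%N = o1) //.
  rewrite /c /= in c0; rewrite c0 min_l //; have [-> ->] := seg0 (u 0 o1).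
  by congr row3; ring.
have cS x : c x.+2 = c x by rewrite /c /= negbK.
have [lM'|lM'] := ltnP l.+2 M.
  rewrite !cell_path // cS c0; have [-> ->] := segS l (u 0 (c l)); by [].
have EM : l.+2 = M by apply/eqP; rewrite eqn_leq lM lM'.
have El : K = l.+1 by rewrite /K -EM.
rewrite cell_path // EM sM cell_phi c0; have [-> ->] := segK (u 0 (c l)) El.
have := K_odd; rewrite El /= => ol; move: c0; rewrite /c /= ol (negbTE ol) => c0.
by rewrite c0 min_r //=; congr row3; ring.
Qed.

Let newcell_succ l (u : 'rV[R]_3) : (l.+2 < M)%N -> u 0 (c l.+1) = 0 -> newcell (s l.+1) u = newcell (s l.+2) u.
Proof.
have cS x : c x.+2 = c x by rewrite /c /= negbK.
move=> lM c0; rewrite !newcell_path //; last exact: ltnW.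
by rewrite cS c0; have [-> ->] := segS l (u 0 (c l)).
Qed.

Let adj i a : i != o2 -> a \in O -> exists l, (l < M)%N /\
  ((a = s l /\ tau i a = s l.+1 /\ i = c l) \/ (tau i a = s l /\ a = s l.+1 /\ i = c l)).
Proof.
move=> i2 /OP[l lM ->].
have c2 : c l = i \/ c l.+1 = i.
  by rewrite /c /=; move: i i2; apply: I3P => // _; case: (odd l) => /=; auto.
have [Ei|Ei] := eqVneq i (c l).
  by exists l; split=> //; left; rewrite s_S -Ei.
have {}c2 : c l.+1 = i by case: c2 => // E; rewrite E eqxx in Ei.
case: l lM Ei c2 => [|l] lM Ei c2.
  exists K; split; first by rewrite M_K.
  right; rewrite -M_K sM s0; have EK : c K = i by rewrite -c2 /c K_odd.
  by split; [rewrite -[in LHS]sM M_K s_S EK tauK | rewrite EK].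
exists l; split; first exact: ltnW.
have Ec : c l = i by rewrite -c2 /c /= negbK.
by right; rewrite s_S Ec tauK.
Qed.

Let cell_tau i a u : i != o2 -> a \in O -> simplex R 2 u -> u 0 i = 0 -> cell (tau i a) u = cell a u.
Proof.
move=> i2 aO Su ui; have [l [lM [[-> [-> El]]|[-> [-> El]]]]] := adj i2 aO;
  by rewrite (cell_succ lM) // -El.
Qed.

Let newcell_tau i a (u : 'rV[R]_3) : i != o2 -> a \in O -> a != phi -> tau i a != phi -> u 0 i = 0 ->
  newcell (tau i a) u = newcell a u.
Proof.
move=> i2 aO; have [[|l] [lM [[-> [-> El]]|[-> [-> El]]]]] := adj i2 aO; rewrite ?eqxx // => N1 N2 ui.
- have [lM'|lM'] := ltnP l.+2 M; first by rewrite -newcell_succ // -El.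
  have EM : l.+2 = M by apply/eqP; rewrite eqn_leq lM lM'.
  by rewrite EM sM eqxx in N2.
- have [lM'|lM'] := ltnP l.+2 M; first by rewrite -newcell_succ // -El.
  have EM : l.+2 = M by apply/eqP; rewrite eqn_leq lM lM'.
  by rewrite EM sM eqxx in N1.
Qed.

Let newcell_psi i u : i != o2 -> simplex R 2 u -> u 0 i = 0 -> newcell (tau i phi) u = cell psi u.
Proof.
move=> i2 Su ui; have /simplex2P[u0 u1 u2 us] := Su; rewrite cell_psi.
move: i i2 ui; apply: I3P => // _ ui.
  rewrite -(s_S 0) newcell_path //= (_ : c 0%N = o0) // (_ : c 1%N = o1) //.
  by rewrite ui min_l //; have [-> ->] := seg0 (u 0 o1); congr row3; ring.
have [k Ek] := K_S; have kM : (k.+1 < M)%N by rewrite M_K Ek.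
have -> : tau o1 phi = s k.+1.
  by rewrite -Ek -{1}sM M_K s_S (_ : c K = o1) ?tauK // /c K_odd.
rewrite newcell_path //; have /= ok : odd k.+1 by rewrite -Ek.
rewrite /c /= ok (negbTE ok) ui min_r //.
by have [-> ->] := segK (u 0 o0) Ek; congr row3; ring.
Qed.

Let newcell_cell a (u : 'rV[R]_3) : a \in O -> a != phi -> u 0 o2 = 0 -> newcell a u = cell a u.
Proof.
move=> /cellI[->|[l lM ->]] N u2; first by rewrite eqxx in N.
by rewrite newcell_path // cell_path // u2 mul0r !addr0.
Qed.

Lemma newcell_surj z : simplex R 2 z -> exists a y,
  [/\ a \in O, a != phi, simplex R 2 y & newcell a y = z].
Proof.
move=> /simplex2P[z0 z1 z2 zs].
have [l [al [be [lK a0 b0 EA EB]]]] := @seg_surj R K (z 0 o1) (z 0 o2) K_gt0 z1 z2.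
have [y [y2 ya yb ys]] := path_point (z 0 o0) al be lK.
have lM : (l.+1 < M)%N by rewrite M_K ltnS.
have Es : al + be = z 0 o1 + z 0 o2 by rewrite /segA in EA; lra.
exists (s l.+1), y; split; first by rewrite O_s.
- by have [-> _] := s_path lM.
- have [Y0 Y1] : 0 <= y 0 o0 /\ 0 <= y 0 o1.
    by move: ya yb; rewrite /c /=; case: (odd l) => /= -> ->.
  by apply/simplex2P; split=> //; lra.
- by rewrite newcell_path // ya yb y2 EA EB; apply: row3P; rewrite !row3E.
Qed.

(** This is the map of the drawn disc to F. Reading it through [newcell] instead of [cell] gives the
    maps of the surviving triangles. *)
Lemma dipole_disc : exists P : 'rV[R]_3 -> F, continuous P /\
  forall a y, (a \in O) || (a == psi) -> simplex R 2 y -> P (cell a y) = q a y.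
Proof.
pose I := {a : G | (a \in O) || (a == psi)}.
have cc (a : I) : continuous (cell (val a)).
  have c0 := @continuous_coord R 3 o0; have c1 := @continuous_coord R 3 o1.
  have c2 := @continuous_coord R 3 o2; have cm := continuous_minr c0 c1.
  have c3 := @continuous_const 'rV[R]_3 R (3^-1).
  have mulc (f : 'rV[R]_3 -> R) : continuous f -> continuous (fun x => f x / 3).
    by move=> cf; apply: continuous_mulr.
  have eqc (f g : 'rV[R]_3 -> 'rV[R]_3) : (forall y, f y = g y) -> continuous g -> continuous f.
    by move=> /funext ->.
  case: a => a /= /orP[/cellI[->|[l lM ->]]|/eqP ->].
  - apply: (eqc _ _ cell_phi).
    apply: continuous_row3; (apply: continuous_addr; last by apply: mulc; exact: continuous_addr).
    + exact: cm.
    + exact: continuous_subr.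
    + exact: continuous_subr.
  - apply: (eqc _ _ (fun y => cell_path y lM)).
    have [cB cA] := @continuous_seg R _ K l _ _ (@continuous_coord R 3 (c l.+1)) (@continuous_coord R 3 (c l)).
    apply: continuous_row3; [exact: mulc | |]; (apply: continuous_addr; last exact: mulc); by [].
  - apply: (eqc _ _ cell_psi).
    apply: continuous_row3; (apply: continuous_addr; last exact: mulc).
    + exact: continuous_addr.
    + exact: continuous_subr.
    + exact: continuous_subr.
have [||||P [cP HP]] := @factor_simplex R F 2 2 I (fun a => cell (val a)) (fun a => q (val a)) cc.
- by move=> a; case: pres.
- by move=> [a Ha] v; exact: cell_simplex.
- by move=> z /cell_surj[a [y [Ha Sy E]]]; exists (exist _ a Ha), y.
- by move=> [a Ha] [b Hb] v w Sv Sw /=; exact: cell_fib.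
by exists P; split=> // a y Ha Sy; exact: (HP (exist _ a Ha)).
Qed.

Definition undipole := {a : G | (a != phi) && (a != psi)}.

(** Where [phi] and [psi] disappear, their outer sides of equal colour are sewn together. *)
Definition dipole_fun i a :=
  if tau i a == phi then tau i psi else if tau i a == psi then tau i phi else tau i a.

Let psiN : psi != phi. Proof. by apply/eqP; have [_] := bip_gem o2; apply. Qed.

Let tau_phi_psi i : i != o2 -> tau i phi != psi.
Proof. by move=> i2; apply/eqP => E; have := O_tau i2 (O_s 0); rewrite s0 E psiO. Qed.

Lemma dipole_fun_in i a : (a != phi) && (a != psi) ->
  (dipole_fun i a != phi) && (dipole_fun i a != psi).
Proof.
have ne b : tau i b != b by apply/eqP; have [_] := bip_gem i; apply.
move=> /andP[a1 a2]; rewrite /dipole_fun; case: (tau i a =P phi) => [E|/eqP E].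
  have i2 : i != o2.
    by apply: contra a2 => /eqP Ei; rewrite -E Ei tauK.
  rewrite ne andbT; apply/eqP => /(congr1 (tau i)); rewrite tauK => /esym/eqP.
  by apply/negP; exact: tau_phi_psi.
case: (tau i a =P psi) => [E'|/eqP E']; last by rewrite E.
have i2 : i != o2.
  by apply: contra a1 => /eqP Ei; move/(congr1 (tau i)): E'; rewrite tauK Ei tauK => ->.
by rewrite ne tau_phi_psi.
Qed.

Definition dipole_tau i (x : undipole) : undipole :=
  exist _ (dipole_fun i (val x)) (dipole_fun_in i (valP x)).

Lemma dipole_tauK i : involutive (dipole_tau i).
Proof.
move=> x; apply: val_inj => /=; rewrite {1}/dipole_fun; have /andP[x1 x2] := valP x.
rewrite /dipole_fun; case: (eqVneq (tau i (val x)) phi) => [E|E1].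
  by rewrite tauK (negbTE psiN) eqxx; exact/esym/(canRL (tauK i) E).
case: (eqVneq (tau i (val x)) psi) => [E|E2].
  by rewrite tauK eqxx; exact/esym/(canRL (tauK i) E).
by rewrite tauK (negbTE x1) (negbTE x2).
Qed.

Lemma dipole_sg i (x : undipole) : sg (val (dipole_tau i x)) = ~~ sg (val x).
Proof.
rewrite /= /dipole_fun; case: eqP => [E|_].
  by rewrite (canRL (tauK i) E) !sgt negbK.
case: eqP => [E|_]; last by rewrite sgt.
by rewrite (canRL (tauK i) E) !sgt negbK.
Qed.

Let dgem : is_gem dipole_tau.
Proof.
move=> i; split; first exact: dipole_tauK.
by move=> x E; have := dipole_sg i x; rewrite E; case: (sg _).
Qed.

Let path_el l : (l.+1 < M)%N -> exists x : undipole, val x = s l.+1.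
Proof.
move=> lM; have [p1 p2] := s_path lM.
have H : (s l.+1 != phi) && (s l.+1 != psi) by rewrite p1 p2.
by exists (exist _ (s l.+1) H).
Qed.

Let path_next l (x : undipole) : (l.+2 < M)%N -> val x = s l.+1 ->
  val (dipole_tau (c l.+1) x) = s l.+2.
Proof.
move=> lM E; rewrite /= /dipole_fun E -s_S; have [p1 p2] := s_path lM.
by rewrite p1 p2.
Qed.

Let path_reach (Z : 'I_3 -> bool) l d (x x' : undipole) : Z o0 -> Z o1 -> (l + d < K)%N ->
  val x = s l.+1 -> val x' = s (l + d).+1 -> reach dipole_tau Z x x'.
Proof.
move=> Z0 Z1; elim: d x' => [|d IH] x' lK Ex Ex'.
  rewrite (_ : x' = x); first exact: reach_refl.
  by apply: val_inj; rewrite Ex Ex' addn0.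
have lM : ((l + d).+2 < M)%N by rewrite M_K ltnS -addnS.
have [|x1 E1] := @path_el (l + d); first by rewrite ltnW.
apply: (reach_trans (IH x1 _ Ex E1)); first by rewrite addnS in lK; rewrite ltnW.
rewrite (_ : x' = dipole_tau (c (l + d).+1) x1).
  by apply: reach_step; rewrite /c; case: ifP.
by apply: val_inj; rewrite (path_next lM E1) Ex' addnS.
Qed.

Let new_fib (x x' : undipole) y z : val x \in O -> val x' \in O ->
  simplex R 2 y -> simplex R 2 z -> newcell (val x) y = newcell (val x') z ->
  y = z /\ reach dipole_tau (zero y) x x'.
Proof.
have np (w : undipole) : val w \in O -> exists2 l, (l.+1 < M)%N & val w = s l.+1.
  by case/cellI => // E; have /andP[] := valP w; rewrite E eqxx.
move=> /np[l lM Ex] /np[l' lM' Ex'] Sy Sz; rewrite Ex Ex' !newcell_path // => E.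
have E0 := congr1 (fun w : 'rV[R]_3 => w 0 o0) E; have E1 := congr1 (fun w : 'rV[R]_3 => w 0 o1) E.
have E2 := congr1 (fun w : 'rV[R]_3 => w 0 o2) E; move: E0 E1 E2; rewrite !row3E => E0 E1 E2.
have [yz H] := path_fib lM lM' Sy Sz E0 E1 E2; split=> //.
have lK : (l < K)%N by rewrite -ltnS -M_K.
have lK' : (l' < K)%N by rewrite -ltnS -M_K.
case: H => [[y0 y1]|Ell|[Ell y0]|[Ell y0]].
- have Z0 : zero y o0 by rewrite /zero y0.
  have Z1 : zero y o1 by rewrite /zero y1.
  have [H|H] := leqP l l'.
    by apply: (@path_reach _ l (l' - l)) => //; rewrite subnKC.
  apply: reach_sym dgem _.
  by apply: (@path_reach _ l' (l - l')) => //; rewrite subnKC // ltnW.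
- rewrite (_ : x' = x); first exact: reach_refl.
  by apply: val_inj; rewrite Ex Ex' Ell.
- rewrite (_ : x' = dipole_tau (c l.+1) x); first by apply: reach_step; rewrite /zero y0.
  by apply: val_inj; rewrite (path_next _ Ex) ?Ex' ?Ell // -Ell.
- apply: reach_sym dgem _.
  rewrite (_ : x = dipole_tau (c l'.+1) x'); first by apply: reach_step; rewrite /zero y0.
  by apply: val_inj; rewrite (path_next _ Ex') ?Ex ?Ell // -Ell.
Qed.

(** Flags around the colour 2 vertex of [phi] are sent through the drawn disc, all others keep their
    map. Fibres are compared through the relation [L]: a colour step of the old gem is followed by a
    possibly empty chain of steps of the new one. *)
Theorem dipole_gempres : exists q', gempres dipole_tau (q' : undipole -> 'rV[R]_3 -> F).
Proof.
have [P [cP HP]] := dipole_disc.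
have ncc (a : G) : a \in O -> a != phi -> continuous (newcell a).
  move=> /cellI[->|[l lM ->]] N; first by rewrite eqxx in N.
  have eqc (f g : 'rV[R]_3 -> 'rV[R]_3) : (forall y, f y = g y) -> continuous g -> continuous f.
    by move=> /funext ->.
  apply: (eqc _ _ (fun y => newcell_path y lM)).
  have [cB cA] := @continuous_seg R _ K l _ _ (@continuous_coord R 3 (c l.+1)) (@continuous_coord R 3 (c l)).
  by apply: continuous_row3 => //; exact: continuous_coord.
pose q' (x : undipole) (y : 'rV[R]_3) := if val x \in O then P (newcell (val x) y) else q (val x) y.
exists q'; have [cq sq _] := pres.
have xphi (x : undipole) : val x != phi by have /andP[] := valP x.
have xpsi (x : undipole) : val x != psi by have /andP[] := valP x.
have liftx (x : undipole) y : simplex R 2 y -> exists a u,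
    [/\ simplex R 2 u, (val x \in O -> ((a \in O) || (a == psi)) /\ newcell (val x) y = cell a u),
      (val x \notin O -> a = val x /\ u = y) & q' x y = q a u].
  move=> Sy; rewrite /q'; case: ifPn => xO; last by exists (val x), y.
  have [a [u [Ha Su E]]] := cell_surj (newcell_simplex xO (xphi x) Sy).
  by exists a, u; split=> //; rewrite -E HP.
(* [L x y a u]: either the point y of the new flag x and the point u of the old flag a are the same
   point of the drawing, or x lies outside the disc and nothing has changed. *)
pose L (x : undipole) y a u := (val x \in O /\ ((a \in O) || (a == psi)) /\ newcell (val x) y = cell a u) \/
  (val x \notin O /\ a = val x /\ u = y).
have {}liftx (x : undipole) y : simplex R 2 y -> exists a u,
    [/\ simplex R 2 u, L x y a u & q' x y = q a u].
  move=> Sy; have [a [u [Su H1 H2 E]]] := liftx x y Sy; exists a, u; split=> //.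
  by case: (boolP (val x \in O)) => H; [left; split; auto | right; split; auto].
have Lq x y a u : simplex R 2 y -> simplex R 2 u -> L x y a u -> q' x y = q a u.
  move=> Sy Su [[xO [Ha E]]|[xO [-> ->]]]; rewrite /q'; last by rewrite (negbTE xO).
  by rewrite xO E HP.
have Luniq x y x' z a u : simplex R 2 y -> simplex R 2 z -> L x y a u -> L x' z a u ->
    y = z /\ reach dipole_tau (zero y) x x'.
  move=> Sy Sz [[xO [Ha E]]|[xO [Ea Eu]]] [[xO' [Ha' E']]|[xO' [Ea' Eu']]].
  - by apply: new_fib => //; rewrite E E'.
  - by move: Ha; rewrite Ea' (negbTE (xpsi x')) (negbTE xO').
  - by move: Ha'; rewrite Ea (negbTE (xpsi x)) (negbTE xO).
  - split; first by rewrite -Eu -Eu'.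
    rewrite (_ : x' = x); first exact: reach_refl.
    by apply: val_inj; rewrite -Ea -Ea'.
have Lself (x : undipole) (u : 'rV[R]_3) : u 0 o2 = 0 -> L x u (val x) u.
  move=> u2; case: (boolP (val x \in O)) => xO; last by right.
  by left; rewrite xO; split=> //; split=> //; apply: newcell_cell.
have phiO : phi \in O by rewrite -s0 O_s.
have tau_in i (x : undipole) : tau i (val x) != phi -> tau i (val x) != psi ->
    val (dipole_tau i x) = tau i (val x).
  by move=> N1 N2; rewrite /= /dipole_fun (negbTE N1) (negbTE N2).
have dt i (x : undipole) : val (dipole_tau i x) = dipole_fun i (val x) by [].
have tphi i (w : undipole) : tau i (val w) = phi -> i != o2.
  by move=> E; apply/eqP => i2; subst i; have := xpsi w; rewrite (canRL (tauK o2) E) eqxx.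
(* The two critical steps: one into [psi] from outside is replaced by a step to the neighbour of
   [phi], and one out of [psi] across an outer side by a step from that neighbour. *)
have trans (x : undipole) (y : 'rV[R]_3) a (u : 'rV[R]_3) i : simplex R 2 y -> simplex R 2 u -> L x y a u -> u 0 i = 0 ->
    exists2 x', reach dipole_tau (zero y) x x' & L x' y (tau i a) u.
  move=> Sy Su HL ui.
  have outer (x1 : undipole) : val x1 \in O -> i = o2 -> a = val x1 ->
      reach dipole_tau (zero y) x x1 -> y = u ->
      exists2 x', reach dipole_tau (zero y) x x' & L x' y (tau i a) u.
    move=> x1O Ei Ea Hr Eyu; subst y i.
    have N1 : tau o2 a != phi by apply: contra (xpsi x1) => /eqP E1; rewrite -Ea; apply/eqP/(canRL (tauK o2) E1).
    have N2 : tau o2 a != psi by rewrite (inj_eq (inv_inj (tauK o2))) Ea.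
    exists (dipole_tau o2 x1).
      by apply: reach_trans Hr _; apply: reach_step; rewrite /zero ui.
    by rewrite Ea -tau_in -?Ea //; exact: Lself.
  have toO (x1 : undipole) : val x1 \in O -> newcell (val x1) u = cell a u ->
      val x \in O -> newcell (val x) y = cell a u -> y = u /\ reach dipole_tau (zero y) x x1.
    by move=> x1O E1 xO E; apply: new_fib => //; rewrite E1.
  case: HL => [[xO [Ha E]]|[xO [Ea Eu]]].
    case/orP: Ha => [aO|/eqP Ea].
      have [i2|i2] := eqVneq i o2; last first.
        by exists x; [exact: reach_refl | left; rewrite xO (O_tau i2 aO) cell_tau].
      subst i; have [Ep|Np] := eqVneq a phi.
        exists x; [exact: reach_refl | left; rewrite xO Ep eqxx orbT; split=> //; split=> //].
        by rewrite E Ep cell_phi cell_psi ui /=; congr row3; ring.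
      have apsi : a != psi by apply/eqP => Eps; rewrite Eps psiO in aO.
      have Hx1 : (a != phi) && (a != psi) by rewrite Np apsi.
      have [|yu Hr] := toO (exist _ a Hx1) aO _ xO E; first exact: newcell_cell.
      by apply: (outer (exist _ a Hx1)).
    have [i2|i2] := eqVneq i o2.
      subst i; exists x; first exact: reach_refl.
      left; rewrite xO Ea tauK phiO; split=> //; split=> //.
      by rewrite E Ea cell_phi cell_psi ui /=; congr row3; ring.
    have Hx1 : (tau i phi != phi) && (tau i phi != psi).
      by rewrite tau_phi_psi // andbT; apply/eqP; have [_] := bip_gem i; apply.
    pose x1 : undipole := exist _ (tau i phi) Hx1.
    have [|yu Hr] := toO x1 (O_tau i2 phiO) _ xO E; first by rewrite Ea; exact: newcell_psi.
    subst y; exists (dipole_tau i x1); first by apply: reach_trans Hr _; apply: reach_step; rewrite /zero ui.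
    have Ed : val (dipole_tau i x1) = tau i a by rewrite /= /dipole_fun tauK eqxx Ea.
    right; rewrite Ed; split=> //; rewrite Ea.
    by apply: O_tauC => //; rewrite psiO.
  subst u a; case: (eqVneq (tau i (val x)) psi) => [Eps|Nps].
    have i2 : i != o2.
      apply: contra xO => /eqP Ei; move: Eps; rewrite Ei => /(inv_inj (tauK o2)) ->; exact: phiO.
    exists (dipole_tau i x); first by apply: reach_step; rewrite /zero ui.
    have Nphi : tau i (val x) != phi by rewrite Eps.
    have Ed : val (dipole_tau i x) = tau i phi by rewrite /= /dipole_fun (negbTE Nphi) Eps eqxx.
    by left; rewrite Ed (O_tau i2 phiO) Eps eqxx orbT newcell_psi.
  have Nphi : tau i (val x) != phi.
    by apply/eqP => Ep; have := O_tauC (tphi _ _ Ep) xO; rewrite Ep phiO.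
  exists (dipole_tau i x); first by apply: reach_step; rewrite /zero ui.
  have Ed := tau_in i x Nphi Nps; rewrite -Ed.
  have [i2|i2] := eqVneq i o2; first by apply: Lself; rewrite -i2.
  by right; rewrite Ed; split=> //; exact: O_tauC.
split.
- move=> x; have [xO|xO] := boolP (val x \in O); last first.
    by rewrite (_ : q' x = q (val x)) //; apply/funext => y; rewrite /q' (negbTE xO).
  rewrite (_ : q' x = P \o newcell (val x)); last by apply/funext => y; rewrite /q' xO.
  by move=> y; apply: continuous_comp; [exact: (ncc _ xO (xphi x)) | exact: cP].
- move=> w; have [a [u [Su <-]]] := sq w.
  case: (boolP ((a \in O) || (a == psi))) => Ha.
    have [b [y [bO Nb Sy E]]] := newcell_surj (cell_simplex Ha Su).
    have Hb : (b != phi) && (b != psi) by rewrite Nb /=; apply/eqP => Eb; rewrite Eb psiO in bO.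
    by exists (exist _ b Hb), y; split=> //; rewrite /q' /= bO E HP.
  move: Ha; rewrite negb_or => /andP[aO aN].
  have Hb : (a != phi) && (a != psi) by rewrite aN andbT; apply: contra aO => /eqP ->.
  by exists (exist _ a Hb), u; split=> //; rewrite /q' /= (negbTE aO).
move=> x x' y z Sy Sz; split.
  have [a [u [Su HL ->]]] := liftx x y Sy; have [b [w [Sw HL' ->]]] := liftx x' z Sz.
  move=> /q_pres => /(_ Su Sw)[Euw Hab]; subst w.
  suff [x1 Hr HL1] : exists2 x1, reach dipole_tau (zero y) x x1 & L x1 y b u.
    have [yz Hr'] := Luniq _ _ _ _ _ _ Sy Sz HL1 HL'.
    by split=> //; apply: reach_trans Hr Hr'.
  apply: (reach_ind (P := fun b => exists2 x1, reach dipole_tau (zero y) x x1 & L x1 y b u)) Hab _; last first.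
    by exists x => //; exact: reach_refl.
  move=> i b' /eqP ui [x1 Hr HL1]; have [x2 Hr2 HL2] := trans _ _ _ _ _ Sy Su HL1 ui.
  by exists x2 => //; apply: reach_trans Hr Hr2.
move=> [<- Hr]; apply: (reach_ind (P := fun x' => q' x y = q' x' y)) Hr _ => //.
move=> i w /eqP yi ->; rewrite [RHS]/q' [LHS]/q' dt.
case: (boolP (val w \in O)) => wO; last first.
  rewrite /dipole_fun; case: eqP => [E|/eqP Nphi].
    have i2 := tphi _ _ E.
    by have := O_tauC i2 wO; rewrite E phiO.
  case: eqP => [E|/eqP Nps].
    have i2 : i != o2.
      by apply: contra wO => /eqP Ei; move: E; rewrite Ei => /(inv_inj (tauK o2)) ->.
    rewrite (O_tau i2 phiO) newcell_psi // HP ?eqxx ?orbT //.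
    by rewrite (canRL (tauK i) E) q_step.
  have [i2|i2] := eqVneq i o2; last by rewrite (negbTE (O_tauC i2 wO)) q_step.
  subst i; case: ifPn => [tO|_]; last by rewrite q_step.
  by rewrite newcell_cell // HP ?tO // q_step.
rewrite /dipole_fun; case: eqP => [E|/eqP Nphi].
  have i2 := tphi _ _ E.
  rewrite (negbTE (O_tauC i2 (negbT psiO))) q_step //.
  rewrite (canRL (tauK i) E).
  by rewrite newcell_psi // HP // eqxx orbT.
case: eqP => [E|/eqP Nps].
  have [i2|i2] := eqVneq i o2; last by have := O_tau i2 wO; rewrite E psiO.
  by have := xphi w; rewrite i2 in E; move/(inv_inj (tauK o2)): E => ->; rewrite eqxx.
have [i2|i2] := eqVneq i o2; last by rewrite (O_tau i2 wO) newcell_tau.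
subst i; rewrite newcell_cell // HP ?wO //.
case: ifPn => [tO|_]; last by rewrite q_step.
by rewrite newcell_cell // HP ?tO // q_step.
Qed.

End Dipole.

(** * Unicellular maps *)

Section VertexCount.
Variables (G : finType) (tau : 'I_3 -> G -> G).

Definition vertex (i : 'I_3) (a : G) : {set G} := [set b | reach tau (fun c => c != i) a b].
Definition nv (i : 'I_3) : nat := #|vertex i @: [set: G]%SET|.

Hypothesis gem : is_gem tau.

Lemma vertexP i a b : reflect (vertex i a = vertex i b) (reach tau (fun c => c != i) a b).
Proof.
apply: (iffP idP) => [H|E]; last first.
  by have : b \in vertex i b; [rewrite inE; exact: reach_refl | rewrite -E inE].
apply/setP => d; rewrite !inE; apply/idP/idP => H'.
  by apply: reach_trans H'; exact: reach_sym.
exact: reach_trans H H'.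
Qed.

Lemma nv_gt0 i (a : G) : (0 < nv i)%N.
Proof. by apply/card_gt0P; exists (vertex i a); apply: imset_f; rewrite inE. Qed.

End VertexCount.

Lemma card_imset_eq (T : finType) (A B : finType) (f : T -> A) (g : T -> B) :
  (forall x y, f x = f y <-> g x = g y) -> #|f @: [set: T]%SET| = #|g @: [set: T]%SET|.
Proof.
move=> fg; pose h (u : A) : option B := omap g [pick x | f x == u].
have hE x : h (f x) = Some (g x).
  rewrite /h; case: pickP => [y /eqP /fg E|/(_ x)]; [by rewrite /= E | by rewrite eqxx].
rewrite -(card_in_imset (f := h) (D := f @: [set: T]%SET)); last first.
  by move=> _ _ /imsetP[x _ ->] /imsetP[y _ ->]; rewrite !hE => -[/fg].
rewrite -(card_imset (f := Some) (g @: [set: T]%SET)); last by move=> ? ? [].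
rewrite -!imset_comp; congr #|pred_of_set _|; apply: eq_imset => x /=; exact: hE.
Qed.

(** * Orbits and vertex numbers after cancelling a dipole *)

Section DipoleCount.
Variables (G : finType) (tau : 'I_3 -> G -> G) (sg : G -> bool).
Hypothesis tauK : forall i, involutive (tau i).
Hypothesis sgt : forall i a, sg (tau i a) = ~~ sg a.
Variable phi : G.
Local Notation psi := (tau o2 phi).
Hypothesis distinct : ~~ reach tau (fun c => c != o2) phi psi.

Let gem : is_gem tau. Proof. exact: bip_gem sgt. Qed.
Local Notation G' := (undipole tau phi).
Let tau' : 'I_3 -> G' -> G' := dipole_tau tauK sgt distinct.
Let gem' : is_gem tau'.
Proof.
move=> i; split; first exact: dipole_tauK.
by move=> x E; have := dipole_sg tauK sgt distinct i x; rewrite -/(tau' i x) E; case: (sg _).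
Qed.

Let val_tau' i (x : G') : val (tau' i x) =
  if tau i (val x) == phi then tau i psi else if tau i (val x) == psi then tau i phi else tau i (val x).
Proof. by []. Qed.

Let val_phi (x : G') : val x != phi. Proof. by case: x => a /= /andP[]. Qed.
Let val_psi (x : G') : val x != psi. Proof. by case: x => a /= /andP[]. Qed.

Let same_side c a b (Z : 'I_3 -> bool) : Z c -> reach tau Z a b -> reach tau Z a (tau c b).
Proof. by move=> Zc /reach_trans; apply; exact: reach_step. Qed.

Let ends (Z : 'I_3 -> bool) (P : G -> bool) (x : G') c :
  (forall a d, Z d -> P (tau d a) = P a) -> Z c -> P phi = P psi ->
  P (val (tau' c x)) = P (val x).
Proof.
move=> HP Zc E; rewrite val_tau'; case: eqP => [Ex|_].
  by have := HP (val x) c Zc; rewrite Ex => <-; rewrite HP.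
case: eqP => [Ex|_]; last exact: HP.
by have := HP (val x) c Zc; rewrite Ex => <-; rewrite HP.
Qed.

Let reachP (Z : 'I_3 -> bool) a0 a d : Z d -> reach tau Z a0 (tau d a) = reach tau Z a0 a.
Proof.
by move=> Zd; apply/idP/idP => /(same_side Zd) //; rewrite tauK.
Qed.

Let up (Z : 'I_3 -> bool) (x x' : G') (P : G -> bool) :
  (forall a d, Z d -> P (tau d a) = P a) -> P phi = P psi ->
  reach tau' Z x x' -> P (val x) = P (val x').
Proof.
move=> HP E H; apply: (reach_ind (P := fun w : G' => P (val x) = P (val w))) H _ => //.
by move=> i w Zi EP; rewrite EP (@ends Z P w i HP Zi E).
Qed.

Let mk a (H : (a != phi) && (a != psi)) : G' := exist _ a H.
Let ne i a : tau i a != a. Proof. by apply/eqP; have [_] := gem i; apply. Qed.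
Let phi_psi k : k != o2 -> (tau k phi != phi) && (tau k phi != psi).
Proof.
move=> k2; rewrite ne; apply/eqP => E; move: distinct; rewrite -E => /negP; apply.
exact: reach_step.
Qed.
Let psi_phi k : k != o2 -> (tau k psi != phi) && (tau k psi != psi).
Proof.
move=> k2; rewrite ne andbT; apply/eqP => E; have /andP[_] := phi_psi k2.
by rewrite -(canRL (tauK k) E) eqxx.
Qed.

(** Under colour 2 and one other colour k, [phi] and [psi] are adjacent in their orbit; deleting the
    pair joins their outer k-neighbours, so the orbit survives and is shorter by two. *)
Lemma dipole_reach_side k (Z : 'I_3 -> bool) (x x' : G') : k != o2 -> Z k -> Z o2 ->
  (forall c, Z c -> c = k \/ c = o2) ->
  reach tau' Z x x' = reach tau Z (val x) (val x').
Proof.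
move=> k2 Zk Z2 HZ; apply/idP/idP => H.
  rewrite -(up _ _ H (P := reach tau Z (val x))) ?reach_refl //.
    by move=> a d; exact: reachP.
  by rewrite reachP.
pose e1 : G' := exist _ (tau k phi) (phi_psi k2).
pose e2 : G' := exist _ (tau k psi) (psi_phi k2).
have e12 : reach tau' Z e1 e2.
  rewrite (_ : e2 = tau' k e1); first exact: reach_step.
  by apply: val_inj; rewrite val_tau' /= tauK eqxx.
(* While the old path stays at [phi] or [psi], its shadow in the new gem waits at [e1]. *)
pose rep (a : G) (w : G') := (val w = a) \/ ((a = phi \/ a = psi) /\ w = e1).
suff : forall w, rep (val x') w -> reach tau' Z x w by apply; left.
apply: (reach_ind (P := fun a => forall w, rep a w -> reach tau' Z x w)) H _; last first.
  move=> w [E|[[E|E] _]].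
  - by rewrite (_ : w = x); [exact: reach_refl | apply: val_inj].
  - by have := val_phi x; rewrite E eqxx.
  - by have := val_psi x; rewrite E eqxx.
move=> i c Zi IH w; have [cphi|Nphi] := eqVneq c phi.
  have re1 : reach tau' Z x e1 by apply: IH; right; split; [left|].
  case: (HZ i Zi) => Ei; subst i c.
    case=> [E|[[E|E] _]].
    - by rewrite (_ : w = e1) //; apply: val_inj.
    - by have := ne k phi; rewrite E eqxx.
    - by have /andP[_] := phi_psi k2; rewrite E eqxx.
  by case=> [E|[_ ->//]]; have := val_psi w; rewrite E eqxx.
have [cpsi|Npsi] := eqVneq c psi.
  have re1 : reach tau' Z x e1 by apply: IH; right; split; [right|].
  case: (HZ i Zi) => Ei; subst i c.
    case=> [E|[[E|E] _]].
    - by rewrite (_ : w = e2); [exact: reach_trans re1 e12 | apply: val_inj].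
    - by have /andP[] := psi_phi k2; rewrite E eqxx.
    - by have := ne k psi; rewrite E eqxx.
  by rewrite tauK; case=> [E|[_ ->//]]; have := val_phi w; rewrite E eqxx.
have Hc : (c != phi) && (c != psi) by rewrite Nphi Npsi.
pose xc : G' := exist _ c Hc; have rc : reach tau' Z x xc by apply: IH; left.
have step : reach tau' Z x (tau' i xc) by apply: reach_trans rc _; exact: reach_step.
case=> [E|[H ->]].
  rewrite (_ : w = tau' i xc) //; apply: val_inj; rewrite val_tau' /= -E.
  by rewrite (negbTE (val_phi w)) (negbTE (val_psi w)).
have ik : i = k.
  case: (HZ i Zi) => // i2; subst i; case: H => H; move: (canRL (tauK o2) H) => E.
    by rewrite E eqxx in Npsi.
  by rewrite tauK in E; rewrite E eqxx in Nphi.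
subst i; case: H => H; have E := canRL (tauK k) H; subst c.
  by rewrite (_ : e1 = xc) //; apply: val_inj.
by apply: (reach_trans rc); rewrite (_ : xc = e2); [exact: reach_sym | apply: val_inj].
Qed.

Let walkb w := walk (tau o0) (tau o1) w.
Let per w := period (tau o0) (tau o1) w.
Local Notation side := (fun c : 'I_3 => c != o2).

Let walk_side w l : reach tau side w (walkb w l).
Proof.
elim: l => [|l IH]; first exact: reach_refl.
by rewrite /walkb /=; case: ifP => _; apply: (same_side _ IH).
Qed.

Let base_el w l : (w == phi) || (w == psi) -> (l.+1 < per w)%N ->
  (walkb w l.+1 != phi) && (walkb w l.+1 != psi).
Proof.
have inj := @walk_inj _ _ _ _ (tauK o0) (sgt o0) (sgt o1) w.
have nw : (l.+1 < per w)%N -> walkb w l.+1 != w.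
  by move=> lp; apply/eqP => E; have := inj _ 0%N lp (ltnW (period_gt1 _ _ _)) E.
have r := walk_side w l.+1.
move=> /orP[/eqP Ew|/eqP Ew] lp; have := nw lp; subst w => -> //=.
  by apply/eqP => E; move: distinct; rewrite -E r.
by rewrite andbT; apply/eqP => E; move: distinct; rewrite -[X in reach _ _ X]E reach_sym.
Qed.

Let base_reach w l (x1 x : G') : (w == phi) || (w == psi) -> (l.+1 < per w)%N ->
  val x1 = tau o0 w -> val x = walkb w l.+1 -> reach tau' side x1 x.
Proof.
move=> Hw; elim: l x => [|l IH] x lp E1 Ex.
  by rewrite (_ : x = x1); [exact: reach_refl | apply: val_inj; rewrite E1 Ex].
have lp' := ltnW lp; pose xl : G' := mk (base_el Hw lp').
apply: (reach_trans (IH xl lp' E1 erefl)).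
pose c := if odd l.+1 then o1 else o0.
rewrite (_ : x = tau' c xl); first by apply: reach_step; rewrite /c; case: ifP.
have W : walkb w l.+2 = tau c (walkb w l.+1) by rewrite /walkb /c /=; case: (odd l).
apply: val_inj; rewrite val_tau' /= -/(walkb w l.+1) -W.
by have /andP[/negbTE -> /negbTE ->] := base_el Hw lp; rewrite Ex.
Qed.

Let in_class w a : reach tau side w a -> exists2 l, (l < per w)%N & a = walkb w l.
Proof.
move=> H; apply: (reach_ind (P := fun a => exists2 l, (l < per w)%N & a = walkb w l)) H _.
  move=> i b; have H := @walk_uv_closed _ _ _ _ (tauK o0) (tauK o1) (sgt o0) (sgt o1) w b.
  by move: i; apply: I3P => // _ /H[].
by exists 0%N => //; exact: ltnW (period_gt1 _ _ _).
Qed.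

Let merged a := reach tau side phi a || reach tau side psi a.

(** The orbits of [phi] and of [psi] under colours 0 and 1 are two disjoint cycles. Each is cut open
    at the deleted flag, and the loose ends are joined to those of the other, which leaves a single
    cycle. *)
Lemma dipole_reach_center (x x' : G') :
  reach tau' side x x' = (reach tau side (val x) (val x')) || (merged (val x) && merged (val x')).
Proof.
have mP d a : d != o2 -> merged (tau d a) = merged a by move=> Hd; rewrite /merged !reachP.
have mphi : merged phi by rewrite /merged reach_refl.
have mpsi : merged psi by rewrite /merged reach_refl orbT.
apply/idP/idP => H.
  case: (boolP (merged (val x))) => mx; last first.
    rewrite -(up _ _ H (P := reach tau side (val x))) ?reach_refl //.
      by move=> a d; exact: reachP.
    have f a : merged a -> reach tau side (val x) a = false.
      move=> ma; apply/negbTE; apply: contra mx => H'; move: ma; rewrite /merged.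
      by case/orP => H2; apply/orP; [left|right]; apply: reach_trans H2 (reach_sym gem H').
    by rewrite !f.
  by rewrite -(up _ _ H (P := merged)) ?mx ?orbT // ?mphi ?mpsi // => a d; exact: mP.
pose e1 : G' := exist _ (tau o0 phi) (phi_psi (k := o0) isT).
pose e2 : G' := exist _ (tau o0 psi) (psi_phi (k := o0) isT).
have e12 : reach tau' side e1 e2.
  rewrite (_ : e2 = tau' o0 e1); first exact: reach_step.
  by apply: val_inj; rewrite val_tau' /= tauK eqxx.
have toe (w : G') : merged (val w) -> reach tau' side e1 w.
  case/orP => /in_class[[|l] lp E].
  - by have := val_phi w; rewrite E eqxx.
  - by apply: base_reach E => //; rewrite eqxx.
  - by have := val_psi w; rewrite E eqxx.
  - by apply: (reach_trans e12); apply: base_reach E => //; rewrite eqxx orbT.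
case: (boolP (merged (val x) && merged (val x'))) H => [/andP[mx mx'] _|nm].
  by apply: reach_trans (toe _ mx'); apply: reach_sym gem' _; exact: toe.
rewrite orbF => H; have mx : ~~ merged (val x).
  apply: contra nm => mx; rewrite mx /=; move: mx; rewrite /merged => /orP[] mx; apply/orP; [left|right];
    exact: reach_trans mx H.
suff [w [Ew Hw] _] : exists2 w : G', val w = val x' /\ reach tau' side x w & ~~ merged (val x').
  by rewrite (_ : x' = w) //; apply: val_inj.
apply: (reach_ind (P := fun a => exists2 w : G', val w = a /\ reach tau' side x w & ~~ merged a)) H _.
  move=> i _ i2 [w [<- Hw] mw]; have mi := mP i (val w) i2.
  exists (tau' i w); last by rewrite mi.
  split; last by apply: reach_trans Hw _; exact: reach_step.
  rewrite val_tau' ifN; last by apply: contra mw => /eqP E; rewrite -mi E.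
  by rewrite ifN //; apply: contra mw => /eqP E; rewrite -mi E.
by exists x => //; split=> //; exact: reach_refl.
Qed.

Lemma card_dipole : #|{: G'}|.+2 = #|G|.
Proof.
rewrite card_sig -(cardC (pred2 phi psi)) card2 eq_sym ne add2n; congr _.+2.
by apply: eq_card => a; rewrite !inE negb_or.
Qed.

Let rep a : exists x : G', forall Z : 'I_3 -> bool, Z o0 -> reach tau Z a (val x).
Proof.
have [->|N1] := eqVneq a phi.
  by exists (mk (phi_psi (k := o0) isT)) => Z Z0; exact: reach_step.
have [->|N2] := eqVneq a psi.
  by exists (mk (psi_phi (k := o0) isT)) => Z Z0; exact: reach_step.
have N : (a != phi) && (a != psi) by rewrite N1.
by exists (mk N) => Z _; exact: reach_refl.
Qed.

Let rep1 a : exists x : G', forall Z : 'I_3 -> bool, Z o1 -> reach tau Z a (val x).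
Proof.
have [->|N1] := eqVneq a phi.
  by exists (mk (phi_psi (k := o1) isT)) => Z Z0; exact: reach_step.
have [->|N2] := eqVneq a psi.
  by exists (mk (psi_phi (k := o1) isT)) => Z Z0; exact: reach_step.
have N : (a != phi) && (a != psi) by rewrite N1.
by exists (mk N) => Z _; exact: reach_refl.
Qed.

Lemma dipole_nv_side i : i != o2 -> nv tau' i = nv tau i.
Proof.
move=> i2; pose k := if i == o0 then o1 else o0.
have [k2 ki K] : [/\ k != o2, k != i & forall c, c != i -> c = k \/ c = o2].
  rewrite {}/k; have [->|->] : i = o0 \/ i = o1 by move: (i) i2; apply: I3P => //; auto.
    by split=> //; apply: I3P => //=; auto.
  by split=> //; apply: I3P => //=; auto.
have i2' : o2 != i by rewrite eq_sym.
rewrite /nv (card_imset_eq (g := fun x : G' => vertex tau i (val x))); last first.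
  move=> x y; split=> [/(vertexP gem')|/(vertexP gem)] H.
    by apply/(vertexP gem); rewrite -(@dipole_reach_side k).
  by apply/(vertexP gem'); rewrite (@dipole_reach_side k).
congr #|pred_of_set _|; apply/setP => A; apply/imsetP/imsetP => -[x _ ->].
  by exists (val x); rewrite ?inE.
have [y Hy] : exists y : G', reach tau (fun c => c != i) x (val y).
  have [->|->] : i = o0 \/ i = o1.
  - by move: (i) i2; apply: I3P => //; auto.
  - by have [y Hy] := rep1 x; exists y; apply: Hy.
  - by have [y Hy] := rep x; exists y; apply: Hy.
by exists y; rewrite ?inE //; apply/(vertexP gem).
Qed.

Lemma dipole_nv_center : (nv tau' o2).+1 = nv tau o2.
Proof.
pose f (x : G') := if merged (val x) then vertex tau o2 phi else vertex tau o2 (val x).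
have nmE a : ~~ merged a -> vertex tau o2 a != vertex tau o2 phi.
  by apply: contra => /eqP/esym/(vertexP gem) r; rewrite /merged r.
rewrite /nv (card_imset_eq (g := f)); last first.
  move=> x y; rewrite /f; split=> [/(vertexP gem')|H].
    rewrite dipole_reach_center => /orP[r|/andP[-> ->] //].
    have -> : merged (val x) = merged (val y).
      rewrite /merged; congr (_ || _); apply/idP/idP => H;
        by [exact: reach_trans H r | exact: reach_trans H (reach_sym gem r)].
    by case: ifP => // _; apply/(vertexP gem).
  apply/(vertexP gem'); rewrite dipole_reach_center; case: ifP H => mx; case: ifP => my E.
  - by rewrite orbT.
  - by have := nmE _ (negbT my); rewrite E eqxx.
  - by have := nmE _ (negbT mx); rewrite -E eqxx.
  - by rewrite (introT (vertexP gem _ _ _) E).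
rewrite [RHS](cardsD1 (vertex tau o2 psi)) imset_f ?inE // add1n.
congr _.+1; congr #|pred_of_set _|.
apply/setP => A; rewrite !inE; apply/imsetP/andP => [[x _ ->]|[nA /imsetP[a _ EA]]].
  split; last by rewrite /f; case: ifP => _; apply: imset_f; rewrite inE.
  rewrite /f; case: ifP => m; apply/eqP => /(vertexP gem) r.
    by move: distinct; rewrite r.
  by move/negbT: m; rewrite /merged (reach_sym gem r) orbT.
case: (boolP (reach tau side phi a)) => ra.
  have [x Hx] := rep phi; have r : merged (val x) by rewrite /merged Hx.
  by exists x; rewrite ?inE // /f r EA; apply/esym/(vertexP gem).
have [x Hx] := rep a; have r := Hx side isT; exists x; rewrite ?inE // /f ifN.
  by rewrite EA; apply/(vertexP gem).
rewrite /merged negb_or; apply/andP; split.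
  by apply: contra ra => r'; apply: reach_trans r' (reach_sym gem r).
apply: contra nA => r'; rewrite EA; apply/eqP/(vertexP gem).
exact: (reach_trans r (reach_sym gem r')).
Qed.
End DipoleCount.

(** The triangles of one component and those of all others cover [F] by two closed sets; these are
    disjoint because points are identified only along colours. *)
Lemma gempres_connected (R : realType) (F : topologicalType) (G : finType)
  (tau : 'I_3 -> G -> G) (q : G -> 'rV[R]_3 -> F) (a b : G) :
  hausdorff_space F -> connected [set: F] -> is_gem tau -> gempres tau q ->
  reach tau (fun=> true) a b.
Proof.
move=> hF cF gem [cq sq fq]; pose img c := [set q c y | y in simplex R 2 `&` setT].
have cimg c : closed (img c).
  by apply: compact_image_closed => //; exact: simplex_compact.
pose U := \bigcup_(c in [set c | reach tau (fun=> true) a c]) img c.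
pose V := \bigcup_(c in [set c | ~ reach tau (fun=> true) a c]) img c.
have cU : closed U by apply: closed_bigcup => //; exact: finite_finset.
have cV : closed V by apply: closed_bigcup => //; exact: finite_finset.
have UV : U = ~` V.
  apply/seteqP; split=> x /=.
    move=> [c /= rc [y [sy _] <-]] [d /= nrd [z [sz _]]] /esym /fq -/(_ sy sz) [_ r].
    by apply: nrd; apply: reach_trans rc _; apply: reach_sub r.
  move=> nV; have [c [y [sy qy]]] := sq x.
  case: (pselect (reach tau (fun=> true) a c)) => rc; first by exists c => //; exists y.
  by case: nV; exists c => //; exists y.
pose y0 : 'rV[R]_3 := \row_i (i == o0)%:R.
have sy0 : simplex R 2 y0.
  split=> [i|]; first by rewrite mxE ler0n.
  by rewrite sum3 !mxE /= addr0 addr0.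
have qE c : img c (q c y0) by exists y0.
have UT : U = setT.
  apply: cF; first by exists (q a y0), a => //=; exact: reach_refl.
    by exists U; [rewrite UV openC | rewrite setTI].
  by exists U => //; rewrite setTI.
have : U (q b y0) by rewrite UT.
move=> [c /= rc [y [sy _]]] /fq -/(_ sy sy0) [_ r].
by apply: reach_trans rc _; apply: reach_sub r.
Qed.

(** * Renaming the colours *)

Section Recolour.
Variables (G : finType) (tau : 'I_3 -> G -> G) (s : 'S_3).

Definition recolour (c : 'I_3) : G -> G := tau (s c).

Lemma recolour_reach (Z : 'I_3 -> bool) a b :
  reach recolour (fun c => Z (s c)) a b = reach tau Z a b.
Proof.
apply: eq_connect => x y /=; apply/existsP/existsP => -[i /andP[Zi E]].
  by exists (s i); rewrite Zi.
by exists (s^-1%g i); rewrite /recolour permKV Zi.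
Qed.

Lemma recolour_nv i : nv recolour i = nv tau (s i).
Proof.
rewrite /nv; congr #|pred_of_set _|; apply: eq_imset => a; apply/setP => b.
rewrite !inE -(recolour_reach (fun c => c != s i)); apply: eq_connect => x y /=.
by apply: eq_existsb => c; rewrite (inj_eq perm_inj).
Qed.

Lemma recolour_gempres (R : realType) (F : topologicalType) (q : G -> 'rV[R]_3 -> F) :
  gempres tau q -> gempres recolour (fun a y => q a (\row_v y 0 (s^-1%g v))).
Proof.
have sp (t : 'S_3) (y : 'rV[R]_3) : simplex R 2 y -> simplex R 2 (\row_v y 0 (t v)).
  move=> [y0 y1]; split=> [i|]; first by rewrite mxE.
  by rewrite -y1 [RHS](reindex_inj (@perm_inj _ t)); apply: eq_bigr => i _; rewrite mxE.
have rowK (t : 'S_3) (y : 'rV[R]_3) : \row_v (\row_v y 0 (t v)) 0 (t^-1%g v) = y.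
  by apply/rowP => v; rewrite !mxE permKV.
move=> [cq sq fq]; split.
- move=> a y.
  apply: (@continuous_comp _ _ _ (fun y : 'rV[R]_3 => \row_v y 0 (s^-1%g v)) (q a)); last exact: cq.
  move: y; change (continuous (fun y : 'rV[R]_3 => \row_v y 0 (s^-1%g v))).
  by apply: continuous_row => v; exact: continuous_coord.
- move=> x; have [a [y [sy <-]]] := sq x.
  by exists a, (\row_v y 0 (s v)); split; [exact: sp | rewrite rowK].
move=> a b y z sy sz; rewrite fq; [|exact: sp|exact: sp].
have rE : reach recolour (zero y) a b = reach tau (zero (\row_v y 0 (s^-1%g v))) a b.
  rewrite -recolour_reach; apply: eq_connect => c d /=.
  by apply: eq_existsb => i; rewrite /zero mxE permK.
rewrite rE; split=> -[E ->]; split=> //; last by rewrite E.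
by rewrite -(rowK s^-1%g y) -(rowK s^-1%g z) E.
Qed.

End Recolour.

(** Cancelling a dipole of any colour k, by renaming k to 2. The new gem is described only by its
    embedding [v] into the old one, so that two cancellations can be composed. *)
Lemma dipole_cancel (R : realType) (F : topologicalType) (G : finType)
  (tau : 'I_3 -> G -> G) (sg : G -> bool) (q : G -> 'rV[R]_3 -> F) (k : 'I_3) (phi : G) :
  (forall i, involutive (tau i)) -> (forall i a, sg (tau i a) = ~~ sg a) -> gempres tau q ->
  ~~ reach tau (fun c => c != k) phi (tau k phi) ->
  exists (G' : finType) (v : G' -> G) (tau' : 'I_3 -> G' -> G') (q' : G' -> 'rV[R]_3 -> F),
  [/\ injective v /\ (forall a, (a != phi) && (a != tau k phi) <-> exists x, v x = a),
      (forall i x, v (tau' i x) =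
        if tau i (v x) == phi then tau i (tau k phi)
        else if tau i (v x) == tau k phi then tau i phi else tau i (v x)),
      (forall i, involutive (tau' i)) /\ (forall i a, sg (v (tau' i a)) = ~~ sg (v a)),
      gempres tau' q'
    & (forall i, (nv tau' i + (i == k))%N = nv tau i) /\ (#|G'|.+2 = #|G|)].
Proof.
move=> tauK sgt pres; pose s := tperm o2 k; have s2 : s o2 = k by rewrite tpermL.
pose rt := recolour tau s; have rtK i : involutive (rt i) by apply: tauK.
have rsg i a : sg (rt i a) = ~~ sg a by apply: sgt.
have rpres := recolour_gempres s pres.
have rk : rt o2 = tau k by rewrite /rt /recolour s2.
rewrite -rk => dist.
have dist' : ~~ reach rt (fun c => c != o2) phi (rt o2 phi).
  apply: contra dist; rewrite -(recolour_reach _ s (fun c => c != k)).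
  by apply: reach_sub => c; rewrite -s2 (inj_eq perm_inj).
have [q' pres'] := dipole_gempres rtK rsg rpres dist'.
pose t' := dipole_tau rtK rsg dist'.
exists (undipole rt phi : finType), val, (recolour t' s), (fun a y => q' a (\row_v y 0 (s^-1%g v))).
have ss i : s (s i) = i by rewrite /s tpermK.
split.
- split=> [|a]; first exact: val_inj.
  split=> [H|[x <-]]; last by case: x.
  by exists (exist _ a H).
- by move=> i x; have -> : tau i = rt (s i) by rewrite /rt /recolour ss.
- split=> i; first exact: dipole_tauK.
  by move=> a; rewrite /recolour dipole_sg.
- exact: recolour_gempres.
split; last exact: card_dipole.
move=> i; have -> : nv tau i = nv rt (s i) by rewrite recolour_nv ss.
rewrite (recolour_nv t' s i); have [E|N] := eqVneq i k.
  by rewrite E addn1 -s2 ss -(dipole_nv_center rtK rsg dist').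
rewrite addn0 dipole_nv_side //; apply: contra N => /eqP E.
by rewrite -(ss i) E s2.
Qed.

(** Since [tau o0] and [tau o2] commute, an edge consists of a, its images under either of them, and
    its image under both. [sg] separates flags one step apart; the remaining coincidences are
    excluded by [tau o0 a <> tau o2 a]. *)
Lemma card_edges (G : finType) (tau : 'I_3 -> G -> G) (sg : G -> bool) :
  (forall i, involutive (tau i)) -> (forall i a, sg (tau i a) = ~~ sg a) ->
  (forall a, tau o0 (tau o2 a) = tau o2 (tau o0 a)) -> (forall a, tau o0 a <> tau o2 a) ->
  (4 * nv tau o1 = #|G|)%N.
Proof.
move=> tauK sgt com ne; have gem := bip_gem tauK sgt.
have tne i a : tau i a != a by apply/eqP; have [_] := gem i; apply.
have vE a : vertex tau o1 a = [set a; tau o0 a; tau o2 a; tau o0 (tau o2 a)]%SET.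
  apply/setP => b; rewrite !inE -!orbA; apply/idP/idP => [r|].
    apply: (reach_ind (P := fun b => [|| b == a, b == tau o0 a, b == tau o2 a | b == tau o0 (tau o2 a)])) r _.
      move=> i c i1; have [->|->] : i = o0 \/ i = o2 by move: (i) i1; apply: I3P; auto.
        by case/or4P => /eqP ->; rewrite ?tauK eqxx ?orbT.
      by case/or4P => /eqP ->; rewrite -?com ?tauK eqxx ?orbT.
    by rewrite eqxx.
  have r0 c : reach tau (fun c => c != o1) c (tau o0 c) by apply: reach_step.
  have r2 c : reach tau (fun c => c != o1) c (tau o2 c) by apply: reach_step.
  case/or4P => /eqP -> //; first exact: reach_refl.
  exact: reach_trans (r2 a) (r0 _).
have c4 a : #|vertex tau o1 a| = 4%N.
  have sgN b c : sg b != sg c -> b != c by apply: contra => /eqP ->.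
  rewrite (eq_card (B := mem [:: a; tau o0 a; tau o2 a; tau o0 (tau o2 a)])); last first.
    by move=> b; rewrite vE !inE -!orbA.
  apply/card_uniqP; rewrite /= !inE !negb_or ![a == tau _ _]eq_sym !tne /= andbT.
  have -> : (tau o0 a == tau o2 a) = false by apply/eqP; apply: ne.
  rewrite (inj_eq (inv_inj (tauK o0))) [a == _]eq_sym tne [tau o2 a == _]eq_sym tne !andbT /=.
  by apply/eqP => H; apply: (ne a); rewrite -[in LHS]H tauK.
rewrite mulnC; have := @card_uniform_partition _ 4 (vertex tau o1 @: [set: G]%SET) [set: G]%SET.
rewrite cardsT => -> //; first by move=> _ /imsetP[a _ ->].
apply/and3P; split.
- apply/eqP/setP => a; rewrite inE; apply/bigcupP; exists (vertex tau o1 a); last by rewrite inE; exact: reach_refl.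
  by apply: imset_f; rewrite inE.
- apply/finset.trivIsetP => _ _ /imsetP[a _ ->] /imsetP[b _ ->] N; rewrite -setI_eq0; apply/eqP/setP => c.
  rewrite !inE; apply/negP => /andP[ra rb]; move/negP: N; apply; apply/eqP/(vertexP gem).
  exact: reach_trans ra (reach_sym gem rb).
apply/imsetP => -[a _ E]; have : a \in vertex tau o1 a by rewrite inE; exact: reach_refl.
by rewrite -E inE.
Qed.

(** * Reducing a map to one vertex and one face *)

Section MapGem.
Variables (R : realType) (F : topologicalType) (g : nat).
Hypothesis (nF : [set: F] !=set0) (hF : hausdorff_space F) (cF : connected [set: F]) (g_gt0 : (0 < g)%N).

(* [tau o0], [tau o1], [tau o2] move a flag of a map on the surface [F] to the adjacent
   one with another vertex, edge, face; [sg] is the orientation of the flags. *)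
Definition map_gem (G : finType) (tau : 'I_3 -> G -> G) (sg : G -> bool)
    (q : G -> 'rV[R]_3 -> F) : Prop :=
  [/\ (forall i, involutive (tau i)) /\ (forall i a, sg (tau i a) = ~~ sg a),
      gempres tau q,
      (forall a, tau o0 (tau o2 a) = tau o2 (tau o0 a)),
      (forall a, tau o0 a <> tau o2 a)
    & (2 * (nv tau o0 + nv tau o1 + nv tau o2) + 4 * g = #|G| + 4)%N].

(** Duality: vertices and faces exchange their roles, so deleting an edge between two faces becomes
    contracting an edge between two vertices. *)
Lemma recolour_map_gem G tau sg q : @map_gem G tau sg q ->
  exists q', map_gem (recolour tau (tperm o0 o2)) sg q'.
Proof.
move=> [[tauK sgt] pres com ne E]; pose s := tperm o0 o2; exists (fun a y => q a (\row_v y 0 (s^-1%g v))).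
have [s0 s1 s2] : [/\ s o0 = o2, s o1 = o1 & s o2 = o0].
  by rewrite tpermL tpermR tpermD.
split; rewrite /recolour ?s0 ?s1 ?s2.
- by split=> i a; [apply: tauK | apply: sgt].
- exact: recolour_gempres.
- by move=> a; rewrite com.
- by move=> a /esym; apply: ne.
by rewrite !recolour_nv s0 s1 s2 -E; lia.
Qed.

(** An edge has four flags, so contracting it takes two dipoles. Cancelling [phi] with [psi] merges
    the two ends and leaves the other two flags x, x' as an edge of their own on which colours 0 and
    2 agree. Cancelling x with its neighbour [xi] of colour 1 absorbs this degenerate edge. *)
Lemma contract_edge G tau sg q phi : @map_gem G tau sg q ->
  ~~ reach tau (fun c => c != o0) phi (tau o0 phi) ->
  exists (G' : finType) tau' sg' q', @map_gem G' tau' sg' q' /\ (#|G'| < #|G|)%N.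
Proof.
move=> [[tauK sgt] pres com ne E] /(dipole_cancel tauK sgt pres).
move=> [G1 [v1 [tau1 [q1 [[inj1 im1] vtau1 [tau1K sgt1] pres1 [nv1 cG1]]]]]].
set psi := tau o0 phi in im1 vtau1.
have gem := bip_gem tauK sgt; have tne i a : tau i a != a by apply/eqP; have [_] := gem i; apply.
have psi_phi : psi != phi by exact: tne.
have psiK : tau o0 psi = phi by rewrite /psi tauK.
pose chi := tau o2 phi; pose chi' := tau o2 psi.
have chi'E : tau o0 chi = chi' by rewrite /chi com.
have chi'E' : tau o0 chi' = chi by rewrite -chi'E tauK.
have N1 : chi != phi by exact: tne.
have N2 : chi != psi by apply/eqP => /esym/ne.
have N3 : chi' != psi by exact: tne.
have N4 : chi' != phi by rewrite -psiK; apply/eqP => /esym/ne.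
have [x xE] : exists x, v1 x = chi by apply/im1; rewrite N1.
have [x' x'E] : exists x, v1 x = chi' by apply/im1; rewrite N4.
have tx0 : tau1 o0 x = x'.
  apply: inj1; rewrite vtau1 xE x'E chi'E; rewrite (negbTE N4) (negbTE N3) //.
have tx2 : tau1 o2 x = x'.
  by apply: inj1; rewrite vtau1 xE x'E /chi tauK eqxx.
have gem1 : is_gem tau1 by exact: bip_gem tau1K sgt1.
pose xi := tau1 o1 x; have xi_x : xi <> x by have [_] := gem1 o1; apply.
have xx' : x <> x' by rewrite -tx0 => /esym; have [_] := gem1 o0; apply.
have nvb i : (0 < nv tau1 i)%N by apply: nv_gt0 x.
have E1 : (2 * (nv tau1 o0 + nv tau1 o1 + nv tau1 o2) + 4 * g = #|G1| + 4)%N.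
  have e0 : (nv tau1 o0 + 1 = nv tau o0)%N := nv1 o0; have e1 : (nv tau1 o1 + 0 = nv tau o1)%N := nv1 o1.
  by have e2 : (nv tau1 o2 + 0 = nv tau o2)%N := nv1 o2; lia.
(* Otherwise x and x' are the whole surface, which is then a sphere, against g > 0. *)
have xi_x' : xi <> x'.
  move=> Exi; have two c : c = x \/ c = x'.
    have := gempres_connected x c hF cF gem1 pres1.
    move=> r; apply: (reach_ind (P := fun c => c = x \/ c = x')) r _; last by left.
    move=> i d _; have step : tau1 i x = x' by move: i; apply: I3P.
    by case=> ->; [right | left; rewrite -step tau1K].
  have : (#|G1| <= 2)%N.
    rewrite -cardsT; apply: leq_trans (subset_leq_card (_ : _ \subset [set x; x']%SET)) _.
      by apply/fintype.subsetP => c _; rewrite !inE; case: (two c) => ->; rewrite eqxx ?orbT.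
    by rewrite cards2; case: (_ != _).
  by have := nvb o0; have := nvb o1; have := nvb o2; lia.
have dist : ~~ reach tau1 (fun c => c != o1) x (tau1 o1 x).
  apply/negP => r; have : xi = x \/ xi = x'; last by case.
  apply: (reach_ind (P := fun c => c = x \/ c = x')) r _; last by left.
  move=> i d i1; have step : tau1 i x = x' by move: (i) i1; apply: I3P.
  by case=> ->; [right | left; rewrite -step tau1K].
have := dipole_cancel tau1K sgt1 pres1 dist; rewrite -/xi.
move=> [G2 [v2 [tau2 [q2 [[inj2 im2] vtau2 [tau2K sgt2] pres2 [nv2 cG2]]]]]].
have v2ne a : v2 a <> x /\ v2 a <> xi.
  by have [_ /(_ (ex_intro _ a erefl))/andP[/eqP ? /eqP ?]] := im2 (v2 a).
(* x' takes the place of [xi] in its edge. With this renaming the new flags embed into the old ones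
   so that colours 0 and 2 are respected, and the conditions on edges carry over. *)
pose m a := if v2 a == x' then xi else v2 a.
have m_ne a : m a <> x /\ m a <> x'.
  by rewrite /m; case: eqP => // N; case: (v2ne a).
have m_inj : injective m.
  move=> a b; rewrite /m; case: eqP => [Ea|_]; case: eqP => [Eb|_] Em; apply: inj2 => //.
  - by rewrite Ea Eb.
  - by case: (v2ne b) => _ [].
  - by case: (v2ne a) => _ [].
have step02 i : i != o1 -> tau1 i x = x' by move: i; apply: I3P.
have m_tau i a : i != o1 -> m (tau2 i a) = tau1 i (m a).
  move=> i1; have tx := step02 i i1; have tx' : tau1 i x' = x by rewrite -tx tau1K.
  have txi : tau1 i xi != x' by apply/eqP => H; apply: xi_x; rewrite -(tau1K i xi) H.
  have txi2 : tau1 i xi != x by apply/eqP => H; apply: xi_x'; rewrite -(tau1K i xi) H.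
  rewrite /m vtau2; have [Ea|Na] := eqVneq (v2 a) x'.
    by rewrite Ea tx' eqxx (negbTE txi).
  have [Ha Hb] := v2ne a.
  have -> : (tau1 i (v2 a) == x) = false.
    by apply/eqP => H; move/eqP: Na; apply; rewrite -(tau1K i (v2 a)) H.
  case: (eqVneq (tau1 i (v2 a)) xi) => [H|_]; first by rewrite tx eqxx.
  by rewrite ifN //; apply/eqP => H; apply: Ha; rewrite -(tau1K i (v2 a)) H.
have low i b : i != o1 -> b <> x -> b <> x' -> v1 (tau1 i b) = tau i (v1 b).
  move=> i1 bx bx'; rewrite vtau1.
  have bphi : v1 b != phi /\ v1 b != psi.
    by have [_ /(_ (ex_intro _ b erefl))/andP[]] := im1 (v1 b).
  have cases (d : G) : (d = phi \/ d = psi) -> tau i (v1 b) <> d.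
    move=> Hd H; have Hb : v1 b = tau i d by rewrite -H tauK.
    have i02 : i = o0 \/ i = o2 by move: (i) i1; apply: I3P; auto.
    case: bphi => /eqP B1 /eqP B2; case: Hd => Ed; case: i02 => Ei; rewrite Ed Ei in Hb.
    - by apply: B2.
    - by apply: bx; apply: inj1; rewrite Hb xE.
    - by apply: B1; rewrite Hb psiK.
    - by apply: bx'; apply: inj1; rewrite Hb x'E.
  by rewrite ifN ?ifN //; apply/eqP; apply: cases; auto.
pose n a := v1 (m a); have n_inj : injective n by move=> a b /inj1/m_inj.
have n_tau i a : i != o1 -> n (tau2 i a) = tau i (n a).
  by move=> i1; rewrite /n m_tau // low //; case: (m_ne a).
exists G2, tau2, (fun a => sg (v1 (v2 a))), q2; split; last by lia.
split=> //.
- by move=> a; apply: n_inj; rewrite !n_tau.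
- by move=> a /(congr1 n); rewrite !n_tau // => /ne.
have e0 : (nv tau2 o0 + 0 = nv tau1 o0)%N := nv2 o0; have e1 : (nv tau2 o1 + 1 = nv tau1 o1)%N := nv2 o1.
by have e2 : (nv tau2 o2 + 0 = nv tau1 o2)%N := nv2 o2; lia.
Qed.

(** Induction on the number of flags: edges with two different ends are contracted, in the map or in
    its dual. When none is left, connectedness gives one vertex and one face. The numerical clause
    of [map_gem] is Euler's formula with [#|G|] = 4 E for E edges, so E = 2 g. *)
Lemma unicellular G tau sg q : @map_gem G tau sg q ->
  exists (G' : finType) tau' sg' q', [/\ @map_gem G' tau' sg' q', #|G'| = (8 * g)%N,
    nv tau' o0 = 1%N & nv tau' o2 = 1%N].
Proof.
have [k] := ubnP #|G|; elim: k G tau sg q => // k IH G tau sg q; rewrite ltnS => Gk M.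
have [[tauK sgt] pres com ne E] := M; have gem := bip_gem tauK sgt.
have [] := boolP [exists a, ~~ reach tau (fun c => c != o0) a (tau o0 a)].
  move=> /existsP[phi /(contract_edge M)[G' [tau' [sg' [q' [M' lt]]]]]].
  by apply: IH M'; exact: leq_trans lt Gk.
rewrite negb_exists => /forallP h0.
have [] := boolP [exists a, ~~ reach tau (fun c => c != o2) a (tau o2 a)].
  have [q2 M2] := recolour_map_gem M.
  move=> /existsP[phi Hphi]; have := @contract_edge _ _ _ _ phi M2.
  rewrite /recolour tpermL; case.
    apply: contra Hphi; rewrite -(recolour_reach _ (tperm o0 o2) (fun c => c != o2)) /=.
    by apply: reach_sub => c; apply: contra => /eqP H; rewrite -(tpermK o0 o2 c) H tpermR.
  move=> G' [tau' [sg' [q' [M' lt]]]].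
  by apply: IH M'; exact: leq_trans lt Gk.
rewrite negb_exists => /forallP h2.
(* If no step of colour k' leaves its class, all of the connected gem is one class. *)
have one k' : (forall a, reach tau (fun c => c != k') a (tau k' a)) -> (nv tau k' <= 1)%N.
  move=> h; rewrite /nv; apply/card_le1_eqP => _ _ /imsetP[a _ ->] /imsetP[b _ ->].
  apply/(vertexP gem); have r := gempres_connected b a hF cF gem pres.
  apply: (reach_ind (P := reach tau (fun c => c != k') b)) r _; last exact: reach_refl.
  move=> i c _ /reach_trans; apply; have [->|ik] := eqVneq i k'; first exact: h.
  exact: reach_step.
have n0 : (nv tau o0 <= 1)%N by apply: one => a; have := h0 a; rewrite negbK.
have n2 : (nv tau o2 <= 1)%N by apply: one => a; have := h2 a; rewrite negbK.
have [a _] : exists a : G, true by case: nF => x _; have [_ /(_ x)[a _] _] := pres; exists a.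
have := nv_gt0 tau o0 a; have := nv_gt0 tau o2 a; have := card_edges tauK sgt com ne.
move=> e1 e2 e3; exists G, tau, sg, q; split=> //; lia.
Qed.

End MapGem.

Lemma perm3_move (s t : 'S_3) : s o0 = t o0 -> t = s \/ t = (tperm o1 o2 * s)%g.
Proof.
move=> E0; case: (eqVneq (t o1) (s o1)) => E1; [left|right].
  exact: perm3P.
apply: perm3P; first by rewrite permM tpermD.
rewrite permM tpermL.
have : t o1 = s o0 \/ t o1 = s o1 \/ t o1 = s o2.
  by rewrite -(permKV s (t o1)); move: (s^-1%g (t o1)); apply: I3P; auto.
by case=> [|[H|//]]; [rewrite E0 => /perm_inj | rewrite H eqxx in E1].
Qed.

(** * Euler characteristic of the subdivided triangulation *)

Section InitialCounts.
Variables (n : nat) (T : face_pairing 2 n).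
Hypothesis paired : forall t i, exists u, T t i = Some u.
Local Notation gl := (tri_glue T).
Local Notation G := ('I_n * 'S_3)%type.
Local Notation sd := (sd_tau gl).

Let glE t i : T t i = Some (gl t i).
Proof. by rewrite /tri_glue; have [u ->] := paired t i. Qed.

Let gl_sym t i t' s : gl t i = (t', s) -> gl t' (s i) = (t, s^-1%g).
Proof. by move=> E; have := glE t i; rewrite E => /pairing_sym; rewrite glE => -[]. Qed.
Let gl_irr t i t' s : gl t i = (t', s) -> (t', s i) <> (t, i).
Proof. by move=> E; have := glE t i; rewrite E => /pairing_irr. Qed.

Lemma sd_gemE : is_gem sd. Proof. exact: sd_gem gl_sym gl_irr. Qed.
Let gem := sd_gemE.

(** The i-dimensional member of the flag, which is an object counted by [num_faces]. *)
Definition gem_cell (i : 'I_3) (a : G) : 'I_n * {set 'I_3} := (a.1, a.2 @: [set j : 'I_3 | (j <= i)%N]%SET).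

Let reach_tri t (s s' : 'S_3) : reach sd (fun c => c != o2) (t, s) (t, s').
Proof.
have st0 r : reach sd (fun c => c != o2) (t, r) (t, (tperm o0 o1 * r)%g).
  exact: (reach_step sd (i := o0)).
have st1 r : reach sd (fun c => c != o2) (t, r) (t, (tperm o1 o2 * r)%g).
  exact: (reach_step sd (i := o1)).
have same (r r' : 'S_3) : r o0 = r' o0 -> reach sd (fun c => c != o2) (t, r) (t, r').
  by case/perm3_move => ->; [exact: reach_refl | exact: st1].
have : s' o0 = s o0 \/ s' o0 = s o1 \/ s' o0 = s o2.
  by rewrite -(permKV s (s' o0)); move: (s^-1%g (s' o0)); apply: I3P; auto.
case=> [E|[E|E]]; first exact: same.
  by apply: reach_trans (st0 s) _; apply: same; rewrite permM tpermL.
apply: reach_trans (st1 s) _; apply: reach_trans (st0 _) _; apply: same.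
by rewrite !permM !tpermL.
Qed.

Let mem_im (s : 'S_3) (A : {set 'I_3}) x : (x \in s @: A) = (s^-1%g x \in A).
Proof. by rewrite -{1}(permKV s x) (mem_imset _ _ (@perm_inj _ s)). Qed.

Let cell_eq i a b : gem_cell i a = gem_cell i b -> reach sd (fun c => c != i) a b.
Proof.
case: a b => t s [t' s']; rewrite /gem_cell /= => -[<- /setP E].
have {}E x : (s^-1%g (s' x) <= i)%N = (x <= i)%N.
  by have := E (s' x); rewrite !mem_im !inE permK.
have st0 r : i != o0 -> reach sd (fun c => c != i) (t, r) (t, (tperm o0 o1 * r)%g).
  by move=> i0; apply: (reach_step sd (i := o0)); rewrite eq_sym.
have st1 r : i != o1 -> reach sd (fun c => c != i) (t, r) (t, (tperm o1 o2 * r)%g).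
  by move=> i0; apply: (reach_step sd (i := o1)); rewrite eq_sym.
have [i0|[i1|i2]] : i = o0 \/ i = o1 \/ i = o2 by move: (i); apply: I3P; auto.
- have : s o0 = s' o0.
    rewrite -[RHS](permKV s); congr (s _); have := E o0; rewrite i0.
    by move: (s^-1%g (s' o0)); apply: I3P.
  by case/perm3_move => ->; [exact: reach_refl | apply: st1; rewrite i0].
- have E2 : s o2 = s' o2.
    rewrite -[RHS](permKV s); congr (s _); have := E o2; rewrite i1.
    by move: (s^-1%g (s' o2)); apply: I3P.
  have : s o0 = s' o0 \/ (tperm o0 o1 * s)%g o0 = s' o0.
    rewrite permM tpermL -[s' o0](permKV s); have := E o0; rewrite i1.
    by move: (s^-1%g (s' o0)); apply: I3P; auto.
  case=> /perm3_move[] H.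
  - by rewrite H; exact: reach_refl.
  - by move: E2; rewrite H permM tpermR => /perm_inj.
  - by rewrite H; apply: st0; rewrite i1.
  - by move: E2; rewrite H !permM tpermR tpermR => /perm_inj.
- by rewrite i2; exact: reach_tri.
Qed.

Let cell_tau i c a : c != i -> connect (face_glued T) (gem_cell i a) (gem_cell i (sd c a)).
Proof.
case: a => t s ci; rewrite /sd_tau.
have tp (k l : 'I_3) : (k <= i)%N = (l <= i)%N -> gem_cell i (t, (tperm k l * s)%g) = gem_cell i (t, s).
  move=> kl; rewrite /gem_cell /=; congr (_, _); apply/setP => x; rewrite !mem_im !inE invMg permM tpermV.
  by case: tpermP => // ->; rewrite kl.
case: eqP => [c0|/eqP c0].
  by rewrite tp //; move: ci; rewrite c0; move: (i); apply: I3P.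
case: eqP => [c1|/eqP c1].
  by rewrite tp //; move: ci; rewrite c1; move: (i); apply: I3P.
apply: connect1; apply/existsP; exists (s o2); apply/existsP; exists (gl t (s o2)).2.
rewrite /= mem_im permK inE -ltnNge; apply/and3P; split.
- by move: (c) c0 c1 ci; apply: I3P => // _ _; move: (i); apply: I3P.
- by rewrite glE; apply/eqP; case: (gl _ _).
- by rewrite -imset_comp; apply/eqP/eq_imset => x /=; rewrite permM.
Qed.

Lemma face_glued_sym : symmetric (face_glued T).
Proof.
suff H a b : face_glued T a b -> face_glued T b a by move=> a b; apply/idP/idP; apply: H.
move=> /existsP[i /existsP[s /and3P[ia /eqP Tai /eqP Eb]]].
apply/existsP; exists (s i); apply/existsP; exists s^-1%g; apply/and3P; split.
- by rewrite Eb (mem_imset _ _ (@perm_inj _ s)).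
- exact/eqP/pairing_sym.
by rewrite Eb -imset_comp; apply/eqP/esym; rewrite -[RHS]imset_id; apply: eq_imset => x /=; exact: permK.
Qed.

Let cell_step i a c : face_glued T (gem_cell i a) c ->
  exists2 b, gem_cell i b = c & reach sd (fun c => c != i) a b.
Proof.
case: a c => t s [t' A] /existsP[j /existsP[r /and3P[/= jA /eqP Tj /eqP ->]]].
(* The position of the vertex opposite the crossed facet. Exchanging it with the last position keeps
   the face and lets colour 2 cross this facet. *)
pose k := s^-1%g j; have ki : (i < k)%N by move: jA; rewrite mem_im inE ltnNge.
have k2 : (i < o2)%N by apply: leq_trans ki _; rewrite -ltnS ltn_ord.
have Ecell : gem_cell i (t, (tperm k o2 * s)%g) = gem_cell i (t, s).
  rewrite /gem_cell /=; congr (_, _); apply/setP => x; rewrite !mem_im !inE invMg permM tpermV.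
  have Nk : (k <= i)%N = false by rewrite leqNgt ki.
  have N2 : (o2 <= i)%N = false by rewrite leqNgt k2.
  by case: tpermP => // ->; rewrite Nk N2.
exists (sd o2 (t, (tperm k o2 * s)%g)).
  move: Ecell; rewrite /gem_cell /sd_tau /= => -[E].
  rewrite permM tpermR permKV; have := glE t j; rewrite Tj => -[<-] /=.
  rewrite -E; apply/eqP; rewrite xpair_eqE eqxx /=; apply/eqP; rewrite -imset_comp.
  by apply: eq_imset => x /=; rewrite [LHS]permM.
apply: reach_trans (cell_eq (esym Ecell)) _; apply: reach_step.
by apply: contraL k2 => /eqP <-; rewrite ltnn.
Qed.

Let cellP i a b : connect (face_glued T) (gem_cell i a) (gem_cell i b) = reach sd (fun c => c != i) a b.
Proof.
apply/idP/idP => [/connectP[p]|r]; last first.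
  apply: (reach_ind (P := fun b => connect (face_glued T) (gem_cell i a) (gem_cell i b))) r _ => //.
  by move=> c d ci /connect_trans; apply; exact: cell_tau.
elim: p a => [|c p IH] a /=; first by move=> _ /esym/cell_eq.
move=> /andP[/cell_step[b' <- r] pp] E; exact: reach_trans r (IH _ pp E).
Qed.

Let set0E : [set j : 'I_3 | (j <= o0)%N]%SET = [set o0]%SET.
Proof. by apply/setP; apply: I3P; rewrite !inE. Qed.
Let set1E : [set j : 'I_3 | (j <= o1)%N]%SET = ~: [set o2]%SET.
Proof. by apply/setP; apply: I3P; rewrite !inE. Qed.
Let set2E : [set j : 'I_3 | (j <= o2)%N]%SET = [set: 'I_3]%SET.
Proof. by apply/setP; apply: I3P; rewrite !inE. Qed.

Let fsym : connect_sym (face_glued T). Proof. exact: sym_connect_sym face_glued_sym. Qed.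

Let card_cell i a : #|(gem_cell i a).2| = i.+1.
Proof.
rewrite /= card_imset; last exact: perm_inj.
by move: i; apply: I3P; [rewrite set0E cards1|rewrite set1E cardsC1 card_ord|rewrite set2E cardsT card_ord].
Qed.

Let cell_surj (i : 'I_3) (c : 'I_n * {set 'I_3}) : #|c.2| = i.+1 -> exists a, gem_cell i a = c.
Proof.
case: c => t A; move: i; apply: I3P => /= cA.
- have /cards1P[v ->] : #|A| == 1%N by rewrite cA.
  by exists (t, tperm o0 v); rewrite /gem_cell set0E imset_set1 tpermL.
- have /cards1P[v Ev] : #|~: A| == 1%N by rewrite cardsCs finset.setCK card_ord cA.
  exists (t, tperm o2 v); rewrite /gem_cell -[A]finset.setCK Ev set1E /=; congr (_, _).
  by apply/setP => x; rewrite mem_im !inE tpermV; case: tpermP => [->|->|]; rewrite ?eqxx //;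
    [rewrite eq_sym | move=> /eqP /negbTE -> /eqP /negbTE ->].
- have /eqP -> : A == [set: 'I_3]%SET by rewrite eqEcard finset.subsetT cardsT card_ord cA.
  exists (t, 1%g); rewrite /gem_cell set2E; congr (_, _); apply/setP => x.
  by rewrite mem_im !inE.
Qed.

(** Flags with the same i-face differ by colours other than i ([cell_eq]), and every gluing of an
    i-face lifts to such colours ([cell_step]). *)
Lemma sd_nv (i : 'I_3) : nv sd i = num_faces T i.
Proof.
rewrite /nv (card_imset_eq (g := fun a => fingraph.root (face_glued T) (gem_cell i a))); last first.
  move=> a b; split=> [/(vertexP gem)|/eqP]; first by rewrite -cellP -(root_connect fsym) => /eqP.
  by rewrite (root_connect fsym) cellP => /(vertexP gem).
rewrite /num_faces /n_comp_mem; apply: eq_card => c; rewrite !inE.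
have card_root a : #|(fingraph.root (face_glued T) (gem_cell i a)).2| = i.+1.
  have /connectP[p + ->] := connect_root (face_glued T) (gem_cell i a).
  elim: p a => [|d p IH] a /=; first by move=> _; exact: card_cell.
  by move=> /andP[/cell_step[b <- _] pp]; exact: IH.
apply/imsetP/andP => [[a _ ->]|[rc /eqP /cell_surj[a Ea]]].
  by rewrite card_root eqxx; split=> //; apply: roots_root fsym _.
by exists a; rewrite ?inE // Ea (eqP rc).
Qed.

Lemma sd_nv2 : nv sd o2 = n.
Proof.
rewrite /nv (card_imset_eq (g := fst)); last first.
  move=> [t s] [t' s']; split=> [/(vertexP gem) r|/= ->]; last by apply/(vertexP gem); exact: reach_tri.
  apply: (reach_ind (P := fun b => t = b.1)) r _ => // i [d r] /=.
  by move: i; apply: I3P.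
rewrite -[RHS]card_ord -cardsT; congr #|pred_of_set _|; apply/setP => t; rewrite inE.
by apply/imsetP; exists (t, 1%g); rewrite ?inE.
Qed.

Lemma sd_comm a : sd o0 (sd o2 a) = sd o2 (sd o0 a).
Proof. by case: a => t s; rewrite /sd_tau /= permM tpermD // mulgA. Qed.

Lemma sd_ne a : sd o0 a <> sd o2 a.
Proof.
case: a => t s; rewrite /sd_tau /= => -[E1 E2].
have := @gl_irr t (s o2) (gl t (s o2)).1 (gl t (s o2)).2.
rewrite -surjective_pairing; apply => //; rewrite -E1; congr (_, _).
by rewrite -permM -E2 permM tpermD.
Qed.

(** The parity of the vertex order compensates that of the gluing permutation, so coherent
    orientations of the triangles make every colour reverse the orientation of flags. *)
Lemma sd_sg (o : 'I_n -> bool) (i : 'I_3) (a : G) :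
  (forall t i t' (s : 'S_3), T t i = Some (t', s) -> o t (+) o t' = ~~ odd_perm s) ->
  o (sd i a).1 (+) odd_perm (sd i a).2 = ~~ (o a.1 (+) odd_perm a.2).
Proof.
case: a => t s ori; move: i; apply: I3P; rewrite /sd_tau /= odd_permM ?odd_tperm //=.
- by rewrite addbN.
- by rewrite addbN.
have := glE t (s o2); case: (gl t (s o2)) => t' r /ori /=.
by case: (o t); case: (o t'); case: (odd_perm r); case: (odd_perm s).
Qed.

End InitialCounts.

Lemma surface_unicellular (R : realType) (F : topologicalType) (g : nat) :
  (0 < g)%N -> closed_orientable_surface R g F ->
  exists (G : finType) tau sg q, [/\ @map_gem R F g G tau sg q, #|G| = (8 * g)%N,
    nv tau o0 = 1%N & nv tau o2 = 1%N].
Proof.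
move=> g0 [[nF cF _ hF bF] [n [T [triT [ornt ori] chi]]]].
have [p pres] := surface_tripres bF triT.
have paired := closed_paired bF triT.
pose tau := sd_tau (tri_glue T); pose sg (a : 'I_n * 'S_3) := ornt a.1 (+) odd_perm a.2.
have sgt i a : sg (tau i a) = ~~ sg a := sd_sg paired i a ori.
have tauK i : involutive (tau i) by have [] := sd_gemE paired i.
have com a : tau o0 (tau o2 a) = tau o2 (tau o0 a) := sd_comm T a.
have ne a : tau o0 a <> tau o2 a := sd_ne paired (a := a).
apply: (@unicellular R F g nF hF cF g0 _ tau sg (fun a y => p a.1 (sd_map a.2 y))).
split=> //; first exact: sd_gempres.
have := card_edges tauK sgt com ne; rewrite card_prod card_ord card_Sn (_ : 3`! = 6)%N // => e1.
have e2 : nv tau o2 = n := sd_nv2 paired.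
have E0 : nv tau o0 = num_faces T 0 := sd_nv paired o0.
have E1 : nv tau o1 = num_faces T 1 := sd_nv paired o1.
have E2 : nv tau o2 = num_faces T 2 := sd_nv paired o2.
move: chi e1; rewrite /euler_char sum3 /= -E0 -E1 -E2 e2 expr0 expr1 sqrrN expr1n !mul1r mulN1r.
by move: (nv tau o0) (nv tau o1) => v e; lia.
Qed.

(** * Subdivision and Sperner's lemma *)

Section Faces.
Variable V : eqType.
Implicit Types (f g : seq V -> bool) (s t u : seq V).

Fixpoint faces (s : seq V) : seq (seq V) :=
  if s is b :: t then t :: map (cons b) (faces t) else [::].

(** The mod 2 coboundary. Simplices are lists of vertices, ordered and possibly degenerate; cochains
    are arbitrary boolean functions of lists. *)
Definition dl f s : bool := \big[addb/false]_(t <- faces s) f t.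

Lemma dl_nil f : dl f [::] = false. Proof. by rewrite /dl big_nil. Qed.

Lemma dl_cons f b t : dl f (b :: t) = f t (+) dl (fun u => f (b :: u)) t.
Proof. by rewrite /dl /= big_cons big_map. Qed.

Lemma dl_eq f g s : (forall t, t \in faces s -> f t = g t) -> dl f s = dl g s.
Proof. exact: eq_big_seq. Qed.

Lemma dl_eq0 f s : (forall t, t \in faces s -> f t = false) -> dl f s = false.
Proof. by move=> H; rewrite (dl_eq H) /dl big1_eq. Qed.

Lemma dl_add f g s : dl (fun t => f t (+) g t) s = dl f s (+) dl g s.
Proof. exact: big_split. Qed.

Lemma dl_dl f s : dl (dl f) s = false.
Proof.
elim: s f => [|b t IH] f; first by rewrite dl_nil.
rewrite dl_cons (dl_eq (f := fun u => dl f (b :: u)) (g := fun u => f u (+) dl (fun w => f (b :: w)) u)); last first.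
  by move=> u _; rewrite dl_cons.
by rewrite dl_add IH addbF addbb.
Qed.

Lemma size_faces s t : t \in faces s -> size s = (size t).+1.
Proof.
elim: s t => [|b s IH] t //=; rewrite inE => /orP[/eqP -> //|/mapP[u /IH -> ->] //].
Qed.

Lemma mem_faces s t x : t \in faces s -> x \in t -> x \in s.
Proof.
elim: s t => [|b s IH] t //=; rewrite !inE => /orP[/eqP ->|/mapP[u us ->]].
  by move=> ->; rewrite orbT.
by rewrite inE => /orP[->//|/(IH _ us) ->]; rewrite orbT.
Qed.

Definition symmetric_cochain f := forall s t, perm_eq s t -> f s = f t.

(** Any entry can be moved to the front; then [dl_cons] reduces to the tail and the cochain
    [f (x :: _)], which is again symmetric. *)
Lemma dl_sym f : symmetric_cochain f -> symmetric_cochain (dl f).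
Proof.
move=> + s; have [k] := ubnP (size s); elim: k s f => // k IH s f; rewrite ltnS => sk sf t st.
have move_front x : forall p1 p2 g, symmetric_cochain g -> dl g (p1 ++ x :: p2) = dl g (x :: p1 ++ p2).
  elim=> // y p1 IHp p2 g sg; rewrite /= dl_cons IHp; last by move=> u w uw; apply: sg; rewrite perm_cons.
  rewrite !dl_cons addbCA; congr (_ (+) (_ (+) _)).
  - by apply: sg; apply/permPl; exact: (perm_catCA p1 [:: x] p2).
  - by apply: dl_eq => u _; apply: sg; apply/permPl; exact: (perm_catCA [:: y] [:: x] u).
case: s sk st => [|x s] sk st; first by move: st; rewrite perm_sym => /perm_nilP ->.
have xt : x \in t by rewrite -(perm_mem st) mem_head.
case/splitPr: xt st => p1 p2 st; rewrite move_front //.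
have st' : perm_eq s (p1 ++ p2) by move: st; rewrite perm_sym -cat1s perm_catCA cat1s perm_cons perm_sym.
rewrite !dl_cons (sf _ _ st'); congr (_ (+) _); apply: IH => //.
by move=> u w uw; apply: sf; rewrite perm_cons.
Qed.

End Faces.

Lemma faces_map (T T' : eqType) (A : T -> T') s : faces (map A s) = map (map A) (faces s).
Proof.
elim: s => //= a s ->; congr cons; rewrite -!map_comp; exact: eq_map.
Qed.

Lemma dl_map (T T' : eqType) (A : T -> T') (f : seq T' -> bool) s :
  dl (fun t => f (map A t)) s = dl f (map A s).
Proof. by rewrite /dl faces_map big_map. Qed.

(** * Barycentric subdivision of cochains *)

Section Cochain.
Variables (R : realType) (n : nat).
Local Notation V := 'rV[R]_n.
Implicit Types (f g : seq V -> bool) (s t u : seq V).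

Definition centroid s : V := (size s)%:R^-1 *: \sum_(x <- s) x.

(** Barycentric subdivision as an iterated cone from centroids. [k] is the fuel of the recursion on
    faces; for [k = size s] the subdivision is complete. *)
Fixpoint sdn (k : nat) (s : seq V) : seq (seq V) :=
  if k is k'.+1 then [seq centroid s :: u | t <- faces s, u <- sdn k' t] else [:: s].

Lemma sdnS k s : sdn k.+1 s = [seq centroid s :: u | t <- faces s, u <- sdn k t].
Proof. by []. Qed.

(** The transpose of the subdivision chain map: the cochain is evaluated on the sum of the small
    simplices. *)
Definition sd f s : bool := \big[addb/false]_(u <- sdn (size s) s) f u.

Lemma sd_nil f : sd f [::] = f [::].
Proof. by rewrite /sd big_seq1. Qed.

Lemma sd_rec f s : (0 < size s)%N -> sd f s = dl (fun t => sd (fun u => f (centroid s :: u)) t) s.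
Proof.
case: s => // a s _; rewrite /sd {1}[size _]/= -/(sdn _ _).
rewrite sdnS big_allpairs_dep; apply: eq_big_seq => t /size_faces [<-] //.
Qed.

Lemma sd_eq f g s : (forall u, u \in sdn (size s) s -> f u = g u) -> sd f s = sd g s.
Proof. exact: eq_big_seq. Qed.

Lemma sd_add f g s : sd (fun t => f t (+) g t) s = sd f s (+) sd g s.
Proof. exact: big_split. Qed.

(** Subdivision is a chain map. For the centroid b, [dl f (b :: u)] is [f u] plus the coboundary of
    [f (b :: _)] at u; by induction the second part sums to a double coboundary, which is 0. *)
Lemma sd_dl f s : sd (dl f) s = dl (sd f) s.
Proof.
have [k] := ubnP (size s); elim: k f s => // k IH f s; rewrite ltnS => sk.
case: s sk => [|a s] sk; first by rewrite sd_nil !dl_nil.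
rewrite sd_rec //; set b := centroid _.
rewrite (dl_eq (g := fun t => sd f t (+) dl (sd (fun w => f (b :: w))) t)).
  by rewrite dl_add dl_dl addbF.
move=> t /size_faces st; rewrite (sd_eq (g := fun u => f u (+) dl (fun w => f (b :: w)) u)).
  by rewrite sd_add IH // -ltnS -st.
by move=> u _; rewrite dl_cons.
Qed.

Lemma size_sdn k s u : u \in sdn k s -> (k <= size s)%N -> size u = size s.
Proof.
elim: k s u => [|k IH] s u /=; first by rewrite inE => /eqP ->.
case/allpairsPdep=> t [w [ts wt ->]] /=; rewrite (size_faces ts) ltnS => kt.
by rewrite (IH _ _ wt).
Qed.

(* [subd m s u]: the simplex [u] occurs in the [m]-fold barycentric subdivision of [s]. *)
Fixpoint subd (m : nat) s u : Prop :=
  if m is m'.+1 then exists2 w, w \in sdn (size s) s & subd m' w u else u = s.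

Lemma iter_sd_eq m f g s : (forall u, subd m s u -> f u = g u) -> iter m sd f s = iter m sd g s.
Proof.
elim: m s => [|m IH] s H /=; first exact: H.
by apply: sd_eq => w ws; apply: IH => u wu; apply: H; exists w.
Qed.

Lemma iter_sd_add m f g s : iter m sd (fun t => f t (+) g t) s = iter m sd f s (+) iter m sd g s.
Proof.
elim: m s => [|m IH] s //=; rewrite -sd_add; apply: sd_eq => w _; exact: IH.
Qed.

Lemma iter_sd_dl m f s : iter m sd (dl f) s = dl (iter m sd f) s.
Proof.
elim: m s => [|m IH] s //=; rewrite -sd_dl; apply: sd_eq => w _; exact: IH.
Qed.

Lemma iter_sd_false m s : iter m sd (fun=> false) s = false.
Proof.
elim: m s => [|m IH] s //=; rewrite (sd_eq (g := fun=> false)) //.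
by rewrite /sd big1_eq.
Qed.

Lemma size_subd m s u : subd m s u -> size u = size s.
Proof.
elim: m s => [|m IH] s /=; first by move=> ->.
by move=> [w /size_sdn -/(_ (leqnn _)) <- /IH].
Qed.

(** The form of convexity that subdivision respects: centroids are the only points it adds. *)
Definition avg_closed (C : set V) : Prop :=
  forall s, (0 < size s)%N -> (forall x, x \in s -> C x) -> C (centroid s).

Lemma sdn_closed C k s u : avg_closed C -> (forall x, x \in s -> C x) ->
  u \in sdn k s -> forall x, x \in u -> C x.
Proof.
move=> aC; elim: k s u => [|k IH] s u sC /=; first by rewrite inE => /eqP ->.
case/allpairsPdep=> t [w [ts wt ->]] x; rewrite inE => /orP[/eqP ->|xw].
  by apply: aC => //; rewrite (size_faces ts).
by apply: (IH t w) xw => // y yt; apply: sC; exact: mem_faces yt.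
Qed.

Lemma subd_closed C m s u : avg_closed C -> (forall x, x \in s -> C x) ->
  subd m s u -> forall x, x \in u -> C x.
Proof.
move=> aC; elim: m s => [|m IH] s sC /=; first by move=> ->.
by move=> [w ws]; apply: IH; exact: sdn_closed sC ws.
Qed.

Lemma avg_closed_ball (x0 : V) (r : R) : avg_closed [set x | `|x - x0| <= r].
Proof.
move=> s s0 sC /=; have s0' : (0 : R) < (size s)%:R by rewrite ltr0n.
have -> : centroid s - x0 = (size s)%:R^-1 *: \sum_(x <- s) (x - x0).
  rewrite sumrB big_const_seq count_predT iter_addr_0 scalerBr -[x0 *+ _]scaler_nat scalerA.
  by rewrite mulVf ?scale1r // gt_eqF.
rewrite normrZ normfV gtr0_norm // mulrC ler_pdivrMr // mulr_natr.
apply: le_trans (ler_norm_sum _ _ _) _.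
rewrite -[in leRHS](count_predT s) -iter_addr_0 -big_const_seq.
by rewrite big_seq [leRHS]big_seq; apply: ler_sum => x /sC.
Qed.

Definition diam_le (D : R) s := forall x y, x \in s -> y \in s -> `|x - y| <= D.

(** One of the [size s] differences between y and the entries is 0, whence the numerator
    [(size s).-1]. *)
Lemma centroid_dist s y D : diam_le D s -> y \in s ->
  `|y - centroid s| <= (size s).-1%:R / (size s)%:R * D.
Proof.
move=> sD ys; have s0 : (0 < size s)%N by case: s ys sD.
have s0' : (0 : R) < (size s)%:R by rewrite ltr0n.
have -> : y - centroid s = (size s)%:R^-1 *: \sum_(x <- s) (y - x).
  rewrite sumrB big_const_seq count_predT iter_addr_0 scalerBr -[y *+ _]scaler_nat scalerA.
  by rewrite mulVf ?scale1r // gt_eqF.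
rewrite normrZ normfV gtr0_norm // [leLHS]mulrC [leRHS]mulrAC ler_pM2r ?invr_gt0 //.
rewrite (perm_big _ (perm_to_rem ys)) /= big_cons subrr add0r.
apply: le_trans (ler_norm_sum _ _ _) _.
rewrite mulr_natl -(size_rem ys) -(count_predT (rem y s)) -iter_addr_0 -big_const_seq.
rewrite big_seq [leRHS]big_seq; apply: ler_sum => x /mem_rem xs; exact: sD.
Qed.

Lemma sdn_diam k s u D N : diam_le D s -> 0 <= D -> (size s <= N.+1)%N -> u \in sdn k s ->
  (k = size s)%N -> diam_le (N%:R / N.+1%:R * D) u.
Proof.
move=> + D0; elim: k s u => [|k IH] s u sD sN us ks.
  by move: us ks; rewrite /= inE => /eqP -> /esym/size0nil -> x y.
move: us; rewrite sdnS => /allpairsPdep[t [w [ts wt ->]]].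
have c0 : 0 <= N%:R / N.+1%:R * D by rewrite mulr_ge0 // divr_ge0.
have tD : diam_le D t by move=> x y /(mem_faces ts) xs /(mem_faces ts) ys; exact: sD.
have szs := size_faces ts.
have bs x : x \in s -> `|x - centroid s| <= N%:R / N.+1%:R * D.
  move=> xs; apply: le_trans (centroid_dist sD xs) _; apply: ler_wpM2r => //.
  rewrite szs /= in sN *; rewrite ler_pdivrMr ?ltr0n // mulrAC ler_pdivlMr ?ltr0n //.
  by rewrite -!natrM ler_nat; lia.
have bw x : x \in w -> `|x - centroid s| <= N%:R / N.+1%:R * D.
  have ac : avg_closed [set x | `|x - centroid s| <= N%:R / N.+1%:R * D] by exact: avg_closed_ball.
  have tC y : y \in t -> [set x | `|x - centroid s| <= N%:R / N.+1%:R * D] y by move=> /(mem_faces ts); exact: bs.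
  exact: (sdn_closed ac tC wt).
move=> x y; rewrite !inE => /orP[/eqP ->|xw] /orP[/eqP ->|yw].
- by rewrite subrr normr0.
- by rewrite distrC; exact: bw.
- exact: bw.
apply: (IH t w) => //; first by apply: leq_trans sN; rewrite szs.
by move: ks; rewrite szs => -[].
Qed.

Lemma subd_diam m s u D N : diam_le D s -> 0 <= D -> (size s <= N.+1)%N -> subd m s u ->
  diam_le ((N%:R / N.+1%:R) ^+ m * D) u.
Proof.
elim: m s D => [|m IH] s D sD D0 sN /=; first by move=> ->; rewrite mul1r.
move=> [w ws wu]; rewrite exprSr -mulrA; apply: IH wu.
- exact: sdn_diam ws _.
- by rewrite mulr_ge0 // divr_ge0.
by rewrite (size_sdn ws).
Qed.

Lemma subd_small D N eps : 0 <= D -> 0 < eps ->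
  exists M, forall m s u, (M <= m)%N -> diam_le D s -> (size s <= N.+1)%N -> subd m s u -> diam_le eps u.
Proof.
move=> D0 e0; have q1 : `|N%:R / N.+1%:R : R| < 1.
  by rewrite ger0_norm ?divr_ge0 // ltr_pdivrMr ?ltr0n // mul1r ltr_nat.
have cv : (fun m => (N%:R / N.+1%:R : R) ^+ m * D) @ \oo --> (0 : R).
  by rewrite -(mul0r D); apply: cvgMl; exact: cvg_expr.
have /cvgrPdist_le/(_ eps e0)[M _ HM] := cv.
exists M => m s u Mm sD sN su x y xu yu; apply: le_trans (subd_diam sD D0 sN su xu yu) _.
have := HM m Mm; rewrite sub0r normrN ger0_norm //.
by rewrite mulr_ge0 // exprn_ge0 // divr_ge0.
Qed.

Lemma centroid_perm s t : perm_eq s t -> centroid s = centroid t.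
Proof. by move=> st; rewrite /centroid (perm_size st) (perm_big _ st). Qed.

Lemma sdn_sym k f : symmetric_cochain f ->
  symmetric_cochain (fun s => \big[addb/false]_(u <- sdn k s) f u).
Proof.
elim: k f => [|k IH] f sf s t st; first by rewrite !big_seq1; exact: sf.
have step w : \big[addb/false]_(u <- sdn k.+1 w) f u =
    dl (fun t => \big[addb/false]_(u <- sdn k t) f (centroid w :: u)) w.
  by rewrite sdnS big_allpairs_dep.
rewrite !step (centroid_perm st); apply: dl_sym st; apply: IH => u w uw.
by apply: sf; rewrite perm_cons.
Qed.

Lemma sd_sym f : symmetric_cochain f -> symmetric_cochain (sd f).
Proof. by move=> sf s t st; rewrite /sd (perm_size st); exact: sdn_sym. Qed.

Lemma iter_sd_sym m f : symmetric_cochain f -> symmetric_cochain (iter m sd f).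
Proof. by move=> sf; elim: m => //= m IH; exact: sd_sym. Qed.

End Cochain.

Section CochainMap.
Variables (R : realType) (n n' : nat) (A : 'rV[R]_n -> 'rV[R]_n').
Hypothesis AD : forall x y, A (x + y) = A x + A y.
Hypothesis AZ : forall a x, A (a *: x) = a *: A x.

Lemma centroid_map s : centroid (map A s) = A (centroid s).
Proof.
rewrite /centroid AZ size_map big_map; congr (_ *: _).
have A0 : A 0 = 0 by rewrite -(scale0r 0) AZ scale0r.
by rewrite (big_morph A AD A0).
Qed.

Lemma sd_map_cochain f s : sd (fun u => f (map A u)) s = sd f (map A s).
Proof.
rewrite /sd size_map; move: (size s) => k; elim: k s f => [|k IH] s f; first by rewrite !big_seq1.
rewrite !sdnS !big_allpairs_dep faces_map big_map; apply: eq_bigr => t _.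
by rewrite -IH; apply: eq_bigr => u _ /=; rewrite centroid_map.
Qed.

Lemma iter_sd_map m f s : iter m (@sd _ _) (fun u => f (map A u)) s = iter m (@sd _ _) f (map A s).
Proof.
elim: m s => //= m IH s; rewrite -sd_map_cochain; apply: eq_bigr => u _; exact: IH.
Qed.

End CochainMap.

Lemma perm_iotaS k : perm_eq (iota 0 k.+1) (k :: iota 0 k).
Proof. by rewrite -[k.+1]addn1 iotaD /= -[_ :: iota 0 k]cat1s perm_catC. Qed.

(** * Sperner's lemma mod 2 *)

Section Sperner.
Variables (R : realType) (n : nat) (l : 'rV[R]_n -> nat).
Local Notation V := 'rV[R]_n.

Definition rainbow (k : nat) (u : seq V) : bool := perm_eq (map l u) (iota 0 k).

Lemma rainbow_sym k : symmetric_cochain (rainbow k).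
Proof.
move=> s t st; rewrite /rainbow; have /permPl H := perm_map l st.
by rewrite -[LHS]/(perm_eq _ _) H.
Qed.

(** If some facet has the labels 0, ..., k-1, the simplex has these and one more label i. For i = k
    there is exactly one such facet; for i < k there are two, omitting either vertex labelled i. *)
Lemma dl_rainbow k u : size u = k.+1 -> (forall x, x \in u -> (l x <= k)%N) ->
  dl (rainbow k) u = rainbow k.+1 u.
Proof.
move=> su lu; pose F k (w : seq nat) := perm_eq w (iota 0 k).
have Fs k' : symmetric_cochain (F k').
  by move=> s t st; rewrite /F; apply/idP/idP; apply: perm_trans; rewrite // perm_sym.
rewrite (dl_map l (F k)) /rainbow -/(F k.+1 _).
have {su} : size (map l u) = k.+1 by rewrite size_map.
have {lu} : forall x, x \in map l u -> (x <= k)%N by move=> _ /mapP[x /lu ? ->].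
move: (map l u) => {u} w wk sw.
have sFx x : symmetric_cochain (fun t => F k (x :: t)).
  by move=> s t st; apply: Fs; rewrite perm_cons.
case: (boolP [exists i : 'I_k.+1, perm_eq w (val i :: iota 0 k)]).
  move=> /existsP[i Pi]; rewrite (dl_sym (Fs k) Pi) (Fs k.+1 _ _ Pi) dl_cons.
  rewrite {1}/F perm_refl /=; have [ik|ik] := eqVneq (val i) k.
    rewrite ik dl_eq0; last first.
      move=> t _; apply/negP => /perm_mem /(_ k); rewrite mem_head mem_iota add0n ltnn.
      by rewrite andbF.
    by rewrite /F perm_sym perm_iotaS.
  have ilt : (i < k)%N by rewrite ltn_neqAle ik -ltnS ltn_ord.
  have Pi2 : perm_eq (iota 0 k) (val i :: rem (val i) (iota 0 k)) by apply: perm_to_rem; rewrite mem_iota.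
  rewrite (dl_sym (sFx _) Pi2) dl_cons {1}/F perm_sym Pi2 dl_eq0; last first.
    move=> t _; apply/negP => /perm_uniq; rewrite iota_uniq /= mem_head //.
  apply/esym/negbTE; apply/negP => /perm_uniq; rewrite iota_uniq /= mem_iota add0n ilt //.
rewrite negb_exists => /forallP nP; rewrite dl_eq0.
  apply/esym/negbTE; apply: contra (nP ord_max) => /perm_trans; apply.
  exact: perm_iotaS.
move=> t tw; apply/negP => Ft.
have [x xw Ex] : exists2 x, x \in w & perm_eq w (x :: t).
  move: tw {Ft nP wk sw}; elim: w t => //= b w IH t; rewrite inE => /orP[/eqP ->|/mapP[v /IH[x xw Hx] ->]].
    by exists b; rewrite ?mem_head.
  exists x; first by rewrite inE xw orbT.
  apply: (@perm_trans _ (b :: x :: v)); first by rewrite perm_cons.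
  by apply/permPl; exact: (perm_catCA [:: b] [:: x] v).
move/negP: (nP (Ordinal (n := k.+1) (m := x) (wk x xw))); apply.
by apply: perm_trans Ex _; rewrite /= perm_cons.
Qed.

Definition delta (j : nat) : V := \row_i (val i == j)%:R.

Definition corner_face (J : pred nat) : set V :=
  [set x | [/\ forall i, 0 <= x 0 i, \sum_i x 0 i = 1 & forall i : 'I_n, J i -> x 0 i = 0]].

Lemma corner_face_avg J : avg_closed (corner_face J).
Proof.
move=> s s0 sC; have c0 : (size s)%:R != 0 :> R by rewrite pnatr_eq0 -lt0n.
have cE i : centroid s 0 i = (size s)%:R^-1 * \sum_(x <- s) x 0 i.
  by rewrite !mxE summxE.
split=> [i||i Ji].
- rewrite cE mulr_ge0 ?invr_ge0 //; rewrite big_seq; apply: sumr_ge0 => x /sC[H _ _]; exact: H.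
- under eq_bigr do rewrite cE.
  rewrite -mulr_sumr exchange_big /= (eq_big_seq (fun=> 1)); last by move=> x /sC[].
  by rewrite big_const_seq count_predT iter_addr_0 mulVf.
- by rewrite cE big_seq big1 ?mulr0 // => x /sC[_ _ ->].
Qed.

Lemma delta_face (J : pred nat) j : (j < n)%N -> ~~ J j -> corner_face J (delta j).
Proof.
move=> jn nJ; split=> [i||i Ji]; first by rewrite mxE ler0n.
  rewrite (bigD1 (Ordinal jn)) //= big1 ?addr0 ?mxE ?eqxx // => i ij.
  rewrite mxE; case: eqP => // E; case/eqP: ij; exact: val_inj.
by rewrite mxE; case: eqP => // E; move: nJ; rewrite -E Ji.
Qed.

Hypothesis l_lt : forall x, corner_face pred0 x -> (l x < n)%N.
Hypothesis l_pos : forall x (i : 'I_n), corner_face pred0 x -> l x = i -> x 0 i != 0.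

(** By [dl_rainbow] and [iter_sd_dl] the count on k + 1 corners is the sum of the counts on its
    facets. The facet opposite corner k is the previous case, and the others contribute nothing. *)
Lemma sperner m k : (k <= n)%N ->
  iter m (@sd _ _) (rainbow k) (map delta (iota 0 k)) = true.
Proof.
have sub J x : corner_face J x -> corner_face pred0 x by case=> H1 H2 _; split.
elim: k => [|k IH] kn.
  by elim: m => //= m IH; rewrite sd_nil.
have Pe := perm_map delta (perm_iotaS k).
have inF (J : pred nat) (s : seq nat) : (forall j, j \in s -> (j < n)%N && ~~ J j) ->
    forall x, x \in map delta s -> corner_face J x.
  by move=> H _ /mapP[j /H/andP[jn nJ] ->]; exact: delta_face.
rewrite (iter_sd_eq (g := dl (rainbow k))); last first.
  move=> u Hu; rewrite dl_rainbow //; first by rewrite (size_subd Hu) size_map size_iota.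
  have F : forall x, x \in u -> corner_face (fun j => (k < j)%N) x.
    apply: (subd_closed (@corner_face_avg _) _ Hu); apply: inF => j; rewrite mem_iota /= => jk.
    by rewrite (leq_trans jk kn) -leqNgt.
  move=> x xu; rewrite leqNgt; apply/negP => kl; have Fx := F x xu.
  have ln := l_lt (sub _ _ Fx); have := l_pos (i := Ordinal ln) (sub _ _ Fx) erefl.
  by case: Fx => _ _ -> //; rewrite eqxx.
rewrite iter_sd_dl (dl_sym (iter_sd_sym m (@rainbow_sym k)) Pe).
rewrite [map _ _]/= dl_cons IH; last exact: ltnW.
rewrite dl_eq0 // => w; rewrite faces_map => /mapP[t tk ->{w}].
(* A facet containing corner k misses some corner j < k. Coordinate j vanishes on it, so label j
   does not occur there. *)
have [j jk jt] : exists2 j, j \in iota 0 k & j \notin t.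
  apply/allPn/negP => /allP H; have := uniq_leq_size (iota_uniq 0 k) H.
  by rewrite size_iota (_ : k = (size t).+1) ?ltnn // -(size_faces tk) size_iota.
rewrite (iter_sd_eq (g := fun=> false)) ?iter_sd_false // => u Hu.
apply/negbTE/negP => /perm_mem /(_ j); rewrite jk => /mapP[x xu jE].
move: jk; rewrite mem_iota /= => jk; have jn := leq_trans jk (ltnW kn).
have F : forall x, x \in u -> corner_face (pred1 j) x.
  apply: (subd_closed (@corner_face_avg _) _ Hu); apply: (inF _ (k :: t)) => i.
  rewrite inE => /orP[/eqP ->|it]; first by rewrite kn /= neq_ltn jk orbT.
  have := mem_faces tk it; rewrite mem_iota /= => ik; rewrite (leq_trans ik (ltnW kn)) /=.
  by apply: contraNneq jt => <-.
have Fx := F x xu; have := l_pos (i := Ordinal jn) (sub _ _ Fx) (esym jE).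
by case: Fx => _ _ -> //=; rewrite eqxx.
Qed.
End Sperner.

(** * The boundary of a cylinder *)

Section Chart.
Variables (R : realType) (d : nat) (M : topologicalType).

Lemma nbhs_sub (X : topologicalType) (A : set X) (u : set_type A) (P : set (set_type A)) :
  nbhs u P -> exists C : set X, [/\ open C, C (set_val u) & forall w, C (set_val w) -> P w].
Proof.
rewrite nbhsE => -[B [[C openC EC] Bu] BP]; exists C; split=> // [|w Cw].
  by move: Bu; rewrite -EC.
by apply: BP; rewrite -EC.
Qed.

(** A chart as two total maps, each continuous at the points of its domain, instead of a
    homeomorphism between subspaces. *)
Definition chart_at (x : M) (U : set M) (V : set 'rV[R]_d) (f : M -> 'rV[R]_d) (k : 'rV[R]_d -> M) :=
  [/\ open U, U x, open V,
      forall m, U m -> [/\ V (f m), k (f m) = m & {for m, continuous f}]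
    & forall v, V v -> [/\ U (k v), f (k v) = v & {for v, continuous k}]].

Lemma euclidean_chart x : locally_euclidean_at R d x -> exists U V f k, chart_at x U V f k.
Proof.
move=> [U [V [oU Ux oV [phi [cphi [g [cg phiK gK]]]]]]].
pose up m (H : U m) : set_type U := SigSub (mem_set H).
pose vp m (H : V m) : set_type V := SigSub (mem_set H).
pose f m : 'rV[R]_d := if pselect (U m) is left H then set_val (phi (up m H)) else 0.
pose k v : M := if pselect (V v) is left H then set_val (g (vp v H)) else x.
have fE (u : set_type U) : f (set_val u) = set_val (phi u).
  rewrite /f; case: pselect => [H|]; last by case; exact: set_valP.
  by congr (set_val (phi _)); exact: val_inj.
have kE (u : set_type V) : k (set_val u) = set_val (g u).
  rewrite /k; case: pselect => [H|]; last by case; exact: set_valP.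
  by congr (set_val (g _)); exact: val_inj.
exists U, V, f, k; split=> // m Hm.
- rewrite (_ : m = set_val (up m Hm)) // fE kE phiK; split=> //; first exact: set_valP.
  move=> W; rewrite fE => /initial_continuous/cphi/nbhs_sub[C [openC Cm CW]].
  rewrite /nbhs /=; apply: filterS (open_nbhs_nbhs (conj (openI openC oU) (conj Cm Hm))).
  by move=> w [Cw Uw] /=; rewrite (_ : w = set_val (up w Uw)) // fE; apply: CW.
- rewrite (_ : m = set_val (vp m Hm)) // kE fE gK; split=> //; first exact: set_valP.
  move=> W; rewrite kE => /initial_continuous/cg/nbhs_sub[C [openC Cm CW]].
  rewrite /nbhs /=; apply: filterS (open_nbhs_nbhs (conj (openI openC oV) (conj Cm Hm))).
  by move=> w [Cw Uw] /=; rewrite (_ : w = set_val (vp w Uw)) // kE; apply: CW.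
Qed.

Lemma chart_euclidean x U V f k : chart_at x U V f k -> locally_euclidean_at R d x.
Proof.
move=> [oU Ux oV Hf Hk]; exists U, V; split=> //.
have Vf (u : set_type U) : V (f (set_val u)) by have [] := Hf _ (set_valP u).
have Uk (u : set_type V) : U (k (set_val u)) by have [] := Hk _ (set_valP u).
pose phi u : set_type V := SigSub (mem_set (Vf u)).
pose g u : set_type U := SigSub (mem_set (Uk u)).
exists phi; split.
  apply: continuous_comp_initial => u; apply: (@continuous_comp _ _ _ set_val f); first exact: initial_continuous.
  by have [] := Hf _ (set_valP u).
exists g; split.
- apply: continuous_comp_initial => u; apply: (@continuous_comp _ _ _ set_val k); first exact: initial_continuous.
  by have [] := Hk _ (set_valP u).
- by move=> u; apply: val_inj; have [] := Hf _ (set_valP u).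
- by move=> u; apply: val_inj; have [] := Hk _ (set_valP u).
Qed.

End Chart.

(** * A Brouwer-type covering argument *)

Section Center.
Variable R : realType.

(** Up to 1/8, [h] is the identity shifted along the diagonal. Label a point by a largest coordinate
    of [h]: some x j is at least 1/4, so i is not the label where x i = 0, and Sperner's lemma
    applies. If [h] missed the diagonal, some label would be absent near every point, against a
    small simplex with all labels. *)
Lemma approx_center (h : 'rV[R]_4 -> 'rV[R]_4) :
  (forall x, simplex R 3 x -> {for x, continuous h}) ->
  (forall x i, simplex R 3 x -> `|h x 0 i - (x 0 i - x 0 ord_max)| < 8%:R^-1) ->
  exists x, simplex R 3 x /\ forall i j, h x 0 i = h x 0 j.
Proof.
move=> ch hid; apply: contrapT => nex.
have /choice[lab Hlab] : forall x, exists i : 'I_4, forall j, h x 0 j <= h x 0 i.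
  move=> x; exists [arg max_(i > ord0) h x 0 i]%O.
  by case: arg_maxP => // i _ H j; apply: H.
(* A uniform scale at which a label is absent around every point: where h i < h j, the label i is
   excluded nearby. *)
have [del [del0 Hdel]] : exists del : R, 0 < del /\
    forall x, simplex R 3 x -> exists i, forall y, `|x - y| <= del -> lab y <> i.
  have /compact_near_coveringP/(_ R (0 : R)^'+ (fun del x => exists i, forall y, `|x - y| <= del -> lab y <> i)) :=
    @simplex_compact R 3.
  case.
    move=> x Sx; have [i [j hij]] : exists i j, h x 0 i < h x 0 j.
      apply: contrapT => ne; apply: nex; exists x; split=> // i j.
      apply/eqP; rewrite eq_le; apply/andP; split; rewrite leNgt; apply/negP => H; apply: ne; eauto.
    have : \forall y \near x, h y 0 i < h y 0 j.
      have ci l : {for x, continuous (fun y => h y 0 l)}.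
        by apply: (@continuous_comp _ _ _ h (fun v : 'rV[R]_4 => v 0 l)); [exact: ch | exact: continuous_coord].
      rewrite -subr_gt0 in hij; have cd : {for x, continuous (fun y => h y 0 j - h y 0 i)}.
        by apply: continuousB; exact: ci.
      have /cvgr_gt/(_ _ hij) := cd; apply: filterS => y; by rewrite subr_gt0.
    move=> /nbhs_ballP[r /= r0 Hr]; exists (ball x (r / 2), [set del | del < r / 2]) => /=.
      by split; [apply: nbhsx_ballx; lra | apply: nbhs_right_lt; lra].
    move=> [y del] /= [xy dr]; exists i => z yz Ez.
    have : h z 0 i < h z 0 j.
      apply: Hr; move: xy; rewrite -!ball_normE /= => xy.
      rewrite (_ : x - z = (x - y) + (y - z)); last by rewrite addrA subrK.
      apply: le_lt_trans (ler_normD _ _) _; lra.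
    by rewrite ltNge -Ez Hlab.
  move=> r /= r0 H; exists (r / 2); have r2 : 0 < r / 2 by lra.
  by split=> //; apply: H => //; rewrite /ball_ /= sub0r normrN gtr0_norm //; lra.
have [M HM] := @subd_small R 4 2 3 del (ler0n _ 2) del0.
have lpos x i : simplex R 3 x -> lab x = i -> x 0 i != 0.
  move=> Sx Ei; apply/eqP => xi0; have [x0 x1] := Sx.
  have [j xj] : exists j, 4%:R^-1 <= x 0 j.
    apply: contrapT => ne; move: x1; apply/eqP; rewrite lt_eqF //.
    have -> : (1 : R) = \sum_(i < 4) 4%:R^-1 by rewrite sumr_const card_ord -mulr_natl; field.
    apply: ltr_sum => [|i' _]; first by apply/hasP; exists ord0; rewrite ?mem_index_enum.
    by rewrite ltNge; apply/negP => H; apply: ne; exists i'.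
  have := Hlab x j; rewrite Ei; have := hid x j Sx; have := hid x i Sx; rewrite xi0 !ltr_norml.
  by move: (h x 0 i) (h x 0 j) (x 0 ord_max) xj => *; lra.
have S0 x : corner_face pred0 x -> simplex R 3 x by case=> ? ? _; split.
have lpos' x (i : 'I_4) : corner_face pred0 x -> lab x = i :> nat -> x 0 i != 0.
  by move=> /S0 Sx /val_inj; exact: lpos.
have := @sperner R 4 (fun x => lab x) (fun x _ => ltn_ord (lab x)) lpos' M 4 isT.
rewrite (iter_sd_eq (g := fun=> false)) ?iter_sd_false // => u Hu.
apply/negbTE/negP => rb; have su : size u = 4 by rewrite (size_subd Hu).
have us x : x \in u -> simplex R 3 x.
  move=> xu; apply: S0; apply: (subd_closed (@corner_face_avg R 4 pred0) _ Hu) xu => y.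
  by move=> /mapP[j]; rewrite mem_iota => /= jn ->; exact: delta_face.
have du : diam_le del u.
  apply: (HM M _ _ (leqnn M)) Hu; last by rewrite size_map size_iota.
  move=> _ _ /mapP[j _ ->] /mapP[j' _ ->]; apply: rV_norm_le => // i; rewrite !mxE.
  by case: (_ == _); case: (_ == _); rewrite /= ?subrr ?subr0 ?sub0r ?normrN ?normr0 ?normr1; lra.
case: u su rb us du Hu => // x u _ rb us du _.
have [i Hi] := Hdel x (us x (mem_head _ _)).
have := perm_mem rb (val i); rewrite mem_iota ltn_ord => /mapP[z zu /val_inj iz].
by apply: (Hi z); [apply: du => //; exact: mem_head | rewrite iz].
Qed.

End Center.

Lemma continuous_row_at (R : realType) n (X : topologicalType) (f : X -> 'I_n -> R) (x : X) :
  (forall i, {for x, continuous (f ^~ i)}) -> {for x, continuous (fun x => \row_i f x i : 'rV[R]_n)}.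
Proof.
move=> cf; apply/cvgrPdist_lt => e e0.
have : \forall y \near x, forall i, `|f x i - f y i| < e.
  by apply: filter_forall => i; move/cvgrPdist_lt: (cf i); apply.
apply: filterS => y H; rewrite /Num.norm /= mx_normrE.
apply: bigmax_lt => // -[i j] _; rewrite !mxE; exact: H.
Qed.

Lemma continuous_pair_at (X Y Z : topologicalType) (f : X -> Y) (g : X -> Z) (x : X) :
  {for x, continuous f} -> {for x, continuous g} -> {for x, continuous (fun x => (f x, g x))}.
Proof. by move=> cf cg; exact: (cvg_pair cf cg). Qed.

(** * End points and inner points of the cylinder *)

Section Cylinder.
Variables (R : realType) (F : topologicalType) (a b : R).
Hypothesis ab : a < b.
Local Notation I := (set_type `[a, b]).
Local Notation M := (F * I)%type.

Lemma itv_val (s : I) : a <= set_val s <= b.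
Proof. by have := set_valP s; rewrite /= in_itv. Qed.

Lemma itv_in (s : R) : a <= s <= b -> s \in (`[a, b]%classic : set R).
Proof. by move=> H; apply/mem_set; rewrite /= in_itv. Qed.

Definition squeeze (del s : R) : R := s + Num.min (Num.max del 0) 1 * ((a + b) / 2 - s).

Lemma squeeze_itv del s : a <= s <= b -> a <= squeeze del s <= b.
Proof.
move=> /andP[H1 H2]; rewrite /squeeze; set m := Num.min _ _.
have /andP[m0 m1] : 0 <= m <= 1.
  by rewrite /m le_min ge_min lexx ler01 orbT le_max lexx orbT.
clearbody m; apply/andP; split; nra.
Qed.

Lemma squeeze_inner del s : 0 < del -> a <= s <= b -> a < squeeze del s < b.
Proof.
move=> d0 /andP[H1 H2]; rewrite /squeeze; set m := Num.min _ _.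
have /andP[m0 m1] : 0 < m <= 1.
  by rewrite /m lt_min ge_min lexx ltr01 orbT lt_max d0.
clearbody m; move: ab => ab'; apply/andP; split; nra.
Qed.

Definition push_height (z : R * M) : I := SigSub (itv_in (squeeze_itv z.1 (itv_val z.2.2))).
Definition push (z : R * M) : M := (z.2.1, push_height z).

Lemma push0 (p : M) : push (0, p) = p.
Proof.
case: p => x s; congr (_, _); apply: val_inj; rewrite /= /squeeze.
by rewrite maxxx min_l ?ler01 // mul0r addr0.
Qed.

Lemma push_continuous : continuous push.
Proof.
have c2 : continuous push_height.
  apply: continuous_comp_initial.
  have cs : continuous (fun z : R * M => set_val z.2.2 : R).
    move=> z; apply: (@continuous_comp _ _ _ (fun z : R * M => z.2.2) set_val); last exact: initial_continuous.
    by apply: (@continuous_comp _ _ _ snd snd); exact: cvg_snd.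
  have cd : continuous (fun z : R * M => z.1) by move=> z; exact: cvg_fst.
  rewrite (_ : _ \o _ = fun z : R * M => set_val z.2.2 +
     Num.min (Num.max z.1 0) 1 * ((a + b) / 2 - set_val z.2.2)) //.
  apply: continuous_addr => //; apply: continuous_mulr.
    by apply: continuous_minr; [apply: continuous_maxr => //|]; exact: cst_continuous.
  by apply: continuous_subr => //; exact: cst_continuous.
move=> z; apply: (@continuous_pair_at _ _ _ (fun z : R * M => z.2.1) push_height z); last exact: c2.
by apply: (@continuous_comp _ _ _ snd fst); [exact: cvg_snd | exact: cvg_fst].
Qed.

(** [push] moves the cylinder slightly away from its ends. In a chart around an end point it is
    close to the identity and so still reaches that point by [approx_center], although its image
    contains no end point. *)
Lemma boundary_not_euclidean (x : F) (s : I) : set_val s = a \/ set_val s = b ->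
  ~ locally_euclidean_at R 3 ((x, s) : M).
Proof.
move=> sab /euclidean_chart[U [V [f [k [oU Ux oV Hf Hk]]]]].
pose c := f (x, s); have [Vc kc _] := Hf _ Ux.
have /nbhs_ballP[r0 /= r00 Hr0] : nbhs c V by apply: open_nbhs_nbhs.
pose r := r0 / 2; have r_gt0 : 0 < r by rewrite /r; lra.
(* An affine tetrahedron in the chart with barycentre c; its size r keeps it inside V. *)
pose psi (p : 'rV[R]_4) : 'rV[R]_3 := \row_i (c 0 i + r * (p 0 (widen_ord (leqnSn 3) i) - p 0 ord_max)).
have cpsi : continuous psi.
  apply: continuous_row => i; apply: continuous_addr; first exact: cst_continuous.
  apply: continuous_mulr; first exact: cst_continuous.
  by apply: continuous_subr; exact: continuous_coord.
have Vpsi p : simplex R 3 p -> V (psi p).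
  move=> Sp; apply: Hr0; rewrite -ball_normE /=; apply: rV_norm_lt => // i.
  rewrite !mxE opprD addrA subrr sub0r normrN normrM (gtr0_norm r_gt0).
  have [p0 _] := Sp; have p1 i' := simplex_le1 i' Sp.
  have : `|p 0 (widen_ord (leqnSn 3) i) - p 0 ord_max| <= 1.
    rewrite ler_norml; have := p0 (widen_ord (leqnSn 3) i); have := p0 ord_max.
    have := p1 (widen_ord (leqnSn 3) i); have := p1 ord_max.
    by move: (p 0 (widen_ord _ _)) (p 0 ord_max) => u v *; apply/andP; split; lra.
  by rewrite /r; move: `|_| => u u1; nra.
pose g (z : R * 'rV[R]_4) : M := push (z.1, k (psi z.2)).
have ck p : simplex R 3 p -> {for p, continuous (k \o psi)}.
  move=> Sp; apply: continuous_comp; first exact: cpsi.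
  by have [] := Hk _ (Vpsi p Sp).
have cg del p : simplex R 3 p -> {for (del, p), continuous g}.
  move=> Sp; apply: (@continuous_comp _ _ _ (fun z : R * 'rV[R]_4 => (z.1, k (psi z.2))) push); last exact: push_continuous.
  apply: (@continuous_pair_at _ _ _ (fun z : R * 'rV[R]_4 => z.1) (fun z => k (psi z.2))); first exact: cvg_fst.
  by apply: (@continuous_comp _ _ _ snd (k \o psi)); [exact: cvg_snd | exact: ck].
pose good del p := U (g (del, p)) /\ `|f (g (del, p)) - psi p| < r / 8.
have [del [del0 Hdel]] : exists del : R, 0 < del /\ forall p, simplex R 3 p -> good del p.
  have /compact_near_coveringP/(_ R (0 : R)^'+ good) := @simplex_compact R 3.
  case.
    move=> p Sp; have gp : g (0, p) = k (psi p) by rewrite /g push0.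
    have [Uk fk _] := Hk _ (Vpsi p Sp); have [_ _ cf] := Hf _ Uk.
    have N1 : nbhs (0 : R, p) (g @^-1` U).
      by apply: cg => //; rewrite gp; exact: open_nbhs_nbhs.
    have N2 : nbhs (0 : R, p) [set z | `|f (g z) - psi z.2| < r / 8].
      have cz : {for (0 : R, p), continuous (fun z => f (g z) - psi z.2)}.
        apply: continuousB; last first.
          by apply: (@continuous_comp _ _ _ snd psi); [exact: cvg_snd | exact: cpsi].
        by apply: (@continuous_comp _ _ _ g f); [exact: cg | rewrite gp].
      have /cvgr_norm_lt H := cz; apply: H; rewrite /= gp fk subrr normr0; lra.
    have [[A B] /= [nA nB] AB] := filterI N1 N2.
    exists (B, A) => /=; first by split=> //; exact: cvg_within.
    by move=> [p' del] /= [Bp Ad]; have := AB (del, p') (conj Ad Bp).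
  move=> e /= e0 H; exists (e / 2); have e2 : 0 < e / 2 by lra.
  by split=> //; apply: H => //; rewrite /ball_ /= sub0r normrN gtr0_norm //; lra.
(* The pushed tetrahedron in the coordinates of [psi]. The last coordinate is 0, so equality of all
   coordinates means that the chart point is c. *)
pose h (p : 'rV[R]_4) : 'rV[R]_4 :=
  \row_i (if unlift ord_max i is Some j then (f (g (del, p)) 0 j - c 0 j) / r else 0).
have [p [Sp hp]] : exists p, simplex R 3 p /\ forall i j, h p 0 i = h p 0 j.
  apply: approx_center.
    move=> p Sp; apply: continuous_row_at => i; case: unliftP => [j|] _; last exact: cst_continuous.
    have [Up _] := Hdel p Sp; have [_ _ cf] := Hf _ Up.
    apply: (@continuous_comp _ _ _ (fun p => f (g (del, p)) 0 j) (fun t : R => (t - c 0 j) / r)); last first.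
      move: (f _ 0 j); change (continuous (fun t : R => (t - c 0 j) / r)).
      by apply: continuous_mulr; [apply: continuous_subr; [move=> t; exact: cvg_id|]|]; exact: cst_continuous.
    apply: (@continuous_comp _ _ _ (fun p => f (g (del, p))) (fun v : 'rV[R]_3 => v 0 j)); last exact: continuous_coord.
    apply: (@continuous_comp _ _ _ (fun p => g (del, p)) f) => //.
    apply: (@continuous_comp _ _ _ (fun p : 'rV[R]_4 => (del, p)) g); last exact: cg.
    by apply: (@continuous_pair_at _ _ _ (fun=> del) id); [exact: cst_continuous | exact: cvg_id].
  move=> p i Sp; have [_ +] := Hdel p Sp; rewrite mxE; case: unliftP => [j|] ->.
    move=> Hn; have := le_lt_trans (coord_norm _ j) Hn; rewrite !mxE.
    rewrite (_ : widen_ord _ j = lift ord_max j); last by apply: val_inj; rewrite /= /bump leqNgt ltn_ord.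
    move: (p 0 _) (p 0 ord_max) (f _ 0 j) (c 0 j) => u v w z.
    have E : r * ((w - z) / r - (u - v)) = w - (z + r * (u - v)) by field; rewrite gt_eqF.
    by move=> Hu; rewrite -(ltr_pM2l r_gt0) -{1}(gtr0_norm r_gt0) -normrM E.
  by move=> _; rewrite !subrr normr0; lra.
have fgc : f (g (del, p)) = c.
  apply/rowP => j; have := hp (lift ord_max j) ord_max; rewrite !mxE liftK unlift_none.
  by move/eqP; rewrite mulf_eq0 invr_eq0 (gt_eqF r_gt0) orbF subr_eq0 => /eqP.
have [Ug _] := Hdel p Sp; have [_ kf _] := Hf _ Ug.
have : g (del, p) = (x, s) by rewrite -kf fgc.
move=> /(congr1 (fun m : M => set_val m.2)) /= E.
have := squeeze_inner del0 (itv_val (k (psi p)).2).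
have -> : squeeze del (set_val (k (psi p)).2) = set_val s by rewrite -E.
by case: sab => ->; rewrite ltxx ?andbF.
Qed.

Lemma interior_euclidean (x : F) (s : I) : manifold_boundary R 2 F = set0 ->
  a < set_val s < b -> locally_euclidean_at R 3 ((x, s) : M).
Proof.
move=> bF sab; have : locally_euclidean_at R 2 x.
  by apply: contrapT => nE; have : manifold_boundary R 2 F x by []; rewrite bF.
move=> /euclidean_chart[U [V [f [k [oU Ux oV Hf Hk]]]]].
pose w i : 'I_3 := widen_ord (leqnSn 2) i.
pose pr (v : 'rV[R]_3) : 'rV[R]_2 := \row_i v 0 (w i).
have cpr : continuous pr by apply: continuous_row => i; exact: continuous_coord.
have clip_in (t : R) : a <= Num.min (Num.max t a) b <= b.
  by rewrite le_min ge_min lexx orbT le_max lexx orbT ltW.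
pose clip t : I := SigSub (itv_in (clip_in t)).
have cclip : continuous clip.
  apply: continuous_comp_initial; rewrite (_ : _ \o _ = fun t => Num.min (Num.max t a) b) //.
  by apply: continuous_minr; [apply: continuous_maxr; [move=> t; exact: cvg_id|]|]; exact: cst_continuous.
have clipE (t : I) : clip (set_val t) = t.
  have /andP[t1 t2] := itv_val t; apply: val_inj => /=; rewrite max_l // min_l //.
have clip_val t : a < t < b -> set_val (clip t) = t.
  by move=> /andP[t1 t2]; rewrite -[LHS]/(Num.min (Num.max t a) b) max_l ?min_l // ltW.
pose f' (m : M) : 'rV[R]_3 := \row_i (if unlift ord_max i is Some j then f m.1 0 j else set_val m.2).
pose k' (v : 'rV[R]_3) : M := (k (pr v), clip (v 0 ord_max)).
have wl j : w j = lift ord_max j by apply: val_inj; rewrite /= /bump leqNgt ltn_ord.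
have pf m : pr (f' m) = f m.1 by apply/rowP => j; rewrite !mxE wl liftK.
have f3 m : f' m 0 ord_max = set_val m.2 by rewrite mxE unlift_none.
have cval : continuous (set_val : I -> R) by exact: initial_continuous.
pose U' : set M := [set m | U m.1 /\ a < set_val m.2 < b].
pose V' : set 'rV[R]_3 := [set v | V (pr v) /\ a < v 0 ord_max < b].
have open_itv : open [set t : R | a < t < b].
  rewrite (_ : [set t | _] = [set` `]a, b[%R]); first exact: interval_open.
  by apply/seteqP; split=> t /=; rewrite in_itv.
apply: (@chart_euclidean _ _ _ _ U' V' f' k'); split.
- apply: openI; first by apply: (open_comp (f := fst)) => // m _; exact: cvg_fst.
  apply: (open_comp (f := fun m : M => set_val m.2)) open_itv => m _.
  by apply: (@continuous_comp _ _ _ snd set_val); [exact: cvg_snd | exact: cval].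
- by [].
- apply: openI; first by apply: (open_comp (f := pr)) => // m _; exact: cpr.
  by apply: (open_comp (f := fun v : 'rV[R]_3 => v 0 ord_max)) open_itv => m _; exact: continuous_coord.
- move=> [y t] [/= Uy tab]; have [Vy ky cy] := Hf _ Uy; split.
  + by rewrite /V' /= pf f3.
  + by rewrite /k' pf f3 /= ky clipE.
  apply: continuous_row_at => i; case: unliftP => [j|] _.
    apply: (@continuous_comp _ _ _ (fun m : M => f m.1) (fun v : 'rV[R]_2 => v 0 j)); last exact: continuous_coord.
    by apply: (@continuous_comp _ _ _ fst f) => //; exact: cvg_fst.
  by apply: (@continuous_comp _ _ _ snd set_val); [exact: cvg_snd | exact: cval].
- move=> v [Vv vab]; have [Uv fv cv] := Hk _ Vv; split.
  + by split=> //=; rewrite clip_val.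
  + apply/rowP => i; rewrite mxE; case: unliftP => [j|] ->; last by rewrite /= clip_val.
    by rewrite /= fv mxE wl.
  apply: (@continuous_pair_at _ _ _ (fun v => k (pr v)) (fun v : 'rV[R]_3 => clip (v 0 ord_max))).
    by apply: (@continuous_comp _ _ _ pr k) => //; exact: cpr.
  by apply: (@continuous_comp _ _ _ (fun v : 'rV[R]_3 => v 0 ord_max) clip); [exact: continuous_coord | exact: cclip].
Qed.

Lemma cylinder_boundary : manifold_boundary R 2 F = set0 ->
  manifold_boundary R 3 M = [set m | set_val m.2 = a \/ set_val m.2 = b].
Proof.
move=> bF; apply/seteqP; split=> -[x s] /=; last exact: boundary_not_euclidean.
move=> nE; have /andP[sa sb] := itv_val s; apply: contrapT => /not_orP[na nb].
apply: nE; apply: interior_euclidean => //; rewrite !lt_neqAle sa sb !andbT.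
by apply/andP; split; apply/eqP => // /esym.
Qed.

End Cylinder.

(** * Voltages and labellings of the surface *)

Lemma big_addb_invol (T : finType) (P : pred T) (f : T -> T) (F : T -> bool) :
  (forall x, P x -> P (f x)) -> (forall x, P x -> f (f x) = x) -> (forall x, P x -> f x <> x) ->
  (forall x, P x -> F (f x) = F x) -> \big[addb/false]_(x | P x) F x = false.
Proof.
have [k] := ubnP #|P|; elim: k P => // k IH P; rewrite ltnS => Pk Pf fK fne FF.
case: (pickP P) => [x Px|P0]; last by rewrite big_pred0.
have fx : P (f x) && (f x != x) by rewrite Pf //; apply/eqP; exact: fne.
rewrite (bigD1 x) //= (bigD1 (f x)) //= FF // addbA addbb addFb.
apply: IH.
- apply: leq_trans Pk; apply: proper_card; apply/properP; split.
    by apply/fintype.subsetP => y /andP[/andP[]].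
  by exists x => //; rewrite /in_mem /= eqxx andbF.
- move=> y /andP[/andP[Py yx] yfx]; rewrite Pf //=; apply/andP; split.
    by apply: contraNneq yfx => <-; rewrite fK.
  by apply: contraNneq yx => E; rewrite -(fK y Py) E fK.
- by move=> y /andP[/andP[Py _] _]; exact: fK.
- by move=> y /andP[/andP[Py _] _]; exact: fne.
- by move=> y /andP[/andP[Py _] _]; exact: FF.
Qed.

Lemma perm3_ind (P : 'S_3 -> Prop) (s t : 'S_3) :
  (forall r, P r -> P (tperm o0 o1 * r)%g) -> (forall r, P r -> P (tperm o1 o2 * r)%g) -> P s -> P t.
Proof.
move=> P0 P1 Ps; have same (r r' : 'S_3) : r o0 = r' o0 -> P r -> P r'.
  by case/perm3_move => -> //; exact: P1.
have : t o0 = s o0 \/ t o0 = s o1 \/ t o0 = s o2.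
  by rewrite -(permKV s (t o0)); move: (s^-1%g (t o0)); apply: I3P; auto.
case=> [E|[E|E]]; first by apply: same Ps.
  by apply: same (P0 _ Ps); rewrite permM tpermL.
by apply: same (P0 _ (P1 _ Ps)); rewrite !permM !tpermL.
Qed.

(** * Double covers given by Z/2-voltages *)

Section Voltage.
Variable N : nat.
Local Notation A := {ffun 'I_N -> bool}.

Definition addf (a b : A) : A := [ffun e => a e (+) b e].

Section Def.
Variables (G : finType) (tau : 'I_3 -> G -> G).
Variables (al : A -> 'I_3 -> G -> bool) (bb : A -> G -> 'I_3 -> bool).

Definition cover_step (a : A) : rel (G * bool) :=
  [rel u v | [exists j, v == (tau j u.1, u.2 (+) al a j u.1)]].

(* For each [a], [al a] is a Z/2-voltage on the gem, defining a double cover of the surface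
   that is connected if [a] is nonzero; [bb a phi k] is the sheet of the vertex [k] of [phi]
   relative to a fixed lift of that vertex. *)
Record volt : Prop := Volt {
  volt_al_add : forall a b j phi, al (addf a b) j phi = al a j phi (+) al b j phi;
  volt_bb_add : forall a b phi k, bb (addf a b) phi k = bb a phi k (+) bb b phi k;
  volt_inv : forall a j phi, al a j (tau j phi) = al a j phi;
  volt_bb : forall a j k phi, j != k -> bb a (tau j phi) k = bb a phi k (+) al a j phi;
  volt_conn : forall (a : A) (u v : G * bool), (exists e, a e) -> connect (cover_step a) u v }.

End Def.

(** New colours 0 and 1 stay in an old triangle and carry no voltage; colour 2 carries that of the
    crossed side. A new vertex takes its sheet from the face whose barycentre it is: from the
    corner, from the smaller end of a side so that both orders agree, or from the triangle
    itself. *)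
Lemma sd_volt (G : finType) (tau : 'I_3 -> G -> G) al bb : volt tau al bb ->
  exists al' bb', volt (sd_tau (fun a i => (tau i a, 1%g))) al' bb'.
Proof.
move=> [Ha Hb Hi Hbb Hc]; set sd := sd_tau _.
pose al' a (j : 'I_3) (f : G * 'S_3) := if j == o2 then al a (f.2 o2) f.1 else false.
pose bb' a (f : G * 'S_3) (k : 'I_3) := if k == o2 then false else
  if k == o0 then bb a f.1 (f.2 o0) else bb a f.1 (if (f.2 o0 < f.2 o1)%N then f.2 o0 else f.2 o1).
have sd2 phi (rho : 'S_3) : sd o2 (phi, rho) = (tau (rho o2) phi, rho) by rewrite /sd /sd_tau /= mulg1.
have ne (rho : 'S_3) i j : i != j -> rho i != rho j by rewrite (inj_eq perm_inj).
exists al', bb'; split.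
- by move=> a b j f; rewrite /al'; case: ifP.
- by move=> a b f k; rewrite /bb'; case: ifP => // _; case: ifP.
- by move=> a j [phi rho]; rewrite /al'; case: eqP => // ->; rewrite sd2 /= Hi.
- move=> a j k [phi rho]; move: j; apply: I3P; move: k; apply: I3P => // _;
    rewrite ?sd2 /bb' /al' /= ?addbF //.
  + by rewrite !permM tpermL tpermR; case: ltngtP => // /val_inj/perm_inj.
  + by rewrite permM tpermD.
  + by rewrite Hbb // ne.
  + by rewrite Hbb //; case: ifP => _; rewrite ne.
move=> a [[phi rho] x] [[psi sig] y] a0.
have st0 f z : connect (cover_step sd al' a) (f, z) (sd o0 f, z).
  by apply: connect1; apply/existsP; exists o0; rewrite /al' /= addbF.
have st1 f z : connect (cover_step sd al' a) (f, z) (sd o1 f, z).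
  by apply: connect1; apply/existsP; exists o1; rewrite /al' /= addbF.
have tri f z (r r' : 'S_3) : connect (cover_step sd al' a) (f, r, z) (f, r', z).
  apply: (perm3_ind (P := fun r' => connect (cover_step sd al' a) (f, r, z) (f, r', z)) (s := r)) => //.
    by move=> s H; apply: connect_trans H (st0 _ _).
  by move=> s H; apply: connect_trans H (st1 _ _).
have /connectP[p + E] := Hc a (phi, x) (psi, y) a0.
elim: p phi x rho E => [|[chi z] p IH] phi x rho /=; first by case=> -> -> _; exact: tri.
move=> E /andP[/existsP[j /eqP[E1 E2]] pp]; subst chi z.
apply: connect_trans (tri _ _ rho (tperm o2 j)) _.
apply: connect_trans (IH _ _ (tperm o2 j) E pp); apply: connect1; apply/existsP; exists o2.
by rewrite sd2 /al' /= tpermL.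
Qed.

End Voltage.

(** * The double covers of a map with one vertex and one face *)

Section BaseVoltage.
Variables (R : realType) (F : topologicalType) (g : nat) (G : finType) (tau : 'I_3 -> G -> G).
Variables (sg : G -> bool) (q : G -> 'rV[R]_3 -> F).
Hypothesis M : map_gem g tau sg q.
Hypotheses (v0 : nv tau o0 = 1%N) (v2 : nv tau o2 = 1%N).
Local Notation N := (nv tau o1).
Variable c0 : G.

Let tauK i : involutive (tau i). Proof. by case: M => -[]. Qed.
Let sgt i a : sg (tau i a) = ~~ sg a. Proof. by case: M => -[]. Qed.
Let com a : tau o0 (tau o2 a) = tau o2 (tau o0 a). Proof. by case: M. Qed.
Let ne02 a : tau o0 a <> tau o2 a. Proof. by case: M. Qed.
Let gem : is_gem tau. Proof. exact: bip_gem sgt. Qed.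

Let one_class k a b : nv tau k = 1%N -> reach tau (fun c => c != k) a b.
Proof.
move=> /eqP/cards1P[C EC]; apply/(vertexP gem).
have cl d : vertex tau k d = C.
  by apply/set1P; rewrite -EC; apply: imset_f; rewrite inE.
by rewrite !cl.
Qed.

Let edge_class (a : G) : {set G} := vertex tau o1 a.
Let edge_in a : edge_class a \in vertex tau o1 @: [set: G]%SET. Proof. by apply: imset_f; rewrite inE. Qed.
Let ix (a : G) : 'I_N := enum_rank_in (edge_in c0) (edge_class a).

Let ix_tau i a : i != o1 -> ix (tau i a) = ix a.
Proof.
move=> i1; rewrite /ix; congr enum_rank_in; apply/esym/(vertexP gem); exact: reach_step.
Qed.

Let ix_surj e : exists a, ix a = e.
Proof.
have /imsetP[a _ Ea] := enum_valP e; exists a; apply: enum_val_inj.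
by rewrite enum_rankK_in ?edge_in.
Qed.

(** [m] names the pair of a and [tau o0 a] by its smaller rank. Comparing the two pairs of an edge,
    [c] chooses one of its two sides. *)
Let m (a : G) : nat := minn (enum_rank a) (enum_rank (tau o0 a)).
Let c (a : G) : bool := (m a < m (tau o2 a))%N.

Let c0E a : c (tau o0 a) = c a.
Proof. by rewrite /c /m -com !tauK minnC [in X in (_ < X)%N]minnC. Qed.

Let c2E a : c (tau o2 a) = ~~ c a.
Proof.
rewrite /c tauK -leqNgt ltn_neqAle andb_idl // => _; apply/eqP.
have ri (x y : G) : enum_rank x = enum_rank y :> nat -> x = y by move=> /val_inj/enum_rank_inj.
have n1 : tau o2 a <> a by have [_] := gem o2; apply.
have n2 : tau o0 (tau o2 a) <> a by move=> H; apply: (@ne02 a); rewrite -[in LHS]H tauK.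
rewrite /m; case: leqP => _; case: leqP => _ /ri // H.
- by apply: (@ne02 a).
- by move: H => /(inv_inj (tauK o0)).
Qed.

Let walk0 := walk (tau o1) (tau o2) c0.
Let per := period (tau o1) (tau o2) c0.

Let p1 : (1 < per)%N. Proof. exact: period_gt1. Qed.
Let perS : per.-1.+1 = per. Proof. by rewrite prednK // ltnW. Qed.
Let per_even : odd per = false. Proof. apply/negbTE; exact: period_even. Qed.
Let per_odd : odd per.-1. Proof. by move: per_even; rewrite -{1}perS /= => /negbFE. Qed.
Let w0 : walk0 0 = c0. Proof. by []. Qed.
Let wp : walk0 per = c0. Proof. exact: walk_period. Qed.
Let stepE k : walk0 k.+1 = tau (if odd k then o2 else o1) (walk0 k).
Proof. by rewrite /walk0 /=; case: odd. Qed.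

Let walk_surj a : exists i : 'I_per, walk0 i == a.
Proof.
have r : reach tau (fun c => c != o0) c0 a by exact: one_class.
suff [l lp ->] : exists2 l, (l < per)%N & a = walk0 l by exists (Ordinal lp).
apply: (reach_ind (P := fun a => exists2 l, (l < per)%N & a = walk0 l)) r _.
  move=> i b i0; have H := @walk_uv_closed _ _ _ _ (tauK o1) (tauK o2) (sgt o1) (sgt o2) c0 b.
  by move: i i0; apply: I3P => // _ /H[].
by exists 0%N => //; exact: ltnW (period_gt1 _ _ _).
Qed.

Let pos a : 'I_per := xchoose (walk_surj a).
Let posK a : walk0 (pos a) = a. Proof. exact/eqP/(xchooseP (walk_surj a)). Qed.
Let walkK (i : 'I_per) : pos (walk0 i) = i.
Proof.
by apply: val_inj; apply: (walk_inj (tauK o1) (sgt o1) (sgt o2)) (ltn_ord _) (ltn_ord _) (posK _).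
Qed.

(** The change of sheet after l steps around the only vertex. The walk alternates [tau o1] and
    [tau o2], and the steps from odd positions cross edges. *)
Let B (a : {ffun 'I_N -> bool}) (l : nat) := \big[addb/false]_(0 <= i < l | odd i) a (ix (walk0 i)).

Let B_S a l : B a l.+1 = B a l (+) (odd l && a (ix (walk0 l))).
Proof.
rewrite /B big_mkcond big_nat_recr //= -big_mkcond /=; by case: odd.
Qed.

(** A full turn crosses every edge twice: the odd positions are the flags of one orientation, and
    the composite of [tau o0] and [tau o2] pairs them within their edges. *)
Let B_per a : B a per = false.
Proof.
rewrite /B big_mkord (reindex (fun x : G => pos x)) /=; last first.
  by exists (fun i => walk0 i) => x _; [exact: posK | exact: walkK].
rewrite (eq_bigl (fun x => sg x == ~~ sg c0)) => [|x]; last first.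
  by rewrite -{2}(posK x) /walk0 (walk_sg (sgt o1) (sgt o2)); case: (sg c0); case: odd.
apply: (big_addb_invol (f := fun x => tau o0 (tau o2 x))).
- by move=> x; rewrite !sgt negbK.
- by move=> x _; rewrite com !tauK.
- by move=> x _ H; apply: (@ne02 x); rewrite -[in LHS]H tauK.
- by move=> x _; rewrite !posK !ix_tau.
Qed.

Let pos_tau (a : G) i : (i == o1) || (i == o2) ->
  let l := pos a in let up := (if odd l then o2 else o1) == i in
  pos (tau i a) = (if up then (if l.+1 == per then 0 else l.+1) else (if l == 0 :> nat then per.-1 else l.-1))%N :> nat.
Proof.
move=> i12 l up; have posE k b : (k < per)%N -> walk0 k = b -> pos b = k :> nat.
  by move=> kp <-; have := congr1 val (walkK (Ordinal kp)).
have Ea : a = walk0 l by rewrite posK.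
case: ifP => Hup.
  have Et : tau i a = walk0 l.+1 by rewrite stepE -(eqP Hup) Ea.
  case: eqP => [lp|/eqP lp]; first by apply: posE; rewrite ?Et ?lp ?wp //; exact: ltnW.
  by apply: posE; rewrite ?Et // ltn_neqAle lp ltn_ord.
case: eqP => l0.
  have i2 : i = o2 by move: Hup i12; rewrite /up l0 /=; move: (i); apply: I3P.
  apply: posE; first by rewrite perS.
  by have := stepE per.-1; rewrite perS wp per_odd i2 Ea l0 w0 => ->; rewrite tauK.
have lpos : (0 < l)%N by rewrite lt0n; apply/eqP.
apply: posE; first by rewrite prednK // ltnW.
have := stepE l.-1; rewrite prednK // -Ea => ->.
have -> : (if odd l.-1 then o2 else o1) = i; last by rewrite tauK.
move: Hup i12; rewrite /up -{1}(prednK lpos) /=.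
by move: (i); apply: I3P => //; case: odd.
Qed.

(** Crossing an edge changes the sheet by the value of a there. [B_per] closes this up around the
    vertex, whose sheet is followed by the partial sums [B]; an edge is referred to its chosen side,
    and the face to the sheet itself. Flags of one sheet are joined inside the only face, and an
    edge with value 1 joins the two sheets. *)
Lemma base_volt : exists al bb, @volt N G tau al bb.
Proof.
pose al (a : {ffun 'I_N -> bool}) (j : 'I_3) phi := (j == o2) && a (ix phi).
pose bb (a : {ffun 'I_N -> bool}) phi (k : 'I_3) := if k == o0 then B a (pos phi) else
  if k == o1 then a (ix phi) && c phi else false.
exists al, bb; split.
- by move=> a b j phi; rewrite /al ffunE; case: (j == o2).
- move=> a b phi k; rewrite /bb; case: ifP => _.
    by rewrite /B -big_split /=; apply: eq_bigr => i _; rewrite ffunE.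
  by case: ifP => // _; rewrite ffunE; case: (c phi); rewrite ?andbT ?andbF.
- by move=> a j phi; rewrite /al; case: eqP => // ->; rewrite ix_tau.
- move=> a j k phi; rewrite /bb /al; move: k; apply: I3P => //=; move: j; apply: I3P => // _ /=; rewrite ?addbF //.
  + rewrite pos_tau //=; set l := pos phi; have El : walk0 l = phi by exact: posK.
    case: ifP => Hl.
      have ev : odd l = false by move: Hl; case: odd.
      case: eqP => [lp|_]; last by rewrite B_S ev addbF.
      by have := congr1 odd lp; rewrite per_even /= ev.
    have od : odd l by move: Hl; case: odd.
    by case: (val l) od => // l' /=; rewrite B_S => /negbTE ->; rewrite addbF.
  + rewrite pos_tau //=; set l := pos phi; have El : walk0 l = phi by exact: posK.
    case: ifP => Hl.
      have od : odd l by move: Hl; case: odd.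
      have BS : B a l.+1 = B a l (+) a (ix phi) by rewrite B_S od El.
      case: eqP => [lp|_]; last by [].
      by rewrite -BS lp B_per /B big_nil.
    have ev : odd l = false by move: Hl; case: odd.
    have ixl k : walk0 k.+1 = tau o2 (walk0 k) -> ix (walk0 k) = ix (walk0 k.+1) by move=> ->; rewrite ix_tau.
    case: eqP => l0.
      have wE : walk0 per.-1.+1 = tau o2 (walk0 per.-1) by rewrite stepE per_odd.
      have Ec : c0 = phi by rewrite -El l0.
      have := B_per a; rewrite -{1}perS B_S per_odd (ixl _ wE) perS wp Ec => /eqP.
      by rewrite l0 /B big_nil addFb; case: (\big[_/_]_(_ <= _ < _ | _) _); case: (a _).
    have lpos : (0 < l)%N by rewrite lt0n; apply/eqP.
    have op : odd l.-1 by move: ev; rewrite -{1}(prednK lpos) /= => /negbFE.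
    have wE : walk0 l.-1.+1 = tau o2 (walk0 l.-1) by rewrite stepE op.
    rewrite -{2}(prednK lpos) B_S op (ixl _ wE) prednK // El.
    by case: (B _ _); case: (a _).
  + by rewrite ix_tau // c0E.
  + by rewrite ix_tau // c2E; case: (a _); case: (c _).
move=> a [phi x] [psi y] [e ae].
have st j f z : connect (cover_step tau al a) (f, z) (tau j f, z (+) al a j f).
  by apply: connect1; apply/existsP; exists j.
have face f f' z : connect (cover_step tau al a) (f, z) (f', z).
  have r : reach tau (fun c => c != o2) f f' by exact: one_class.
  apply: (reach_ind (P := fun f' => connect (cover_step tau al a) (f, z) (f', z))) r _ => //.
  move=> i b i2 H; apply: connect_trans H _; have := st i b z.
  by rewrite {2}/al (negbTE i2) addbF.
have [f Ef] := ix_surj e.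
have flip z : connect (cover_step tau al a) (phi, z) (psi, ~~ z).
  apply: connect_trans (face phi f z) _; apply: connect_trans (st o2 f z) _.
  by rewrite {2}/al /= Ef ae addbT; exact: face.
by case: (eqVneq x y) => [->|]; [exact: face | case: x y => -[]// _; exact: (flip _)].
Qed.

End BaseVoltage.

Definition third (k l : 'I_3) : 'I_3 :=
  if (k != o0) && (l != o0) then o0 else if (k != o1) && (l != o1) then o1 else o2.

Lemma thirdP k l : k != l -> (third k l != k) && (third k l != l).
Proof. by move: k; apply: I3P; move: l; apply: I3P. Qed.

Lemma thirdC k l : third k l = third l k.
Proof. by move: k; apply: I3P; move: l; apply: I3P. Qed.

(** * Triangle cochains pulled back to a double cover *)

Section Coboundary.
Variables (N : nat) (G : finType) (tau : 'I_3 -> G -> G) (al : {ffun 'I_N -> bool} -> 'I_3 -> G -> bool).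
Variables (bb : {ffun 'I_N -> bool} -> G -> 'I_3 -> bool) (a : {ffun 'I_N -> bool}).
Hypotheses (gem : is_gem tau) (V : volt tau al bb).

Definition lift_step (u : G * bool) (j : 'I_3) : G * bool := (tau j u.1, u.2 (+) al a j u.1).

Lemma lift_stepK j : involutive (lift_step^~ j).
Proof.
move=> [phi x]; have [K _] := gem j; rewrite /lift_step /= K (volt_inv V).
by rewrite -addbA addbb addbF.
Qed.

(** [E u j] is the value of a 1-cochain on the side of colour j of the lifted triangle u, the same
    seen from both triangles at that side. *)
Definition coboundary (h : G * bool -> bool) : Prop := exists E : G * bool -> 'I_3 -> bool,
  (forall u j, E (lift_step u j) j = E u j) /\ forall u, h u = E u o0 (+) E u o1 (+) E u o2.

Lemma coboundary_add h h' : coboundary h -> coboundary h' -> coboundary (fun u => h u (+) h' u).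
Proof.
move=> [E [E1 E2]] [E' [E1' E2']]; exists (fun u j => E u j (+) E' u j); split=> u.
  by move=> j; rewrite E1 E1'.
by rewrite E2 E2'; move: (E u o0) (E u o1) (E u o2) (E' u o0) (E' u o1) (E' u o2); do 6!case.
Qed.

Lemma coboundary_ext h h' : h =1 h' -> coboundary h -> coboundary h'.
Proof. by move=> hh [E [E1 E2]]; exists E; split=> // u; rewrite -hh. Qed.

Lemma coboundary_edge u j : coboundary (fun w => (w == u) (+) (w == lift_step u j)).
Proof.
have ne : lift_step u j != u.
  by apply/eqP => /(congr1 fst) /=; have [_] := gem j; apply.
exists (fun w i => (i == j) && ((w == u) || (w == lift_step u j))); split=> [w i|w].
  case: eqP => //= ->; rewrite orbC; congr (_ || _).
    by rewrite (can_eq (lift_stepK j)).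
  by rewrite -{1}(lift_stepK j u) (can_eq (lift_stepK j)).
have -> : (w == u) (+) (w == lift_step u j) = (w == u) || (w == lift_step u j).
  by case: (eqVneq w u) => // ->; rewrite eq_sym (negbTE ne).
by case: (_ || _); rewrite ?andbF //; move: (j); apply: I3P.
Qed.

Lemma coboundary_connect u v : connect (cover_step tau al a) u v ->
  coboundary (fun w => (w == u) (+) (w == v)).
Proof.
move=> /connectP[p + ->]; elim: p u => [|w p IH] u /=.
  by move=> _; exists (fun _ _ => false); split=> // w; rewrite addbb.
move=> /andP[/existsP[j /eqP Ew] /IH H].
have := coboundary_add (coboundary_edge u j) H; apply: coboundary_ext => z.
by rewrite Ew -/(lift_step u j); case: (z == u); case: (z == lift_step u j); case: (z == last _ _).
Qed.

(** Mod 2 classes of degree 2 die in a connected double cover. The pullback is a sum over pairs of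
    lifts of one triangle; such a pair is joined by a chain of adjacent triangles, and the sides
    crossed by the chain carry the 1-cochain. *)
Lemma coboundary_pullback (th : G -> bool) : (exists e, a e) -> coboundary (fun u => th u.1).
Proof.
move=> a0; have H : forall s : seq G,
    coboundary (fun u => \big[addb/false]_(f <- s | th f) ((u == (f, false)) (+) (u == (f, true)))).
  elim=> [|f s IH].
    by exists (fun _ _ => false); split=> // u; rewrite big_nil.
  case: (boolP (th f)) => thf.
    have := coboundary_add (coboundary_connect (volt_conn V (f, false) (f, true) a0)) IH.
    by apply: coboundary_ext => u; rewrite [RHS]big_cons thf.
  by apply: coboundary_ext IH => u; rewrite [RHS]big_cons (negbTE thf).
apply: coboundary_ext (H (enum G)) => -[f x] /=; rewrite big_enum_cond /= big_mkcond (bigD1 f) //= big1.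
  by rewrite !xpair_eqE eqxx /= addbF; case: (th f); case: x.
by move=> i fi; rewrite !xpair_eqE eq_sym (negbTE fi) /=; case: ifP.
Qed.

End Coboundary.

(** * Vertex labels and edge cochains on the surface *)

Section CoverData.
Variables (R : realType) (F : topologicalType) (G : finType) (tau : 'I_3 -> G -> G).
Variables (q : G -> 'rV[R]_3 -> F) (N : nat).
Variables (al : {ffun 'I_N -> bool} -> 'I_3 -> G -> bool) (bb : {ffun 'I_N -> bool} -> G -> 'I_3 -> bool).
Hypotheses (hF : hausdorff_space F) (gem : is_gem tau) (pres : gempres tau q) (V : volt tau al bb).
Local Notation W := ('I_3 * {set G})%type.

Definition vt (phi : G) (k : 'I_3) : W := (k, vertex tau k phi).

(** An edge is determined by its two endpoints, so functions of edges can be written as functions of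
    pairs of vertices. *)
Definition honest := forall phi psi k l, k != l -> vt phi k = vt psi k -> vt phi l = vt psi l ->
  psi = phi \/ psi = tau (third k l) phi.

Hypothesis hon : honest.

Lemma vt_zero phi psi k y : ~~ zero y k -> reach tau (@zero R y) phi psi -> vt phi k = vt psi k.
Proof.
move=> yk r; congr (_, _); apply/(vertexP gem); apply: reach_sub r => j zj.
by apply: contraNneq yk => <-.
Qed.

(** A point is labelled by a vertex at which its barycentric coordinate is at least 1/3. Let phi
    contain x0: the points with such a coordinate at a vertex not in phi form a closed set that
    misses x0, so near x0 only vertices of phi occur. *)
Lemma star_label : exists lam : F -> W,
  (forall x, exists phi y k, [/\ simplex R 2 y, q phi y = x & lam x = vt phi k]) /\
  (forall x0 : F, exists phi, \forall x \near x0, exists k, lam x = vt phi k).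
Proof.
have [cq sq fq] := pres.
have /choice[f Hf] : forall x, exists f : G * 'I_3, exists y,
    [/\ simplex R 2 y, q f.1 y = x & 3%:R^-1 <= y 0 f.2].
  move=> x; have [phi [y [Sy qy]]] := sq x.
  have [k yk] : exists k, 3%:R^-1 <= y 0 k.
    apply: contrapT => ne; have [_] := Sy; rewrite sum3; apply/eqP; rewrite lt_eqF //.
    have H k : y 0 k < 3%:R^-1 by rewrite ltNge; apply/negP => H; apply: ne; exists k.
    have := H o0; have := H o1; have := H o2; lra.
  by exists (phi, k), y.
exists (fun x => vt (f x).1 (f x).2); split=> [x|x0].
  by have [y [Sy qy _]] := Hf x; exists (f x).1, y, (f x).2.
have [phi [y0 [Sy0 qy0]]] := sq x0; exists phi.
pose far (e : G * 'I_3) := [forall k, vt e.1 e.2 != vt phi k].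
pose D (k : 'I_3) : set 'rV[R]_3 := (fun y : 'rV[R]_3 => y 0 k) @^-1` [set x | 3%:R^-1 <= x].
pose bad (e : G * 'I_3) := [set q e.1 y | y in simplex R 2 `&` D e.2].
have cbad : closed (\bigcup_(e in [set e | far e]) bad e).
  apply: closed_bigcup; first exact: finite_finset.
  move=> e _; apply: compact_image_closed => //; first exact: simplex_compact.
  by apply: closed_preim; [exact: continuous_coord | exact: closed_ge].
have nb : (~` \bigcup_(e in [set e | far e]) bad e) x0.
  move=> [e /= /forallP fe [y [Sy ye]]] qe; have [Ey r] : y = y0 /\ reach tau (zero y) e.1 phi.
    by apply/fq => //; rewrite qe qy0.
  move: (fe e.2); rewrite (@vt_zero e.1 phi e.2 y) ?eqxx //.
  by rewrite /zero gt_eqF //; apply: lt_le_trans ye; rewrite invr_gt0 ltr0n.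
have : nbhs x0 (~` \bigcup_(e in [set e | far e]) bad e).
  by apply: open_nbhs_nbhs; split=> //; exact: closed_openC.
apply: filterS => x nx; apply: contrapT => nk; apply: nx.
have [y [Sy qy yk]] := Hf x; exists (f x) => /=; last by exists y.
by apply/forallP => k; apply/eqP => Ek; apply: nk; exists k.
Qed.

Definition pick_flag (v w : W) : option G := [pick f | (vt f v.1 == v) && (vt f w.1 == w)].

Lemma pick_flagE phi k l : k != l -> exists psi, pick_flag (vt phi k) (vt phi l) = Some psi /\
  (psi = phi \/ psi = tau (third k l) phi).
Proof.
move=> kl; rewrite /pick_flag /=; case: pickP => [psi /andP[/eqP H1 /eqP H2]|/(_ phi)].
  by exists psi; split=> //; apply: hon.
by rewrite !eqxx.
Qed.

(** The class a on the edge from v to w, as a difference of sheets; under [honest] every flag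
    containing both vertices gives the same value. Pairs that do not span an edge get [false]. *)
Definition Uv a (v w : W) : bool :=
  if pick_flag v w is Some f then bb a f v.1 (+) bb a f w.1 else false.

Lemma UvE a phi k l : Uv a (vt phi k) (vt phi l) = bb a phi k (+) bb a phi l.
Proof.
have [->|kl] := eqVneq k l.
  by rewrite /Uv; case: pick_flag => [f|]; rewrite ?addbb.
rewrite /Uv; have [psi [-> [->|->]]] := pick_flagE phi kl; first by [].
have /andP[tk tl] := thirdP kl; rewrite /= !(volt_bb V) //.
by case: (bb a phi k); case: (bb a phi l); case: (al a _ phi).
Qed.

Lemma Uv_add a b v w : Uv (addf a b) v w = Uv a v w (+) Uv b v w.
Proof.
rewrite /Uv; case: pick_flag => // f; rewrite !(volt_bb_add V).
exact: addbACA.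
Qed.

(** [eta x v w] is the 1-cochain of [coboundary_pullback] on the lift of the edge from v to w that
    starts at v in sheet x. The first clause reverses the edge; the second is the coboundary
    equation for the indicator of triangles labelled 0, 1, 2. *)
Lemma eta_exists (ell : W -> nat) (a : {ffun 'I_N -> bool}) : (exists e, a e) -> exists eta : bool -> W -> W -> bool,
  (forall phi k l x, eta x (vt phi k) (vt phi l) =
     eta (x (+) Uv a (vt phi k) (vt phi l)) (vt phi l) (vt phi k)) /\
  (forall phi k l m x, perm_eq [:: ell (vt phi k); ell (vt phi l); ell (vt phi m)] (iota 0 3) =
     eta (x (+) Uv a (vt phi k) (vt phi l)) (vt phi l) (vt phi m) (+)
     (eta x (vt phi k) (vt phi m) (+) eta x (vt phi k) (vt phi l))).
Proof.
move=> a0; pose th phi := perm_eq [:: ell (vt phi o0); ell (vt phi o1); ell (vt phi o2)] (iota 0 3).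
have [E [E1 E2]] := coboundary_pullback gem V th a0.
pose eta x (v w : W) := if v.1 == w.1 then false else
  if pick_flag v w is Some f then E (f, x (+) bb a f v.1) (third v.1 w.1) else false.
have etaE phi k l x : k != l -> eta x (vt phi k) (vt phi l) = E (phi, x (+) bb a phi k) (third k l).
  move=> kl; rewrite /eta /= (negbTE kl); have [psi [-> [->|->]]] := pick_flagE phi kl; first by [].
  have /andP[tk tl] := thirdP kl; rewrite (volt_bb V) // addbA.
  by rewrite -[in RHS]E1.
have eta0 phi psi k x : eta x (vt phi k) (vt psi k) = false by rewrite /eta eqxx.
have sym phi k l x : eta x (vt phi k) (vt phi l) =
     eta (x (+) Uv a (vt phi k) (vt phi l)) (vt phi l) (vt phi k).
  have [->|kl] := eqVneq k l; first by rewrite !eta0.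
  rewrite !etaE ?[l == k]eq_sym // UvE thirdC; congr (E (_, _) _).
  by case: x; case: (bb a phi k); case: (bb a phi l).
exists eta; split=> // phi k l m x.
have rep y z : perm_eq [:: y; y; z] (iota 0 3) = false.
  by apply/negP => /perm_uniq; rewrite /= inE eqxx.
have [->|kl] := eqVneq k l.
  by rewrite rep eta0 UvE addbb addbF addbF addbb.
have [->|km] := eqVneq k m.
  rewrite eta0 addFb -sym addbb; apply/negP => /perm_uniq; rewrite /= !inE eqxx orbT //.
have [->|lm] := eqVneq l m.
  by rewrite eta0 addFb addbb; apply/negP => /perm_uniq; rewrite /= !inE eqxx /= andbF.
have -> : perm_eq [:: ell (vt phi k); ell (vt phi l); ell (vt phi m)] (iota 0 3) = th phi.
  have P : perm_eq [:: k; l; m] [:: o0; o1; o2].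
    by move: k kl km; apply: I3P; move: l lm; apply: I3P; move: m; apply: I3P.
  by have /permPl H := perm_map (fun k => ell (vt phi k)) P; exact: H.
rewrite !etaE // UvE -[th phi]/(th (phi, x (+) bb a phi k).1) E2.
have -> : x (+) (bb a phi k (+) bb a phi l) (+) bb a phi l = x (+) bb a phi k.
  by case: x; case: (bb a phi k); case: (bb a phi l).
move: {E1 E2 etaE eta0 sym} (E _) kl km lm => e.
by move: k; apply: I3P; move: l; apply: I3P; move: m; apply: I3P => //= _ _ _;
  case: (e o0); case: (e o1); case: (e o2).
Qed.

End CoverData.

(** * Fine triangulations by repeated subdivision *)

Section FineGem.
Variables (R : realType) (F : topologicalType).

(** The coordinate differences d0, d1, d2 add up to 0, so the first new difference is 2/3 d0 + 1/6
    d1, while the second is d1/2 + d2/3; both are at most 5/6 of the norm. *)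
Lemma sd_contract (rho : 'S_3) (y z : 'rV[R]_3) : simplex R 2 y -> simplex R 2 z ->
  `|sd_map rho y - sd_map rho z| <= 5%:R / 6%:R * `|y - z|.
Proof.
move=> /simplex2P[_ _ _ y1] /simplex2P[_ _ _ z1].
have d i : `|y 0 i - z 0 i| <= `|y - z| by have := coord_norm (y - z) i; rewrite !mxE.
have sd_le : forall k, `|sd_coord k y - sd_coord k z| <= 5%:R / 6%:R * `|y - z|.
  have := d o0; have := d o1; have := d o2; rewrite /sd_coord; move: `|y - z| y1 z1 => D.
  move: (y 0 o0) (y 0 o1) (y 0 o2) (z 0 o0) (z 0 o1) (z 0 o2) => a0 a1 a2 b0 b1 b2 Ea Eb.
  rewrite !ler_norml => /andP[H1 H2] /andP[H3 H4] /andP[H5 H6]; apply: I3P => /=;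
    rewrite ler_norml; apply/andP; split; lra.
apply: rV_norm_le => [|i]; first by rewrite mulr_ge0 // divr_ge0.
by rewrite !mxE.
Qed.

Lemma sd_gem_of (G : finType) (tau : 'I_3 -> G -> G) : is_gem tau ->
  is_gem (sd_tau (fun a i => (tau i a, 1%g : 'S_3))).
Proof.
move=> gem; apply: sd_gem => [t i t' s|t i t' s] [<- <-].
  by rewrite perm1 invg1; have [K _] := gem i; rewrite K.
by rewrite perm1 => -[]; have [_] := gem i; apply.
Qed.

(** A vertex of colour 2 remembers the old triangle, one of colour 1 the old side, one of colour 0
    the colour of an old corner. Any two of these fix the flag up to the third colour. *)
Lemma sd_honest (G : finType) (tau : 'I_3 -> G -> G) : is_gem tau ->
  honest (sd_tau (fun a i => (tau i a, 1%g : 'S_3))).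
Proof.
move=> gem; have gem' := sd_gem_of gem; set sd := sd_tau _ in gem' *.
have sd2 phi (rho : 'S_3) : sd o2 (phi, rho) = (tau (rho o2) phi, rho) by rewrite /sd /sd_tau /= mulg1.
have c2 f f' : vt sd f o2 = vt sd f' o2 -> f.1 = f'.1.
  move=> [/(vertexP gem') r].
  by apply: (reach_ind (P := fun f' => f.1 = f'.1)) r _ => // i [phi rho] i2 ->; move: i i2; apply: I3P.
have c0 (f f' : G * 'S_3) : vt sd f o0 = vt sd f' o0 -> f.2 o0 = f'.2 o0.
  move=> [/(vertexP gem') r].
  apply: (reach_ind (P := fun f' : G * 'S_3 => f.2 o0 = f'.2 o0)) r _ => // i [phi rho] i2 ->; move: i i2; apply: I3P => // _.
    by rewrite /= permM tpermD.
  by rewrite sd2.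
have c1 (f f' : G * 'S_3) : vt sd f o1 = vt sd f' o1 -> f.2 o2 = f'.2 o2 /\ (f'.1 = f.1 \/ f'.1 = tau (f.2 o2) f.1).
  move=> [/(vertexP gem') r].
  apply: (reach_ind (P := fun f' : G * 'S_3 => f.2 o2 = f'.2 o2 /\ (f'.1 = f.1 \/ f'.1 = tau (f.2 o2) f.1))) r _.
    move=> i [phi rho] i2 /= [E1 E2]; move: i i2; apply: I3P => // _.
      by rewrite /= permM tpermD.
    rewrite sd2 /= -E1; split=> //; have [K _] := gem (f.2 o2).
    by case: E2 => ->; [right | left; rewrite K].
  by split=> //; left.
have swap1 (r s : 'S_3) : r o2 = s o2 -> s = r \/ s = (tperm o0 o1 * r)%g.
  move=> E; have : s o0 = r o0 \/ s o0 = r o1 \/ s o0 = r o2.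
    by rewrite -(permKV r (s o0)); move: (r^-1%g (s o0)); apply: I3P; auto.
  case=> [E0|[E0|E0]]; last by move: E0; rewrite E => /perm_inj.
    by case: (perm3_move (esym E0)) => Es; auto; move: E; rewrite Es permM tpermR => /perm_inj.
  have E0' : (tperm o0 o1 * r)%g o0 = s o0 by rewrite permM tpermL.
  by case: (perm3_move E0') => Es; auto; move: E; rewrite Es !permM !tpermR => /perm_inj.
have K01 f f' : vt sd f o0 = vt sd f' o0 -> vt sd f o1 = vt sd f' o1 -> f' = f \/ f' = sd o2 f.
  case: f f' => phi r [psi s] /c0 /= E0 /c1 /= [E2 Ep].
  have Es : s = r.
    case: (perm3_move E0) => // Es; move: E2; rewrite Es permM tpermR => /perm_inj //.
  by rewrite sd2 Es; case: Ep => ->; auto.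
have K02 f f' : vt sd f o0 = vt sd f' o0 -> vt sd f o2 = vt sd f' o2 -> f' = f \/ f' = sd o1 f.
  case: f f' => phi r [psi s] /c0 /= E0 /c2 /= <-.
  by case: (perm3_move E0) => ->; auto.
have K12 f f' : vt sd f o1 = vt sd f' o1 -> vt sd f o2 = vt sd f' o2 -> f' = f \/ f' = sd o0 f.
  case: f f' => phi r [psi s] /c1 /= [E2 _] /c2 /= <-.
  by case: (swap1 _ _ E2) => ->; auto.
by move=> f f'; apply: I3P; apply: I3P => // _ H1 H2; [exact: K01|exact: K02|exact: K01|exact: K12|exact: K02|exact: K12].
Qed.

Variables (N : nat) (G0 : finType) (tau0 : 'I_3 -> G0 -> G0) (q0 : G0 -> 'rV[R]_3 -> F).
Hypotheses (gem0 : is_gem tau0) (pres0 : gempres tau0 q0).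
Hypothesis volt0 : exists al bb, @volt N G0 tau0 al bb.

(** [f] and [A] record the original triangle and the position in it. Positions contract by 5/6 at
    each subdivision, which makes the new triangles uniformly small. *)
Lemma fine_gem (m : nat) : exists (G : finType) (tau : 'I_3 -> G -> G) (q : G -> 'rV[R]_3 -> F),
  [/\ is_gem tau, gempres tau q, (exists al bb, @volt N G tau al bb), ((0 < m)%N -> honest tau)
    & exists (f : G -> G0) (A : G -> 'rV[R]_3 -> 'rV[R]_3), forall phi,
      (forall y, simplex R 2 y -> simplex R 2 (A phi y) /\ q phi y = q0 (f phi) (A phi y)) /\
      (forall y z, simplex R 2 y -> simplex R 2 z ->
         `|A phi y - A phi z| <= (5%:R / 6%:R) ^+ m * `|y - z|)].
Proof.
elim: m => [|m [G [tau [q [gem pres [al [bb V]] _ [f [A HA]]]]]]].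
  exists G0, tau0, q0; split=> //; exists id, (fun _ y => y) => phi.
  by split=> [y //|y z _ _]; rewrite mul1r.
exists (G * 'S_3)%type, (sd_tau (fun a i => (tau i a, 1%g))), (fun a y => q a.1 (sd_map a.2 y)).
split.
- exact: sd_gem_of.
- exact: (sd_gempres (gem_tripres pres)).
- exact: sd_volt V.
- by move=> _; exact: sd_honest.
exists (fun a => f a.1), (fun a y => A a.1 (sd_map a.2 y)) => -[phi rho] /=.
have [H1 H2] := HA phi; split=> [y Sy|y z Sy Sz]; first by apply: H1; exact: sd_map_simplex.
apply: le_trans (H2 _ _ (sd_map_simplex rho Sy) (sd_map_simplex rho Sz)) _.
rewrite exprSr -mulrA ler_wpM2l ?exprn_ge0 ?divr_ge0 //; exact: sd_contract.
Qed.

End FineGem.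

Lemma compact_unif (R : realType) (n : nat) (W : normedModType R) (K : set 'rV[R]_n) (h : 'rV[R]_n -> W) (e : R) :
  compact K -> continuous h -> 0 < e ->
  exists del : R, 0 < del /\ forall x y, K x -> `|x - y| <= del -> `|h x - h y| < e.
Proof.
move=> cK ch e0; have /compact_near_coveringP/(_ R (0 : R)^'+
    (fun del x => forall y, `|x - y| <= del -> `|h x - h y| < e)) := cK.
case.
  move=> x Kx; have e2 : 0 < e / 2 by lra.
  have /cvgrPdist_lt/(_ _ e2)/nbhs_ballP[r /= r0 Hr] := ch x.
  exists (ball x (r / 2), [set del | del < r / 2]) => /=.
    by split; [apply: nbhsx_ballx; lra | apply: nbhs_right_lt; lra].
  move=> [y del] /= [xy dr] z yz; move: xy; rewrite -ball_normE /= => xy.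
  have H1 : `|h x - h y| < e / 2 by apply: Hr; rewrite -ball_normE /=; lra.
  have H2 : `|h x - h z| < e / 2.
    apply: Hr; rewrite -ball_normE /= (_ : x - z = (x - y) + (y - z)); last by rewrite addrA subrK.
    apply: le_lt_trans (ler_normD _ _) _; lra.
  rewrite (_ : h y - h z = (h x - h z) - (h x - h y)); last by rewrite opprB [RHS]addrC addrA subrK.
  apply: le_lt_trans (ler_normB _ _) _; lra.
move=> r /= r0 H; exists (r / 2); have r2 : 0 < r / 2 by lra.
split=> // x y Kx; apply: H => //; rewrite /ball_ /= sub0r normrN gtr0_norm //; lra.
Qed.

(** The interface between the surface and the lower bound. The gem is so fine that [Y] varies by
    less than eps / 2 between a point and a corner of its triangle; labelling each vertex by a
    largest coordinate of [Y] there then gives labels that are largest up to eps at every point. *)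
Lemma cover_data (R : realType) (F : topologicalType) (g : nat) (Y : F -> 'rV[R]_4) (eps : R) :
  (0 < g)%N -> closed_orientable_surface R g F -> continuous Y -> 0 < eps ->
  exists (W : finType) (lam : F -> W) (ell : W -> 'I_4) (G : finType) (vt : G -> 'I_3 -> W)
    (U : {ffun 'I_(2 * g) -> bool} -> W -> W -> bool)
    (bb : {ffun 'I_(2 * g) -> bool} -> G -> 'I_3 -> bool),
  [/\ forall x j, Y x 0 j <= Y x 0 (ell (lam x)) + eps,
      forall x0 : F, exists phi, \forall x \near x0, exists k, lam x = vt phi k,
      forall a b v w, U (addf a b) v w = U a v w (+) U b v w,
      forall a phi k l, U a (vt phi k) (vt phi l) = bb a phi k (+) bb a phi l
    & forall a : {ffun 'I_(2 * g) -> bool}, (exists e, a e) -> exists eta : bool -> W -> W -> bool,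
      (forall phi k l x, eta x (vt phi k) (vt phi l) =
        eta (x (+) U a (vt phi k) (vt phi l)) (vt phi l) (vt phi k)) /\
      (forall phi k l m x, perm_eq [:: val (ell (vt phi k)); val (ell (vt phi l)); val (ell (vt phi m))] (iota 0 3) =
        eta (x (+) U a (vt phi k) (vt phi l)) (vt phi l) (vt phi m) (+)
        (eta x (vt phi k) (vt phi m) (+) eta x (vt phi k) (vt phi l)))].
Proof.
move=> g0 surf cY e0; have [[nF _ _ hF _] _] := surf.
have [G0 [tau0 [sg [q0 [M cG v0 v2]]]]] := surface_unicellular g0 surf.
have [[tauK sgt] pres0 com ne _] := M; have gem0 := bip_gem tauK sgt.
have nv1 : nv tau0 o1 = (2 * g)%N by have := card_edges tauK sgt com ne; rewrite cG; lia.
have [c0 _] : exists c : G0, true by case: nF => x _; have [_ /(_ x)[c _] _] := pres0; exists c.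
have := base_volt M v0 v2 c0; rewrite nv1 => V0.
have [cq0 _ _] := pres0.
have e2 : 0 < eps / 2 by lra.
have /choice[del Hdel] : forall phi : G0, exists del : R, 0 < del /\ forall x y,
    simplex R 2 x -> `|x - y| <= del -> `|Y (q0 phi x) - Y (q0 phi y)| < eps / 2.
  move=> phi; apply: compact_unif => //; first exact: simplex_compact.
  by move=> y; apply: continuous_comp; [exact: cq0 | exact: cY].
have [m Hm] : exists m, forall phi, (5%:R / 6%:R) ^+ m.+1 <= del phi.
  have H phi : \forall m \near \oo, (5%:R / 6%:R : R) ^+ m <= del phi.
    have cv : (fun m => (5%:R / 6%:R : R) ^+ m) @ \oo --> (0 : R).
      by apply: cvg_expr; rewrite ger0_norm ?divr_ge0 // ltr_pdivrMr // mul1r ltr_nat.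
    have /cvgrPdist_le/(_ _ (proj1 (Hdel phi))) := cv; apply: filterS => k.
    by rewrite sub0r normrN ger0_norm // exprn_ge0 // divr_ge0.
  have HF : \forall m \near \oo, forall phi, (5%:R / 6%:R : R) ^+ m <= del phi by apply: filter_forall.
  by have [k _ Hk] := HF; exists k => phi; exact: (Hk k.+1 (leqnSn k)).
have [G [tau [q [gem pres [al [bb V]] hon [f [A HA]]]]]] := fine_gem gem0 pres0 V0 m.+1.
have {}hon := hon isT; have [lam [Hlam Hstar]] := star_label hF gem pres.
have [cq sq fq] := pres.
pose ek (k : 'I_3) : 'rV[R]_3 := \row_i (i == k)%:R.
have Sek k : simplex R 2 (ek k).
  split=> [i|]; first by rewrite mxE ler0n.
  by rewrite (bigD1 k) //= big1 ?addr0 ?mxE ?eqxx // => i /negbTE ik; rewrite mxE ik.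
(* All flags at a vertex send that corner to the same point of F, so a largest coordinate of [Y]
   there depends only on the vertex. *)
have /choice[ell Hell] : forall w : 'I_3 * {set G}, exists l : 'I_4, forall phi k, w = vt tau phi k ->
    forall j, Y (q phi (ek k)) 0 j <= Y (q phi (ek k)) 0 l.
  move=> w; case: (pselect (exists phi k, w = vt tau phi k)) => [[phi [k Ew]]|nw]; last first.
    by exists ord0 => phi k Ew; case: nw; exists phi, k.
  exists [arg max_(i > ord0) Y (q phi (ek k)) 0 i]%O => psi l Ew' j.
  have kl : k = l by move: Ew'; rewrite Ew => -[].
  have <- : q phi (ek k) = q psi (ek l).
    apply/fq => //; split; first by rewrite kl.
    move: Ew'; rewrite Ew kl => -[/(vertexP gem)]; apply: reach_sub => i il.
    by rewrite /zero mxE (negbTE il).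
  by case: arg_maxP => // i _; apply.
exists ('I_3 * {set G})%type, lam, ell, G, (vt tau), (fun a => Uv tau bb a), bb; split.
- move=> x j; have [phi [y [k [Sy qy ->]]]] := Hlam x.
  have [H1 H2] := HA phi; have [SA Eq] := H1 y Sy; have [SA' Eq'] := H1 _ (Sek k).
  have near : `|Y x - Y (q phi (ek k))| < eps / 2.
    rewrite -qy Eq Eq'; have [_ H] := Hdel (f phi); apply: H => //.
    apply: le_trans (H2 _ _ Sy (Sek k)) _; apply: le_trans (Hm (f phi)).
    rewrite ler_piMr ?exprn_ge0 ?divr_ge0 //; apply: rV_norm_le => // i; rewrite !mxE.
    have [y0 _] := Sy; have := simplex_le1 i Sy; have := y0 i.
    by move: (y 0 i) => u u0 u1; rewrite ler_norml; case: (_ == _) => /=; apply/andP; split; lra.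
  have n1 := le_lt_trans (coord_norm _ j) near; have n2 := le_lt_trans (coord_norm _ (ell (vt tau phi k))) near.
  have := Hell _ phi k erefl j; move: n1 n2; rewrite !mxE !ltr_norml => /andP[? ?] /andP[? ?] ?.
  lra.
- exact: Hstar.
- by move=> a b v w; exact: (Uv_add V).
- by move=> a phi k l; exact: (UvE V hon).
- by move=> a a0; exact: (eta_exists gem V hon (fun w => val (ell w)) a0).
Qed.

(** * The lower bound *)

Notation p0 := (@Ordinal 4 0 isT).
Notation p1 := (@Ordinal 4 1 isT).
Notation p2 := (@Ordinal 4 2 isT).
Notation p3 := (@Ordinal 4 3 isT).
Notation I4 := [:: p0; p1; p2; p3].

Lemma I4P (P : 'I_4 -> Prop) : P p0 -> P p1 -> P p2 -> P p3 -> forall i, P i.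
Proof.
move=> P0 P1 P2 P3 [[|[|[|[|//]]]] Hi].
- by rewrite (_ : Ordinal Hi = p0) //; apply: val_inj.
- by rewrite (_ : Ordinal Hi = p1) //; apply: val_inj.
- by rewrite (_ : Ordinal Hi = p2) //; apply: val_inj.
- by rewrite (_ : Ordinal Hi = p3) //; apply: val_inj.
Qed.

Lemma big4 (V : Type) (z : V) (op : Monoid.law z) (f : 'I_4 -> V) (P : pred 'I_4) :
  \big[op/z]_(i | P i) f i = op (if P p0 then f p0 else z) (op (if P p1 then f p1 else z)
    (op (if P p2 then f p2 else z) (if P p3 then f p3 else z))).
Proof.
have E (i j : 'I_4) : val i = val j -> (if P i then f i else z) = (if P j then f j else z).
  by move=> /val_inj ->.
rewrite big_mkcond !big_ord_recl big_ord0 Monoid.mulm1.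
by congr (op _ (op _ (op _ _))); apply: E.
Qed.

Lemma mem_I4 (i : 'I_4) : i \in I4.
Proof. by move: i; apply: I4P. Qed.

Definition others (i : 'I_4) : seq 'I_4 := [seq j <- I4 | j != i].

(** * Corners, facets and gluing maps of the standard tetrahedron *)

Section Tet.
Variable R : realType.
Local Notation V := 'rV[R]_4.

Definition corners (J : seq 'I_4) : seq V := [seq delta R 4 (val j) | j <- J].

Lemma dl_corners4 (f : seq V -> bool) :
  dl f (corners I4) = \big[addb/false]_i f (corners (others i)).
Proof.
by rewrite big4 /corners /= !dl_cons dl_nil addbF /others /=.
Qed.

Lemma dl_corners3 (f : seq V -> bool) (i : 'I_4) :
  dl f (corners (others i)) =
  \big[addb/false]_(l | l != i) f (corners [seq j <- I4 | (j != l) && (j != i)]).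
Proof.
by move: i; apply: I4P; rewrite big4 /others /corners /= !dl_cons dl_nil /= ?addbF.
Qed.

Lemma in_corners (J : seq 'I_4) (D : pred nat) x : (forall j, j \in J -> ~~ D j) ->
  x \in corners J -> corner_face D x.
Proof. by move=> H /mapP[j /H jD ->]; apply: delta_face; [exact: ltn_ord | exact: jD]. Qed.

Lemma corner_simplex D (x : V) : corner_face D x -> simplex R 3 x.
Proof. by case=> H1 H2 _; split. Qed.

Lemma simplex_avg : avg_closed (simplex R 3).
Proof.
move=> s s0 Hs; apply: (@corner_simplex pred0); apply: corner_face_avg => // x /Hs[H1 H2].
by split.
Qed.

Lemma delta_simplex (j : 'I_4) : simplex R 3 (delta R 4 (val j)).
Proof. by apply: (@corner_simplex pred0); apply: delta_face => //; exact: ltn_ord. Qed.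

Lemma corners_simplex J x : x \in corners J -> simplex R 3 x.
Proof. by move=> /mapP[j _ ->]; exact: delta_simplex. Qed.

Lemma simplex_diam s : (forall x, x \in s -> simplex R 3 x) -> diam_le 1 s.
Proof.
move=> Hs x y /Hs Sx /Hs Sy; apply: rV_norm_le => // i; rewrite !mxE.
have [x0 _] := Sx; have [y0 _] := Sy.
have := simplex_le1 i Sx; have := simplex_le1 i Sy; have := x0 i; have := y0 i.
by move: (x 0 i) (y 0 i) => u v *; rewrite ler_norml; apply/andP; split; lra.
Qed.

Definition perm_row (s : 'S_4) (y : V) : V := \row_v y 0 (s^-1%g v).

Lemma perm_rowD s x y : perm_row s (x + y) = perm_row s x + perm_row s y.
Proof. by apply/rowP => i; rewrite !mxE. Qed.
Lemma perm_rowZ s a x : perm_row s (a *: x) = a *: perm_row s x.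
Proof. by apply/rowP => i; rewrite !mxE. Qed.
Lemma perm_row_delta s (j : 'I_4) : perm_row s (delta R 4 (val j)) = delta R 4 (val (s j)).
Proof.
by apply/rowP => i; rewrite !mxE !val_eqE -(inj_eq (@perm_inj _ s)) permKV.
Qed.

Lemma perm_row_corners s J : map (perm_row s) (corners J) = corners (map s J).
Proof. by rewrite /corners -!map_comp; apply: eq_map => j /=; exact: perm_row_delta. Qed.

Lemma perm_row_simplex s y : simplex R 3 y -> simplex R 3 (perm_row s y).
Proof.
move=> [y0 y1]; split=> [i|]; first by rewrite mxE.
by rewrite -y1 [RHS](reindex_inj (@perm_inj _ s^-1%g)); apply: eq_bigr => i _; rewrite mxE.
Qed.

Lemma iter_sd1 m (f : seq V -> bool) x : iter m (@sd R 4) f [:: x] = f [:: x].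
Proof.
elim: m => //= m IH; rewrite /sd /= big_seq1 (_ : centroid [:: x] = x) //.
by rewrite /centroid /= big_seq1 invr1 scale1r.
Qed.

End Tet.

Lemma perm_others (s : 'S_4) i : perm_eq (map s (others i)) (others (s i)).
Proof.
apply: uniq_perm.
- by rewrite (map_inj_uniq perm_inj) filter_uniq.
- by rewrite filter_uniq.
move=> j; rewrite mem_filter mem_I4 andbT; apply/mapP/idP => [[k]|ji].
  by rewrite mem_filter => /andP[ki _] ->; rewrite (inj_eq perm_inj).
exists (s^-1%g j); last by rewrite permKV.
by rewrite mem_filter mem_I4 andbT; apply: contraNneq ji => <-; rewrite permKV.
Qed.

(** * Labels and voltages on the tetrahedra *)

Section Cochains.
Variables (R : realType) (F : Type) (n : nat) (T : face_pairing 3 n) (P : 'I_n -> 'rV[R]_4 -> F).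
Hypothesis glP : forall t i t' s y, T t i = Some (t', s) -> simplex R 3 y -> y 0 i = 0 ->
  P t y = P t' (perm_row s y).
Variables (N : nat) (W G : finType) (lam : F -> W) (ell : W -> 'I_4) (vt : G -> 'I_3 -> W).
Local Notation A := {ffun 'I_N -> bool}.
Variables (U : A -> W -> W -> bool) (bb : A -> G -> 'I_3 -> bool).
Hypothesis U_add : forall a b v w, U (addf a b) v w = U a v w (+) U b v w.
Hypothesis UE : forall a phi k l, U a (vt phi k) (vt phi l) = bb a phi k (+) bb a phi l.
Variables (m : nat) (del : R).
Hypothesis star : forall t x, simplex R 3 x -> exists phi, forall y, `|x - y| <= del ->
  exists k, lam (P t y) = vt phi k.
Hypothesis mesh : forall s u : seq 'rV[R]_4, diam_le 1 s -> (size s <= 4)%N -> subd m s u -> diam_le del u.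
Local Notation V := 'rV[R]_4.
Local Notation sdm := (iter m (@sd R 4)).

Let l t y := lam (P t y).

Lemma subd_star t s u : (forall x, x \in s -> simplex R 3 x) -> (size s <= 4)%N -> subd m s u ->
  exists phi, forall y, y \in u -> exists k, l t y = vt phi k.
Proof.
move=> Ss s4 Hu; have du := mesh (simplex_diam Ss) s4 Hu.
have Su := subd_closed (@simplex_avg R) Ss Hu.
case: u Hu du Su => [|x u] _ du Su.
  have [phi _] := star t (@delta_simplex R p0).
  by exists phi.
have [phi Hphi] := star t (Su x (mem_head _ _)); exists phi => y yu; apply: Hphi.
by apply: du => //; exact: mem_head.
Qed.

Definition th t (u : seq V) : bool := rainbow (fun y => val (ell (l t y))) 3 u.

(** By the Sperner identity the sum counts small tetrahedra with four different labels. Each of them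
    lies over the star of one flag, whose three vertices have at most three labels. *)
Lemma th_sum t : \big[addb/false]_i sdm (th t) (corners R (others i)) = false.
Proof.
rewrite -dl_corners4 -iter_sd_dl -[RHS](iter_sd_false m (corners R I4)); apply: iter_sd_eq => u Hu.
have su : size u = 4%N by rewrite (size_subd Hu).
rewrite dl_rainbow //; last by move=> x _; rewrite -ltnS ltn_ord.
have [phi Hphi] := subd_star t (@corners_simplex R I4) (leqnn 4) Hu.
apply/negbTE/negP => /perm_uniq; rewrite iota_uniq => un.
have /uniq_leq_size : {subset [seq val (ell (l t y)) | y <- u] <= [seq val (ell (vt phi k)) | k <- [:: o0; o1; o2]]}.
  by move=> _ /mapP[y /Hphi[k ->] ->]; apply: (map_f (fun k => val (ell (vt phi k)))); move: k; apply: I3P.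
by move=> /(_ un); rewrite !size_map su.
Qed.

Lemma transport t i t' s (c c' : seq V -> bool) (x : seq V) : T t i = Some (t', s) ->
  (forall u, (forall y, y \in u -> corner_face (pred1 (val i)) y) -> c u = c' (map (perm_row s) u)) ->
  (forall y, y \in x -> corner_face (pred1 (val i)) y) -> sdm c x = sdm c' (map (perm_row s) x).
Proof.
move=> _ cc Hx; rewrite -(iter_sd_map (@perm_rowD R s) (@perm_rowZ R s)); apply: iter_sd_eq => u Hu.
by apply: cc => y; apply: (subd_closed (@corner_face_avg R 4 _) Hx Hu).
Qed.

Let gl_l t i t' s y : T t i = Some (t', s) -> corner_face (pred1 (val i)) y -> l t y = l t' (perm_row s y).
Proof.
move=> E Hy; rewrite /l (glP E) //; first exact: corner_simplex Hy.
by have [_ _] := Hy; apply => /=.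
Qed.

Lemma th_glue t i t' s : T t i = Some (t', s) ->
  sdm (th t) (corners R (others i)) = sdm (th t') (corners R (others (s i))).
Proof.
move=> E; rewrite (transport E (c' := th t')).
- rewrite perm_row_corners; apply: iter_sd_sym; first exact: rainbow_sym.
  exact/perm_map/perm_others.
- move=> u Hu; rewrite /th /rainbow -map_comp; congr perm_eq; apply/eq_in_map => y yu /=.
  by rewrite -(gl_l E) //; exact: Hu.
by move=> y; apply: in_corners => j; rewrite mem_filter => /andP[].
Qed.

Definition uh a t (u : seq V) : bool := if u is [:: x; y] then U a (l t x) (l t y) else false.
(** The class a integrated along the segment from x to y in t: the voltages of the small pieces of
    the segment are added. *)
Definition fe a t x y : bool := sdm (uh a t) [:: x; y].

Lemma fe_add a b t x y : fe (addf a b) t x y = fe a t x y (+) fe b t x y.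
Proof.
rewrite /fe -iter_sd_add; apply: iter_sd_eq => -[|p [|q [|]]] //= _; exact: U_add.
Qed.

Lemma fe_cocycle a t x y z : simplex R 3 x -> simplex R 3 y -> simplex R 3 z ->
  fe a t x z = fe a t x y (+) fe a t y z.
Proof.
move=> Sx Sy Sz; have : dl (sdm (uh a t)) [:: x; y; z] = false.
  rewrite -iter_sd_dl -[RHS](iter_sd_false m [:: x; y; z]); apply: iter_sd_eq => u Hu.
  have Ss w : w \in [:: x; y; z] -> simplex R 3 w by rewrite !inE => /or3P[] /eqP ->.
  have [phi Hphi] := subd_star t Ss isT Hu; have := size_subd Hu.
  case: u {Hu} Hphi => [|p [|q [|r [|]]]] // Hphi _.
  have [k ek] := Hphi p (mem_head _ _); have [k' ek'] : exists k, l t q = vt phi k by apply: Hphi; rewrite !inE eqxx orbT.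
  have [k'' ek''] : exists k, l t r = vt phi k by apply: Hphi; rewrite !inE eqxx !orbT.
  rewrite !dl_cons dl_nil /= ek ek' ek'' !UE.
  by case: (bb a phi k); case: (bb a phi k'); case: (bb a phi k'').
rewrite !dl_cons dl_nil /= -!/(fe _ _ _ _).
by case: (fe a t x z); case: (fe a t x y); case: (fe a t y z).
Qed.

Lemma fe_refl a t x : simplex R 3 x -> fe a t x x = false.
Proof. by move=> Sx; have := fe_cocycle a t Sx Sx Sx; case: (fe a t x x). Qed.

Lemma fe_sym a t x y : simplex R 3 x -> simplex R 3 y -> fe a t x y = fe a t y x.
Proof.
by move=> Sx Sy; have := fe_cocycle a t Sx Sy Sx; rewrite fe_refl //; case: (fe a t x y); case: (fe a t y x).
Qed.

(** Over one star the voltage is the coboundary of the sheet function [be], so the sum along the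
    segment depends only on its ends. *)
Lemma fe_small a t x y : simplex R 3 x -> simplex R 3 y -> `|x - y| <= del ->
  fe a t x y = U a (l t x) (l t y).
Proof.
move=> Sx Sy xy; have [phi Hphi] := star t Sx.
have d0 : 0 <= del by apply: le_trans xy.
have [kk Hkk] : exists kk : V -> 'I_3, forall p, `|x - p| <= del -> l t p = vt phi (kk p).
  have /choice[kk Hkk] : forall p, exists k, `|x - p| <= del -> l t p = vt phi k.
    by move=> p; case: (lerP `|x - p| del) => [/Hphi[k Ek]|_]; [exists k | exists o0].
  by exists kk.
pose be (u : seq V) := if u is [:: p] then bb a phi (kk p) else false.
rewrite /fe (iter_sd_eq (g := dl be)).
  rewrite iter_sd_dl !dl_cons dl_nil /= addbF !iter_sd1 /= addbC.
  by rewrite !Hkk ?UE // subrr normr0.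
move=> u Hu; have := size_subd Hu.
have near : forall p, p \in u -> [set p | `|p - x| <= del] p.
  apply: (subd_closed (@avg_closed_ball R 4 x del) _ Hu) => p.
  by rewrite !inE => /orP[] /eqP -> /=; rewrite ?subrr ?normr0 // distrC.
case: u {Hu} near => [|p [|q [|]]] // near _.
have np : `|x - p| <= del by rewrite distrC; apply: near; exact: mem_head.
have nq : `|x - q| <= del by rewrite distrC; apply: near; rewrite !inE eqxx orbT.
by rewrite !dl_cons dl_nil /= addbF !Hkk ?UE // addbC.
Qed.

Lemma fe_glue a t i t' s x y : T t i = Some (t', s) -> corner_face (pred1 (val i)) x ->
  corner_face (pred1 (val i)) y -> fe a t x y = fe a t' (perm_row s x) (perm_row s y).
Proof.
move=> E Hx Hy; rewrite /fe (transport E (c' := uh a t')) //.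
  by move=> [|p [|q [|]]] //= Hu; rewrite !(gl_l E) //; apply: Hu; rewrite !inE eqxx ?orbT.
by move=> w; rewrite !inE => /orP[] /eqP ->.
Qed.

Section Sheets.
Variable a : A.
Variable eta : bool -> W -> W -> bool.
Hypothesis eta_sym : forall phi k l x, eta x (vt phi k) (vt phi l) =
  eta (x (+) U a (vt phi k) (vt phi l)) (vt phi l) (vt phi k).
Hypothesis eta_th : forall phi k l m x,
  perm_eq [:: val (ell (vt phi k)); val (ell (vt phi l)); val (ell (vt phi m))] (iota 0 3) =
  eta (x (+) U a (vt phi k) (vt phi l)) (vt phi l) (vt phi m) (+)
  (eta x (vt phi k) (vt phi m) (+) eta x (vt phi k) (vt phi l)).

(* The two orders of the endpoints give the same value on short edges; the conjunction makes
   the cochain symmetric everywhere. *)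
Definition Eh t (o : V) (u : seq V) : bool := if u is [:: x; y] then
  eta (fe a t o x) (l t x) (l t y) && eta (fe a t o y) (l t y) (l t x) else false.

Definition side t o (u : seq V) : bool := sdm (Eh t o) u.

Lemma side_sym t o : symmetric_cochain (side t o).
Proof.
apply: iter_sd_sym => u w uw; have su := perm_size uw; rewrite /Eh.
case: u uw su => [|x [|y [|? ?]]]; case: w => [|x' [|y' [|? ?]]] //= uw _.
have : x' \in [:: x; y] by rewrite (perm_mem uw) mem_head.
rewrite !inE => /orP[] /eqP E; subst x'.
  by move: uw; rewrite perm_cons => /perm_mem/(_ y'); rewrite !inE eqxx => /eqP ->.
have : perm_eq [:: y; x] [:: y; y'] by apply: perm_trans uw; rewrite -(perm_rot 1).
by rewrite perm_cons => /perm_mem/(_ y'); rewrite !inE eqxx => /eqP ->; rewrite andbC.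
Qed.

(** Putting o into sheet [false] places every point p of the tetrahedron into sheet [fe a t o p].
    This lifts the tetrahedron to the double cover, where [th] is the coboundary of [eta]. *)
Lemma th_side t o s : simplex R 3 o -> (forall x, x \in s -> simplex R 3 x) -> size s = 3%N ->
  sdm (th t) s = dl (side t o) s.
Proof.
move=> So Ss s3; rewrite -iter_sd_dl; apply: iter_sd_eq => u Hu.
have s4 : (size s <= 4)%N by rewrite s3.
have [phi Hphi] := subd_star t Ss s4 Hu; have := size_subd Hu; rewrite s3 => su.
have Su := subd_closed (@simplex_avg R) Ss Hu; have du := mesh (simplex_diam Ss) s4 Hu.
have sheet p q : p \in u -> q \in u -> fe a t o q = fe a t o p (+) U a (l t p) (l t q).
  by move=> pu qu; rewrite (fe_cocycle a t So (Su p pu) (Su q qu)) (@fe_small a t p q (Su p pu) (Su q qu) (du p q pu qu)).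
have EhE p q : p \in u -> q \in u -> Eh t o [:: p; q] = eta (fe a t o p) (l t p) (l t q).
  move=> pu qu; rewrite /Eh (sheet p q) //; have [k ->] := Hphi p pu; have [k' ->] := Hphi q qu.
  by rewrite -eta_sym andbb.
case: u su Hu Hphi Su du sheet EhE => [|p [|q [|r [|]]]] // _ _ Hphi _ _ sheet EhE.
have pu : p \in [:: p; q; r] by rewrite inE eqxx.
have qu : q \in [:: p; q; r] by rewrite !inE eqxx orbT.
have ru : r \in [:: p; q; r] by rewrite !inE eqxx !orbT.
rewrite !dl_cons dl_nil !EhE // (sheet p q) // /th /rainbow /=.
have [k ->] := Hphi p pu; have [k' ->] := Hphi q qu; have [k'' ->] := Hphi r ru.
by rewrite (eta_th _ _ _ _ (fe a t o p)) addbF.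
Qed.

(** Base points joined by a segment of voltage 0 define the same lift. *)
Lemma side_change t o o' s : simplex R 3 o -> simplex R 3 o' -> fe a t o o' = false ->
  (forall x, x \in s -> simplex R 3 x) -> side t o s = side t o' s.
Proof.
move=> So So' E Ss; apply: iter_sd_eq => u Hu; have Su := subd_closed (@simplex_avg R) Ss Hu.
case: u Su {Hu} => [|p [|q [|]]] //= Su.
have fo w : simplex R 3 w -> fe a t o w = fe a t o' w by move=> Sw; rewrite (fe_cocycle a t So So' Sw) E.
by rewrite !fo //; apply: Su; rewrite !inE eqxx ?orbT.
Qed.

Lemma side_glue t i t' s o x : T t i = Some (t', s) -> corner_face (pred1 (val i)) o ->
  (forall y, y \in x -> corner_face (pred1 (val i)) y) ->
  side t o x = side t' (perm_row s o) (map (perm_row s) x).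
Proof.
move=> E Ho Hx; apply: (transport E) => // -[|p [|q [|]]] //= Hu.
have Hp : corner_face (pred1 (val i)) p by apply: Hu; rewrite inE eqxx.
have Hq : corner_face (pred1 (val i)) q by apply: Hu; rewrite !inE eqxx orbT.
by rewrite !(fe_glue a E) // !(gl_l E).
Qed.

End Sheets.
End Cochains.

(** * Counting tetrahedra at one end *)

Section HalfBound.
Variables (R : realType) (F : Type) (n : nat) (T : face_pairing 3 n) (P : 'I_n -> 'rV[R]_4 -> F).
Hypothesis glP : forall t i t' s y, T t i = Some (t', s) -> simplex R 3 y -> y 0 i = 0 ->
  P t y = P t' (perm_row s y).
Variables (N : nat) (W G : finType) (lam : F -> W) (ell : W -> 'I_4) (vt : G -> 'I_3 -> W).
Local Notation A := {ffun 'I_N -> bool}.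
Variables (U : A -> W -> W -> bool) (bb : A -> G -> 'I_3 -> bool).
Hypothesis U_add : forall a b v w, U (addf a b) v w = U a v w (+) U b v w.
Hypothesis UE : forall a phi k l, U a (vt phi k) (vt phi l) = bb a phi k (+) bb a phi l.
Hypothesis eta_ex : forall a : A, (exists e, a e) -> exists eta : bool -> W -> W -> bool,
  (forall phi k l x, eta x (vt phi k) (vt phi l) =
    eta (x (+) U a (vt phi k) (vt phi l)) (vt phi l) (vt phi k)) /\
  (forall phi k l m x, perm_eq [:: val (ell (vt phi k)); val (ell (vt phi l)); val (ell (vt phi m))] (iota 0 3) =
    eta (x (+) U a (vt phi k) (vt phi l)) (vt phi l) (vt phi m) (+)
    (eta x (vt phi k) (vt phi m) (+) eta x (vt phi k) (vt phi l))).
Variables (m : nat) (del : R).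
Hypothesis star : forall t x, simplex R 3 x -> exists phi, forall y, `|x - y| <= del ->
  exists k, lam (P t y) = vt phi k.
Hypothesis mesh : forall s u : seq 'rV[R]_4, diam_le 1 s -> (size s <= 4)%N -> subd m s u -> diam_le del u.
Variable lab : 'I_n -> 'I_4 -> bool.
Hypothesis lab_glue : forall t i t' s j, T t i = Some (t', s) -> j != i -> lab t' (s j) = lab t j.
Hypothesis lab_mono : forall t i j k, T t i = None -> j != i -> k != i -> lab t j = lab t k.

Local Notation V := 'rV[R]_4.
Local Notation sdm := (iter m (@sd R 4)).
Local Notation Th t i := (sdm (th P lam ell t) (corners R (others i))).
Local Notation fe := (fe P lam U m).
Local Notation e j := (delta R 4 (val (j : 'I_4))).

(** [lab t j] stands for vertex j of t being off the chosen end. So [ntrue t = 1] means three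
    vertices on the end, and [ntrue t = 2] means two. *)
Definition ntrue t : nat := (\sum_i (lab t i : nat))%N.

Hypothesis base_odd : \big[addb/false]_(p : 'I_n * 'I_4 |
  (T p.1 p.2 == None) && [forall j, (j != p.2) ==> ~~ lab p.1 j]) Th p.1 p.2 = true.

Let glue_inv t i t' s : T t i = Some (t', s) -> T t' (s i) = Some (t, s^-1%g).
Proof. exact: pairing_sym. Qed.

Lemma facet_pairs_cancel (Q : 'I_n -> 'I_4 -> bool) (sig : 'I_n -> 'I_4 -> bool) :
  (forall t i t' s, T t i = Some (t', s) -> Q t i -> Q t' (s i) /\ sig t' (s i) = sig t i) ->
  \big[addb/false]_(p : 'I_n * 'I_4 | (T p.1 p.2 != None) && Q p.1 p.2) sig p.1 p.2 = false.
Proof.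
move=> HQ; pose f (p : 'I_n * 'I_4) := if T p.1 p.2 is Some (t', s) then (t', s p.2) else p.
apply: (big_addb_invol (f := f)) => -[t i] /=; rewrite /f /=;
  case E: (T t i) => [[t' s]|] //= Qti; have [Q' sE] := HQ _ _ _ _ E Qti.
- by rewrite (glue_inv E) Q'.
- by rewrite (glue_inv E) permK.
- by have := pairing_irr E.
- by rewrite sE.
Qed.

Lemma ntrueE t : ntrue t = (lab t p0 + (lab t p1 + (lab t p2 + lab t p3)))%N.
Proof. by rewrite /ntrue big4. Qed.

Definition base t l : seq 'I_4 := [seq j <- I4 | (j != l) && ~~ lab t j].
(** One vertex off the end and two on it: a facet through which an edge of the end passes from one
    tetrahedron to the next. *)
Definition tff t l : bool := (\sum_(j | j != l) (lab t j : nat) == 1)%N.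

Lemma one_true t i : ntrue t = 1%N -> lab t i -> forall j, lab t j = (j == i).
Proof.
move=> t1 li j; apply/idP/eqP => [lj|-> //]; apply/eqP; apply: contraT => ji.
by move: t1; rewrite /ntrue (bigD1 i) //= li (bigD1 j) //= lj; lia.
Qed.

Lemma tff_glue t i t' s : T t i = Some (t', s) -> tff t i -> tff t' (s i).
Proof.
rewrite /tff => E /eqP ti; apply/eqP; rewrite -[RHS]ti [LHS](reindex_inj (@perm_inj _ s)) /=.
by apply: eq_big => j; [rewrite (inj_eq perm_inj) | move=> ji; rewrite (lab_glue E) // -(inj_eq (@perm_inj _ s))].
Qed.

(** Sum over all facets with three vertices on the end: paired facets cancel, and the unpaired ones
    give [base_odd]. A tetrahedron with four vertices on the end contributes 0 by [th_sum], one with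
    three contributes its base, and the others have no such facet. *)
Lemma tops_odd : \big[addb/false]_(t | ntrue t == 1%N) \big[addb/false]_(i | lab t i) Th t i = true.
Proof.
pose allF t i := [forall j, (j != i) ==> ~~ lab t j].
have H : \big[addb/false]_(p : 'I_n * 'I_4 | allF p.1 p.2) Th p.1 p.2 = true.
  rewrite (bigID (fun p : 'I_n * 'I_4 => T p.1 p.2 == None)) /=.
  rewrite (eq_bigl _ _ (fun p => andbC (allF p.1 p.2) (T p.1 p.2 == None))) base_odd.
  rewrite (eq_bigl _ _ (fun p => andbC (allF p.1 p.2) (T p.1 p.2 != None))).
  rewrite (facet_pairs_cancel (Q := allF) (sig := fun t i => Th t i)) // => t i t' s E /forallP H; split.
    apply/forallP => j; apply/implyP => ji; rewrite -(permKV s j) (lab_glue E); last first.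
      by apply: contraNneq ji => <-; rewrite permKV.
    by apply: (implyP (H _)); apply: contraNneq ji => <-; rewrite permKV.
  by rewrite -(th_glue glP lam ell m E).
rewrite -[RHS]H -(pair_big_dep xpredT allF (fun t i => Th t i)) /= [RHS](bigID (fun t => ntrue t == 1%N)) /=.
rewrite [X in _ (+) X]big1 ?addbF => [|t nt].
  apply: eq_bigr => t /eqP t1; apply: eq_bigl => i; apply/idP/forallP => [li j|H'].
    by rewrite (one_true t1 li); apply/implyP.
  apply: contraT => li; move: t1; rewrite /ntrue big1 // => j _; case: (eqVneq j i) => [->|ji].
    by rewrite (negbTE li).
  by rewrite (negbTE (implyP (H' j) ji)).
case: (boolP (ntrue t == 0%N)) => t0.
  rewrite (eq_bigl xpredT); first by apply: (th_sum ell star mesh).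
  move=> i; apply/forallP => j; apply/implyP => _.
  by move: t0; rewrite /ntrue sum_nat_eq0 => /forall_inP/(_ j isT); case: lab.
rewrite big_pred0 // => i; apply/negbTE/negP => /forallP H'; move: nt t0; rewrite /ntrue (bigD1 i) //= big1.
  by case: lab.
by move=> j ji; rewrite (negbTE (implyP (H' j) ji)).
Qed.

(** Unpaired facets have all their vertices on the end or all off it, so the facets in question are
    paired and cancel. A tetrahedron with two vertices off the end has two of them, with equal
    values; one with a single vertex off has three; the others have none. *)
Lemma tff_cancel (sig : 'I_n -> 'I_4 -> bool) :
  (forall t i t' s, T t i = Some (t', s) -> tff t i -> sig t' (s i) = sig t i) ->
  (forall t i j, ntrue t = 2%N -> lab t i -> lab t j -> sig t i = sig t j) ->
  \big[addb/false]_(t | ntrue t == 1%N) \big[addb/false]_(l | ~~ lab t l) sig t l = false.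
Proof.
move=> Hg Hq.
have H : \big[addb/false]_(p : 'I_n * 'I_4 | (T p.1 p.2 != None) && tff p.1 p.2) sig p.1 p.2 = false.
  apply: facet_pairs_cancel => t i t' s E ti; split; last exact: Hg E ti.
  exact: tff_glue E ti.
have H2 : \big[addb/false]_(p : 'I_n * 'I_4 | tff p.1 p.2) sig p.1 p.2 = false.
  rewrite -[RHS]H; apply: eq_bigl => -[t i] /=; case E: (T t i) => [u|] //=; apply/negbTE.
  have M j k := @lab_mono t i j k E; rewrite /tff big4.
  move: i E M; apply: I4P => E M /=.
  - by rewrite -(M p1 p2) // -(M p1 p3) //; case: lab.
  - by rewrite -(M p0 p2) // -(M p0 p3) //; case: lab.
  - by rewrite -(M p0 p1) // -(M p0 p3) //; case: lab.
  - by rewrite -(M p0 p1) // -(M p0 p2) //; case: lab.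
rewrite -[RHS]H2 -(pair_big_dep xpredT tff sig) /= [RHS](bigID (fun t => ntrue t == 1%N)) /=.
rewrite [X in _ (+) X]big1 ?addbF => [|t nt].
  apply: eq_bigr => t; rewrite ntrueE => t1; apply: eq_bigl; rewrite /tff; apply: I4P; rewrite big4 /=;
    by move: t1; case: (lab t p0); case: (lab t p1); case: (lab t p2); case: (lab t p3).
have := Hq t; rewrite big4 /tff !big4 /=; move: nt; rewrite ntrueE.
case E0: (lab t p0); case E1: (lab t p1); case E2: (lab t p2); case E3: (lab t p3) => //= _ HQ;
  first [ by rewrite (HQ p0 p1) ?addbF ?addbb // | by rewrite (HQ p0 p2) ?addbF ?addbb //
        | by rewrite (HQ p0 p3) ?addbF ?addbb // | by rewrite (HQ p1 p2) ?addbF ?addbb //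
        | by rewrite (HQ p1 p3) ?addbF ?addbb // | by rewrite (HQ p2 p3) ?addbF ?addbb // ].
Qed.

Lemma base_perm t i t' (s : 'S_4) : T t i = Some (t', s) -> perm_eq (map s (base t i)) (base t' (s i)).
Proof.
move=> E; apply: uniq_perm.
- by rewrite (map_inj_uniq perm_inj) filter_uniq.
- by rewrite filter_uniq.
move=> j; rewrite mem_filter mem_I4 andbT; apply/mapP/idP => [[k]|].
  by rewrite mem_filter => /andP[/andP[ki lk] _] ->; rewrite (inj_eq perm_inj) ki (lab_glue E).
move=> /andP[ji lj]; have ki : s^-1%g j != i by apply: contraNneq ji => <-; rewrite permKV.
exists (s^-1%g j); last by rewrite permKV.
by rewrite mem_filter mem_I4 andbT ki -(lab_glue E ki) permKV.
Qed.

Lemma base_face t i j : j \in base t i -> corner_face (pred1 (val i)) (e j).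
Proof.
by rewrite mem_filter => /andP[/andP[ji _] _]; apply: delta_face; [exact: ltn_ord | exact: ji].
Qed.

Lemma top_sides t o i (eta : bool -> W -> W -> bool) (a : A) : ntrue t = 1%N -> lab t i ->
  simplex R 3 o ->
  (forall phi k l x, eta x (vt phi k) (vt phi l) =
    eta (x (+) U a (vt phi k) (vt phi l)) (vt phi l) (vt phi k)) ->
  (forall phi k l m x, perm_eq [:: val (ell (vt phi k)); val (ell (vt phi l)); val (ell (vt phi m))] (iota 0 3) =
    eta (x (+) U a (vt phi k) (vt phi l)) (vt phi l) (vt phi m) (+)
    (eta x (vt phi k) (vt phi m) (+) eta x (vt phi k) (vt phi l))) ->
  Th t i = \big[addb/false]_(l | ~~ lab t l) side P lam U m a eta t o (corners R (base t l)).
Proof.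
move=> t1 li So eta_sym eta_th; rewrite (th_side (a := a) UE star mesh eta_sym eta_th t So) //; last first.
- by move: (i); apply: I4P.
- by move=> x; exact: corners_simplex.
have E := one_true t1 li.
rewrite dl_corners3; apply: eq_big => [l|l _]; first by rewrite E.
by congr (side _ _ _ _ _ _ _ _ (corners _ _)); apply: eq_filter => j; rewrite E.
Qed.

(** With fewer such tetrahedra, two of the 2^N classes agree on the off-end edges of all of them,
    and their sum c is a nonzero class vanishing there. The off-end vertex of a [tff] facet then
    determines its lift consistently, and [tff_cancel] makes the total of [tops_odd] even. *)
Lemma quads_bound : (N <= #|[set t | ntrue t == 2%N]%SET|)%N.
Proof.
set Q := [set t | ntrue t == 2%N]%SET; rewrite leqNgt; apply/negP => QN.
pose tr t := [seq j <- I4 | lab t j].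
(* The values of a on the edges joining the two vertices off the end. *)
pose val2 (a : A) : {ffun {t : 'I_n | t \in Q} -> bool} :=
  [ffun u => let t := sval u in fe a t (e (nth p0 (tr t) 0)) (e (nth p0 (tr t) 1))].
have [a [b [ab Eab]]] : exists a b : A, a != b /\ val2 a = val2 b.
  apply: contrapT => nex; have inj : injective val2.
    by move=> a b E; apply/eqP; apply: contraT => ab; case: nex; exists a, b.
  by have := leq_card val2 inj; rewrite !card_ffun card_ord card_bool card_sig leq_exp2l // leqNgt QN.
pose c := addf a b; have c0 : exists x, c x.
  apply: contrapT => nc; case/eqP: ab; apply/ffunP => x; apply/eqP; apply: contraT => abx.
  by case: nc; exists x; rewrite ffunE; move: abx; case: (a x); case: (b x).
have quad t i j : ntrue t = 2%N -> lab t i -> lab t j -> fe c t (e i) (e j) = false.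
  move=> t2 li lj; have tQ : t \in Q by rewrite inE t2.
  have := congr1 (fun f : {ffun {t : 'I_n | t \in Q} -> bool} => f (exist _ t tQ)) Eab; rewrite !ffunE /= => Et.
  have {Et} : fe c t (e (nth p0 (tr t) 0)) (e (nth p0 (tr t) 1)) = false.
    by rewrite (fe_add P lam U_add) Et addbb.
  have S k : simplex R 3 (e k) := @delta_simplex R k.
  have refl k : fe c t (e k) (e k) = false by rewrite (fe_refl UE star mesh).
  have sym k k' : fe c t (e k) (e k') = fe c t (e k') (e k) by rewrite (fe_sym UE star mesh).
  move: t2 li lj; rewrite ntrueE /tr /=.
  case E0: (lab t p0); case E1: (lab t p1); case E2: (lab t p2); case E3: (lab t p3) => //= _;
    move: i; apply: I4P; rewrite ?E0 ?E1 ?E2 ?E3 // => _; move: j; apply: I4P; rewrite ?E0 ?E1 ?E2 ?E3 // => _ H;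
    by rewrite ?refl // sym.
have [eta [eta_sym eta_th]] := eta_ex c0.
pose apex t l := odflt p0 [pick j | (j != l) && lab t j].
(* The facet is lifted with its off-end vertex as base point. Within a tetrahedron with two such
   vertices, c vanishes between them, so both facets give the same lift. *)
pose sig t l := side P lam U m c eta t (e (apex t l)) (corners R (base t l)).
have apexP t l : tff t l -> (apex t l != l) && lab t (apex t l).
  rewrite /apex; case: pickP => //= H; rewrite /tff big1 // => j jl; have := H j; rewrite jl /=.
  by case: lab.
have apex_uniq t l j : tff t l -> j != l -> lab t j -> j = apex t l.
  move=> tl jl lj; have /andP[al la] := apexP t l tl; apply/eqP; apply: contraT => ja.
  by move: tl; rewrite /tff (bigD1 j) //= lj (bigD1 (apex t l)) /= ?la // al eq_sym ja.
have := tops_odd; rewrite (eq_bigr (fun t => \big[addb/false]_(l | ~~ lab t l) sig t l)); last first.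
  move=> t /eqP t1; have [i li] : exists i, lab t i.
    by apply: contrapT => H; move: t1; rewrite /ntrue big1 // => i _; case E: lab => //; case: H; exists i.
  have E := one_true t1 li.
  rewrite (eq_bigl (pred1 i)) // big_pred1_eq (@top_sides t (e i) i eta c) //; last exact: delta_simplex.
  apply: eq_bigr => l ll; rewrite /sig; congr (side _ _ _ _ _ _ _ (e _) _); apply: apex_uniq => //.
    rewrite /tff (bigD1 i) /=; last by apply: contraNneq ll => <-.
    by rewrite li big1 // => j /andP[_ ji]; rewrite E (negbTE ji).
  by apply: contraNneq ll => <-.
rewrite tff_cancel // => [t i t' s E ti|t i j t2 li lj]; rewrite /sig.
  have /andP[ai la] := apexP t i ti.
  have tff' : tff t' (s i) by exact: tff_glue E ti.
  rewrite [RHS](side_glue glP lam U m c eta E); first last.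
  - by move=> y /mapP[j /base_face jf ->].
  - by apply: delta_face; [exact: ltn_ord | exact: ai].
  rewrite perm_row_delta perm_row_corners -(apex_uniq t' (s i) (s (apex t i))) //; last first.
  - by rewrite (lab_glue E).
  - by rewrite (inj_eq perm_inj).
  by apply: side_sym; rewrite perm_sym; apply/perm_map/base_perm.
have tf k : lab t k -> tff t k.
  by move=> lk; move: t2; rewrite /tff /ntrue (bigD1 k) //= lk => t2; apply/eqP; lia.
have /andP[ai lai] := apexP t i (tf i li); have /andP[aj laj] := apexP t j (tf j lj).
have -> : base t i = base t j.
  apply: eq_filter => k; case E: (lab t k); rewrite ?andbF // !andbT.
  by rewrite !(contraFneq _ E) // => ->.
apply: (side_change UE star mesh); [exact: delta_simplex|exact: delta_simplex|exact: quad|].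
by move=> x; exact: corners_simplex.
Qed.

(** Its classes are the edges of the glued complex, without direction; a base edge may occur in many
    tetrahedra. *)
Definition edge_step : rel ('I_n * 'I_4 * 'I_4) := [rel u v |
  [exists i, exists s : 'S_4, [&& T u.1.1 i == Some (v.1.1, s), u.1.2 != i, u.2 != i,
    v.1.2 == s u.1.2 & v.2 == s u.2]] || (v == (u.1.1, u.2, u.1.2))].

Lemma edge_step_sym : symmetric edge_step.
Proof.
suff H u v : edge_step u v -> edge_step v u by move=> u v; apply/idP/idP; exact: H.
case: u v => [[t x] y] [[t' x'] y'] /orP[/existsP[i /existsP[s /and5P[/= /eqP E xi yi /eqP -> /eqP ->]]]|/eqP[-> -> ->]]; last first.
  by apply/orP; right.
apply/orP; left; apply/existsP; exists (s i); apply/existsP; exists s^-1%g => /=.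
by rewrite (glue_inv E) eqxx !(inj_eq perm_inj) xi yi !permK !eqxx.
Qed.

Definition edge_class u := fingraph.root edge_step u.

Lemma edge_classP u v : edge_step u v -> edge_class u = edge_class v.
Proof.
move=> uv; apply/eqP; rewrite /edge_class root_connect ?connect1 //.
exact: sym_connect_sym edge_step_sym.
Qed.

Lemma edge_invariant (D : Type) (f : 'I_n * 'I_4 * 'I_4 -> D) u :
  (forall u v, edge_step u v -> f u = f v) -> f (edge_class u) = f u.
Proof.
move=> H; have : connect edge_step u (edge_class u) by exact: connect_root.
move=> /connectP[p + ->]; elim: p u => [|v p IH] u //= /andP[/H -> pp]; exact: IH.
Qed.

Definition base_edge t l : 'I_n * 'I_4 * 'I_4 := edge_class (t, nth p0 (base t l) 0, nth p0 (base t l) 1).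

Lemma base_edge_glue t i t' s : T t i = Some (t', s) -> tff t i -> base_edge t' (s i) = base_edge t i.
Proof.
move=> E ti; have Pb := base_perm E.
have [x [y Eb]] : exists x y, base t i = [:: x; y].
  move: ti; rewrite /tff /base /=; move: (i); apply: I4P; rewrite big4 /=;
  by case: (lab t p0); case: (lab t p1); case: (lab t p2); case: (lab t p3) => //= _; eauto.
have [xi yi] : x != i /\ y != i.
  have : (x \in base t i) && (y \in base t i) by rewrite Eb !inE !eqxx orbT.
  by rewrite !mem_filter => /andP[/andP[/andP[-> _] _] /andP[/andP[-> _] _]].
have st : edge_class (t, x, y) = edge_class (t', s x, s y).
  apply: edge_classP; apply/orP; left; apply/existsP; exists i; apply/existsP; exists s => /=.
  by rewrite E xi yi !eqxx.
rewrite /base_edge Eb /= st; move: Pb; rewrite Eb /= => Pb.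
case: (base t' (s i)) Pb (perm_size Pb) => [|x' [|y' [|]]] //= Pb _.
have : x' \in [:: s x; s y] by rewrite (perm_mem Pb) mem_head.
rewrite !inE => /orP[] /eqP Ex; subst x'.
  by move: Pb; rewrite perm_cons => /perm_mem/(_ y'); rewrite !inE eqxx => /eqP ->.
have : perm_eq [:: s y; s x] [:: s y; y'] by apply: perm_trans Pb; rewrite -(perm_rot 1).
rewrite perm_cons => /perm_mem/(_ y'); rewrite !inE eqxx => /eqP ->.
by apply: edge_classP; apply/orP; right.
Qed.

Let S1 := [set t | ntrue t == 1%N]%SET.
(** The coefficient at the edge c of the mod 2 boundary of the bases of Z. *)
Let cnt (Z : {set 'I_n}) (c : 'I_n * 'I_4 * 'I_4) : bool :=
  \big[addb/false]_(t in Z) \big[addb/false]_(l | ~~ lab t l) (base_edge t l == c).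
Let cycle_set (Z : {set 'I_n}) : bool := [forall c, ~~ cnt Z c].
Let odd_set (Z : {set 'I_n}) : bool := \big[addb/false]_(t in Z) \big[addb/false]_(i | lab t i) Th t i.

Let S1_cycle : cycle_set S1.
Proof.
apply/forallP => c; apply/negPf; rewrite /cnt (eq_bigl (fun t => ntrue t == 1%N)); last by move=> t; rewrite inE.
apply: (@tff_cancel (fun t l => base_edge t l == c)) => [t i t' s E ti|t i j t2 li lj].
  by rewrite (base_edge_glue E).
rewrite /base_edge; suff -> : base t i = base t j by [].
apply: eq_filter => k; case E: (lab t k); rewrite ?andbF // !andbT.
by rewrite !(contraFneq _ E) // => ->.
Qed.

Let S1_odd : odd_set S1.
Proof.
rewrite /odd_set (eq_bigl (fun t => ntrue t == 1%N)); last by move=> t; rewrite inE.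
by rewrite tops_odd.
Qed.

(** A smallest cycle of bases with odd total. Deleting a nonempty even subcycle would leave a
    smaller one, so its only subcycles are itself and the empty set. *)
Let Z0 := [arg min_(Z < S1 | [&& Z \subset S1, cycle_set Z & odd_set Z]) #|Z|].

Let Z0P : [/\ Z0 \subset S1, cycle_set Z0, odd_set Z0 &
  forall Z : {set 'I_n}, Z \subset Z0 -> cycle_set Z -> odd_set Z -> Z = Z0].
Proof.
rewrite /Z0; case: arg_minnP; first by rewrite subxx S1_cycle S1_odd.
move=> Z /and3P[ZS cZ oZ] Zmin; split=> // Z' Z'Z cZ' oZ'; apply/eqP; rewrite eqEcard Z'Z /=.
by apply: Zmin; rewrite cZ' oZ' (fintype.subset_trans Z'Z ZS).
Qed.

Let Z0_sub : {in Z0, forall t, ntrue t = 1%N}.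
Proof. by move=> t; have [/fintype.subsetP H _ _ _] := Z0P => /H; rewrite inE => /eqP. Qed.

Let fedge a (u : 'I_n * 'I_4 * 'I_4) : bool := fe a u.1.1 (e u.1.2) (e u.2).

Let fedge_inv a u v : edge_step u v -> fedge a u = fedge a v.
Proof.
case: u v => [[t x] y] [[t' x'] y'] /orP[/existsP[i /existsP[s /and5P[/= /eqP E xi yi /eqP -> /eqP ->]]]|/eqP[-> -> ->]]; last first.
  by rewrite /fedge /= (fe_sym UE star mesh) //; exact: delta_simplex.
rewrite /fedge /= (fe_glue glP lam U m a E); first by rewrite !perm_row_delta.
  by apply: delta_face; [exact: ltn_ord | exact: xi].
by apply: delta_face; [exact: ltn_ord | exact: yi].
Qed.

(** If a vanished on all edges of [Z0], the cycle would lift to the double cover. There the count is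
    the coboundary of [eta], and its sum over a cycle is 0, not odd. *)
Lemma cycle_detects (a : A) : (exists x, a x) ->
  exists t l, [/\ t \in Z0, ~~ lab t l & fedge a (base_edge t l)].
Proof.
move=> a0; apply: contrapT => nex; have [eta [eta_sym eta_th]] := eta_ex a0.
(* The factor [~~ fedge a u] makes this a function of the edge class: lifts based at the two ends
   agree only if a vanishes on the edge. *)
pose kap (u : 'I_n * 'I_4 * 'I_4) : bool :=
  ~~ fedge a u && side P lam U m a eta u.1.1 (e u.1.2) (corners R [:: u.1.2; u.2]).
have kap_inv u v : edge_step u v -> kap u = kap v.
  move=> uv; rewrite /kap (fedge_inv a uv); case: (boolP (fedge a v)) => //= fv; have fu := fv; rewrite -(fedge_inv a uv) in fu.
  case: u v uv fv fu => [[t x] y] [[t' x'] y'] /orP[/existsP[i /existsP[s /and5P[/= /eqP E xi yi /eqP -> /eqP ->]]]|/eqP[-> -> ->]] fv fu.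
    rewrite [LHS](side_glue glP lam U m a eta E); first by rewrite perm_row_delta /= !perm_row_delta.
      by apply: delta_face; [exact: ltn_ord | exact: xi].
    move=> w; rewrite !inE => /orP[] /eqP ->; by apply: delta_face; rewrite ?ltn_ord.
  transitivity (side P lam U m a eta t (e y) (corners R [:: x; y])).
    apply: (side_change UE star mesh); [exact: delta_simplex | exact: delta_simplex | exact: (negbTE fu) |].
    by move=> w; exact: (@corners_simplex R [:: x; y]).
  by apply: side_sym; try (exact: delta_simplex); try (by rewrite -(perm_rot 1)); eassumption.
have [_ cZ oZ _] := Z0P; move: oZ; rewrite /odd_set.
rewrite (eq_bigr (fun t => \big[addb/false]_(l | ~~ lab t l) kap (base_edge t l))) => [|t tZ].
  rewrite (eq_bigr (fun t => \big[addb/false]_(l | ~~ lab t l) \big[addb/false]_c ((base_edge t l == c) && kap c))); last first.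
    move=> t _; apply: eq_bigr => l _; rewrite (bigD1 (base_edge t l)) //= eqxx big1 ?addbF // => c.
    by rewrite eq_sym => /negbTE ->.
  under eq_bigr do rewrite exchange_big /=.
  rewrite exchange_big /= big1 // => c _; have := forallP cZ c; rewrite /cnt.
  case: (kap c); last by move=> _; apply: big1 => t _; apply: big1 => l _; rewrite andbF.
  by under [in X in _ -> X = _]eq_bigr do (under eq_bigr do rewrite andbT); move/negbTE.
have t1 := Z0_sub tZ; have [i li] : exists i, lab t i.
  by apply: contrapT => H; move: t1; rewrite /ntrue big1 // => i _; case E: lab => //; case: H; exists i.
have E := one_true t1 li; rewrite (eq_bigl (pred1 i)) // big_pred1_eq.
have f0 l : l != i -> fedge a (t, nth p0 (base t l) 0, nth p0 (base t l) 1) = false.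
  move=> l1; apply/negP => H; apply: nex; exists t, l; split; rewrite ?E //.
  by rewrite (edge_invariant (t, _, _) (fedge_inv a)).
have f00 x y : x != i -> y != i -> fe a t (e x) (e y) = false.
  have fr x' : fe a t (e x') (e x') = false by rewrite (fe_refl UE star mesh) //; exact: delta_simplex.
  have fs x' y' : fe a t (e x') (e y') = fe a t (e y') (e x').
    by rewrite (fe_sym UE star mesh) //; exact: delta_simplex.
  move: f0; rewrite /fedge /base /= !E => f0.
  move: (i) f0; apply: I4P => /= f0; have := f0 p0; have := f0 p1; have := f0 p2; have := f0 p3 => //= g3 g2 g1 g0;
    move: x; apply: I4P => // _; move: y; apply: I4P => // _;
    by [exact: fr | exact: g0 | exact: g1 | exact: g2 | exact: g3 | rewrite fs; exact: g0 | rewrite fs; exact: g1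
       | rewrite fs; exact: g2 | rewrite fs; exact: g3].
pose x0 := if i == p0 then p1 else p0; have x0i : x0 != i by rewrite /x0; move: (i); apply: I4P.
rewrite (@top_sides t (e x0) i eta a t1 li (delta_simplex R x0) eta_sym eta_th).
apply: eq_bigr => l; rewrite E => li'; rewrite (edge_invariant (t, _, _) kap_inv) /kap f0 //=.
have [x [y [Eb xi]]] : exists x y, base t l = [:: x; y] /\ x != i.
  by rewrite /base /= !E; move: (i) li'; apply: I4P; move: l; apply: I4P => //= _; do 2!eexists; split; eauto.
rewrite Eb /=; apply: (side_change UE star mesh); [exact: delta_simplex|exact: delta_simplex|exact: f00|].
by move=> w; exact: (@corners_simplex R [:: x; y]).
Qed.

Let occ (t : 'I_n) (c : 'I_n * 'I_4 * 'I_4) : bool :=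
  \big[addb/false]_(l | ~~ lab t l) (base_edge t l == c).
Let E0 := [set c : 'I_n * 'I_4 * 'I_4 | [exists t, [exists l, [&& t \in Z0, ~~ lab t l & base_edge t l == c]]]]%SET.

Let E0_in t l : t \in Z0 -> ~~ lab t l -> base_edge t l \in E0.
Proof. by move=> tZ ll; rewrite inE; apply/existsP; exists t; apply/existsP; exists l; rewrite tZ ll eqxx. Qed.

(** Every edge of the cycle occurs an even and positive number of times, and every base has three
    edges. *)
Let E0_bound : (2 * #|E0| <= 3 * #|Z0|)%N.
Proof.
pose cn c := (\sum_(t in Z0) \sum_(l | ~~ lab t l) (base_edge t l == c : nat))%N.
have cn2 c : c \in E0 -> (2 <= cn c)%N.
  rewrite inE => /existsP[t /existsP[l /and3P[tZ ll /eqP Ec]]].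
  have ev : ~~ odd (cn c).
    have Eo : odd (cn c) = cnt Z0 c.
      rewrite /cn (big_morph odd oddD (erefl : odd 0 = false)); apply: eq_bigr => t' _.
      by rewrite (big_morph odd oddD (erefl : odd 0 = false)); apply: eq_bigr => l' _; case: (_ == _).
    by have [_ /forallP/(_ c) + _ _] := Z0P; rewrite Eo.
  have : (0 < cn c)%N by rewrite /cn (bigD1 t) //= (bigD1 l) //= Ec eqxx.
  by move: ev; case: (cn c) => [|[|]].
have : (\sum_(c in E0) cn c = 3 * #|Z0|)%N.
  rewrite /cn exchange_big /= mulnC -sum_nat_const; apply: eq_bigr => t tZ.
  rewrite exchange_big /=; have t1 := Z0_sub tZ.
  rewrite (eq_bigr (fun=> 1%N)) => [|l ll].
    by rewrite big4 /=; move: t1; rewrite ntrueE; case: (lab t p0); case: (lab t p1); case: (lab t p2); case: (lab t p3).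
  rewrite (bigD1 (base_edge t l)) ?E0_in //= eqxx big1 // => c /andP[_]; rewrite eq_sym => /negbTE -> //.
move=> <-; rewrite mulnC -sum_nat_const; exact: leq_sum.
Qed.

Local Notation f2 b := ((b : bool)%:R : 'F_2).

Let f2D x y : f2 (x (+) y) = f2 x + f2 y.
Proof. by case: x; case: y; apply/eqP. Qed.

Let f2M x y : f2 (x && y) = f2 x * f2 y.
Proof. by case: x; case: y; apply/eqP. Qed.

Let f2_inj x : f2 x = 0 -> x = false.
Proof. by case: x => // /eqP. Qed.

Let f2E (x : 'F_2) : x = f2 (x != 0).
Proof. by case: x => [[|[|//]]] H; apply/val_inj. Qed.

Let f2_sum (J : Type) (r : seq J) (Q : pred J) (b : J -> bool) :
  f2 (\big[addb/false]_(i <- r | Q i) b i) = \sum_(i <- r | Q i) f2 (b i).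
Proof. by apply: (big_morph (fun b : bool => f2 b) f2D). Qed.

Definition unitf (j : 'I_N) : A := [ffun x => x == j].

Let fedge_lin (a : A) u : fedge a u = \big[addb/false]_j (a j && fedge (unitf j) u).
Proof.
have fadd b c : fedge (addf b c) u = fedge b u (+) fedge c u by rewrite /fedge (fe_add P lam U_add).
have f0 : fedge [ffun=> false] u = false.
  by have := fadd [ffun=> false] [ffun=> false]; rewrite (_ : addf _ _ = [ffun=> false]);
    [case: (fedge _ u) | apply/ffunP => x; rewrite !ffunE].
have H (s : seq 'I_N) : uniq s -> fedge [ffun x => (x \in s) && a x] u =
    \big[addb/false]_(j <- s) (a j && fedge (unitf j) u).
  elim: s => [|j s IH] /=; first by rewrite big_nil -f0 (_ : [ffun x => _] = [ffun=> false]) //; apply/ffunP => x; rewrite !ffunE.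
  move=> /andP[js us]; rewrite big_cons -IH //.
  have -> : [ffun x => (x \in j :: s) && a x] = addf [ffun x => (x == j) && a j] [ffun x => (x \in s) && a x].
    apply/ffunP => x; rewrite !ffunE inE; case: (eqVneq x j) => [->|] //=.
    by rewrite (negbTE js) addbF.
  rewrite fadd; congr (_ (+) _); case: (a j) => /=.
    by rewrite (_ : [ffun x => _] = unitf j) //; apply/ffunP => x; rewrite !ffunE andbT.
  have -> : ([ffun x => (x == j) && false] : A) = [ffun=> false] by apply/ffunP => x; rewrite !ffunE andbF.
  exact: f0.
have Ea : a = [ffun x => (x \in enum 'I_N) && a x] by apply/ffunP => x; rewrite ffunE mem_enum.
by rewrite {1}Ea H ?enum_uniq // big_enum.
Qed.

(** [Mx] is the boundary matrix of the cycle and [Bx] evaluates the N basic classes on its edges;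
    that their product vanishes is the cocycle condition on the bases. *)
Let Mx : 'M['F_2]_(#|Z0|, #|E0|) := \matrix_(r, c) f2 (occ (enum_val r) (enum_val c)).
Let Bx : 'M['F_2]_(N, #|E0|) := \matrix_(j, c) f2 (fedge (unitf j) (enum_val c)).

Let fedge_triangle a t : t \in Z0 -> \big[addb/false]_(l | ~~ lab t l) fedge a (base_edge t l) = false.
Proof.
move=> tZ; have t1 := Z0_sub tZ.
rewrite (eq_bigr (fun l => fe a t (e (nth p0 (base t l) 0)) (e (nth p0 (base t l) 1)))); last first.
  by move=> l _; rewrite (edge_invariant (t, _, _) (fedge_inv a)).
have C x y z := fe_cocycle UE star mesh a t (delta_simplex R x) (delta_simplex R y) (delta_simplex R z).
have [i li] : exists i, lab t i.
  by apply: contrapT => H; move: t1; rewrite /ntrue big1 // => i _; case E: lab => //; case: H; exists i.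
have E := one_true t1 li; rewrite big4 /base /= !E.
by move: (i); apply: I4P => /=; [rewrite (C p1 p2 p3)|rewrite (C p0 p2 p3)|rewrite (C p0 p1 p3)|rewrite (C p0 p1 p2)];
  move: (fe a t _ _) (fe a t _ _) => [] [].
Qed.

Let BM0 : Bx *m Mx^T = 0.
Proof.
apply/matrixP => j r; rewrite !mxE; set t := enum_val r; have tZ : t \in Z0 := enum_valP r.
under eq_bigr do rewrite !mxE -f2M.
rewrite -f2_sum (_ : \big[_/_]_(_ | _) _ = false) //.
rewrite -[RHS](fedge_triangle (unitf j) tZ) -/t.
have -> : \big[addb/false]_(i < #|E0|) (fedge (unitf j) (enum_val i) && occ t (enum_val i)) =
   \big[addb/false]_(c in E0) (fedge (unitf j) c && occ t c).
  by rewrite [RHS]big_enum_val.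
rewrite (eq_bigr (fun c => \big[addb/false]_(l | ~~ lab t l) (fedge (unitf j) c && (base_edge t l == c)))); last first.
  by move=> c _; rewrite /occ; case: (fedge _ c) => //=; rewrite big1_eq.
rewrite exchange_big /=; apply: eq_bigr => l ll.
rewrite (bigD1 (base_edge t l)) ?E0_in //= eqxx andbT big1 ?addbF // => c /andP[_].
by rewrite eq_sym => /negbTE ->; rewrite andbF.
Qed.

Let B_free : row_free Bx.
Proof.
apply: inj_row_free => v vB; apply/rowP => j; rewrite mxE; apply/eqP; apply: contraT => vj.
pose a : A := [ffun x => v 0 x != 0]; have a0 : exists x, a x by exists j; rewrite ffunE.
have [t [l [tZ ll fa]]] := cycle_detects a0.
have cE := E0_in tZ ll; have := congr1 (fun w : 'rV_ _ => w 0 (enum_rank_in cE (base_edge t l))) vB.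
rewrite !mxE => vB0; suff : fedge a (base_edge t l) = false by rewrite fa.
apply: f2_inj; rewrite fedge_lin f2_sum -[RHS]vB0; apply: eq_bigr => x _.
by rewrite !mxE enum_rankK_in // f2M ffunE -f2E.
Qed.

(** Kernel vectors are subcycles of [Z0]; by minimality these are only 0 and the all-ones vector, so
    the kernel has dimension at most 1. *)
Let M_rank : (#|Z0| <= (\rank Mx).+1)%N.
Proof.
have [_ cZ0 oZ0 Zmin] := Z0P.
suff K : (\rank (kermx Mx) <= 1)%N by move: K; rewrite mxrank_ker leq_subLR addn1.
apply: leq_trans (mxrankS (_ : (kermx Mx <= (const_mx 1 : 'rV_#|Z0|))%MS)) (rank_leq_row _).
apply/row_subP => i0; move: (row i0 _) (row_sub i0 (kermx Mx)) => v /sub_kermxP vM.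
pose Z : {set 'I_n} := [set enum_val r | r in [set r | v 0 r != 0]%SET]%SET.
have ZZ0 : Z \subset Z0 by apply/fintype.subsetP => _ /imsetP[r _ ->]; exact: enum_valP.
have cZ c : cnt Z c = false.
  rewrite /cnt -/(occ _ _); case: (boolP (c \in E0)) => cE; last first.
    rewrite big1 // => t /(fintype.subsetP ZZ0) tZ; rewrite big1 // => l ll; apply/negbTE.
    by apply: contraNneq cE => <-; exact: E0_in.
  apply: f2_inj; have := congr1 (fun w : 'rV_ _ => w 0 (enum_rank_in cE c)) vM; rewrite !mxE => vM0.
  rewrite -[RHS]vM0 f2_sum big_imset /=; last by move=> ? ? _ _; exact: enum_val_inj.
  rewrite big_mkcond; apply: eq_bigr => r _; rewrite inE mxE enum_rankK_in // {2}[v 0 r]f2E.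
  by case: eqP => _ /=; rewrite ?mul0r ?mul1r.
have splitZ (h : 'I_n -> bool) : \big[addb/false]_(t in Z0) h t =
    \big[addb/false]_(t in Z) h t (+) \big[addb/false]_(t in Z0 :\: Z) h t.
  by rewrite (big_setID Z) /= (finset.setIidPr ZZ0).
have vE r : v 0 r != 0 -> v 0 r = 1 by rewrite {2}[v 0 r]f2E => ->.
case: (boolP (odd_set Z)) => oZ.
  have EZ : Z = Z0 by apply: Zmin => //; apply/forallP => c; rewrite cZ.
  suff -> : v = const_mx 1 by [].
  apply/rowP => r; rewrite mxE; apply: vE; have : enum_val r \in Z by rewrite EZ; exact: enum_valP.
  by move=> /imsetP[r']; rewrite inE => H /enum_val_inj ->.
have EZ : Z0 :\: Z = Z0.
  apply: Zmin; first exact: finset.subsetDl.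
    apply/forallP => c; have := forallP cZ0 c; rewrite /cnt splitZ -/(cnt Z c) cZ //.
  by move: oZ0; rewrite /odd_set splitZ -/(odd_set Z) (negbTE oZ).
suff -> : v = 0 by exact: sub0mx.
apply/rowP => r; rewrite mxE; apply/eqP; apply: contraT => vr.
have rZ : enum_val r \in Z by apply: imset_f; rewrite inE.
have : enum_val r \in Z0 :\: Z by rewrite EZ; exact: enum_valP.
by rewrite inE rZ.
Qed.

(** Let [Z0] have z bases and e edges. [Bx] has rank N and is orthogonal to [Mx], so N + rank Mx <=
    e; also z - 1 <= rank Mx and 2 e <= 3 z. Hence z >= 2 N - 2. *)
Lemma tops_bound : (2 * N <= #|S1| + 2)%N.
Proof.
have := mulmx0_rank_max BM0; rewrite mxrank_tr (eqP B_free) => H1.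
have [/subset_leq_card H2 _ _ _] := Z0P; have := M_rank; have := E0_bound; lia.
Qed.

End HalfBound.

(** * The tetrahedra of a triangulated cylinder *)

Section LowerBound.
Variables (R : realType) (F : topologicalType) (g : nat) (a b : R).
Hypotheses (g_gt0 : (0 < g)%N) (hF : closed_orientable_surface R g F) (ab : a < b).
Local Notation M := (F * set_type `[a, b])%type.
Local Notation V := 'rV[R]_4.
Variables (n : nat) (T : face_pairing 3 n) (h : realization R T -> M).
Hypotheses (hh : homeomorphism h)
  (hB : [set h (to_realization T x) | x in @unpaired_points R 3 n T] = manifold_boundary R 3 M).

Definition cpt (t : 'I_n) (y : V) : M := h (to_realization T (point_of t y)).
Local Notation P := (fun t y => (cpt t y).1).
Definition height (t : 'I_n) (y : V) : R := set_val (cpt t y).2.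

Lemma cpt_continuous t : continuous (cpt t).
Proof.
have [ch _] := hh; move=> y; apply: (@continuous_comp _ _ _ (fun y => to_realization T (point_of t y)) h); last exact: ch.
apply: (@continuous_comp _ _ _ (@point_of R 3 n t) (to_realization T)); first exact: point_of_continuous.
exact: to_realization_continuous.
Qed.

Lemma P_continuous t : continuous (P t).
Proof.
move=> y; apply: (@continuous_comp _ _ _ (cpt t) (fun x : M => x.1)); first exact: cpt_continuous.
exact: cvg_fst.
Qed.

Lemma height_continuous t : continuous (height t).
Proof.
move=> y; apply: (@continuous_comp _ _ _ (cpt t) (fun x : M => set_val x.2 : R)); first exact: cpt_continuous.
apply: (@continuous_comp _ _ _ (fun x : M => x.2) (fun u : set_type `[a, b] => set_val u : R)); first exact: cvg_snd.
exact: initial_continuous.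
Qed.

Lemma cpt_glue t i t' s y : T t i = Some (t', s) -> simplex R 3 y -> y 0 i = 0 ->
  cpt t y = cpt t' (perm_row s y).
Proof.
move=> E Sy yi; congr h; apply/to_realizationP/glue_relP; apply: rst_step; exists i, s.
rewrite !bary_point_of //; last exact: perm_row_simplex.
by split=> // j; rewrite mxE permK.
Qed.

Lemma cpt_eq t y t' y' : cpt t y = cpt t' y' -> glue_rel T (point_of t y) (point_of t' y').
Proof.
have [_ [k [_ hK _]]] := hh; move=> E; apply/to_realizationP.
by rewrite -[LHS]hK -/(cpt t y) E hK.
Qed.

Lemma manF : manifold_boundary R 2 F = set0. Proof. by have [[]] := hF. Qed.

Lemma height_facet t i y : T t i = None -> simplex R 3 y -> y 0 i = 0 -> height t y = a \/ height t y = b.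
Proof.
move=> E Sy yi; have : [set h (to_realization T x) | x in @unpaired_points R 3 n T] (cpt t y).
  by exists (point_of t y) => //; exists i; rewrite bary_point_of.
by rewrite hB (cylinder_boundary ab manF).
Qed.

(** On an unpaired facet the height has only the values a and b, so by the intermediate value
    theorem it is constant along segments. *)
Lemma height_const t i y z : T t i = None -> simplex R 3 y -> y 0 i = 0 -> simplex R 3 z -> z 0 i = 0 ->
  height t y = height t z.
Proof.
move=> E Sy yi Sz zi; pose p r : V := y + r *: (z - y).
have pE r j : p r 0 j = (1 - r) * y 0 j + r * z 0 j by rewrite !mxE; ring.
have Sp r : 0 <= r <= 1 -> simplex R 3 (p r) /\ p r 0 i = 0.
  move=> /andP[r0 r1]; split; last by rewrite pE yi zi !mulr0 addr0.
  have [y0 y1] := Sy; have [z0 z1] := Sz; split=> [j|].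
    by rewrite pE; apply: addr_ge0; apply: mulr_ge0; rewrite ?subr_ge0.
  by under eq_bigr do rewrite pE; rewrite big_split /= -!mulr_sumr y1 z1; ring.
have cp : continuous (fun r => height t (p r)).
  move=> r; apply: (@continuous_comp _ _ _ p (height t)); last exact: height_continuous.
  apply: continuous_coordP => j r'; rewrite (_ : (fun _ => _) = fun r => (1 - r) * y 0 j + r * z 0 j); last by apply/funext.
  apply: continuous_addr; apply: continuous_mulr; try exact: continuous_const; try by move=> ?; exact: cvg_id.
  by apply: continuous_subr; [exact: continuous_const | move=> ?; exact: cvg_id].
have e0 : p 0 = y by rewrite /p scale0r addr0.
have e1 : p 1 = z by rewrite /p scale1r addrC subrK.
have mid (c : R) : 0 <= c <= 1 -> height t (p c) = (a + b) / 2 -> False.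
  move=> /Sp[S1 S2] H; have [] := height_facet E S1 S2; rewrite H => H'; move: ab; lra.
have ivt := @IVT R (fun r => height t (p r)) 0 1 ((a + b) / 2) ler01 (continuous_subspaceT cp).
have [Hy|Hy] := height_facet E Sy yi; have [Hz|Hz] := height_facet E Sz zi; rewrite Hy Hz //.
  have [|c] := ivt; first by rewrite /= e0 e1 Hy Hz ge_min le_max; apply/andP; split; apply/orP; move: ab => ?; [left|right]; lra.
  by rewrite in_itv /= => c01 /(mid _ c01).
have [|c] := ivt; first by rewrite /= e0 e1 Hy Hz ge_min le_max; apply/andP; split; apply/orP; move: ab => ?; [right|left]; lra.
by rewrite in_itv /= => c01 /(mid _ c01).
Qed.

(** The only facet through such a point is unpaired, so no gluing starts or ends there. *)
Lemma facet_interior t i (x z : simplices R 3 n) : T t i = None -> tag x = t ->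
  (forall j, j != i -> bary x 0 j != 0) -> glue_rel T x z -> z = x.
Proof.
move=> E tx x0 /glue_relP xz.
have G u v : glued T u v -> u = x -> False.
  move=> [i' [s [E' b0 _]]] ux; move: E' b0; rewrite ux tx => E' b0.
  have [ei|ne] := eqVneq i' i; first by rewrite ei E in E'.
  by have := x0 _ ne; rewrite b0 eqxx.
suff H u v : clos_refl_sym_trans _ (glued T) u v -> (u = x <-> v = x) by apply/(H _ _ xz).
elim=> {u v} [u v uv|u|u v _ IH|u v w _ IH1 _ IH2].
- by split=> ux; [case: (G _ _ uv ux) | case: (G _ _ (glued_sym uv) ux)].
- by [].
- by split=> ?; apply/IH.
- by split=> H; [apply/IH2/IH1 | apply/IH1/IH2].
Qed.

Section Level.
Variable c : R.
Hypothesis cE : c = a \/ c = b.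

Definition lower t (j : 'I_4) : bool := height t (delta R 4 (val j)) != c.
Definition level_facet (p : 'I_n * 'I_4) : bool := (T p.1 p.2 == None) && [forall j, (j != p.2) ==> ~~ lower p.1 j].
Definition facet_pt (i : 'I_4) : set V := [set y | simplex R 3 y /\ y 0 i = 0].

Lemma facet_delta (i j : 'I_4) : j != i -> facet_pt i (delta R 4 (val j)).
Proof. by move=> ji; split; [exact: delta_simplex | rewrite mxE val_eqE eq_sym (negbTE ji)]. Qed.

Lemma level_facetE p y : level_facet p -> facet_pt p.2 y -> height p.1 y = c.
Proof.
move=> /andP[/eqP E /forallP H] [Sy yi].
have [j ji] : exists j, j != p.2 by exists (lift p.2 o0); rewrite eq_sym neq_lift.
have [S1 S2] := facet_delta ji; rewrite (height_const E Sy yi S1 S2).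
by have := H j; rewrite ji /lower negbK => /eqP.
Qed.

Lemma lower_glue t i t' s j : T t i = Some (t', s) -> j != i -> lower t' (s j) = lower t j.
Proof.
move=> E ji; have [S1 S2] := facet_delta ji.
by rewrite /lower {2}/height (cpt_glue E S1 S2) perm_row_delta.
Qed.

Lemma lower_mono t i j k : T t i = None -> j != i -> k != i -> lower t j = lower t k.
Proof.
move=> E ji ki; have [S1 S2] := facet_delta ji; have [S3 S4] := facet_delta ki.
by rewrite /lower (height_const E S1 S2 S3 S4).
Qed.

Lemma level_facet_cover x : exists p y, [/\ level_facet p, facet_pt p.2 y & P p.1 y = x].
Proof.
have c_itv : a <= c <= b by move: ab; case: cE => -> ?; apply/andP; split; lra.
pose z : M := (x, SigSub (itv_in c_itv)).
have : manifold_boundary R 3 M z by rewrite (cylinder_boundary ab manF) /=.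
rewrite -hB => -[u [i [E ui]] uz].
have Sb := bary_simplex u; have uE : cpt (tag u) (bary u) = z by rewrite /cpt point_of_bary.
exists (tag u, i), (bary u); split=> //=; last by rewrite uE.
rewrite /level_facet /= E eqxx /=; apply/forallP => j; apply/implyP => ji; rewrite /lower negbK.
have [S1 S2] := facet_delta ji; rewrite (height_const E S1 S2 Sb ui).
by rewrite /height uE.
Qed.

(** The end at height c is a copy of [F] covered by the level facets. Compatible maps on them
    descend to [F], continuously because the facets are compact and [F] is Hausdorff. *)
Lemma level_descent (vf : 'I_n * 'I_4 -> V -> V) : (forall p, continuous (vf p)) ->
  (forall p p' y y', level_facet p -> level_facet p' -> facet_pt p.2 y -> facet_pt p'.2 y' ->
     P p.1 y = P p'.1 y' -> vf p y = vf p' y') ->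
  exists Y : F -> V, continuous Y /\ forall p y, level_facet p -> facet_pt p.2 y -> Y (P p.1 y) = vf p y.
Proof.
move=> cvf compat.
have /choice[ch Hch] : forall x, exists q : ('I_n * 'I_4) * V, [/\ level_facet q.1, facet_pt q.1.2 q.2 & P q.1.1 q.2 = x].
  by move=> x; have [p [y H]] := level_facet_cover x; exists (p, y).
pose Y x := vf (ch x).1 (ch x).2; exists Y; have YE p y : level_facet p -> facet_pt p.2 y -> Y (P p.1 y) = vf p y.
  by move=> lp fy; have [H1 H2 H3] := Hch (P p.1 y); apply: compat.
split=> //; apply/continuous_closedP => D cD.
have -> : Y @^-1` D = \bigcup_(p in [set p | level_facet p])
    [set P p.1 y | y in simplex R 3 `&` ([set y : V | y 0 p.2 = 0] `&` (fun y : V => vf p y) @^-1` D)].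
  apply/seteqP; split=> x.
    move=> Dx; have [H1 [H2 H2'] H3] := Hch x; exists (ch x).1 => //; exists (ch x).2 => //.
  by move=> [p lp [y [Sy [yi Dy]] <-]]; rewrite /preimage /= YE.
apply: closed_bigcup; first exact: finite_finset.
move=> p _; apply: compact_image_closed.
- by have [[]] := hF.
- exact: P_continuous.
- exact: simplex_compact.
apply: closedI; last by apply: (closed_preim (cvf p)).
by apply: (closed_preim (@continuous_coord R 4 p.2) (D := [set 0])); exact: closed_eq.
Qed.

Variables (t0 : 'I_n) (i0 : 'I_4).
Hypothesis f0 : level_facet (t0, i0).

Local Notation x0 := (lift i0 o0).
Local Notation x1 := (lift i0 o1).
Local Notation x2 := (lift i0 o2).
Definition mu (y : V) : R := Num.min (y 0 x0) (Num.min (y 0 x1) (y 0 x2)).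
(* The bump of height mu sits over the interior of the marked facet; fourth coordinate 1/18 is half the
   value of [mu y * y_k] at the barycentre of the facet. *)
Definition bump_row (u v w : R) : V := \row_j nth 18%:R^-1 [:: u; v; w] (val j).
Definition bump (y : V) : V := bump_row (mu y * y 0 x0) (mu y * y 0 x1) (mu y * y 0 x2).
Definition flat : V := bump_row 0 0 0.

Lemma mu_continuous : continuous mu.
Proof. by do ![apply: continuous_minr; first exact: continuous_coord]; exact: continuous_coord. Qed.

Lemma bump_continuous : continuous bump.
Proof.
apply: continuous_coordP => j y; rewrite (_ : (fun _ => _) = fun y => nth 18%:R^-1 [:: mu y * y 0 x0; mu y * y 0 x1; mu y * y 0 x2] (val j)); last first.
  by apply/funext => z; rewrite mxE.
by move: j y; apply: I4P => /=; try exact: continuous_const;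
  apply: continuous_mulr; try exact: mu_continuous; exact: continuous_coord.
Qed.

Lemma lift_cases (j : 'I_4) : j != i0 -> [\/ j = x0, j = x1 | j = x2].
Proof.
move=> ji; have [k ->] : exists k, j = lift i0 k by case: (unliftP i0 j) ji => [k -> _|->]; [exists k | rewrite eqxx].
by move: k; apply: I3P; [constructor 1 | constructor 2 | constructor 3].
Qed.

Lemma mu_gt0 y : simplex R 3 y -> 0 < mu y -> forall j, j != i0 -> y 0 j != 0.
Proof.
by move=> Sy; rewrite /mu !lt_min => /and3P[h0 h1 h2] j /lift_cases[] ->; rewrite gt_eqF.
Qed.

Lemma mu_eq0 y : simplex R 3 y -> ~~ (0 < mu y) -> bump y = flat.
Proof.
move=> [y0 _] H; suff mu0 : mu y = 0 by rewrite /bump mu0 !mul0r.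
by apply/eqP; rewrite eq_le leNgt H /= /mu !le_min !y0.
Qed.

Lemma level_eq p p' y y' : level_facet p -> level_facet p' -> facet_pt p.2 y -> facet_pt p'.2 y' ->
  P p.1 y = P p'.1 y' -> glue_rel T (point_of p.1 y) (point_of p'.1 y').
Proof.
move=> lp lp' fy fy' E; apply: cpt_eq; have := level_facetE lp fy; have := level_facetE lp' fy'.
rewrite /height; move: E; case: (cpt p.1 y) => u v; case: (cpt p'.1 y') => u' v' /= -> <- E.
by congr pair; apply: val_inj.
Qed.

(** Inner points of the marked facet are glued to nothing, and on its rim [mu] vanishes, where the
    bump equals [flat]. So the bump on this facet and [flat] on the others fit together. *)
Lemma marked_map : exists Y : F -> V, [/\ continuous Y,
  forall y, facet_pt i0 y -> Y (P t0 y) = bump y &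
  forall p y, level_facet p -> p != (t0, i0) -> facet_pt p.2 y -> Y (P p.1 y) = flat].
Proof.
pose vf p := if p == (t0, i0) then bump else fun=> flat.
have T0 : T t0 i0 = None by have /andP[/eqP] := f0.
have sing y p y' : facet_pt i0 y -> 0 < mu y -> level_facet p -> facet_pt p.2 y' ->
    P t0 y = P p.1 y' -> p = (t0, i0) /\ y' = y.
  move=> fy m0 lp fy' E; have Sy := fy.1; have Sy' := fy'.1.
  have GE := level_eq f0 lp fy fy' E; have := @facet_interior t0 i0 (point_of t0 y) _ T0 erefl _ GE.
  rewrite bary_point_of // => /(_ (mu_gt0 Sy m0)) Ep.
  have Et : p.1 = t0 by have := congr1 (@tag _ _) Ep.
  have Ey : y' = y by have := congr1 (@bary R 3 n) Ep; rewrite !bary_point_of.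
  split=> //; rewrite [p]surjective_pairing Et; congr pair; apply/eqP; apply: contraT => /(mu_gt0 Sy m0).
  by rewrite -Ey fy'.2 eqxx.
have key y p' y' : facet_pt i0 y -> level_facet p' -> facet_pt p'.2 y' -> P t0 y = P p'.1 y' -> bump y = vf p' y'.
  move=> fy lp' fy' E; have [m0|m0] := boolP (0 < mu y).
    by have [-> ->] := sing _ _ _ fy m0 lp' fy' E; rewrite /vf eqxx.
  rewrite (mu_eq0 fy.1 m0) /vf; case: eqP => // p0'; rewrite p0' /= in fy' E.
  have [m1|m1] := boolP (0 < mu y'); last by rewrite (mu_eq0 fy'.1 m1).
  have [_ yy] := sing _ (t0, i0) _ fy' m1 f0 fy (esym E); by rewrite -yy (mu_eq0 fy.1 m0).
have [] := @level_descent vf.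
- by move=> p; rewrite /vf; case: eqP => _; [exact: bump_continuous | exact: continuous_const].
- move=> p p' y y' lp lp' fy fy' E; have [p00|np] := eqVneq p (t0, i0).
    by rewrite p00 {1}/vf eqxx; apply: key => //; move: fy E; rewrite p00.
  have [p00|np'] := eqVneq p' (t0, i0).
    rewrite p00 in fy' E; rewrite p00 [RHS]/vf eqxx; apply/esym; exact: key.
  by rewrite /vf (negbTE np) (negbTE np').
move=> Y [cY YE]; exists Y; split=> // [y fy|p y lp np fy].
  by rewrite (YE (t0, i0)) // /vf eqxx.
by rewrite YE // /vf (negbTE np).
Qed.

Definition emb (w : 'rV[R]_3) : V := \row_j (if unlift i0 j is Some k then w 0 k else 0).

Lemma embD x y : emb (x + y) = emb x + emb y.
Proof. by apply/rowP => j; rewrite !mxE; case: unlift => [k|]; rewrite ?mxE ?addr0. Qed.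
Lemma embZ r x : emb (r *: x) = r *: emb x.
Proof. by apply/rowP => j; rewrite !mxE; case: unlift => [k|]; rewrite ?mxE ?mulr0. Qed.
Lemma emb_lift w k : emb w 0 (lift i0 k) = w 0 k.
Proof. by rewrite mxE liftK. Qed.
Lemma emb_facet w : simplex R 2 w -> facet_pt i0 (emb w).
Proof.
move=> [w0 w1]; split; last by rewrite mxE unlift_none.
split=> [j|]; first by rewrite mxE; case: unlift.
rewrite (bigD1_ord i0) //= mxE unlift_none add0r -w1; apply: eq_bigr => k _; exact: emb_lift.
Qed.
Lemma emb_corners : corners R (others i0) = map emb (map (delta R 3) (iota 0 3)).
Proof.
have E (k : 'I_3) : emb (delta R 3 (val k)) = delta R 4 (val (lift i0 k)).
  apply/rowP => j; rewrite !mxE; case: (unliftP i0 j) => [k' ->|->]; first by rewrite mxE !val_eqE (inj_eq lift_inj).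
  by rewrite val_eqE (negbTE (neq_lift i0 k)).
rewrite -[iota 0 3]/([:: val o0; val o1; val o2]) /= -[0%N]/(val o0) -[1%N]/(val o1) -[2%N]/(val o2) !E.
by move: (i0); apply: I4P.
Qed.

Lemma bump_emb w : ((bump (emb w) 0 p0 = mu (emb w) * w 0 o0) * (bump (emb w) 0 p1 = mu (emb w) * w 0 o1)) *
  ((bump (emb w) 0 p2 = mu (emb w) * w 0 o2) * (bump (emb w) 0 p3 = 18%:R^-1)).
Proof. by rewrite -!(emb_lift w) !mxE. Qed.

(** Replacing label 3 by the largest barycentric coordinate turns [lp] into a Sperner labelling. A
    small simplex with all three labels of the latter lies near the barycentre, where the first
    three coordinates of the bump are far above 1/18 and label 3 is excluded. So both labellings
    have the same rainbow simplices. *)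
Lemma marked_label (lp : 'rV[R]_3 -> nat) :
  (forall w, simplex R 2 w -> (lp w <= 3)%N) ->
  (forall w j, simplex R 2 w -> bump (emb w) 0 j <= nth 18%:R^-1 [:: bump (emb w) 0 p0; bump (emb w) 0 p1; bump (emb w) 0 p2] (lp w) + 1000%:R^-1) ->
  forall m, (forall s u : seq 'rV[R]_3, diam_le 1 s -> (size s <= 4)%N -> subd m s u -> diam_le 100%:R^-1 u) ->
  iter m (@sd R 3) (rainbow lp 3) (map (delta R 3) (iota 0 3)) = true.
Proof.
move=> lp3 lpE m mesh.
have muE (w : 'rV[R]_3) : simplex R 2 w -> [/\ mu (emb w) <= w 0 o0, mu (emb w) <= w 0 o1, mu (emb w) <= w 0 o2 & 0 <= mu (emb w)].
  move=> [w0 _]; rewrite /mu !emb_lift; split; rewrite ?le_min ?w0 //.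
  - exact: ge_min_id || by rewrite ge_min lexx.
  - by rewrite ge_min ge_min lexx orbT.
  - by rewrite ge_min ge_min lexx !orbT.
have muG (w : 'rV[R]_3) (r : R) : r <= w 0 o0 -> r <= w 0 o1 -> r <= w 0 o2 -> r <= mu (emb w).
  by move=> *; rewrite /mu !emb_lift !le_min; apply/and3P.
pose am (w : 'rV[R]_3) : nat := if (w 0 o1 <= w 0 o0) && (w 0 o2 <= w 0 o0) then 0%N
   else if w 0 o2 <= w 0 o1 then 1%N else 2%N.
(* Label 3 marks the points where the constant coordinate 1/18 wins; there [am] decides. *)
pose l' (w : 'rV[R]_3) := if lp w == 3%N then am w else lp w.
have sumw (w : 'rV[R]_3) : simplex R 2 w -> w 0 o0 + w 0 o1 + w 0 o2 = 1 by move=> [_]; rewrite sum3.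
have near (w : 'rV[R]_3) (j k : 'I_3) : simplex R 2 w -> l' w = val j -> w 0 k <= w 0 j + 50%:R^-1.
  move=> Sw; have [m0 m1 m2 mp] := muE w Sw; have s1 := sumw w Sw; have [w0 _] := Sw.
  have g0 := w0 o0; have g1 := w0 o1; have g2 := w0 o2.
  rewrite /l'; case: eqP => [_|n3].
    rewrite /am; case: ifP => [/andP[h0 h1]|/negbT].
      by move: j; apply: I3P => //= _; move: k; apply: I3P; lra.
    rewrite negb_and -!ltNge => h0; case: ifP => [h1|/negbT]; rewrite -?ltNge.
      by move: j; apply: I3P => //= _; move: k; apply: I3P; case/orP: h0 => ?; lra.
    by move=> h1; move: j; apply: I3P => //= _; move: k; apply: I3P; case/orP: h0 => ?; lra.
  move=> Ej; have H q := lpE w q Sw; move: H; rewrite Ej => H.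
  (* Here r is [mu]. A label that beats 1/18 up to 1/1000 forces r >= 54/1000, and dividing the
     error 1/1000 by this r gives at most 1/50. *)
  have num (r u v : R) : 0 <= r -> 0 <= u -> u <= 1 -> r * v <= r * u + 1000%:R^-1 -> 18%:R^-1 <= r * u + 1000%:R^-1 -> v <= u + 50%:R^-1.
    move=> r0 u0 u1 H1 H2; rewrite leNgt; apply/negP => H3.
    have : 0 <= r * (1 - u) by apply: mulr_ge0; lra.
    have : 0 <= (r - 54 / 1000) * (v - u) by apply: mulr_ge0; [nra | lra].
    nra.
  have u0 : w 0 o0 <= 1 by lra.
  have u1 : w 0 o1 <= 1 by lra.
  have u2 : w 0 o2 <= 1 by lra.
  have H3 := H p3; have H0 := H p0; have H1 := H p1; have H2 := H p2; move: H0 H1 H2 H3.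
  rewrite !bump_emb; move: m0 m1 m2 mp s1 g0 g1 g2; move: (mu (emb w)) => r m0 m1 m2 mp s1 g0 g1 g2.
  clear H; move: j Ej; apply: I3P; move: k; apply: I3P => /= _ H0 H1 H2 H3;
    first [by rewrite lerDl invr_ge0 ler0n | by apply: (num r) => //].
have l'3 (w : 'rV[R]_3) : simplex R 2 w -> (l' w < 3)%N.
  move=> Sw; rewrite /l' /am; case: eqP => [_|n3]; first by case: ifP => // _; case: ifP.
  by have := lp3 w Sw; lia.
have S0 x : corner_face pred0 x -> simplex R 2 x by case=> ? ? _; split.
rewrite -[RHS](@sperner R 3 l' (fun x Hx => l'3 x (S0 x Hx)) _ m 3 (leqnn 3)); last first.
  move=> x i /S0 Sx E; have N k := near x i k Sx E; have := sumw x Sx.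
  have := N o0; have := N o1; have := N o2; move=> N2 N1 N0 s1; apply/eqP => xi; rewrite xi in N0 N1 N2; clear E; lra.
apply: iter_sd_eq => u Hu; have su : size u = 3%N by rewrite (size_subd Hu).
have Su x : x \in u -> simplex R 2 x.
  move=> xu; apply: S0; apply: (subd_closed (@corner_face_avg R 3 pred0) _ Hu) xu => y.
  by move=> /mapP[j]; rewrite mem_iota => /= jn ->; exact: delta_face.
have du : diam_le 100%:R^-1 u.
  apply: (mesh _ _ _ _ Hu) => //.
  move=> _ _ /mapP[j _ ->] /mapP[j' _ ->]; apply: rV_norm_le => // i; rewrite !mxE.
  by case: (_ == _); case: (_ == _); rewrite /= ?subrr ?subr0 ?sub0r ?normrN ?normr0 ?normr1; lra.
have E : (forall y, y \in u -> lp y != 3%N) -> map lp u = map l' u.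
  by move=> H; apply/eq_in_map => y yu; rewrite /l' (negbTE (H y yu)).
have mem (f : 'rV[R]_3 -> nat) : rainbow f 3 u -> forall i, (i < 3)%N = (i \in map f u).
  by move=> H i; rewrite (perm_mem H) mem_iota.
apply/idP/idP => H; rewrite /rainbow.
  rewrite -E // => y yu; have : lp y \in map lp u by exact: map_f.
  by rewrite -(mem _ H); apply: contraTneq => ->.
rewrite E // => y yu; apply/eqP => ly3; have Sy := Su y yu.
(* 1/50 from [near], and the mesh 1/100 once for each of the two coordinates. *)
have close (j k : 'I_3) : y 0 k <= y 0 j + 4 / 100.
  have := mem _ H (val j); rewrite ltn_ord => /esym/mapP[x xu /esym Ex].
  have := near x j k (Su x xu) Ex; have dxy := du _ _ xu yu.
  have := le_trans (coord_norm (x - y) j) dxy; have := le_trans (coord_norm (x - y) k) dxy; rewrite !mxE !ler_norml.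
  by move=> /andP[? ?] /andP[? ?] ?; lra.
have := sumw y Sy; have := close o0 o1; have := close o0 o2; have := close o1 o0; have := close o2 o0.
have := close o1 o2; have := close o2 o1 => c1 c2 c3 c4 c5 c6 s1.
have y0 : 3 / 10 <= y 0 o0 by lra.
have y1 : 3 / 10 <= y 0 o1 by lra.
have y2 : 3 / 10 <= y 0 o2 by lra.
have m3 := muG y _ y0 y1 y2; have := lpE y p0 Sy; rewrite ly3 /= bump_emb.
have : 0 <= (mu (emb y) - 3 / 10) * (y 0 o0 - 3 / 10) by apply: mulr_ge0; lra.
nra.
Qed.

(** The bump over a single facet makes the degree count visible: the marked facet contributes an odd
    number by [marked_label], and every other facet of the end carries only label 3. This is the
    hypothesis [base_odd] of the two counts. *)
Lemma level_bounds : (2 * g <= #|[set t | ntrue lower t == 2]%SET|)%N /\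
  (2 * (2 * g) <= #|[set t | ntrue lower t == 1]%SET| + 2)%N.
Proof.
have [Y [cY Ym Yf]] := marked_map.
have e0 : 0 < 1000%:R^-1 :> R by rewrite invr_gt0 ltr0n.
have [W [lam [ell [G [vt [U [bb [Yell starF U_add UE eta_ex]]]]]]]] := cover_data g_gt0 hF cY e0.
pose Q t x del := exists phi, forall y : V, `|x - y| <= del -> exists k, lam (P t y) = vt phi k.
have near_t t : \forall del \near (0 : R)^'+, forall x, simplex R 3 x -> Q t x del.
  have /compact_near_coveringP/(_ R (0 : R)^'+ (fun del x => Q t x del)) := @simplex_compact R 3.
  case.
    move=> x Sx; have [phi Hphi] := starF (P t x).
    have /nbhs_ballP[r /= r0 Hr] := P_continuous Hphi.
    exists (ball x (r / 2), [set del | del < r / 2]) => /=.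
      by split; [apply: nbhsx_ballx; lra | apply: nbhs_right_lt; lra].
    move=> [y del] /= [xy dr]; exists phi => z yz; apply: Hr.
    move: xy; rewrite -!ball_normE /= => xy.
    rewrite (_ : x - z = (x - y) + (y - z)); last by rewrite addrA subrK.
    apply: le_lt_trans (ler_normD _ _) _; lra.
  by move=> r /= r0 H; exists r => //.
have [del [Hdel d0 d1]] : exists del : R, [/\ forall t x, simplex R 3 x -> Q t x del, 0 < del & del <= 100%:R^-1].
  have n1 : \forall del \near (0 : R)^'+, forall t x, simplex R 3 x -> Q t x del by apply: filter_forall => t.
  have n2 : \forall del \near (0 : R)^'+, 0 < del by exact: nbhs_right_gt.
  have n3 : \forall del \near (0 : R)^'+, del <= 100%:R^-1 by apply: nbhs_right_le; rewrite invr_gt0 ltr0n.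
  have [del [[H1 H2] H3]] := filter_ex (filterI (filterI n1 n2) n3).
  by exists del.
have [M1 HM1] := @subd_small R 4 1 3 del (ler01) d0.
have [M2 HM2] := @subd_small R 3 1 3 del (ler01) d0.
pose m := maxn M1 M2.
have mesh (s u : seq V) : diam_le 1 s -> (size s <= 4)%N -> subd m s u -> diam_le del u.
  by apply: HM1; exact: leq_maxl.
have mesh3 (s u : seq 'rV[R]_3) : diam_le 1 s -> (size s <= 4)%N -> subd m s u -> diam_le 100%:R^-1 u.
  move=> ds s4 Hu x y xu yu; apply: le_trans d1; apply: (HM2 m s u) => //; exact: leq_maxr.
have glP t i t' s y : T t i = Some (t', s) -> simplex R 3 y -> y 0 i = 0 -> P t y = P t' (perm_row s y).
  by move=> E Sy yi; rewrite /= (cpt_glue E).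
have base_odd : \big[addb/false]_(p : 'I_n * 'I_4 | (T p.1 p.2 == None) && [forall j, (j != p.2) ==> ~~ lower p.1 j])
   iter m (@sd R 4) (th P lam ell p.1) (corners R (others p.2)) = true.
  rewrite (bigD1 (t0, i0)) //= big1 => [|p /andP[lp np]].
    rewrite addbF emb_corners -(iter_sd_map embD embZ).
    rewrite (iter_sd_eq (g := rainbow (fun w => val (ell (lam (P t0 (emb w))))) 3)); last first.
      by move=> u _; rewrite /th /rainbow -map_comp.
    apply: (@marked_label _ _ _ m mesh3) => [w _|w j Sw]; first by rewrite -ltnS ltn_ord.
    have := Yell (P t0 (emb w)) j; rewrite Ym; last exact: emb_facet.
    move/le_trans; apply; rewrite lerD2r; move: (ell _); apply: I4P => //=.
    by rewrite mxE.
  rewrite -[RHS](iter_sd_false m (corners R (others p.2))); apply: iter_sd_eq => u Hu.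
  have su : size u = 3%N by rewrite (size_subd Hu) size_map; move: (p.2); apply: I4P.
  have Su x : x \in u -> corner_face (pred1 (val p.2)) x.
    move=> xu; apply: (subd_closed (@corner_face_avg R 4 _) _ Hu) xu => y.
    by apply: in_corners => j; rewrite mem_filter => /andP[].
  case: u Hu su Su => // x u _ _ Su; have Sx := Su x (mem_head _ _).
  have fx : facet_pt p.2 x by split; [exact: corner_simplex Sx | have [_ _] := Sx; apply => /=].
  have : ell (lam (P p.1 x)) = p3.
    have := Yell (P p.1 x) p3; rewrite (Yf _ _ lp np fx) /flat /bump_row.
    by move: (ell _); apply: I4P => //; rewrite !mxE /= => H; exfalso; move: H; apply/negP; rewrite -ltNge; lra.
  move=> E3; apply/negbTE/negP => /perm_mem/(_ 3%N); rewrite mem_iota /= in_cons.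
  by rewrite E3.
split.
- exact: (quads_bound glP U_add UE eta_ex Hdel mesh lower_glue lower_mono base_odd).
exact: (tops_bound glP U_add UE eta_ex Hdel mesh lower_glue lower_mono base_odd).
Qed.

End Level.

Lemma marked_facet c : c = a \/ c = b -> exists t i, level_facet c (t, i).
Proof.
move=> cE; have [[[x _] _ _ _ _] _] := hF.
by have [[t i] [y [H _ _]]] := level_facet_cover cE x; exists t, i.
Qed.

(** No vertex lies on both ends, so a tetrahedron with three vertices on the end b has at most one
    on a, and the three families are disjoint. *)
Lemma tetrahedra_bound : (10 * g - 4 <= n)%N.
Proof.
have aE : a = a \/ a = b by left.
have bE : b = a \/ b = b by right.
have [t [i fa]] := marked_facet aE; have [A2 A1] := level_bounds aE fa.
have [t' [i' fb]] := marked_facet bE; have [_ B1] := level_bounds bE fb.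
set SA2 := [set _ | _]%SET in A2; set SA1 := [set _ | _]%SET in A1; set SB1 := [set _ | _]%SET in B1.
have nt c u : ntrue (lower c) u = (lower c u p0 + (lower c u p1 + (lower c u p2 + lower c u p3)))%N by exact: ntrueE.
have ab_lower u j : lower a u j || lower b u j.
  by rewrite /lower -negb_and; apply/negP => /andP[/eqP -> /eqP E]; move: ab; rewrite E ltxx.
have d1 : SA2 :&: SA1 = finset.set0 by apply/setP => u; rewrite !inE; case: eqP => // ->.
have d2 : (SA2 :|: SA1) :&: SB1 = finset.set0.
  apply/setP => u; rewrite !inE !nt; have := ab_lower u p0; have := ab_lower u p1; have := ab_lower u p2; have := ab_lower u p3.
  by do 8!case: (lower _ u _).
have := max_card (mem ((SA2 :|: SA1) :|: SB1)); rewrite card_ord !cardsU d2 d1 !cards0; lia.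
Qed.
End LowerBound.

Theorem cylinder_lower_bound (R : realType) (F : topologicalType) (g : nat) (a b : R) :
  (0 < g)%N -> closed_orientable_surface R g F -> a < b ->
  forall (n : nat) (T : face_pairing 3 n), triangulates R T (F * set_type `[a, b])%type -> (10 * g - 4 <= n)%N.
Proof.
move=> g0 hF ab n T [_ [h [hh hB]]]; exact: (tetrahedra_bound g0 hF ab hh hB).
Qed.

(** * The upper bound *)

Section Polygon.
Variables (R : realType) (F : topologicalType) (G : finType) (tau : 'I_3 -> G -> G) (sg : G -> bool).
Variables (q : G -> 'rV[R]_3 -> F) (a0 : G) (L : nat).
Hypothesis tauK : forall i, involutive (tau i).
Hypothesis sgt : forall i a, sg (tau i a) = ~~ sg a.
Hypothesis gq : gempres tau q.
Hypothesis L_gt0 : (0 < L)%N.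
Hypothesis one_face : forall a, reach tau (fun i => i != o2) a0 a.
Hypothesis card_start : #|[pred x | sg x == sg a0]| = L.+2.

Definition start a := sg a == sg a0.
(** The next side around the face. Flags with the orientation of [a0] sit at the start of their
    side, and [side_of] numbers the sides in this order from [a0]. *)
Definition rho a := tau o1 (tau o0 a).
Definition side_flag j := iter j rho a0.
Definition side_of a := findex rho a0 (if start a then a else tau o0 a).

Let rho_inj : injective rho.
Proof. by move=> x y E; apply: (inv_inj (tauK o0)); exact: (inv_inj (tauK o1) E). Qed.

Lemma start_tau i a : start (tau i a) = ~~ start a.
Proof. by rewrite /start sgt; case: (sg a); case: (sg a0). Qed.

Lemma start_side_flag j : start (side_flag j).
Proof. by elim: j => [|j IH]; rewrite /side_flag /start //= !sgt negbK. Qed.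

Let all_flags a : exists j, (j < fingraph.order rho a0)%N /\ (a = side_flag j \/ a = tau o0 (side_flag j)).
Proof.
have og := fingraph.order_gt0 rho a0.
apply: (reach_ind (P := fun a => exists j, (j < fingraph.order rho a0)%N /\ (a = side_flag j \/ a = tau o0 (side_flag j)))) (one_face a) _; last by exists 0%N; split=> //; left.
move=> i c i2 [j [jn Hc]]; have [->|->] : i = o0 \/ i = o1 by move: i i2; apply: I3P => // _; [left|right].
  by exists j; split=> //; case: Hc => ->; [right | left; rewrite tauK].
case: Hc => ->.
  case: j jn => [|j] jn.
    exists (fingraph.order rho a0).-1; split; first by rewrite ltn_predL.
    right; rewrite -[side_flag 0](iter_order rho_inj) -{1}(prednK og) /= /rho tauK //.
  by exists j; split; [exact: ltnW | right; rewrite /side_flag /= /rho tauK].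
have [jn'|jn'] := ltnP j.+1 (fingraph.order rho a0); first by exists j.+1; split=> //; left.
exists 0%N; split=> //; left; rewrite -[RHS](iter_order rho_inj).
by have -> : fingraph.order rho a0 = j.+1 by apply/eqP; rewrite eqn_leq jn jn'.
Qed.

Let start_conn a : start a = fconnect rho a0 a.
Proof.
apply/idP/idP => [sa|/iter_findex <-]; last exact: start_side_flag.
have [j [_ [->|E]]] := all_flags a; first exact: fconnect_iter.
by move: sa; rewrite E start_tau start_side_flag.
Qed.

Let order_rho : fingraph.order rho a0 = L.+2.
Proof. by rewrite -card_start; apply: eq_card => a; rewrite !inE -start_conn. Qed.

Let start_of a : start (if start a then a else tau o0 a).
Proof. by case: ifP => //; rewrite start_tau => ->. Qed.

Lemma side_of_lt a : (side_of a < L.+2)%N.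
Proof. by rewrite -order_rho; apply: findex_max; rewrite -start_conn. Qed.

Lemma side_flag_of a : side_flag (side_of a) = if start a then a else tau o0 a.
Proof. by apply: iter_findex; rewrite -start_conn. Qed.

Lemma side_of_flag j : (j < L.+2)%N -> side_of (side_flag j) = j.
Proof. by move=> jL; rewrite /side_of start_side_flag findex_iter // order_rho. Qed.

Lemma side_of_tau0 a : side_of (tau o0 a) = side_of a.
Proof. by rewrite /side_of start_tau tauK; case: (start a). Qed.

Lemma side_flag_last : side_flag L.+2 = a0.
Proof. by rewrite /side_flag -order_rho; exact: (iter_order rho_inj). Qed.

Local Notation V3 := 'rV[R]_3.
Local Notation l := (L%:R : R).

Let l_gt0 : 0 < l. Proof. by rewrite ltr0n. Qed.
Let l_neq0 : l != 0. Proof. by rewrite gt_eqF. Qed.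

Local Ltac fld := field; rewrite ?l_neq0 //.

Definition ctr : V3 := row3 3%:R^-1 3%:R^-1 3%:R^-1.

(* The polygon is drawn as a triangle: its first corner is a vertex, and the others are equally
   spaced along the opposite edge. *)
Definition pos (k : nat) : V3 := if (k == 0)%N || (k == L.+2) then row3 1 0 0
  else row3 0 ((l + 1 - k%:R) / l) ((k%:R - 1) / l).

Definition sp j (u v : R) : V3 := u *: pos j + v *: pos j.+1.

Lemma sp_first u v : sp 0 u v = row3 u v 0.
Proof.
by rewrite /sp /pos /=; apply: row3P; rewrite !mxE /=; fld.
Qed.

Lemma sp_last u v : sp L.+1 u v = row3 v 0 u.
Proof.
rewrite /sp /pos /= eqxx (_ : (L.+1 == L.+2)%N = false); last by apply/negbTE; lia.
by apply: row3P; rewrite !mxE /= -?natr1; fld.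
Qed.

Lemma sp_mid j u v : (0 < j <= L)%N ->
  sp j u v = row3 0 ((u * (l + 1 - j%:R) + v * (l - j%:R)) / l) ((u * (j%:R - 1) + v * j%:R) / l).
Proof.
move=> /andP[j0 jL]; rewrite /sp /pos; have -> : (j == 0)%N = false by lia.
have -> : (j == L.+2)%N = false by lia.
have -> : (j.+1 == L.+2)%N = false by lia.
by apply: row3P; rewrite !mxE /= -?natr1; fld.
Qed.

Lemma side_cases j : (j < L.+2)%N -> [\/ j = 0%N, j = L.+1 | (0 < j <= L)%N].
Proof.
move=> jL; have [->|j0] := eqVneq j 0%N; first by constructor 1.
by have [->|j1] := eqVneq j L.+1; [constructor 2 | constructor 3; lia].
Qed.

Let row3_inj (x y z x' y' z' : R) : row3 x y z = row3 x' y' z' -> [/\ x = x', y = y' & z = z'].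
Proof.
move=> E; have H i := congr1 (fun m : V3 => m 0 i) E.
by have := H o0; have := H o1; have := H o2; rewrite !row3E.
Qed.

Definition next j j' := (j' == if j == L.+1 then 0 else j.+1)%N.

Let sp_inj_lt j j' u v u' v' : (j < j' < L.+2)%N -> 0 <= u -> 0 <= v -> 0 <= u' -> 0 <= v' ->
  sp j u v = sp j' u' v' ->
  [\/ [/\ u = 0, v = 0, u' = 0 & v' = 0], [/\ u = 0, v' = 0, v = u' & next j j'] |
     [/\ u' = 0, v = 0, v' = u & next j' j]].
Proof.
move=> /andP[jj jL] u0 v0 u0' v0'.
have divI (x y : R) : x / l = y / l -> x = y by move=> /(mulIf (invr_neq0 l_neq0)).
have eq0 (x y : R) : 0 <= x -> 0 <= y -> x + y = 0 -> x = 0 /\ y = 0 by move=> *; split; lra.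
have posn k : (0 < k)%N -> 1 <= k%:R :> R by move=> k0; rewrite ler1n.
have [j0|j1|jm] := side_cases (ltn_trans jj jL); last 2 first.
- lia.
- have [?|j1'|jm'] := side_cases jL; first lia.
    rewrite j1' sp_mid // sp_last => /row3_inj[<- E1 E2].
    have [k1 kL] : 1 <= j%:R :> R /\ j%:R <= l by case/andP: jm => *; rewrite ler1n ler_nat.
    have /eqP := E1; rewrite mulf_eq0 invr_eq0 (negbTE l_neq0) orbF => /eqP E1'.
    have [||E3 E4] := eq0 _ _ _ _ E1'; try by apply: mulr_ge0; lra.
    have u00 : u = 0 by apply/eqP; move/eqP: E3; rewrite mulf_eq0 => /orP[//|/eqP ?]; lra.
    move/eqP: E4; rewrite mulf_eq0 => /orP[/eqP v00|/eqP jl].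
      by constructor 1; rewrite -E2 u00 v00 !mul0r addr0 mul0r.
    have jE : j = L by apply/eqP; rewrite -(eqr_nat R); apply/eqP; lra.
    constructor 2; rewrite /next jE; split=> //; last by rewrite ifN //; lia.
    by rewrite -E2 u00 jE mul0r add0r mulfK.
  rewrite !sp_mid // => /row3_inj[_ /divI E1 /divI E2].
  have dj : 1 <= j'%:R - j%:R :> R by rewrite -natrB ?ler1n; lia.
  have E3 : u + v = u' + v'.
    have : l * (u + v) = l * (u' + v') by nra.
    by move/(mulfI l_neq0).
  have E4 : (j'%:R - j%:R - 1) * (u + v) + (u + v') = 0 by nra.
  have [||H1 H2] := eq0 _ _ _ _ E4; try by [apply: mulr_ge0; lra | lra].
  have [||uz vz] := eq0 _ _ _ _ H2 => //.
  move/eqP: H1; rewrite mulf_eq0 => /orP[/eqP jd|/eqP uv0]; last by constructor 1; split; lra.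
  constructor 2; split=> //; first by lra.
  have /eqP : (j' = j.+1) by apply/eqP; rewrite -(eqr_nat R) -natr1; apply/eqP; lra.
  by rewrite /next ifN //; lia.
subst j; rewrite sp_first; have [?|->|jm] := side_cases jL; first lia.
  by rewrite sp_last => /row3_inj[-> -> ->]; constructor 3; rewrite /next eqxx.
rewrite sp_mid // => /row3_inj[-> E1 E2]; case/andP: jm => j0 jL1; have k1 := posn _ j0.
have /eqP := E2; rewrite eq_sym mulf_eq0 invr_eq0 (negbTE l_neq0) orbF => /eqP E2'.
have [||E3 E4] := eq0 _ _ _ _ E2'; try by apply: mulr_ge0; lra.
have vz : v' = 0 by apply/eqP; move/eqP: E4; rewrite mulf_eq0 => /orP[//|/eqP ?]; lra.
move/eqP: E3; rewrite mulf_eq0 => /orP[/eqP uz|/eqP jz].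
  by constructor 1; rewrite E1 uz vz !mul0r addr0 mul0r.
have jE : j' = 1%N by apply/eqP; rewrite -(eqr_nat R); apply/eqP; lra.
by constructor 2; rewrite E1 vz jE /next; split=> //; fld.
Qed.

(** Apart from equal positions and zero weights, coincidences are the corners shared by two
    cyclically consecutive sides. *)
Lemma sp_inj j j' u v u' v' : (j < L.+2)%N -> (j' < L.+2)%N -> 0 <= u -> 0 <= v -> 0 <= u' -> 0 <= v' ->
  sp j u v = sp j' u' v' ->
  [\/ [/\ j = j', u = u' & v = v'], [/\ u = 0, v = 0, u' = 0 & v' = 0],
     [/\ u = 0, v' = 0, v = u' & next j j'] | [/\ u' = 0, v = 0, v' = u & next j' j]].
Proof.
move=> jL jL' u0 v0 u0' v0' E; have [lt|lt|eq] := ltngtP j j'.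
- have H : (j < j' < L.+2)%N by rewrite lt.
  by have [?|?|?] := sp_inj_lt H u0 v0 u0' v0' E; [constructor 2 | constructor 3 | constructor 4].
- have H : (j' < j < L.+2)%N by rewrite lt.
  by have [[? ? ? ?]|[? ? ? ?]|[? ? ? ?]] := sp_inj_lt H u0' v0' u0 v0 (esym E); [constructor 2 | constructor 4 | constructor 3].
subst j'; constructor 1; have divI (x y : R) : x / l = y / l -> x = y by move=> /(mulIf (invr_neq0 l_neq0)).
have [j0|j0|jm] := side_cases jL.
- by rewrite j0 !sp_first in E *; move/row3_inj: E => [-> -> _].
- by rewrite j0 !sp_last in E *; move/row3_inj: E => [-> _ ->].
rewrite !sp_mid // in E; move/row3_inj: E => [_ /divI E1 /divI E2].
have E3 : l * (u + v) = l * (u' + v') by nra.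
have /(mulfI l_neq0) E4 := E3; have E5 : (u + v) * j%:R = (u' + v') * j%:R by rewrite E4.
have uu : u = u' by lra.
by split=> //; lra.
Qed.

Lemma sp_ge0 j u v i : (j < L.+2)%N -> 0 <= u -> 0 <= v -> 0 <= sp j u v 0 i.
Proof.
move=> jL u0 v0; have [->|->|jm] := side_cases jL; rewrite ?sp_first ?sp_last ?sp_mid //; move: i; apply: I3P; rewrite row3E //;
  case/andP: jm => j0 jl; have k1 : 1 <= j%:R :> R by rewrite ler1n.
- have kl : j%:R <= l by rewrite ler_nat.
  by apply: divr_ge0; last exact: ltW; apply: addr_ge0; apply: mulr_ge0 => //; lra.
- by apply: divr_ge0; last exact: ltW; apply: addr_ge0; apply: mulr_ge0 => //; lra.
Qed.

Lemma sp_zero j u v : (j < L.+2)%N -> exists i, sp j u v 0 i = 0.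
Proof.
move=> jL; have [->|->|jm] := side_cases jL; rewrite ?sp_first ?sp_last ?sp_mid //.
- by exists o2; rewrite row3E.
- by exists o1; rewrite row3E.
- by exists o0; rewrite row3E.
Qed.

Lemma sp_sum j u v : (j < L.+2)%N -> sp j u v 0 o0 + sp j u v 0 o1 + sp j u v 0 o2 = u + v.
Proof.
move=> jL; have [->|->|jm] := side_cases jL; rewrite ?sp_first ?sp_last ?sp_mid // !row3E; try ring.
by fld.
Qed.

Lemma sp_cover x1 x2 : 0 <= x1 -> 0 <= x2 -> exists j u v,
  [/\ (0 < j <= L)%N, 0 <= u, 0 <= v, u + v = x1 + x2 & sp j u v = row3 0 x1 x2].
Proof.
move=> h1 h2; have ex : exists k, l * x2 <= k.+1%:R * (x1 + x2).
  by exists L; rewrite -natr1; have := l_gt0; nra.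
pose k := ex_minn ex; have [k1 k2 k3] : [/\ l * x2 <= k.+1%:R * (x1 + x2), (k < L)%N & k%:R * (x1 + x2) <= l * x2].
  rewrite /k; case: ex_minnP => m Hm min; have mL : (m < L)%N.
    suff : (m <= L.-1)%N by lia.
    by apply: min; rewrite prednK //; have := l_gt0; nra.
  split=> //; case: m Hm min mL => [|m] Hm min mL; first by rewrite mul0r mulr_ge0 // ltW.
  by rewrite leNgt; apply/negP => /ltW /min; rewrite ltnn.
rewrite -natr1 in k1; exists k.+1, (x1 + x2 - (l * x2 - k%:R * (x1 + x2))), (l * x2 - k%:R * (x1 + x2)).
split; [lia | lra | lra | ring |].
by rewrite sp_mid ?k2 // -natr1; apply: row3P; rewrite !row3E //; fld.
Qed.

Definition corner a : V3 := if start a then pos (side_of a) else pos (side_of a).+1.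
Definition mid a : V3 := sp (side_of a) 2%:R^-1 2%:R^-1.
(** The flag drawn in the polygon, as half of its side coned from the centre. *)
Definition wedge a (y : V3) : V3 := y 0 o0 *: corner a + y 0 o1 *: mid a + y 0 o2 *: ctr.

Lemma wedge_start a y : start a -> wedge a y = sp (side_of a) (y 0 o0 + y 0 o1 / 2) (y 0 o1 / 2) + y 0 o2 *: ctr.
Proof. by move=> sa; rewrite /wedge /corner sa /mid /sp; apply/rowP => i; rewrite !mxE; field. Qed.

Lemma wedge_end a y : ~~ start a -> wedge a y = sp (side_of a) (y 0 o1 / 2) (y 0 o0 + y 0 o1 / 2) + y 0 o2 *: ctr.
Proof. by move=> sa; rewrite /wedge /corner (negbTE sa) /mid /sp; apply/rowP => i; rewrite !mxE; field. Qed.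

Lemma mid_tau0 a : mid (tau o0 a) = mid a.
Proof. by rewrite /mid side_of_tau0. Qed.

Lemma corner_tau1 a : corner (tau o1 a) = corner a.
Proof.
suff H b : ~~ start b -> corner (tau o1 b) = corner b.
  have [sa|sa] := boolP (start a); last exact: H.
  by have := H (tau o1 a); rewrite tauK start_tau sa => /(_ isT) ->.
move=> sb; rewrite /corner start_tau (negbTE sb) /=.
have E : tau o1 b = side_flag (side_of b).+1.
  by rewrite /side_flag /= -/(side_flag _) side_flag_of (negbTE sb) /rho tauK.
have [lt|ge] := ltnP (side_of b).+1 L.+2; first by rewrite E side_of_flag.
have -> : (side_of b).+1 = L.+2 by apply/eqP; rewrite eqn_leq ge side_of_lt.
have -> : tau o1 b = side_flag 0.
  by rewrite E (_ : (side_of b).+1 = L.+2) ?side_flag_last //; apply/eqP; rewrite eqn_leq ge side_of_lt.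
by rewrite side_of_flag // /pos /= ?eqSS eqxx.
Qed.

Lemma wedge_tau0 a (y : V3) : y 0 o0 = 0 -> wedge (tau o0 a) y = wedge a y.
Proof. by move=> y0; rewrite /wedge y0 !scale0r mid_tau0. Qed.

Lemma wedge_tau1 a (y : V3) : y 0 o1 = 0 -> wedge (tau o1 a) y = wedge a y.
Proof. by move=> y1; rewrite /wedge y1 !scale0r corner_tau1. Qed.

Lemma wedge_parts a y : simplex R 2 y -> exists u v, [/\ 0 <= u, 0 <= v, u + v = y 0 o0 + y 0 o1,
  wedge a y = sp (side_of a) u v + y 0 o2 *: ctr & if start a then u = y 0 o0 + y 0 o1 / 2 /\ v = y 0 o1 / 2
    else u = y 0 o1 / 2 /\ v = y 0 o0 + y 0 o1 / 2].
Proof.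
move=> /simplex2P[h0 h1 h2 _]; have [sa|sa] := boolP (start a).
  rewrite wedge_start //; exists (y 0 o0 + y 0 o1 / 2), (y 0 o1 / 2); split; [lra | lra | lra | by [] | by split].
rewrite wedge_end //; exists (y 0 o1 / 2), (y 0 o0 + y 0 o1 / 2); split; [lra | lra | lra | by [] | by split].
Qed.

Lemma ctr_add j u v h i : (sp j u v + h *: ctr) 0 i = sp j u v 0 i + h / 3.
Proof. by rewrite !mxE; case: ifP => _ //; case: ifP. Qed.

(** A border point has a zero coordinate, so the weight of the centre is three times the smallest
    coordinate of the sum. *)
Lemma spc_inj j j' u v u' v' h h' : (j < L.+2)%N -> (j' < L.+2)%N -> 0 <= u -> 0 <= v -> 0 <= u' -> 0 <= v' ->
  sp j u v + h *: ctr = sp j' u' v' + h' *: ctr -> h = h' /\ sp j u v = sp j' u' v'.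
Proof.
move=> jL jL' u0 v0 u0' v0' E; have H i : sp j u v 0 i + h / 3 = sp j' u' v' 0 i + h' / 3 by rewrite -!ctr_add E.
have [i Ei] := sp_zero u v jL; have [i' Ei'] := sp_zero u' v' jL'.
have hh : h = h'.
  have := H i; have := H i'; rewrite Ei Ei'; have := sp_ge0 i jL' u0' v0'; have := sp_ge0 i' jL u0 v0.
  lra.
by split=> //; apply/rowP => k; have := H k; rewrite hh; lra.
Qed.

Lemma flag_step a i y : simplex R 2 y -> y 0 i = 0 -> q (tau i a) y = q a y.
Proof.
move=> Sy yi; have [_ _ gqE] := gq; apply/esym/gqE => //; split=> //.
by apply: reach_step; rewrite /zero yi.
Qed.

Lemma side_weights (c : bool) (y0 y1 u v : R) : 0 <= y0 -> 0 <= y1 ->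
  (if c then u = y0 + y1 / 2 /\ v = y1 / 2 else u = y1 / 2 /\ v = y0 + y1 / 2) ->
  [/\ u = 0 -> v = 0 -> y0 = 0 /\ y1 = 0, u = 0 -> v != 0 -> [/\ c = false, y1 = 0 & y0 = v]
    & v = 0 -> u != 0 -> [/\ c = true, y1 = 0 & y0 = u]].
Proof.
have half (x : R) : x / 2 = 0 -> x = 0 by move/eqP; rewrite mulf_eq0 invr_eq0 pnatr_eq0 orbF => /eqP.
have sum0 (x y : R) : 0 <= x -> 0 <= y -> x + y / 2 = 0 -> x = 0 /\ y = 0.
  by move=> x0 y0' /eqP; rewrite paddr_eq0 ?divr_ge0 // => /andP[/eqP -> /eqP/half].
move=> h0 h1; case: c => -[-> ->]; split.
- by move=> /(sum0 _ _ h0 h1)[-> ->].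
- by move=> /(sum0 _ _ h0 h1)[_ ->]; rewrite mul0r eqxx.
- by move=> /half -> _; rewrite mul0r addr0.
- by move=> _ /(sum0 _ _ h0 h1)[-> ->].
- by move=> /half -> _; rewrite mul0r addr0.
- by move=> /(sum0 _ _ h0 h1)[_ ->]; rewrite mul0r eqxx.
Qed.

Lemma same_weights (c c' : bool) (y0 y1 z0 z1 u v : R) : 0 <= y0 -> 0 <= z0 ->
  (if c then u = y0 + y1 / 2 /\ v = y1 / 2 else u = y1 / 2 /\ v = y0 + y1 / 2) ->
  (if c' then u = z0 + z1 / 2 /\ v = z1 / 2 else u = z1 / 2 /\ v = z0 + z1 / 2) ->
  [/\ y0 = z0, y1 = z1 & c != c' -> y0 = 0].
Proof. by move=> y0' z0'; case: c; case: c' => -[e1 e2] [e3 e4]; split=> //; lra. Qed.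

(** Coincidences in the drawing occur within one side, at a corner between consecutive sides, which
    is crossed by [tau o1], or at the centre, where [one_face] relates all flags. *)
Lemma wedge_q a b y z : simplex R 2 y -> simplex R 2 z -> wedge a y = wedge b z -> q a y = q b z.
Proof.
move=> Sy Sz E; have [_ _ gqE] := gq.
have [u [v [u0 v0 uv Ea Ha]]] := wedge_parts a Sy; have [u' [v' [u0' v0' uv' Eb Hb]]] := wedge_parts b Sz.
have la := side_of_lt a; have lb := side_of_lt b.
rewrite Ea Eb in E; have [h2 E'] := spc_inj la lb u0 v0 u0' v0' E.
have [ya yb yc _] := (simplex2P y).1 Sy; have [za zb zc _] := (simplex2P z).1 Sz.
have same : side_of a = side_of b -> a = b \/ a = tau o0 b.
  move=> Es; have := side_flag_of a; rewrite Es side_flag_of.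
  by case: (start a); case: (start b) => H; rewrite -?H ?tauK; [left|right|right|left]; rewrite ?H ?tauK // -(inv_inj (tauK o0) H).
have [Wa0 Wa1 Wa2] := side_weights ya yb Ha; have [Wb0 Wb1 Wb2] := side_weights za zb Hb.
have corner_case c d (x w : V3) : simplex R 2 x -> ~~ start c -> start d -> next (side_of c) (side_of d) ->
    x 0 o1 = 0 -> x = w -> q c x = q d w.
  move=> Sx sc sd /eqP nx x1 <-; rewrite -(flag_step c Sx x1); congr (q _ x).
  have := side_flag_of d; rewrite sd => <-; rewrite nx; case: ifP => [/eqP Es|_].
    have := side_flag_last; rewrite -Es /side_flag /= -/(side_flag _) side_flag_of (negbTE sc) /rho tauK.
    by rewrite /side_flag.
  by rewrite /side_flag /= -/(side_flag _) side_flag_of (negbTE sc) /rho tauK.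
have all0 : u = 0 -> v = 0 -> u' = 0 -> v' = 0 -> q a y = q b z.
  move=> uz vz uz' vz'; have [y0 y1] := Wa0 uz vz; have [z0 z1] := Wb0 uz' vz'.
  apply/gqE => //; split; first by apply: row3P; rewrite ?y0 ?y1 ?z0 ?z1.
  have gem : is_gem tau by move=> i; split=> // c H; have := sgt i c; rewrite H; case: (sg c).
  have sub (i : 'I_3) : i != o2 -> zero y i by move: i; apply: I3P => // _; rewrite /zero ?y0 ?y1 eqxx.
  apply: (reach_sub sub); apply: reach_trans (one_face b); exact: reach_sym.
have [[Es Eu Ev]|[uz vz uz' vz']|[uz vz' Ev nx]|[uz' vz Ev nx]] := sp_inj la lb u0 v0 u0' v0' E'.
- rewrite -Eu -Ev in Hb; have [e0 e1 ne] := same_weights ya za Ha Hb; have yz : y = z by exact: row3P.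
  have [<-|Et] := same Es; first by rewrite yz.
  by rewrite -yz Et flag_step // ne // Et start_tau; case: (start b).
- exact: all0.
- have [vz|vn] := eqVneq v 0; first by apply: all0; rewrite // -Ev.
  have [sa y1 y0] := Wa1 uz vn; rewrite Ev in vn; have [sb z1 z0] := Wb2 vz' vn.
  by apply: corner_case => //; [rewrite sa | apply: row3P; rewrite ?y0 ?y1 ?z0 ?z1].
have [vz'|vn] := eqVneq v' 0; first by apply: all0; rewrite // -Ev.
have [sb z1 z0] := Wb1 uz' vn; rewrite Ev in vn; have [sa y1 y0] := Wa2 vz vn.
by apply/esym; apply: corner_case => //; [rewrite sb | apply: row3P; rewrite ?y0 ?y1 ?z0 ?z1].
Qed.

Lemma spc_simplex j u v h : (j < L.+2)%N -> 0 <= u -> 0 <= v -> 0 <= h -> u + v + h = 1 -> simplex R 2 (sp j u v + h *: ctr).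
Proof.
move=> jL u0 v0 h0 s1; apply/simplex2P; rewrite !ctr_add; have := sp_sum u v jL.
have := sp_ge0 o0 jL u0 v0; have := sp_ge0 o1 jL u0 v0; have := sp_ge0 o2 jL u0 v0.
by split; lra.
Qed.

Lemma wedge_simplex a y : simplex R 2 y -> simplex R 2 (wedge a y).
Proof.
move=> Sy; have [u [v [u0 v0 uv -> _]]] := wedge_parts a Sy; have [ya yb yc y1] := (simplex2P y).1 Sy.
by apply: spc_simplex => //; [exact: side_of_lt | lra].
Qed.

Lemma spc_cell a u v h : start a -> 0 <= u -> 0 <= v -> sp (side_of a) u v + h *: ctr =
  if v <= u then wedge a (row3 (u - v) (2 * v) h) else wedge (tau o0 a) (row3 (v - u) (2 * u) h).
Proof.
move=> sa u0 v0; case: ifP => _.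
  by rewrite wedge_start // !row3E; congr (sp _ _ _ + _); field.
by rewrite wedge_end ?start_tau ?sa // side_of_tau0 !row3E; congr (sp _ _ _ + _); field.
Qed.

Lemma row3_simplex (x y z : R) : 0 <= x -> 0 <= y -> 0 <= z -> x + y + z = 1 -> simplex R 2 (row3 x y z).
Proof. by move=> *; apply/simplex2P; rewrite !row3E. Qed.

Lemma disc_cover z : simplex R 2 z -> exists j u v h,
  [/\ (j < L.+2)%N, [/\ 0 <= u, 0 <= v & 0 <= h], u + v + h = 1 & z = sp j u v + h *: ctr].
Proof.
move=> /simplex2P[z0 z1 z2 zs].
have key j u v h : (j < L.+2)%N -> 0 <= u -> 0 <= v -> 0 <= h -> (forall i, z 0 i = sp j u v 0 i + h / 3) ->
   exists j u v h, [/\ (j < L.+2)%N, [/\ 0 <= u, 0 <= v & 0 <= h], u + v + h = 1 & z = sp j u v + h *: ctr].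
  move=> jL u0 v0 h0 E; exists j, u, v, h; split=> //; last by apply/rowP => i; rewrite ctr_add.
  by have := sp_sum u v jL; have := E o0; have := E o1; have := E o2; lra.
have [/andP[h0 h1]|H0] := boolP ((z 0 o2 <= z 0 o0) && (z 0 o2 <= z 0 o1)).
  apply: (@key 0%N (z 0 o0 - z 0 o2) (z 0 o1 - z 0 o2) (3 * z 0 o2)) => //; try lra.
  by apply: I3P; rewrite sp_first row3E; field.
have [/andP[h0 h1]|H1] := boolP ((z 0 o1 <= z 0 o0) && (z 0 o1 <= z 0 o2)).
  apply: (@key L.+1 (z 0 o2 - z 0 o1) (z 0 o0 - z 0 o1) (3 * z 0 o1)) => //; try lra.
  by apply: I3P; rewrite sp_last row3E; field.
have [h1 h2] : z 0 o0 <= z 0 o1 /\ z 0 o0 <= z 0 o2.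
  by move: H0 H1; rewrite !negb_and -!ltNge => /orP[?|?] /orP[?|?]; split; lra.
have [||j [u [v [/andP[j0 jL] u0 v0 _ E]]]] := @sp_cover (z 0 o1 - z 0 o0) (z 0 o2 - z 0 o0); try lra.
have jL2 : (j < L.+2)%N := leq_ltn_trans jL (leqnSn _).
have h0 : 0 <= 3 * z 0 o0 by lra.
apply: (@key j u v (3 * z 0 o0)) => //.
by rewrite E; apply: I3P; rewrite row3E; field.
Qed.

Lemma wedge_cover z : simplex R 2 z -> exists a y, simplex R 2 y /\ wedge a y = z.
Proof.
move=> /disc_cover[j [u [v [h [jL [u0 v0 h0] s1 ->]]]]].
have Ej := side_of_flag jL; have sj := start_side_flag j.
have := spc_cell h sj u0 v0; rewrite Ej => ->; case: (leP v u) => uv.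
  by exists (side_flag j), (row3 (u - v) (2 * v) h); split=> //; apply: row3_simplex; lra.
by exists (tau o0 (side_flag j)), (row3 (v - u) (2 * u) h); split=> //; apply: row3_simplex; lra.
Qed.

Lemma polygon_map : exists P : V3 -> F, continuous P /\ forall a y, simplex R 2 y -> P (wedge a y) = q a y.
Proof.
apply: (@factor_simplex R F 2 2 G wedge q).
- move=> a; apply: continuous_coordP => i y.
  rewrite (_ : (fun _ => _) = fun y : V3 => y 0 o0 * corner a 0 i + y 0 o1 * mid a 0 i + y 0 o2 * ctr 0 i); last first.
    by apply/funext => z; rewrite !mxE.
  by do ![apply: continuous_addr]; apply: continuous_mulr; first [exact: continuous_coord | exact: continuous_const].
- by have [] := gq.
- exact: wedge_simplex.
- exact: wedge_cover.
exact: wedge_q.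
Qed.

Local Notation V4 := 'rV[R]_4.
(** The projection of the k-th fan tetrahedron to the polygon: [p0], [p1], [p2] span the triangle
    between the first corner and side k.+1, and [p3], on the other end, lies over the centre. *)
Definition pt (k : nat) (w : V4) : V3 := w 0 p0 *: row3 1 0 0 + sp k.+1 (w 0 p1) (w 0 p2) + w 0 p3 *: ctr.

Lemma sum4 (f : 'I_4 -> R) : \sum_i f i = f p0 + f p1 + f p2 + f p3.
Proof. by rewrite big4 /= !addrA. Qed.

Lemma simplex3P (w : V4) : simplex R 3 w <->
  [/\ [/\ 0 <= w 0 p0, 0 <= w 0 p1, 0 <= w 0 p2 & 0 <= w 0 p3] & w 0 p0 + w 0 p1 + w 0 p2 + w 0 p3 = 1].
Proof.
split=> [[H1 H2]|[[H0 H1 H2 H3] H4]]; first by rewrite -sum4.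
by split; [apply: I4P | rewrite sum4].
Qed.

Lemma row4P (w w' : V4) : w 0 p0 = w' 0 p0 -> w 0 p1 = w' 0 p1 -> w 0 p2 = w' 0 p2 -> w 0 p3 = w' 0 p3 -> w = w'.
Proof. by move=> *; apply/rowP; apply: I4P. Qed.

Definition row4 (x y z t : R) : V4 := \row_i nth 0 [:: x; y; z; t] (val i).
Lemma row4E x y z t : (row4 x y z t 0 p0 = x) * (row4 x y z t 0 p1 = y) * (row4 x y z t 0 p2 = z) * (row4 x y z t 0 p3 = t).
Proof. by rewrite !mxE. Qed.

Lemma pt_coord k w : (k < L)%N ->
  [/\ pt k w 0 o0 = w 0 p0 + w 0 p3 / 3,
      pt k w 0 o1 = (w 0 p1 * (l - k%:R) + w 0 p2 * (l - k%:R - 1)) / l + w 0 p3 / 3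
    & pt k w 0 o2 = (w 0 p1 * k%:R + w 0 p2 * (k%:R + 1)) / l + w 0 p3 / 3].
Proof. by move=> kL; rewrite /pt sp_mid ?kL // -natr1; split; rewrite !mxE /=; fld. Qed.

Let kfact k : (k < L)%N -> 0 <= k%:R :> R /\ k%:R + 1 <= l.
Proof. by move=> kL; rewrite natr1 ler_nat. Qed.

Lemma pt_ge k w i : (k < L)%N -> simplex R 3 w -> w 0 p3 / 3 <= pt k w 0 i.
Proof.
move=> kL /simplex3P[[w0 w1 w2 w3] _]; have [E0 E1 E2] := pt_coord w kL; have [k0 k1] := kfact kL.
have H (x : R) : 0 <= x -> 0 <= x / l by move=> ?; apply: divr_ge0 => //; exact: ltW.
move: i; apply: I3P; rewrite ?E0 ?E1 ?E2; first lra.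
  by rewrite lerDr; apply: H; apply: addr_ge0; apply: mulr_ge0 => //; lra.
by rewrite lerDr; apply: H; apply: addr_ge0; apply: mulr_ge0 => //; lra.
Qed.

Lemma pt_sum k w : (k < L)%N -> pt k w 0 o0 + pt k w 0 o1 + pt k w 0 o2 = w 0 p0 + w 0 p1 + w 0 p2 + w 0 p3.
Proof. by move=> /(pt_coord w)[-> -> ->]; fld. Qed.

Lemma pt_simplex k w : (k < L)%N -> simplex R 3 w -> simplex R 2 (pt k w).
Proof.
move=> kL Sw; have /simplex3P[[w0 w1 w2 w3] ws] := Sw; apply/simplex2P; have Gi i := pt_ge i kL Sw.
by have := pt_sum w kL; have := Gi o0; have := Gi o1; have := Gi o2; split; lra.
Qed.

Lemma wedge_min a y : simplex R 2 y -> exists i, wedge a y 0 i = y 0 o2 / 3.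
Proof.
move=> Sy; have [u [v [_ _ _ -> _]]] := wedge_parts a Sy.
have [i Ei] := sp_zero u v (side_of_lt a).
by exists i; rewrite ctr_add Ei add0r.
Qed.

Lemma wedge_ge a y i : simplex R 2 y -> y 0 o2 / 3 <= wedge a y 0 i.
Proof.
move=> Sy; have [u [v [u0 v0 _ -> _]]] := wedge_parts a Sy.
by rewrite ctr_add lerDr sp_ge0 // side_of_lt.
Qed.

(** All coordinates of the projection are at least a third of the weight of [p3], while the smallest
    coordinate of a wedge point is y2 / 3. *)
Lemma pt_height k w a y : (k < L)%N -> simplex R 3 w -> simplex R 2 y -> pt k w = wedge a y -> w 0 p3 <= y 0 o2.
Proof. by move=> kL Sw Sy E; have [i Ei] := wedge_min a Sy; have := pt_ge i kL Sw; rewrite E Ei; lra. Qed.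

(** Since s <= y2, removing s times the centre leaves nonnegative coordinates, and [sp_cover] finds
    the triangle of the fan. *)
Lemma fan_cover a y s : simplex R 2 y -> 0 <= s <= y 0 o2 ->
  exists k w, [/\ (k < L)%N, simplex R 3 w, w 0 p3 = s & pt k w = wedge a y].
Proof.
move=> Sy /andP[s0 sy]; have Gi i := wedge_ge a i Sy.
have G0 := Gi o0; have G1 := Gi o1; have G2 := Gi o2.
have [||[|j] [u [v [j0 u0 v0 uv E]]]] := @sp_cover (wedge a y 0 o1 - s / 3) (wedge a y 0 o2 - s / 3) => //; try lra.
have /simplex2P[c0 c1 c2 cs] := wedge_simplex a Sy.
exists j, (row4 (wedge a y 0 o0 - s / 3) u v s); rewrite /pt !row4E E; split=> //.
  by apply/simplex3P; rewrite !row4E; split; [split|]; lra.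
by move: (wedge a y) => z; apply: row3P; rewrite !mxE /=; field.
Qed.

Lemma pt_inj k k' w w' : (k < L)%N -> (k' < L)%N -> simplex R 3 w -> simplex R 3 w' -> w 0 p3 = w' 0 p3 ->
  pt k w = pt k' w' -> w 0 p0 = w' 0 p0 /\
  [\/ [/\ k = k', w 0 p1 = w' 0 p1 & w 0 p2 = w' 0 p2], [/\ w 0 p1 = 0, w 0 p2 = 0, w' 0 p1 = 0 & w' 0 p2 = 0],
     [/\ w 0 p1 = 0, w' 0 p2 = 0, w 0 p2 = w' 0 p1 & k' = k.+1] | [/\ w' 0 p1 = 0, w 0 p2 = 0, w' 0 p2 = w 0 p1 & k = k'.+1]].
Proof.
move=> kL kL' Sw Sw' E3 E; have [E0 _ _] := pt_coord w kL; have [E0' _ _] := pt_coord w' kL'.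
have W0 : w 0 p0 = w' 0 p0 by have := congr1 (fun m : V3 => m 0 o0) E; rewrite E0 E0' E3; lra.
split=> //; move: E; rewrite /pt E3 W0 => /addIr/addrI.
have /simplex3P[[_ w1 w2 _] _] := Sw; have /simplex3P[[_ w1' w2' _] _] := Sw'.
case/sp_inj => //; try lia.
- by move=> [[->] ? ?]; constructor 1.
- by constructor 2.
- by move=> [? ? ?]; rewrite /next ifN => [/eqP[->]|]; [constructor 3 | lia].
- by move=> [? ? ?]; rewrite /next ifN => [/eqP[->]|]; [constructor 4 | lia].
Qed.

(* The facet of the fan lying on side j: its tetrahedron, and its vertices listed as
   start of the side, end of the side, apex, opposite vertex. *)
Definition side_tet j : nat := if (j == 0)%N then 0%N else if (j == L.+1)%N then L.-1 else j.-1.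
Definition side_verts j : seq 'I_4 := if (j == 0)%N then [:: p0; p1; p3; p2]
  else if (j == L.+1)%N then [:: p2; p0; p3; p1] else [:: p1; p2; p3; p0].

Lemma side_tet_lt j : (j < L.+2)%N -> (side_tet j < L)%N.
Proof. by rewrite /side_tet; case: ifP => //; case: ifP => // *; lia. Qed.

Lemma pt_side j (w : V4) : (j < L.+2)%N -> w 0 (nth p0 (side_verts j) 3) = 0 ->
  pt (side_tet j) w = sp j (w 0 (nth p0 (side_verts j) 0)) (w 0 (nth p0 (side_verts j) 1)) + w 0 p3 *: ctr.
Proof.
have add (m m' : V3) : m = m' -> m + w 0 p3 *: ctr = m' + w 0 p3 *: ctr by move=> ->.
move=> jL; have [->|->|jm] := side_cases jL; rewrite /pt /side_tet /side_verts /=.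
- by move=> w2; apply: add; rewrite w2 sp_first sp_mid //; apply: row3P; rewrite !mxE /=; fld.
- rewrite eqxx /= => w1; apply: add; rewrite w1 sp_last prednK // sp_mid ?leqnn ?L_gt0 //.
  by apply: row3P; rewrite !mxE /=; fld.
have -> : (j == 0)%N = false by lia.
have -> : (j == L.+1)%N = false by lia.
by move=> /= w0; apply: add; rewrite w0 scale0r add0r prednK //; lia.
Qed.

Lemma wedge_step i c (y : V3) : y 0 i = 0 -> i != o2 -> wedge (tau i c) y = wedge c y.
Proof.
move=> yi i2; have [Ei|Ei] : i = o0 \/ i = o1 by move: i i2 {yi}; apply: I3P => // _; [left|right].
  by rewrite Ei in yi *; exact: (wedge_tau0 c yi).
by rewrite Ei in yi *; exact: (wedge_tau1 c yi).
Qed.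

Section PolygonMap.
Variable P : V3 -> F.
Hypothesis PE : forall a y, simplex R 2 y -> P (wedge a y) = q a y.
Hypothesis tau02 : forall a, tau o0 a <> tau o2 a.

(** An open side is not folded in F. Its halves are the flags b and [tau o0 b], and colour 2, the
    only identification at its inner points away from the middle, does not lead from one to the
    other by [tau02]. *)
Lemma side_inj j u v u' v' : (j < L.+2)%N -> 0 <= u -> 0 <= v -> 0 <= u' -> 0 <= v' -> u + v = 1 -> u' + v' = 1 ->
  (u == 0) = (u' == 0) -> (v == 0) = (v' == 0) -> P (sp j u v) = P (sp j u' v') -> u = u'.
Proof.
move=> jL u0 v0 u0' v0' s1 s1' zu zv E; apply: contrapT => /eqP ne.
have Ej := side_of_flag jL; have sj := start_side_flag j; set b := side_flag j in Ej sj.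
have S1 : v <= u -> simplex R 2 (row3 (u - v) (2 * v) 0) by move=> *; apply: row3_simplex; lra.
have S2 : u <= v -> simplex R 2 (row3 (v - u) (2 * u) 0) by move=> *; apply: row3_simplex; lra.
have S1' : v' <= u' -> simplex R 2 (row3 (u' - v') (2 * v') 0) by move=> *; apply: row3_simplex; lra.
have S2' : u' <= v' -> simplex R 2 (row3 (v' - u') (2 * u') 0) by move=> *; apply: row3_simplex; lra.
have [_ _ gqE] := gq.
have key c d (x y : R) (z : V3) : x != 0 -> y != 0 -> simplex R 2 (row3 x y 0) -> simplex R 2 z -> q c (row3 x y 0) = q d z ->
    z = row3 x y 0 /\ (d = c \/ d = tau o2 c).
  move=> x0 y0 Sx Sz /gqE[] // <- H; split=> //.
  apply: (reach_ind (P := fun d => d = c \/ d = tau o2 c)) H _; last by left.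
  move=> i e; rewrite /zero; move: i; apply: I3P; rewrite row3E ?(negbTE x0) ?(negbTE y0) // => _ [] ->; [by right | by left; rewrite tauK].
have n1 : tau o0 b <> b by move=> H; have := sgt o0 b; rewrite H; case: (sg b).
have n2 := @tau02 b.
have n3 : tau o2 (tau o0 b) <> b by move=> H; apply: n2; rewrite -{2}H tauK.
have eqrow (x y x' y' : R) : row3 x y 0 = row3 x' y' 0 -> x = x'.
  by move=> H; have := congr1 (fun m : V3 => m 0 o0) H; rewrite !row3E.
have := spc_cell 0 sj u0 v0; have := spc_cell 0 sj u0' v0'; rewrite Ej !scale0r !addr0 => H' H.
have inj0 c (y z : V3) : simplex R 2 y -> simplex R 2 z -> q c y = q c z -> y = z by move=> Sy Sz /gqE[].
have nz (x : R) : 0 < x -> x != 0 by move=> ?; rewrite gt_eqF.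
move: E; rewrite H H'; clear H H'; case: (leP v u) => uv; case: (leP v' u') => uv'.
- have Sa := S1 uv; have Sb := S1' uv'; rewrite !PE // => /(inj0 _ _ _ Sa Sb) /eqrow ?; move/eqP: ne; apply; lra.
- have v1 : 0 < v by rewrite lt_def v0 andbT zv gt_eqF //; lra.
  have Sa := S1 uv; have Sb := S2' (ltW uv'); rewrite !PE // => /esym Eq.
  have u1 : 0 < u' by rewrite lt_def u0' andbT -zu gt_eqF //; lra.
  have X : v' - u' != 0 by apply: nz; lra.
  have Y : 2 * u' != 0 by apply: nz; lra.
  by have [_ [/esym|/esym]] := key _ _ _ _ _ X Y Sb Sa Eq.
- have u1 : 0 < u by rewrite lt_def u0 andbT zu gt_eqF //; lra.
  have Sa := S2 (ltW uv); have Sb := S1' uv'; rewrite !PE // => Eq.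
  have X : v - u != 0 by apply: nz; lra.
  have Y : 2 * u != 0 by apply: nz; lra.
  by have [_ [/esym|/esym]] := key _ _ _ _ _ X Y Sa Sb Eq.
have Sa := S2 (ltW uv); have Sb := S2' (ltW uv'); rewrite !PE // => /(inj0 _ _ _ Sa Sb) /eqrow ?; move/eqP: ne; apply; lra.
Qed.

Lemma side_of_pt k w w' : (k < L)%N -> simplex R 3 w -> simplex R 3 w' -> (forall i, (w 0 i == 0) = (w' 0 i == 0)) ->
  w 0 p3 = 0 -> (exists i, pt k w 0 i = 0) -> w = w' \/ exists j (i1 i2 : 'I_4), [/\ (j < L.+2)%N,
    pt k w = sp j (w 0 i1) (w 0 i2), pt k w' = sp j (w' 0 i1) (w' 0 i2),
    w 0 i1 + w 0 i2 = 1 /\ w' 0 i1 + w' 0 i2 = 1 & w 0 i1 = w' 0 i1 -> w = w'].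
Proof.
move=> kL Sw Sw' zz w3 [i Ei]; have /simplex3P[[h0 h1 h2 h3] hs] := Sw; have /simplex3P[[h0' h1' h2' h3'] hs'] := Sw'.
have zt j : w 0 j = 0 -> w' 0 j = 0 by move=> H; apply/eqP; rewrite -zz H.
have w3' := zt _ w3.
have onside j : (j < L.+2)%N -> side_tet j = k -> w 0 (nth p0 (side_verts j) 3) = 0 -> nth p0 (side_verts j) 2 = p3 ->
   perm_eq (side_verts j) I4 ->
   w = w' \/ exists j (i1 i2 : 'I_4), [/\ (j < L.+2)%N,
    pt k w = sp j (w 0 i1) (w 0 i2), pt k w' = sp j (w' 0 i1) (w' 0 i2),
    w 0 i1 + w 0 i2 = 1 /\ w' 0 i1 + w' 0 i2 = 1 & w 0 i1 = w' 0 i1 -> w = w'].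
  move=> jL Ek z3 E2 pv; right; exists j, (nth p0 (side_verts j) 0), (nth p0 (side_verts j) 1); split=> //.
  - by rewrite -Ek pt_side // w3 scale0r addr0.
  - by rewrite -Ek pt_side ?w3' ?scale0r ?addr0 //; exact: zt.
  - have z3' := zt _ z3; move: z3 z3' E2 pv; rewrite /side_verts; case: ifP => _; [|case: ifP => _] => /= z3 z3' _ _;
      by rewrite -[X in _ = X /\ _]hs -[X in _ /\ _ = X]hs' z3 z3' w3 w3' ?addr0 ?add0r // addrC [in X in _ /\ X]addrC.
  have cn (x y x' y' : R) : x + y = 1 -> x' + y' = 1 -> x = x' -> y = y' by move=> e e' xx; apply: (addrI x); rewrite e xx e'.
  have z3' := zt _ z3; move: z3 z3' E2 pv; rewrite /side_verts; case: ifP => _; [|case: ifP => _] => /= z3 z3' _ _ e;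
    rewrite z3 w3 ?addr0 ?add0r in hs; rewrite z3' w3' ?addr0 ?add0r in hs'; apply: row4P; rewrite ?z3 ?z3' ?w3 ?w3' //.
  - exact: cn hs hs' e.
  - by rewrite addrC in hs; rewrite addrC in hs'; exact: cn hs hs' e.
  exact: cn hs hs' e.
have [E0 E1 E2] := pt_coord w kL; have [k0 k1] := kfact kL.
have kl : 0 <= l - k%:R by rewrite subr_ge0; apply: le_trans k1; rewrite lerDl.
have kl1 : 0 <= l - k%:R - 1 by rewrite -addrA -opprD subr_ge0.
have k01 : 0 <= k%:R + 1 :> R by exact: addr_ge0.
have pos0 (x y : R) : 0 <= x -> 0 <= y -> (x + y) / l = 0 -> x = 0 /\ y = 0.
  move=> x0 y0 /eqP; rewrite mulf_eq0 invr_eq0 (negbTE l_neq0) orbF => /eqP ?; split; lra.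
have vert : w 0 p1 = 0 -> w 0 p2 = 0 -> w = w'.
  by move=> w1 w2; have w1' := zt _ w1; have w2' := zt _ w2; apply: row4P; lra.
move: i Ei; apply: I3P; rewrite ?E0 ?E1 ?E2 w3 mul0r addr0.
- have kL1 : (k == L)%N = false by rewrite ltn_eqF.
  have kL2 : (k.+1 < L.+2)%N by rewrite !ltnS ltnW.
  by move=> w0; apply: (@onside k.+1 kL2); rewrite /side_verts /side_tet /= ?eqSS kL1.
- case/(pos0 _ _ (mulr_ge0 h1 kl) (mulr_ge0 h2 kl1)) => W1 W2.
  have w1 : w 0 p1 = 0 by apply/eqP; move/eqP: W1; rewrite mulf_eq0 => /orP[//|/eqP ?]; lra.
  move/eqP: W2; rewrite mulf_eq0 => /orP[/eqP w2|/eqP kk]; first by left; apply: vert.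
  have kE : k.+1 = L by apply/eqP; rewrite -(eqr_nat R) -natr1; apply/eqP; lra.
  by apply: (@onside L.+1); rewrite /side_verts /side_tet /= ?eqxx -?kE //=.
case/(pos0 _ _ (mulr_ge0 h1 k0) (mulr_ge0 h2 k01)) => W1 W2.
have w2 : w 0 p2 = 0 by apply/eqP; move/eqP: W2; rewrite mulf_eq0 => /orP[//|/eqP ?]; lra.
move/eqP: W1; rewrite mulf_eq0 => /orP[/eqP w1|/eqP kk]; first by left; apply: vert.
have kE : k = 0%N by apply/eqP; rewrite -(eqr_nat R); apply/eqP; lra.
by apply: (@onside 0%N); rewrite /side_verts /side_tet /= ?kE.
Qed.

(** Off the sides of the polygon, points identified in F coincide in the drawing and [pt_inj]
    applies. On a side the weight of [p3] is 0, and [side_inj] treats its inner points. *)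
Lemma pt_face_inj k w w' : (k < L)%N -> simplex R 3 w -> simplex R 3 w' -> (forall i, (w 0 i == 0) = (w' 0 i == 0)) ->
  w 0 p3 = w' 0 p3 -> P (pt k w) = P (pt k w') -> w = w'.
Proof.
move=> kL Sw Sw' zz E3 E; have [a [y [Sy Ea]]] := wedge_cover (pt_simplex kL Sw).
have [b [z [Sz Eb]]] := wedge_cover (pt_simplex kL Sw').
have [_ _ gqE] := gq; move: (E); rewrite -Ea -Eb !PE // => /gqE[] // yz H; subst z.
have [y2|y2] := eqVneq (y 0 o2) 0.
  have w3 : w 0 p3 = 0.
    by have := pt_height kL Sw Sy (esym Ea); rewrite y2; have /simplex3P[[_ _ _ ?] _] := Sw; lra.
  have ex : exists i, pt k w 0 i = 0 by have [i Ei] := wedge_min a Sy; exists i; rewrite -Ea Ei y2 mul0r.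
  have [//|[j [i1 [i2 [jL E1 E2 [s1 s2] HH]]]]] := side_of_pt kL Sw Sw' zz w3 ex; apply: HH.
  apply: (side_inj jL) (zz i1) (zz i2) _ => //; try by [case: Sw | case: Sw'].
  by rewrite -E1 -E2.
have step i c : zero y i -> wedge (tau i c) y = wedge c y.
  move=> zi; apply: wedge_step; first exact: (eqP zi).
  by apply: contraNneq y2 => <-; exact: zi.
have Ec : wedge b y = wedge a y.
  apply: (reach_ind (P := fun c => wedge c y = wedge a y)) H (erefl _) => i c Zi <-; exact: step.
have := pt_inj kL kL Sw Sw' E3; rewrite -Ea -Eb Ec => /(_ erefl)[W0 [[_ W1 W2]|[W1 W2 W1' W2']|[_ _ _ kk]|[_ _ _ kk]]]; try lia.
  exact: (row4P W0 W1 W2 E3).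
exact: (row4P W0 (etrans W1 (esym W1')) (etrans W2 (esym W2')) E3).
Qed.
End PolygonMap.
End Polygon.

(** * Face pairings from matched lists of vertices *)

Section Pairing.
Variables (R : realType) (X : finType) (mate : X * 'I_4 -> option (X * 'I_4)) (fv : X * 'I_4 -> seq 'I_4).
Hypothesis mateK : forall f f', mate f = Some f' -> mate f' = Some f.
Hypothesis mate_irr : forall f f', mate f = Some f' -> f' <> f.
Hypothesis fvP : forall f, perm_eq (fv f) I4.
Hypothesis fv_last : forall f, nth p0 (fv f) 3 = f.2.

(** Mated facets are glued by sending the r-th vertex of one list to the r-th of the other; the
    vertex opposite the facet comes last. *)
Definition transport_vertex f f' v := nth p0 (fv f') (index v (fv f)).

Let fv_in f v : v \in fv f. Proof. by rewrite (perm_mem (fvP f)) mem_I4. Qed.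
Let fv_uniq f : uniq (fv f). Proof. by rewrite (perm_uniq (fvP f)). Qed.
Let fv_size f : size (fv f) = 4%N. Proof. by rewrite (perm_size (fvP f)). Qed.

Let idx_lt f v : (index v (fv f) < 4)%N.
Proof. by have := fv_in f v; rewrite -index_mem fv_size. Qed.

Lemma transport_vertexK f f' : cancel (transport_vertex f f') (transport_vertex f' f).
Proof.
move=> v; rewrite /transport_vertex index_uniq ?nth_index ?fv_uniq ?fv_in //.
by rewrite fv_size idx_lt.
Qed.

Definition facet_perm f f' : 'S_4 := perm (can_inj (transport_vertexK f f')).

Lemma facet_permV f f' : (facet_perm f f')^-1%g = facet_perm f' f.
Proof.
apply/permP => v; apply: (@perm_inj _ (facet_perm f f')).
by rewrite permKV !permE transport_vertexK.
Qed.

Lemma facet_perm_nth f f' r : (r < 4)%N -> facet_perm f f' (nth p0 (fv f) r) = nth p0 (fv f') r.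
Proof. by move=> r4; rewrite permE /transport_vertex index_uniq ?fv_uniq ?fv_size. Qed.

Lemma facet_perm_last f f' : facet_perm f f' f.2 = f'.2.
Proof. by rewrite -!fv_last facet_perm_nth. Qed.

Definition mated (t : 'I_#|X|) (i : 'I_4) : option ('I_#|X| * 'S_4) :=
  if mate (enum_val t, i) is Some f' then Some (enum_rank f'.1, facet_perm (enum_val t, i) f') else None.

Lemma matedP t i t' s : mated t i = Some (t', s) ->
  exists f', [/\ mate (enum_val t, i) = Some f', t' = enum_rank f'.1 & s = facet_perm (enum_val t, i) f'].
Proof. by rewrite /mated; case E: (mate _) => [f'|] // [<- <-]; exists f'. Qed.

Lemma mated_sym t i t' s : mated t i = Some (t', s) -> mated t' (s i) = Some (t, s^-1%g).
Proof.
move=> /matedP[[x' i'] [E -> ->]]; have := mateK E; rewrite /mated enum_rankK /=.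
by rewrite (facet_perm_last (enum_val t, i)) => -> /=; rewrite enum_valK facet_permV.
Qed.

Lemma mated_irr t i t' s : mated t i = Some (t', s) -> (t', s i) <> (t, i).
Proof.
move=> /matedP[[x' i'] [E -> ->]] [Et]; rewrite (facet_perm_last (enum_val t, i)) /= => Ei.
by apply: (mate_irr E); rewrite -Et enum_rankK Ei.
Qed.

Definition mated_pairing : face_pairing 3 #|X| := FacePairing mated_sym mated_irr.

Local Notation pnt x w := (@point_of R 3 #|X| (enum_rank x) w).

Lemma mated_glue x i f' w w' : mate (x, i) = Some f' -> simplex R 3 w -> simplex R 3 w' -> w 0 i = 0 ->
  (forall r, (r < 4)%N -> w' 0 (nth p0 (fv f') r) = w 0 (nth p0 (fv (x, i)) r)) ->
  glue_rel mated_pairing (pnt x w) (pnt f'.1 w').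
Proof.
move=> E Sw Sw' wi H; apply/glue_relP/rst_step; exists i, (facet_perm (x, i) f'); split.
- by rewrite /= /mated /= enum_rankK E.
- by rewrite bary_point_of.
move=> j; rewrite !bary_point_of // -{2}(nth_index p0 (fv_in (x, i) j)) -H ?idx_lt //.
by rewrite permE.
Qed.

Lemma mated_glued (u v : simplices R 3 #|X|) : glued mated_pairing u v -> exists i f',
  [/\ mate (enum_val (tag u), i) = Some f', tag v = enum_rank f'.1, bary u 0 i = 0 &
    forall r, (r < 4)%N -> bary v 0 (nth p0 (fv f') r) = bary u 0 (nth p0 (fv (enum_val (tag u), i)) r)].
Proof.
move=> [i [s [/matedP[f' [E Et Es]] ui H]]]; exists i, f'; split=> // r r4.
by rewrite -H Es facet_perm_nth.
Qed.

Lemma mated_move x i f' w : mate (x, i) = Some f' -> simplex R 3 w -> w 0 i = 0 -> exists w',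
  [/\ simplex R 3 w', forall r, (r < 4)%N -> w' 0 (nth p0 (fv f') r) = w 0 (nth p0 (fv (x, i)) r) &
    glue_rel mated_pairing (pnt x w) (pnt f'.1 w')].
Proof.
move=> E Sw wi; exists (perm_row (facet_perm (x, i) f') w).
have Sw' := perm_row_simplex (facet_perm (x, i) f') Sw.
have H r : (r < 4)%N -> perm_row (facet_perm (x, i) f') w 0 (nth p0 (fv f') r) = w 0 (nth p0 (fv (x, i)) r).
  by move=> r4; rewrite mxE -(facet_perm_nth (x, i) f' r4) permK.
by split=> //; apply: mated_glue E Sw Sw' wi H.
Qed.

Lemma mated_unpaired x i : mated_pairing (enum_rank x) i = None <-> mate (x, i) = None.
Proof. by rewrite /= /mated enum_rankK; case: (mate _). Qed.
End Pairing.

(** * The dual map *)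

Section Dual.
Variables (R : realType) (F : topologicalType) (G : finType) (tau : 'I_3 -> G -> G) (q : G -> 'rV[R]_3 -> F).

(** For [d = true] vertices and faces of the map are exchanged, so the same statements serve the
    fans at both ends. *)
Definition flip (d : bool) (y : 'rV[R]_3) : 'rV[R]_3 := if d then row3 (y 0 o2) (y 0 o1) (y 0 o0) else y.
Definition turn (d : bool) (i : 'I_3) : 'I_3 := if d then (if i == o0 then o2 else if i == o2 then o0 else i) else i.
Definition dtau (d : bool) (i : 'I_3) : G -> G := tau (turn d i).
Definition dq (d : bool) (x : G) (y : 'rV[R]_3) : F := q x (flip d y).

Lemma turnK d : involutive (turn d).
Proof. by case: d => // i; move: i; apply: I3P. Qed.

Lemma flipK d : involutive (flip d).
Proof. by case: d => // y; apply: row3P; rewrite !row3E. Qed.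

Lemma flipE d y i : flip d y 0 i = y 0 (turn d i).
Proof. by case: d => //; move: i; apply: I3P; rewrite row3E. Qed.

Lemma flip_simplex d y : simplex R 2 y -> simplex R 2 (flip d y).
Proof.
case: d => // /simplex2P[h0 h1 h2 h3]; apply/simplex2P; rewrite !row3E; split=> //.
by rewrite -h3; ring.
Qed.

Lemma dtau_gempres d : gempres tau q -> gempres (dtau d) (dq d).
Proof.
move=> [cq sq eq_q]; split.
- move=> x y; apply: (@continuous_comp _ _ _ (flip d) (q x)); last exact: cq.
  apply: continuous_coordP => i z; rewrite (_ : (fun _ => _) = fun y : 'rV[R]_3 => y 0 (turn d i)); first exact: continuous_coord.
  by apply/funext => w; rewrite flipE.
- by move=> x; have [c [y [Sy <-]]] := sq x; exists c, (flip d y); split; [exact: flip_simplex | rewrite /dq flipK].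
move=> x x' y z Sy Sz; rewrite /dq eq_q; try exact: flip_simplex.
have H (Z Z' : 'I_3 -> bool) (t t' : 'I_3 -> G -> G) : (forall i, Z i -> exists j, Z' j /\ t i = t' j) -> reach t Z x x' -> reach t' Z' x x'.
  move=> ZZ Hr; apply: (reach_ind (P := fun c => reach t' Z' x c)) Hr (reach_refl _ _ _) => i c /ZZ[j [Zj ->]] Hc.
  by apply: reach_trans Hc _; exact: reach_step.
split=> -[E Hr].
  move/(inv_inj (flipK d)): (E) => Eyz; split=> //.
  apply: H Hr => i Zi; exists (turn d i); rewrite /dtau turnK; split=> //.
  by move: Zi; rewrite /zero flipE.
rewrite E in Hr *; split=> //; apply: H Hr => i Zi; exists (turn d i); split=> //.
by rewrite /zero flipE turnK.
Qed.
End Dual.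

(** * The triangulation of the cylinder *)

Section Cylinder.
Variables (R : realType) (F : topologicalType) (a b : R) (G : finType) (tau : 'I_3 -> G -> G) (sg : G -> bool).
Variables (q : G -> 'rV[R]_3 -> F) (c0 : G) (K : nat).
Hypothesis ab : a < b.
Hypothesis tauK : forall i, involutive (tau i).
Hypothesis sgt : forall i x, sg (tau i x) = ~~ sg x.
Hypothesis gq : gempres tau q.
Hypothesis tauC : forall x, tau o0 (tau o2 x) = tau o2 (tau o0 x).
Hypothesis tau02 : forall x, tau o0 x <> tau o2 x.
Hypothesis one_cell : forall d x, reach (dtau tau d) (fun i => i != o2) c0 x.
Local Notation L := K.+1.
Hypothesis card_start : #|[pred x | sg x == sg c0]| = L.+2.
Local Notation V3 := 'rV[R]_3.
Local Notation V4 := 'rV[R]_4.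
Local Notation st := (start sg c0).
Local Notation cl d := (@wedge R G (dtau tau d) sg c0 L).
Local Notation so d := (side_of (dtau tau d) sg c0).
Local Notation sf d := (side_flag (dtau tau d) c0).
Local Notation fan := (@pt R L).

Let dK d i : involutive (dtau tau d i). Proof. exact: tauK. Qed.
Let dsg d i x : sg (dtau tau d i x) = ~~ sg x. Proof. exact: sgt. Qed.
Let dgq d : gempres (dtau tau d) (dq q d). Proof. exact: dtau_gempres. Qed.
Let d02 d x : dtau tau d o0 x <> dtau tau d o2 x.
Proof. by case: d; [apply/nesym; exact: tau02 | exact: tau02]. Qed.

(** The other flag of the same orientation on the same edge. [isrep] chooses one of the two, so
    [rep] has one element per edge. *)
Definition iota x := tau o0 (tau o2 x).
Lemma iotaK : involutive iota.
Proof. by move=> x; rewrite /iota [LHS]tauC !tauK. Qed.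
Lemma iota_start x : st (iota x) = st x. Proof. by rewrite /start !sgt negbK. Qed.
Lemma iota_neq x : iota x != x.
Proof. by apply/eqP => H; apply: (@tau02 x); rewrite -{1}H /iota tauK. Qed.

Definition isrep x := st x && (enum_rank x < enum_rank (iota x))%N.
Lemma isrep_or x : st x -> isrep x || isrep (iota x).
Proof.
move=> sx; rewrite /isrep iota_start sx iotaK /= -neq_ltn; apply: contraNneq (iota_neq x) => /val_inj/enum_rank_inj E.
by rewrite -E.
Qed.
Lemma isrep_not x : isrep x -> isrep (iota x) = false.
Proof. by rewrite /isrep iotaK iota_start => /andP[-> H] /=; rewrite ltnNge ltnW. Qed.
Definition rep : finType := {x : G | isrep x}.
Lemma rep_start (x : rep) : st (val x). Proof. by have /andP[] := valP x. Qed.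
Lemma rep_iota (x x' : rep) : iota (val x) <> val x'.
Proof. by move=> H; have := isrep_not (valP x); rewrite H (valP x'). Qed.

Lemma card_rep : (2 * #|{: rep}| = L.+2)%N.
Proof.
rewrite card_sig -card_start.
have <- : (#|[pred x | isrep x]| + #|[pred x | isrep (iota x)]| = #|[pred x | sg x == sg c0]|)%N.
  rewrite -cardUI [X in (_ + X)%N](_ : _ = 0%N) ?addn0; last first.
    by apply: eq_card0 => x; rewrite !inE; apply/negbTE/negP => /andP[/isrep_not ->].
  apply: eq_card => x; rewrite !inE; apply/orP/idP => [[|]|/isrep_or/orP //].
    by move=> /andP[].
  by move=> /andP[+ _]; rewrite iota_start.
have -> : #|[pred x | isrep (iota x)]| = #|[pred x | isrep x]|.
  by rewrite -!sum1_card [RHS](reindex_inj (inv_inj iotaK)).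
by rewrite mul2n addnn.
Qed.

Definition tet : finType := (bool * 'I_L + rep)%type.
(** Names for the facets not on an end, with the fan d they belong to or face. [inl (m, e)] is the
    diagonal between tetrahedra m and m + 1 of the fan, seen from m if e is true; [inr (inl j)] is
    the fan facet at side j; [inr (inr x)] is the facet of an edge tetrahedron at the side starting
    with flag x. [opp] names the same facet from the other tetrahedron. *)
Definition kind : eqType := (bool * ((nat * bool) + (nat + G)))%type.
Definition fk (f : tet * 'I_4) : option kind := match f.1 with
  | inl (d, k) => if f.2 == p3 then None else if f.2 == p0 then Some (d, inr (inl k.+1))
      else if f.2 == p1 then (if k == K :> nat then Some (d, inr (inl L.+1)) else Some (d, inl (val k, true)))
      else if k == 0%N :> nat then Some (d, inr (inl 0%N)) else Some (d, inl (k.-1, false))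
  | inr x => if f.2 == p0 then Some (true, inr (inr (iota (val x)))) else if f.2 == p1 then Some (true, inr (inr (val x)))
      else if f.2 == p2 then Some (false, inr (inr (iota (val x)))) else Some (false, inr (inr (val x)))
  end.
(** At a side the order is that of [side_verts]; at a diagonal the first corner, the other end and
    the apex come first. Mated facets thus correspond entry by entry. *)
Definition fv (f : tet * 'I_4) : seq 'I_4 := match f.1 with
  | inl (d, k) => if f.2 == p3 then I4 else if f.2 == p0 then [:: p1; p2; p3; p0]
      else if f.2 == p1 then (if k == K :> nat then [:: p2; p0; p3; p1] else [:: p0; p2; p3; p1])
      else [:: p0; p1; p3; p2]
  | inr x => if f.2 == p0 then [:: p3; p2; p1; p0] else if f.2 == p1 then [:: p2; p3; p0; p1]
      else if f.2 == p2 then [:: p1; p0; p3; p2] else I4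
  end.
Definition opp (k : kind) : kind := match k with
  | (d, inl (m, e)) => (d, inl (m, ~~ e))
  | (d, inr (inl j)) => (d, inr (inr (sf d j)))
  | (d, inr (inr x)) => (d, inr (inl (so d x)))
  end.
Definition side_facet d j : tet * 'I_4 := (inl (d, inord (side_tet L j)), nth p0 (side_verts L j) 3).
Definition mate f := if fk f is Some k then [pick f' | fk f' == Some (opp k)] else None.

Lemma fvP f : perm_eq (fv f) I4.
Proof. by case: f => -[[d k]|x] i; rewrite /fv /=; move: i; apply: I4P => //=; case: ifP. Qed.
Lemma fv_last f : nth p0 (fv f) 3 = f.2.
Proof. by case: f => -[[d k]|x] i; rewrite /fv /=; move: i; apply: I4P => //=; case: ifP. Qed.

Lemma side_tet_lt' j : (j < L.+2)%N -> (side_tet L j < L)%N.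
Proof. exact: (side_tet_lt R (dK false) (dsg false) (ltn0Sn K) (one_cell false) card_start). Qed.

Lemma side_facetK d j : (j < L.+2)%N -> fk (side_facet d j) = Some (d, inr (inl j)) /\ fv (side_facet d j) = side_verts L j.
Proof.
move=> jL; rewrite /side_facet /fk /fv /= inordK ?side_tet_lt' // /side_tet /side_verts.
case: (eqVneq j 0%N) => [->|j0] //=; case: (eqVneq j L.+1) => [->|j1] /=; first by rewrite eqxx.
by rewrite prednK // lt0n.
Qed.

Lemma fk_valid f k : fk f = Some k -> match k.2 with
  | inl _ => True | inr (inl j) => (j < L.+2)%N | inr (inr x) => st x end.
Proof.
case: f => -[[d m]|x] i; rewrite /fk /=; move: i; apply: I4P => //=; try case: ifP => _; move=> //= [<-] //=; rewrite ?iota_start ?rep_start //.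
by have := ltn_ord m; lia.
Qed.

Lemma oppK f k : fk f = Some k -> opp (opp k) = k.
Proof.
move=> /fk_valid; case: k => d [[m e]|[j|x]] /= H; first by rewrite negbK.
- by rewrite (side_of_flag (dK d) (dsg d) (one_cell d) card_start).
- by rewrite (side_flag_of (dK d) (dsg d) (one_cell d)) H.
Qed.

Lemma opp_neq k : opp k <> k.
Proof. by case: k => d [[m [|]]|[j|x]]. Qed.

Lemma fan_facetK d (m : 'I_L) i k : fk (inl (d, m), i) = Some k -> let f := match k.2 with
  | inl (n, e) => if e then (n, p1) else (n.+1, p2)
  | inr (inl j) => (side_tet L j, nth p0 (side_verts L j) 3) | _ => (0%N, p0) end in
  [/\ d = k.1, val m = f.1 & i = f.2].
Proof.
rewrite /fk /=; move: i; apply: I4P => //=.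
- move=> [<-] /=; rewrite /side_tet /side_verts /= eqSS.
  by rewrite (_ : (m == L :> nat) = false) // ltn_eqF.
- case: ifP => [/eqP mK|_] [<-] //=; rewrite /side_tet /side_verts /= eqxx /=.
  by split.
- case: ifP => [/eqP m0|/negbT m0] [<-]; first by split.
  by split=> //=; rewrite prednK // lt0n.
Qed.

Lemma fk_inj f f' k : fk f = Some k -> fk f' = Some k -> f = f'.
Proof.
case: f => -[[d m]|x] i; case: f' => -[[d' m']|x'] i'; rewrite /fk /=.
- by move=> /fan_facetK[E1 E2 E3] /fan_facetK[E1' E2' E3']; rewrite E1 E1' E3 E3' (val_inj (etrans E2 (esym E2'))).
- by move: i; apply: I4P => //=; move: i'; apply: I4P => //=; do ?case: ifP => _; move=> [<-].
- by move: i; apply: I4P => //=; move: i'; apply: I4P => //=; do ?case: ifP => _; move=> [<-].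
by move: i; apply: I4P => /=; move: i'; apply: I4P => /= -[<-] [] //; try (by move=> /(inv_inj iotaK)/val_inj ->); try (by move=> /val_inj ->);
  try (by move/rep_iota); by move/esym/rep_iota.
Qed.

Lemma edge_ex d x : st x -> exists f, fk f = Some (d, inr (inr x)).
Proof.
move=> /isrep_or/orP[rx|rx].
  by exists (inr (exist _ x rx), if d then p1 else p3); case: d.
by exists (inr (exist _ (iota x) rx), if d then p0 else p2); case: d; rewrite /fk /= iotaK.
Qed.

Lemma fk_opp f k : fk f = Some k -> exists f', fk f' = Some (opp k).
Proof.
move=> E; have := fk_valid E; case: k E => d [[m e]|[j|x]] E /= H; last 2 first.
- by apply: edge_ex; exact: (start_side_flag c0 (dsg d)).
- exists (side_facet d (so d x)); apply: (side_facetK d _).1.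
  exact: (side_of_lt (dK d) (dsg d) (one_cell d) card_start).
case: f E => -[[d' k]|x] i; rewrite /fk /=; move: i; apply: I4P => //=; case: ifP => // /eqP k0 [<- <- <-].
  have kK : (k < K)%N by have := ltn_ord k; lia.
  by exists (inl (d', inord k.+1), p2); rewrite /= inordK ?ltnS.
have kK : (k.-1 < L)%N by have := ltn_ord k; lia.
exists (inl (d', inord k.-1), p1); rewrite /= inordK // ifF //; have := ltn_ord k; lia.
Qed.

Lemma mate_fk f k : fk f = Some k -> exists f', mate f = Some f' /\ fk f' = Some (opp k).
Proof.
move=> E; rewrite /mate E; case: pickP => [f' /eqP E'|none]; first by exists f'.
by have [f' /eqP] := fk_opp E; rewrite none.
Qed.

Lemma mate_some f f' : mate f = Some f' -> exists k, fk f = Some k /\ fk f' = Some (opp k).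
Proof. by rewrite /mate; case E: fk => [k|] //; case: pickP => // f'' /eqP E' [<-]; exists k. Qed.

Lemma mateK f f' : mate f = Some f' -> mate f' = Some f.
Proof.
move=> /mate_some[k [E E']]; have [f'' [-> E'']] := mate_fk E'.
by congr Some; apply: (fk_inj E'' _); rewrite (oppK E).
Qed.

Lemma mate_irr f f' : mate f = Some f' -> f' <> f.
Proof. by move=> /mate_some[k [E E']] H; move: E'; rewrite H E => -[/esym/opp_neq]. Qed.

Lemma mate_None f : mate f = None <-> fk f = None.
Proof.
split=> H; last by rewrite /mate H.
by case E: (fk f) => [k|] //; have [f' []] := mate_fk E; rewrite H.
Qed.

Definition cyl : face_pairing 3 #|{: tet}| := mated_pairing mateK mate_irr fvP fv_last.
Local Notation pnt x w := (@point_of R 3 #|{: tet}| (enum_rank (x : tet)) w).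
Local Notation gl x w x' w' := (glue_rel cyl (pnt x w) (pnt x' w')).

Lemma card_tet : #|{: tet}| = (2 * L + #|{: rep}|)%N.
Proof. by rewrite card_sum card_prod card_bool card_ord. Qed.

Definition hgt_val (s : R) : R := a + (b - a) * Num.min (Num.max s 0) 1.
Lemma hgt_itv s : a <= hgt_val s <= b.
Proof.
rewrite /hgt_val; have : 0 <= Num.min (Num.max s 0) 1 <= 1 by rewrite le_min le_max lexx orbT ler01 ge_min lexx orbT.
move: (Num.min _ _) => t /andP[t0 t1]; have h0 : 0 < b - a by move: ab; lra.
have : 0 <= (b - a) * t by apply: mulr_ge0 => //; exact: ltW.
have : 0 <= (b - a) * (1 - t) by apply: mulr_ge0; [exact: ltW | lra].
by move=> *; apply/andP; split; lra.
Qed.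
Definition hgt (s : R) : set_type `[a, b] := SigSub (itv_in (hgt_itv s)).
Lemma hgt_continuous : continuous hgt.
Proof.
apply: continuous_comp_initial => s; rewrite (_ : set_val \o hgt = hgt_val); last by apply/funext.
apply: continuous_addr; first exact: continuous_const.
apply: continuous_mulr; first exact: continuous_const.
apply: continuous_minr; last exact: continuous_const.
by apply: continuous_maxr; [move=> ?; exact: cvg_id | exact: continuous_const].
Qed.
Lemma hgtE (s : R) : 0 <= s <= 1 -> hgt_val s = a + (b - a) * s.
Proof. by move=> /andP[s0 s1]; rewrite /hgt_val (max_idPl s0) (min_idPl s1). Qed.
Lemma hgt_set s : set_val (hgt s) = hgt_val s. Proof. by []. Qed.
Lemma hgt_inj (s s' : R) : 0 <= s <= 1 -> 0 <= s' <= 1 -> hgt s = hgt s' -> s = s'.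
Proof.
move=> hs hs' /(congr1 (fun u : set_type `[a, b] => set_val u : R)); rewrite !hgt_set !hgtE // => /addrI/mulfI; apply.
by rewrite subr_eq0 gt_eqF.
Qed.
Lemma hgt_surj (u : set_type `[a, b]) : exists2 s : R, 0 <= s <= 1 & hgt s = u.
Proof.
have /andP[ua ub] := itv_val u; have h0 : 0 < b - a by rewrite subr_gt0.
have hs : 0 <= (set_val u - a) / (b - a) <= 1.
  by rewrite ler_pdivrMr // mul1r lerB // andbT; apply: divr_ge0; rewrite ?subr_ge0 // ltW.
exists ((set_val u - a) / (b - a)) => //; apply: val_inj => /=; rewrite hgtE //.
have -> : (b - a) * ((set_val u - a) / (b - a)) = set_val u - a by field; rewrite gt_eqF.
by rewrite addrC subrK.
Qed.

(** The four flags of an edge cut its tetrahedron into four pieces: [sig.1] and [sig.2] say which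
    end of the edge [p0 p1] and of the dual edge [p2 p3] has more weight. [scoord] gives the flag
    coordinates of a point, and [spoint] recovers the point from them and its height s. *)
Definition sector (sig : bool * bool) (w : V4) : Prop :=
  (if sig.1 then w 0 p0 <= w 0 p1 else w 0 p1 <= w 0 p0) /\ (if sig.2 then w 0 p2 <= w 0 p3 else w 0 p3 <= w 0 p2).
Definition sflag (x : G) (sig : bool * bool) : G :=
  (if sig.1 then tau o0 else id) ((if sig.2 then tau o2 else id) x).
Definition scoord (sig : bool * bool) (w : V4) : V3 :=
  row3 (if sig.1 then w 0 p1 - w 0 p0 else w 0 p0 - w 0 p1)
    (2 * (if sig.1 then w 0 p0 else w 0 p1) + 2 * (if sig.2 then w 0 p2 else w 0 p3))
    (if sig.2 then w 0 p3 - w 0 p2 else w 0 p2 - w 0 p3).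
Definition spoint (sig : bool * bool) (y : V3) (s : R) : V4 :=
  row4 (if sig.1 then (1 - s - y 0 o0) / 2 else (1 - s + y 0 o0) / 2) (if sig.1 then (1 - s + y 0 o0) / 2 else (1 - s - y 0 o0) / 2)
    (if sig.2 then (s - y 0 o2) / 2 else (s + y 0 o2) / 2) (if sig.2 then (s + y 0 o2) / 2 else (s - y 0 o2) / 2).

Lemma sector_ex w : exists sig, sector sig w.
Proof.
exists (w 0 p0 <= w 0 p1, w 0 p2 <= w 0 p3); split=> /=; case: ifP => // /negbT; rewrite -ltNge => /ltW //.
Qed.

Lemma scoord_simplex sig w : sector sig w -> simplex R 3 w -> simplex R 2 (scoord sig w).
Proof.
move=> [h1 h2] /simplex3P[[w0 w1 w2 w3] ws]; apply/simplex2P; rewrite !row3E.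
by case: sig h1 h2 => -[] [] /= h1 h2; split; lra.
Qed.

Lemma scoordK sig w : simplex R 3 w -> spoint sig (scoord sig w) (w 0 p2 + w 0 p3) = w.
Proof.
move=> /simplex3P[_ ws]; apply: row4P; rewrite !row4E !row3E; case: sig => -[] [] /=; lra.
Qed.

Lemma spointK sig (y : V3) (s : R) : simplex R 2 y -> y 0 o0 <= 1 - s -> y 0 o2 <= s ->
  [/\ simplex R 3 (spoint sig y s), sector sig (spoint sig y s), scoord sig (spoint sig y s) = y &
   spoint sig y s 0 p2 + spoint sig y s 0 p3 = s].
Proof.
move=> /simplex2P[y0 y1 y2 ys] h1 h2; split.
- by apply/simplex3P; rewrite !row4E; case: sig => -[] [] /=; (split; [split|]); lra.
- by rewrite /sector !row4E; case: sig => -[] [] /=; split; lra.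
- by apply: row3P; rewrite !row3E !row4E; case: sig => -[] [] /=; lra.
by rewrite !row4E; case: sig => -[] [] /=; lra.
Qed.

Lemma sflag_inj (x x' : rep) sig sig' : sflag (val x) sig = sflag (val x') sig' -> x = x' /\ sig = sig'.
Proof.
move=> E; have sx := rep_start x; have sx' := rep_start x'; have := congr1 sg E.
have sgx : sg (val x) = sg (val x') by move: sx sx'; rewrite /start => /eqP -> /eqP ->.
have n1 (y : G) : tau o0 (tau o2 y) <> y by move/eqP: (iota_neq y).
have i0 (y z : G) : tau o0 y = tau o0 z -> y = z by move/(inv_inj (tauK o0)).
have i2 (y z : G) : tau o2 y = tau o2 z -> y = z by move/(inv_inj (tauK o2)).
have ii (y z : rep) : tau o0 (tau o2 (val y)) <> val z by exact: rep_iota.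
have i02 (y z : rep) : tau o0 (val y) <> tau o2 (val z).
  by move=> H; apply: (ii z y); rewrite -H tauK.
move: E; case: sig => -[] []; case: sig' => -[] []; rewrite /sflag /= ?sgt ?negbK sgx; case: (sg _) => // E _;
  try (by move/i0/i2/val_inj: E); try (by move/i0/val_inj: E); try (by move/i2/val_inj: E); try (by move/val_inj: E);
  try (by case: (ii _ _ E)); try (by case: (ii _ _ (esym E))); try (by case: (i02 _ _ E)); by case: (i02 _ _ (esym E)).
Qed.

Lemma sflag_cover y : exists (x : rep) sig, y = sflag (val x) sig.
Proof.
suff H z : st z -> exists (x : rep) sig, sig.1 = sig.2 /\ z = sflag (val x) sig.
  have [sy|sy] := boolP (st y); first by have [x [sig [_ E]]] := H y sy; exists x, sig.
  have [|x [sig [E1 E2]]] := H (tau o0 y); first by rewrite start_tau.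
  exists x, (~~ sig.1, sig.2); rewrite -(tauK o0 y) E2 /sflag /=; case: (sig.1) => //=; rewrite tauK //.
move=> /isrep_or/orP[rz|rz].
  by exists (exist _ z rz), (false, false).
by exists (exist _ (iota z) rz), (true, true); split=> //; rewrite /sflag /= -/(iota _) iotaK.
Qed.

Lemma sflag_tau0 x sig : tau o0 (sflag x sig) = sflag x (~~ sig.1, sig.2).
Proof. by rewrite /sflag; case: sig => -[] c /=; rewrite ?tauK. Qed.
Lemma sflag_tau2 x sig : tau o2 (sflag x sig) = sflag x (sig.1, ~~ sig.2).
Proof. by rewrite /sflag; case: sig => -[] [] /=; rewrite -?tauC ?tauK. Qed.

Lemma half_inj (c c' : bool) (x y x' y' : R) : 0 <= x -> 0 <= x' ->
  (if c then y / 2 else x + y / 2) = (if c' then y' / 2 else x' + y' / 2) ->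
  (if c then x + y / 2 else y / 2) = (if c' then x' + y' / 2 else y' / 2) -> [/\ x = x', y = y' & c != c' -> x = 0].
Proof. by case: c; case: c' => /= *; split=> // *; lra. Qed.

(** On each of the four pieces the map is [q] in flag coordinates; pieces agree on a common wall
    because the coordinate of the crossed colour vanishes there. *)
Lemma quad_map x : exists Q : V4 -> F, continuous Q /\
  forall sig w, sector sig w -> simplex R 3 w -> Q w = q (sflag x sig) (scoord sig w).
Proof.
(* [E sig] maps the standard tetrahedron linearly onto the piece [sig], and [D sig] is its inverse
   there. *)
pose E (sig : bool * bool) (v : V4) : V4 :=
  row4 (if sig.1 then v 0 p1 / 2 else v 0 p0 + v 0 p1 / 2) (if sig.1 then v 0 p0 + v 0 p1 / 2 else v 0 p1 / 2)
    (if sig.2 then v 0 p3 / 2 else v 0 p2 + v 0 p3 / 2) (if sig.2 then v 0 p2 + v 0 p3 / 2 else v 0 p3 / 2).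
pose pr (sig : bool * bool) (v : V4) := q (sflag x sig) (row3 (v 0 p0) (v 0 p1 + v 0 p3) (v 0 p2)).
pose D (sig : bool * bool) (w : V4) : V4 := row4 (if sig.1 then w 0 p1 - w 0 p0 else w 0 p0 - w 0 p1)
  (2 * (if sig.1 then w 0 p0 else w 0 p1)) (if sig.2 then w 0 p3 - w 0 p2 else w 0 p2 - w 0 p3) (2 * (if sig.2 then w 0 p2 else w 0 p3)).
have ED sig w : E sig (D sig w) = w by apply: row4P; rewrite !row4E; case: sig => -[] [] /=; field.
have DS sig w : sector sig w -> simplex R 3 w -> simplex R 3 (D sig w).
  move=> [h1 h2] /simplex3P[[w0 w1 w2 w3] ws]; apply/simplex3P; rewrite !row4E.
  by case: sig h1 h2 => -[] [] /= h1 h2; (split; [split|]); lra.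
have chalf i : continuous (fun v : V4 => v 0 i / 2).
  by apply: continuous_mulr; [exact: continuous_coord | exact: continuous_const].
have csum i j : continuous (fun v : V4 => v 0 i + v 0 j / 2) by apply: continuous_addr; [exact: continuous_coord | exact: chalf].
have [|||||Q [cQ QE]] := @factor_simplex R F 3 3 (bool * bool)%type E pr.
- move=> sig; rewrite /E; case: sig => -[] [] /=; apply: continuous_row => i; move: i; apply: I4P => /=; by [exact: chalf | exact: csum].
- move=> sig v; apply: (@continuous_comp _ _ _ (fun v : V4 => row3 (v 0 p0) (v 0 p1 + v 0 p3) (v 0 p2)) (q (sflag x sig))).
    apply: continuous_row => i; move: i; apply: I3P => /=; try exact: continuous_coord.
    by apply: continuous_addr; exact: continuous_coord.
  by case: gq => cq _ _; exact: cq.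
- move=> sig v /simplex3P[[w0 w1 w2 w3] ws]; apply/simplex3P; rewrite !row4E.
  by case: sig => -[] [] /=; (split; [split|]); lra.
- by move=> z Sz; have [sig Hs] := sector_ex z; exists sig, (D sig z); split; [exact: DS | exact: ED].
- move=> sig sig' v w /simplex3P[[v0 v1 v2 v3] vs] /simplex3P[[w0 w1 w2 w3] ws] EE.
  have H i := congr1 (fun m : V4 => m 0 i) EE; have H0 := H p0; have H1 := H p1; have H2 := H p2; have H3 := H p3.
  rewrite !row4E in H0 H1 H2 H3.
  have [r0 r1 z0] := half_inj v0 w0 H0 H1; have [r2 r3 z2] := half_inj v2 w2 H2 H3.
  have vw : v = w by exact: row4P.
  clear r0 r1 r2 r3; subst w; rewrite /pr; have Sr : simplex R 2 (row3 (v 0 p0) (v 0 p1 + v 0 p3) (v 0 p2)).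
    by apply/simplex2P; rewrite !row3E; split; lra.
  have st0 c : v 0 p0 = 0 -> q (sflag x (~~ c.1, c.2)) (row3 (v 0 p0) (v 0 p1 + v 0 p3) (v 0 p2)) = q (sflag x c) (row3 (v 0 p0) (v 0 p1 + v 0 p3) (v 0 p2)).
    by move=> vz; rewrite -sflag_tau0; apply: (flag_step gq) => //; rewrite row3E.
  have st2 c : v 0 p2 = 0 -> q (sflag x (c.1, ~~ c.2)) (row3 (v 0 p0) (v 0 p1 + v 0 p3) (v 0 p2)) = q (sflag x c) (row3 (v 0 p0) (v 0 p1 + v 0 p3) (v 0 p2)).
    by move=> vz; rewrite -sflag_tau2; apply: (flag_step gq) => //; rewrite row3E.
  have [e1|n1] := eqVneq sig.1 sig'.1; have [e2|n2] := eqVneq sig.2 sig'.2.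
  + by rewrite (surjective_pairing sig) (surjective_pairing sig') e1 e2.
  + have vz := z2 n2.
    by rewrite -(st2 sig vz); congr (q (sflag x _) _); rewrite (surjective_pairing sig') /= e1; congr pair; move: n2; case: (sig.2); case: (sig'.2).
  + have vz := z0 n1.
    by rewrite -(st0 sig vz); congr (q (sflag x _) _); rewrite (surjective_pairing sig') /= e2; congr pair; move: n1; case: (sig.1); case: (sig'.1).
  have vz := z2 n2.
  have vz' := z0 n1.
  rewrite -(st0 sig vz') -(st2 _ vz) /=; congr (q (sflag x _) _); rewrite (surjective_pairing sig'); congr pair.
    by move: n1; case: (sig.1); case: (sig'.1).
  by move: n2; case: (sig.2); case: (sig'.2).
exists Q; split=> // sig w Hs Sw; rewrite -{1}(ED sig w) QE; last exact: DS.
by rewrite /pr /D !row4E /scoord.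
Qed.

Variables (P : bool -> V3 -> F) (Q : G -> V4 -> F).
Hypothesis cP : forall d, continuous (P d).
Hypothesis PE : forall d x y, simplex R 2 y -> P d (cl d x y) = dq q d x y.
Hypothesis cQ : forall x, continuous (Q x).
Hypothesis QE : forall x sig w, sector sig w -> simplex R 3 w -> Q x w = q (sflag x sig) (scoord sig w).

Local Notation pol d k := (inl (d, k) : tet).
Local Notation lev d s := (if d then 1 - s else s).

Definition psi (x : tet) (w : V4) : F * set_type `[a, b] := match x with
  | inl (d, k) => (P d (fan k w), hgt (lev d (w 0 p3)))
  | inr x => (Q (val x) w, hgt (w 0 p2 + w 0 p3)) end.

(* The point w of the tetrahedron x sits over the point y of the flag phi, at height s. *)
Definition over (phi : G) (y : V3) (s : R) (x : tet) (w : V4) : Prop := match x with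
  | inl (d, k) => cl d phi (flip d y) = fan k w /\ s = lev d (w 0 p3)
  | inr x => exists sig, [/\ phi = sflag (val x) sig, sector sig w, y = scoord sig w & s = w 0 p2 + w 0 p3] end.

Lemma over_psi phi y s x w : simplex R 3 w -> simplex R 2 y -> over phi y s x w -> psi x w = (q phi y, hgt s).
Proof.
move=> Sw Sy; case: x => [[d k] [E ->]|x [sig [-> Hs -> ->]]] /=; last by rewrite (QE _ Hs).
by rewrite -E PE ?/dq ?flipK //; exact: flip_simplex.
Qed.

Lemma over_ex x w : simplex R 3 w -> exists phi y (s : R), [/\ simplex R 2 y, 0 <= s <= 1 & over phi y s x w].
Proof.
move=> Sw; have /simplex3P[[w0 w1 w2 w3] ws] := Sw; case: x => [[d k]|x].
  have Sp := pt_simplex (dK d) (dsg d) (ltn0Sn K) (one_cell d) card_start (ltn_ord k) Sw.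
  have [phi [y [Sy E]]] := wedge_cover (dK d) (dsg d) (ltn0Sn K) (one_cell d) card_start Sp.
  exists phi, (flip d y), (lev d (w 0 p3)); split; first exact: flip_simplex.
    by case: (d); apply/andP; split; lra.
  by rewrite /over flipK.
have [sig Hs] := sector_ex w; exists (sflag (val x) sig), (scoord sig w), (w 0 p2 + w 0 p3); split.
- exact: scoord_simplex.
- by apply/andP; split; lra.
by exists sig.
Qed.

Lemma fan_over d phi y (s : R) : simplex R 2 y -> 0 <= s <= 1 -> lev d s <= flip d y 0 o2 ->
  exists k w, simplex R 3 w /\ over phi y s (pol d k) w.
Proof.
move=> Sy s01 H; have H' : 0 <= lev d s <= flip d y 0 o2.
  by rewrite H andbT; case/andP: s01; case: (d) => *; lra.
have [k [w [kL Sw w3 E]]] := fan_cover (dK d) (dsg d) (ltn0Sn K) (one_cell d) card_start phi (flip_simplex d Sy) H'.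
exists (Ordinal kL), w; split=> //; split=> //.
by rewrite w3; case: (d); lra.
Qed.

Lemma quad_over phi (y : V3) (s : R) : simplex R 2 y -> y 0 o0 <= 1 - s -> y 0 o2 <= s ->
  exists (x : rep) w, simplex R 3 w /\ over phi y s (inr x) w.
Proof.
move=> Sy h0 h2; have [x [sig ->]] := sflag_cover phi.
have [S1 S2 S3 S4] := spointK sig Sy h0 h2.
by exists x, (spoint sig y s); split=> //; exists sig.
Qed.

Lemma gl_sym x w x' w' : gl x w x' w' -> gl x' w' x w.
Proof. by rewrite glue_rel_sym. Qed.
Lemma gl_trans x w x' w' x'' w'' : gl x w x' w' -> gl x' w' x'' w'' -> gl x w x'' w''.
Proof. exact: glue_rel_trans. Qed.

Lemma mateE f f' k : fk f = Some k -> fk f' = Some (opp k) -> mate f = Some f'.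
Proof. by move=> E E'; have [f'' [-> E'']] := mate_fk E; congr Some; exact: fk_inj E'' E'. Qed.

Lemma mate_diag d (k k' : 'I_L) : k' = k.+1 :> nat -> mate (pol d k, p1) = Some (pol d k', p2) /\
  fv (pol d k, p1) = [:: p0; p2; p3; p1].
Proof.
move=> E; have kK : (k == K :> nat) = false by have := ltn_ord k'; rewrite E => ?; apply/negbTE; rewrite neq_ltn; apply/orP; left.
split; last by rewrite /fv /= kK.
by apply: (@mateE _ _ (d, inl (val k, true))); rewrite /fk /= ?kK // E.
Qed.

Lemma four (B : nat -> Prop) : B 0%N -> B 1%N -> B 2%N -> B 3%N -> forall r, (r < 4)%N -> B r.
Proof. by move=> ? ? ? ? [|[|[|[|]]]]. Qed.

Lemma diag_gl d (k k' : 'I_L) w w' : k' = k.+1 :> nat -> simplex R 3 w -> simplex R 3 w' ->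
  w 0 p1 = 0 -> w' 0 p2 = 0 -> w 0 p0 = w' 0 p0 -> w 0 p2 = w' 0 p1 -> w 0 p3 = w' 0 p3 -> gl (pol d k) w (pol d k') w'.
Proof.
move=> E Sw Sw' w1 w2' e0 e2 e3; have [M V1] := mate_diag d E.
apply: (mated_glue mateK mate_irr fvP fv_last M Sw Sw' w1).
by rewrite V1; apply: four => /=; rewrite ?w1 ?w2'.
Qed.

Lemma fan_gl d (k k' : 'I_L) w w' : simplex R 3 w -> simplex R 3 w' -> w 0 p3 = w' 0 p3 ->
  fan k w = fan k' w' -> gl (pol d k) w (pol d k') w'.
Proof.
move=> Sw Sw' E3 E.
have chain v : simplex R 3 v -> v 0 p1 = 0 -> v 0 p2 = 0 -> forall n, (n < L)%N -> gl (pol d ord0) v (pol d (inord n)) v.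
  move=> Sv v1 v2; elim=> [|n IH] nL.
    by rewrite (_ : inord 0 = ord0) ?glue_rel_refl //; apply: val_inj; rewrite /= inordK.
  apply: gl_trans (IH (ltnW nL)) _; apply: diag_gl => //; first by rewrite !inordK // ltnW.
  by rewrite v1 v2.
have chain' v : simplex R 3 v -> v 0 p1 = 0 -> v 0 p2 = 0 -> gl (pol d k) v (pol d k') v.
  move=> Sv v1 v2; have C := chain v Sv v1 v2; have := C _ (ltn_ord k); have := C _ (ltn_ord k'); rewrite !inord_val => C1 C2.
  exact: gl_trans (gl_sym C2) C1.
have [E0 [[kk e1 e2]|[e1 e2 e1' e2']|[e1 e2' e2 kk]|[e1' e2 e2' kk]]] :=
  pt_inj (dK d) (dsg d) (ltn0Sn K) (one_cell d) card_start (ltn_ord k) (ltn_ord k') Sw Sw' E3 E.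
- by rewrite (val_inj kk) (row4P E0 e1 e2 E3) glue_rel_refl.
- have <- : w = w' by apply: row4P => //; rewrite ?e1 ?e2 ?e1' ?e2'.
  exact: chain'.
- exact: diag_gl.
by apply: gl_sym; apply: diag_gl.
Qed.

(** The facet towards the fan d that borders the piece [sig], opposite the vertex of smaller
    weight. *)
Definition qf d (sig : bool * bool) : 'I_4 := if d then (if sig.1 then p0 else p1) else (if sig.2 then p2 else p3).
Definition qside d (sig : bool * bool) (x : rep) : G := if (if d then sig.1 else sig.2) then iota (val x) else val x.

Lemma mate_quad d sig x : mate (inr x, qf d sig) = Some (side_facet d (so d (qside d sig x))).
Proof.
apply: (@mateE _ _ (d, inr (inr (qside d sig x)))); first by case: d; case: sig => -[] [].
by apply: (side_facetK d _).1; exact: (side_of_lt (dK d) (dsg d) (one_cell d) card_start).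
Qed.

Lemma spc_start d x (u v h : R) : st x -> cl d x (row3 (u - v) (2 * v) h) = sp L (so d x) u v + h *: ctr R.
Proof. by move=> sx; rewrite (wedge_start _ _ _ sx) !row3E; congr (sp _ _ _ _ + _); field. Qed.

Lemma spc_end d x (u v h : R) : st x -> cl d (dtau tau d o0 x) (row3 (v - u) (2 * u) h) = sp L (so d x) u v + h *: ctr R.
Proof.
move=> sx; rewrite wedge_end ?(start_tau _ (dsg d)) ?sx // (side_of_tau0 _ (dK d) (dsg d)) !row3E.
by congr (sp _ _ _ _ + _); field.
Qed.

Lemma quad_side_over d sig (x : rep) (w w' : V4) : sector sig w -> simplex R 3 w -> w 0 (qf d sig) = 0 ->
  (forall r, (r < 4)%N -> w' 0 (nth p0 (fv (side_facet d (so d (qside d sig x)))) r) = w 0 (nth p0 (fv (inr x, qf d sig)) r)) ->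
  over (sflag (val x) sig) (scoord sig w) (w 0 p2 + w 0 p3) (side_facet d (so d (qside d sig x))).1 w'.
Proof.
move=> Hs Sw wz; have jL : (so d (qside d sig x) < L.+2)%N by exact: (side_of_lt (dK d) (dsg d) (one_cell d) card_start).
rewrite (side_facetK d jL).2 => H.
have sq : st (qside d sig x) by rewrite /qside; case: ifP => _; rewrite ?iota_start rep_start.
have v2 : nth p0 (side_verts L (so d (qside d sig x))) 2 = p3.
  by rewrite /side_verts; case: ifP => _ //; case: ifP.
have H0 := H 0%N isT; have H1 := H 1%N isT; have H2 := H 2%N isT; have H3 := H 3%N isT; rewrite v2 in H2.
have H3' : w' 0 (nth p0 (side_verts L (so d (qside d sig x))) 3) = 0 by rewrite H3 fv_last.
have /simplex3P[_ ws] := Sw.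
have E := pt_side (dK d) (dsg d) (ltn0Sn K) (one_cell d) card_start jL H3'.
rewrite /over /side_facet /= inordK ?side_tet_lt' // E H0 H1 H2; clear E H H0 H1 H3 H3' jL v2.
split; last by clear H2; move: wz; case: (d); case: (sig) => -[] [] /= wz; lra.
move: wz sq; case: d {H2}; case: sig Hs => -[] [] [/= h1 h2] wz sq; rewrite /scoord /sflag /qside /= in sq *.
- rewrite -(@spc_start true) //; congr (cl true _ _); apply: row3P; rewrite !row3E; lra.
- rewrite -(@spc_end true) // (_ : dtau tau true o0 (iota (val x)) = tau o0 (val x)); last by rewrite /dtau /= /iota -tauC tauK.
  congr (cl true _ _); apply: row3P; rewrite !row3E; lra.
- rewrite -(@spc_end true) //; congr (cl true _ _); apply: row3P; rewrite !row3E; lra.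
- rewrite -(@spc_start true) //; congr (cl true _ _); apply: row3P; rewrite !row3E; lra.
- rewrite -(@spc_start false) //; congr (cl false _ _); apply: row3P; rewrite !row3E; lra.
- rewrite -(@spc_end false) //; congr (cl false _ _); apply: row3P; rewrite !row3E; lra.
- rewrite -(@spc_end false) // (_ : dtau tau false o0 (iota (val x)) = tau o2 (val x)); last by rewrite /dtau /= /iota tauK.
  congr (cl false _ _); apply: row3P; rewrite !row3E; lra.
rewrite -(@spc_start false) //; congr (cl false _ _); apply: row3P; rewrite !row3E; lra.
Qed.

Lemma quad_side d sig x w : sector sig w -> simplex R 3 w -> w 0 (qf d sig) = 0 -> exists k w', [/\ simplex R 3 w',
  over (sflag (val x) sig) (scoord sig w) (w 0 p2 + w 0 p3) (pol d k) w' & gl (inr x) w (pol d k) w'].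
Proof.
move=> Hs Sw wz; have [w' [Sw' Hw' G']] := mated_move mateK mate_irr fvP fv_last (mate_quad d sig x) Sw wz.
exists (inord (side_tet L (so d (qside d sig x)))), w'; split=> //.
exact: (quad_side_over Hs Sw wz Hw').
Qed.

Lemma over_height d k phi y s w : simplex R 2 y -> simplex R 3 w -> over phi y s (pol d k) w -> lev d s <= flip d y 0 o2.
Proof.
move=> Sy Sw [E ->].
have := pt_height (dK d) (dsg d) (ltn0Sn K) (one_cell d) card_start (ltn_ord k) Sw (flip_simplex d Sy) (esym E).
by case: (d) => //; rewrite opprB addrC subrK.
Qed.

Lemma over_gl_quad d k x phi y s w w' : simplex R 2 y -> simplex R 3 w -> simplex R 3 w' ->
  over phi y s (pol d k) w -> over phi y s (inr x) w' -> gl (inr x) w' (pol d k) w.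
Proof.
move=> Sy Sw Sw' H [sig [Ep Hs Ey Es]]; have lh := over_height Sy Sw H; have /simplex3P[[w0 w1 w2 w3] ws] := Sw'.
have wz : w' 0 (qf d sig) = 0.
  have g0 : 0 <= w' 0 (qf d sig) by case: (Sw').
  move: lh g0; rewrite Ey Es flipE; case: (d); case: (sig) => -[] [] /=; rewrite row3E => *; lra.
have [k' [w'' [Sw'' H' G']]] := quad_side x Hs Sw' wz; apply: gl_trans G' _.
rewrite -Ep -Ey -Es in H'; case: H' => E1 E2; case: H => E1' E2'; apply: fan_gl => //; last by rewrite -E1 -E1'.
by move: E2 E2'; case: (d) => *; lra.
Qed.

(** Over one point of one flag at one height, tetrahedra of the same fan are glued by [fan_gl], a
    fan and an edge tetrahedron by [over_gl_quad], and the edge tetrahedron is unique by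
    [sflag_inj]. *)
Lemma over_gl phi y s x w x' w' : simplex R 2 y -> simplex R 3 w -> simplex R 3 w' ->
  over phi y s x w -> over phi y s x' w' -> gl x w x' w'.
Proof.
move=> Sy Sw Sw'.
have mixed k k' v v' : simplex R 3 v -> simplex R 3 v' -> over phi y s (pol false k) v -> over phi y s (pol true k') v' ->
    gl (pol false k) v (pol true k') v'.
  move=> Sv Sv' H H'; have h1 := over_height Sy Sv H; have h2 := over_height Sy Sv' H'.
  have /simplex2P[y0 y1 y2 ys] := Sy; rewrite /= row3E in h1 h2.
  (* In both fans y2 >= s and y0 >= 1 - s, hence equality; an edge tetrahedron passes through the
     same point and links them. *)
  have [||xq [wq [Sq Hq]]] := @quad_over phi y s Sy; try lra.
  exact: gl_trans (gl_sym (over_gl_quad Sy Sv Sq H Hq)) (over_gl_quad Sy Sv' Sq H' Hq).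
case: x => [[d k]|x]; case: x' => [[d' k']|x'].
- have [<-|dd] := eqVneq d d'.
    move=> [E1 E2] [E1' E2']; apply: fan_gl => //; last by rewrite -E1 -E1'.
    by move: E2 E2'; case: (d) => *; lra.
  case: d dd; case: d' => // _ H H'; last exact: mixed.
  by apply: gl_sym; exact: mixed.
- by move=> H H'; apply: gl_sym; exact: over_gl_quad H H'.
- by move=> H H'; exact: over_gl_quad H' H.
move=> [sig [Ep Hs Ey Es]] [sig' [Ep' Hs' Ey' Es']].
have [Ex Eg] := sflag_inj (etrans (esym Ep) Ep'); subst x' sig'.
by rewrite -(scoordK sig Sw) -(scoordK sig Sw') -Ey -Ey' -Es -Es' glue_rel_refl.
Qed.

Lemma over_fan_step d k phi (y : V3) (s : R) (w : V4) i : y 0 i = 0 -> turn d i != o2 -> over phi y s (pol d k) w -> over (tau i phi) y s (pol d k) w.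
Proof.
move=> yi ti [E Es]; split; last exact: Es.
rewrite -E -{1}(turnK d i) -/(dtau tau d (turn d i)).
apply: (wedge_step (dK d) (dsg d) (one_cell d) card_start) => //.
by rewrite flipE turnK.
Qed.

Lemma over_quad_step phi y s x w i : simplex R 2 y -> simplex R 3 w -> y 0 i = 0 -> over phi y s (inr x) w ->
  exists x' w', [/\ simplex R 3 w', over (tau i phi) y s x' w' & gl (inr x) w x' w'].
Proof.
move=> Sy Sw yi H; have [sig [Ep Hs Ey Es]] := H; have /simplex3P[[w0 w1 w2 w3] ws] := Sw.
have id_case sig' : tau i phi = sflag (val x) sig' -> sector sig' w -> y = scoord sig' w ->
    exists x' w', [/\ simplex R 3 w', over (tau i phi) y s x' w' & gl (inr x) w x' w'].
  by move=> E1 E2 E3; exists (inr x), w; split; [| exists sig' | rewrite glue_rel_refl].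
move: i yi id_case; apply: I3P => yi id_case.
- apply: (id_case (~~ sig.1, sig.2)); first by rewrite Ep sflag_tau0.
    by move: yi Hs; rewrite Ey /sector row3E; case: (sig) => -[] c /= ? [? ?]; split=> //; lra.
  by move: yi; rewrite Ey row3E => yi; apply: row3P; rewrite !row3E; move: yi; case: (sig) => -[] [] /= *; lra.
- have [||k [w' [Sw' H']]] := @fan_over false phi y s Sy.
  + by rewrite Es; apply/andP; split; lra.
  + by move: yi Hs; rewrite Es Ey !row3E; case: (sig) => -[] [] /= ? [? ?]; lra.
  exists (pol false k), w'; split; [exact: Sw' | exact: over_fan_step | exact: over_gl H H'].
apply: (id_case (sig.1, ~~ sig.2)); first by rewrite Ep sflag_tau2.
  by move: yi Hs; rewrite Ey /sector row3E; case: (sig) => -[] [] /= ? [? ?]; split=> //; lra.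
by move: yi; rewrite Ey row3E => yi; apply: row3P; rewrite !row3E; move: yi; case: (sig) => -[] [] /= *; lra.
Qed.

(** A fan continues over its whole polygon, so only crossing a polygon side leaves it. There the
    point has the height of the end that carries the base of the fan, and an edge tetrahedron
    reaches it. *)
Lemma over_step phi y s x w i : simplex R 2 y -> simplex R 3 w -> y 0 i = 0 -> over phi y s x w ->
  exists x' w', [/\ simplex R 3 w', over (tau i phi) y s x' w' & gl x w x' w'].
Proof.
move=> Sy Sw yi; case: x => [[d k]|x] H; last exact: over_quad_step H.
have [ti|ti] := eqVneq (turn d i) o2; last first.
  by exists (pol d k), w; split; [exact: Sw | exact: over_fan_step | exact: glue_rel_refl].
have yz : flip d y 0 o2 = 0 by rewrite flipE -ti turnK.
have := over_height Sy Sw H; rewrite yz; have /simplex3P[[w0 w1 w2 w3] ws] := Sw; have /simplex2P[y0 y1 y2 ys] := Sy; case: (H) => _ Es.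
move=> lz; have [||xq [wq [Sq Hq]]] := @quad_over phi y s Sy.
- by move: yz lz Es; case: (d) => /=; rewrite ?row3E => *; lra.
- by move: yz lz Es; case: (d) => /=; rewrite ?row3E => *; lra.
have [x' [w' [Sw' H' G']]] := over_quad_step Sy Sq yi Hq; exists x', w'; split; [exact: Sw' | exact: H' | exact: gl_trans (over_gl Sy Sw Sq H Hq) G'].
Qed.

(** Equal images lie in one fibre of [q] at one height. The chain of colours joining the two flags
    is followed through glued points by [over_step], and [over_gl] compares the last points. *)
Lemma psi_inj x w x' w' : simplex R 3 w -> simplex R 3 w' -> psi x w = psi x' w' -> gl x w x' w'.
Proof.
move=> Sw Sw' E; have [phi [y [s [Sy s01 H]]]] := over_ex x Sw; have [phi' [y' [s' [Sy' s01' H']]]] := over_ex x' Sw'.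
move: E; rewrite (over_psi Sw Sy H) (over_psi Sw' Sy' H') => Ep.
have Eq := congr1 fst Ep; have Es := hgt_inj s01 s01' (congr1 snd Ep).
have [_ _ gqE] := gq; have [Ey Hr] := (gqE _ _ _ _ Sy Sy').1 Eq; subst y' s'.
have [x'' [w'' [Sw'' H'' G'']]] : exists x'' w'', [/\ simplex R 3 w'', over phi' y s x'' w'' & gl x w x'' w''].
  apply: (reach_ind (P := fun c => exists x'' w'', [/\ simplex R 3 w'', over c y s x'' w'' & gl x w x'' w''])) Hr _; last first.
    by exists x, w; rewrite glue_rel_refl.
  move=> i c /eqP yi [x1 [w1 [S1 H1 G1]]]; have [x2 [w2 [S2 H2 G2]]] := over_step Sy S1 yi H1.
  by exists x2, w2; split; [exact: S2 | exact: H2 | exact: gl_trans G1 G2].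
exact: gl_trans G'' (over_gl Sy Sw'' Sw' H'' H').
Qed.

Lemma psi_mated_edge (x : rep) i f' w w' k : fk (inr x, i) = Some k -> mate (inr x, i) = Some f' -> simplex R 3 w -> simplex R 3 w' ->
  w 0 i = 0 -> (forall r, (r < 4)%N -> w' 0 (nth p0 (fv f') r) = w 0 (nth p0 (fv (inr x, i)) r)) -> psi (inr x) w = psi f'.1 w'.
Proof.
move=> E M Sw Sw' wi H; have [w0 _] := Sw.
have [d [sig [Ei Hs]]] : exists d sig, i = qf d sig /\ sector sig w.
  have [sig [h1 h2]] := sector_ex w; move: i wi {E M H}; apply: I4P => wi.
  - by exists true, (true, sig.2); split=> //; split=> //=; rewrite wi.
  - by exists true, (false, sig.2); split=> //; split=> //=; rewrite wi.
  - by exists false, (sig.1, true); split=> //; split=> //=; rewrite wi.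
  - by exists false, (sig.1, false); split=> //; split=> //=; rewrite wi.
subst i; move: M; rewrite mate_quad => -[Ef]; rewrite -Ef in H *.
have O := quad_side_over Hs Sw wi H; have Sy := scoord_simplex Hs Sw.
rewrite (over_psi Sw' Sy O); apply: (over_psi Sw Sy); by exists sig.
Qed.

Lemma psi_mated f f' w w' : mate f = Some f' -> simplex R 3 w -> simplex R 3 w' -> w 0 f.2 = 0 ->
  (forall r, (r < 4)%N -> w' 0 (nth p0 (fv f') r) = w 0 (nth p0 (fv f) r)) -> psi f.1 w = psi f'.1 w'.
Proof.
have diag (d : bool) (k : 'I_L) d' (k' : 'I_L) i i' m (v v' : V4) : fk (pol d k, i) = Some (d, inl (m, true)) -> fk (pol d' k', i') = Some (d, inl (m, false)) ->
    v 0 i = 0 -> (forall r, (r < 4)%N -> v' 0 (nth p0 (fv (pol d' k', i')) r) = v 0 (nth p0 (fv (pol d k, i)) r)) -> psi (pol d k) v = psi (pol d' k') v'.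
  move=> E E'; have [_ /= km ip] := fan_facetK E; have [/= dd km' ip'] := fan_facetK E'; subst i i' d'.
  have kk : k' = k.+1 :> nat by rewrite km'; congr _.+1.
  have [_ V1] := mate_diag d kk; rewrite V1 => v1 H.
  have /= H0 := H 0%N isT; have /= H1 := H 1%N isT; have /= H2 := H 2%N isT; have /= H3 := H 3%N isT.
  by rewrite /psi H2; congr (P d _, _); rewrite /pt H0 H1 H2 H3 v1 kk /sp !scale0r add0r addr0.
move=> M Sw Sw' wi H; have [k [E E']] := mate_some M.
have wi' : w' 0 f'.2 = 0 by have := H 3%N isT; rewrite !fv_last wi.
have H' r : (r < 4)%N -> w 0 (nth p0 (fv f) r) = w' 0 (nth p0 (fv f') r) by move=> /H ->.
case: f M wi E H H' => -[[d x]|x] i M wi E H H'; last exact: psi_mated_edge E M Sw Sw' wi H.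
case: f' M E' wi' H H' => -[[d' x']|x'] i' M E' wi' H H'; last by apply/esym; apply: (psi_mated_edge E' (mateK M) Sw' Sw wi' H').
have [Ed _ _] := fan_facetK E; case: k E E' Ed => dk [[m e]|[j|y]] E E' Ed.
- move: Ed => /= Ed; subst dk; case: e E E' => E E'; first by apply: diag E E' wi H.
  have [/= d'E _ _] := fan_facetK E'; subst d'.
  by apply/esym; apply: diag E' E wi' H'.
- by exfalso; move: E'; rewrite /fk /=; clear; move: i'; apply: I4P => //=; case: ifP.
by exfalso; move: E; rewrite /fk /=; clear; move: i; apply: I4P => //=; case: ifP.
Qed.

Local Notation psit := (fun t : 'I_#|{: tet}| => psi (enum_val t)).

Lemma psi_glue u v : psit (tag u) (bary u) = psit (tag v) (bary v) <-> glue_rel cyl u v.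
Proof.
split=> [E|/glue_relP].
  have := psi_inj (bary_simplex u) (bary_simplex v) E.
  by rewrite !enum_valK !point_of_bary.
elim=> {u v} [u v /mated_glued[i [f' [M Et ui H]]]|u|u v _ ->|u v z _ -> _ ->] //.
have := psi_mated M (bary_simplex u) (bary_simplex v) ui H.
by rewrite /= Et enum_rankK.
Qed.

Lemma psi_continuous x : continuous (psi x).
Proof.
have clev d : continuous (fun w : V4 => hgt (lev d (w 0 p3))).
  move=> w; apply: (@continuous_comp _ _ _ (fun w : V4 => lev d (w 0 p3)) hgt); last exact: hgt_continuous.
  move: w; case: d; last exact: continuous_coord.
  by apply: continuous_subr; [exact: continuous_const | exact: continuous_coord].
case: x => [[d k]|x] w.
  apply: (@continuous_pair_at _ _ _ (fun w => P d (fan k w)) (fun w => hgt (lev d (w 0 p3)))); last exact: clev.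
  apply: (@continuous_comp _ _ _ (fan k) (P d)); last exact: cP.
  apply: continuous_coordP => i v; rewrite (_ : (fun _ => _) = fun w : V4 => w 0 p0 * row3 1 0 0 0 i +
    (w 0 p1 * pos R L k.+1 0 i + w 0 p2 * pos R L k.+2 0 i) + w 0 p3 * ctr R 0 i); last by apply/funext => z; rewrite !mxE.
  have cm j c : continuous (fun w : V4 => w 0 j * c) by apply: continuous_mulr; [exact: continuous_coord | exact: continuous_const].
  by apply: continuous_addr; [apply: continuous_addr; [exact: cm | apply: continuous_addr; exact: cm] | exact: cm].
apply: (@continuous_pair_at _ _ _ (Q (val x)) (fun w => hgt (w 0 p2 + w 0 p3))); first exact: cQ.
apply: (@continuous_comp _ _ _ (fun w : V4 => w 0 p2 + w 0 p3) hgt); last exact: hgt_continuous.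
by apply: continuous_addr; exact: continuous_coord.
Qed.

Lemma psi_surj m : exists t w, simplex R 3 w /\ psit t w = m.
Proof.
case: m => z u; have [_ sq _] := gq; have [phi [y [Sy <-]]] := sq z; have [s s01 <-] := hgt_surj u.
suff [x [w [Sw H]]] : exists x w, simplex R 3 w /\ over phi y s x w.
  by exists (enum_rank x), w; split=> //; rewrite enum_rankK; exact: over_psi H.
have [h|h] := leP s (y 0 o2).
  by have [k [w H]] := @fan_over false phi y s Sy s01 h; exists (pol false k), w.
have [h'|h'] := leP (1 - s) (y 0 o0).
  have h2 : 1 - s <= flip true y 0 o2 by rewrite /= row3E.
  by have [k [w H]] := @fan_over true phi y s Sy s01 h2; exists (pol true k), w.
by have [x [w H]] := quad_over phi Sy (ltW h') (ltW h); exists (inr x), w.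
Qed.

Lemma swap_coord (c c' : bool) (u v u' v' : R) : 0 <= u -> 0 <= v -> 0 <= u' -> 0 <= v' -> u + v = u' + v' ->
  (u == 0) = (u' == 0) -> (v == 0) = (v' == 0) -> (if c then u <= v else v <= u) -> (if c' then u' <= v' else v' <= u') ->
  (if c then v - u else u - v) = (if c' then v' - u' else u' - v') ->
  (u = u' /\ v = v') \/ [/\ c != c', (if c then v - u else u - v) != 0, 0 < u & 0 < v].
Proof.
move=> u0 v0 u0' v0' s1 zu zv h h' e; have [cc|nc] := eqVneq c c'.
  by left; move: h h' e; rewrite -cc; clear zu zv; case: c cc => *; split; lra.
have [uv|uv] := eqVneq u v; first by left; move: nc h h' e; clear zu zv; case: c; case: c' => //= *; split; lra.
have sw : u = v' /\ v = u' by move: nc h h' e; clear zu zv; case: c; case: c' => //= *; split; lra.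
right; split=> //.
- by case: (c); rewrite subr_eq0 // eq_sym.
- rewrite lt_def u0 andbT; apply: contraNneq uv => e0; move: zu; rewrite e0 eqxx => /esym/eqP e0'.
  by case: sw => _ ->; rewrite e0'.
rewrite lt_def v0 andbT; apply: contraNneq uv => e0; move: zv; rewrite e0 eqxx => /esym/eqP e0'.
by case: sw => -> _; rewrite e0'.
Qed.

(** Height, zero pattern and flag coordinates determine w up to exchanging the weights of [p0], [p1]
    or of [p2], [p3]. An exchange of unequal weights would change the flag by a colour whose
    coordinate does not vanish. *)
Lemma quad_face_inj (x : rep) w w' : simplex R 3 w -> simplex R 3 w' -> (forall i, (w 0 i == 0) = (w' 0 i == 0)) ->
  psi (inr x) w = psi (inr x) w' -> w = w'.
Proof.
move=> Sw Sw' zz E; have [sig Hs] := sector_ex w; have [sig' Hs'] := sector_ex w'.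
have /simplex3P[[w0 w1 w2 w3] ws] := Sw; have /simplex3P[[w0' w1' w2' w3'] ws'] := Sw'.
have Es : w 0 p2 + w 0 p3 = w' 0 p2 + w' 0 p3.
  by apply: hgt_inj (congr1 snd E); apply/andP; split; lra.
have := congr1 fst E; rewrite /= (QE _ Hs Sw) (QE _ Hs' Sw'); have [_ _ gqE] := gq.
move=> /(gqE _ _ _ _ (scoord_simplex Hs Sw) (scoord_simplex Hs' Sw')).1 [Ey Hr].
have C i := congr1 (fun m : V3 => m 0 i) Ey; have C0 := C o0; have C2 := C o2; rewrite !row3E in C0 C2.
set y := scoord sig w in Hr; have only j : (forall i, i != j -> y 0 i != 0) ->
    sflag (val x) sig' = sflag (val x) sig \/ sflag (val x) sig' = tau j (sflag (val x) sig).
  move=> Hj; apply: (reach_ind (P := fun c => c = sflag (val x) sig \/ c = tau j (sflag (val x) sig))) Hr _; last by left.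
  move=> i c yi; have -> : i = j by apply/eqP; apply: contraTT yi => /Hj.
  by move=> [->|->]; [right | left; rewrite tauK].
have sI (c c' : bool * bool) : sflag (val x) c = sflag (val x) c' -> c = c' by move/sflag_inj => [].
have E01 : w 0 p0 + w 0 p1 = w' 0 p0 + w' 0 p1 by apply: (addIr (w 0 p2 + w 0 p3)); rewrite [in RHS]Es !addrA ws ws'.
have A : w 0 p0 = w' 0 p0 /\ w 0 p1 = w' 0 p1.
  have [//|[n1 y0 h0 h1]] := swap_coord w0 w1 w0' w1' E01 (zz p0) (zz p1) Hs.1 Hs'.1 C0.
  have y1 : y 0 o1 != 0.
    rewrite /y row3E gt_eqF //; apply: ltr_pwDl; first by apply: mulr_gt0; rewrite ?ltr0n //; case: (sig.1).
    by apply: mulr_ge0 => //; case: (sig.2).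
  have yy : y 0 o0 != 0 by rewrite /y row3E.
  have [|/sI e|] := only o2; first by apply: I3P.
    by rewrite e eqxx in n1.
  by rewrite sflag_tau2 => /sI e; rewrite e eqxx in n1.
have B : w 0 p2 = w' 0 p2 /\ w 0 p3 = w' 0 p3.
  have [//|[n1 y0 h0 h1]] := swap_coord w2 w3 w2' w3' Es (zz p2) (zz p3) Hs.2 Hs'.2 C2.
  have y1 : y 0 o1 != 0.
    rewrite /y row3E gt_eqF //; apply: ltr_wpDl; last by apply: mulr_gt0; rewrite ?ltr0n //; case: (sig.2).
    by apply: mulr_ge0 => //; case: (sig.1).
  have yy : y 0 o2 != 0 by rewrite /y row3E.
  have [|/sI e|] := only o0; first by apply: I3P.
    by rewrite e eqxx in n1.
  by rewrite sflag_tau0 => /sI e; rewrite e eqxx in n1.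
by case: A => *; case: B => *; exact: row4P.
Qed.

Lemma psi_face_inj x w w' : simplex R 3 w -> simplex R 3 w' -> (forall i, (w 0 i == 0) = (w' 0 i == 0)) ->
  psi x w = psi x w' -> w = w'.
Proof.
case: x => [[d k]|x] Sw Sw' zz E; last exact: quad_face_inj E.
have /simplex3P[[w0 w1 w2 w3] ws] := Sw; have /simplex3P[[w0' w1' w2' w3'] ws'] := Sw'.
have E3 : w 0 p3 = w' 0 p3.
  have : lev d (w 0 p3) = lev d (w' 0 p3).
    by apply: hgt_inj (congr1 snd E); case: (d); apply/andP; split; lra.
  by case: (d) => *; lra.
have Ef : P d (fan k w) = P d (fan k w') := congr1 fst E.
exact: (pt_face_inj (dK d) (dsg d) (dgq d) (ltn0Sn K) (one_cell d) card_start (PE d) (@d02 d) (ltn_ord k) Sw Sw' zz E3 Ef).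
Qed.

Hypothesis hF : hausdorff_space F.
Hypothesis bF : manifold_boundary R 2 F = set0.

Lemma cylinder_hausdorff : hausdorff_space (F * set_type `[a, b])%type.
Proof.
have sep (Y : topologicalType) (f : F * set_type `[a, b] -> Y) : hausdorff_space Y -> continuous f ->
    forall p p', cluster (nbhs p) p' -> f p = f p'.
  move=> hY cf p p' pp'; apply: hY => A B /cf nA /cf nB.
  by have [z [Az Bz]] := pp' _ _ nA nB; exists (f z).
move=> p p' pp'.
have E1 : p.1 = p'.1 by apply: (sep F fst) pp' => //; move=> z; exact: cvg_fst.
have E2 : (set_val p.2 : R) = set_val p'.2.
  apply: (sep R (fun z => set_val z.2)) pp'; first exact: norm_hausdorff.
  move=> z; apply: (@continuous_comp _ _ _ (fun z : F * set_type `[a, b] => z.2) (fun u : set_type `[a, b] => set_val u : R)).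
    exact: cvg_snd.
  exact: initial_continuous.
by case: p p' E1 E2 {pp'} => p1 p2 [p1' p2'] /= -> /val_inj ->.
Qed.

Lemma cylinder_triangulates : triangulates R cyl (F * set_type `[a, b])%type.
Proof.
have [h [hh hE]] := realization_homeomorphism cylinder_hausdorff (fun t => @psi_continuous (enum_val t)) psi_surj psi_glue.
split.
  move=> u v tuv zz /to_realizationP/psi_glue E; rewrite -(point_of_bary u) -(point_of_bary v) tuv.
  congr (point_of _ _); apply: (psi_face_inj (bary_simplex u) (bary_simplex v) zz (x := enum_val (tag u))).
  by rewrite E tuv.
exists h; split=> //; rewrite (cylinder_boundary ab bF).
have end0 d : set_val (hgt (lev d 0)) = (if d then b else a) :> R.
  rewrite hgt_set hgtE; first by case: d; ring.
  by case: d; apply/andP; split; lra.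
apply/seteqP; split=> [m /= [u [i [Ti ui]] <-]|m /= Hm].
  rewrite hE; have : mate (enum_val (tag u), i) = None.
    by apply: (mated_unpaired mateK mate_irr fvP fv_last (enum_val (tag u)) i).1; rewrite enum_valK.
  move/mate_None; case: (enum_val (tag u)) => [[d k]|x]; rewrite /fk /=; last by move: i {Ti ui}; apply: I4P.
  move: i ui {Ti}; apply: I4P => ui //=; try by case: ifP.
  by rewrite ui end0; case: (d); [right | left].
have [d Ed] : exists d : bool, set_val m.2 = (if d then b else a) :> R.
  by case: Hm => ->; [exists false | exists true].
have [_ sq _] := gq; have [phi [y [Sy Ey]]] := sq m.1.
have l01 : 0 <= lev d (0 : R) <= 1 by case: (d); apply/andP; split; lra.
have [|k [w [Sw H]]] := fan_over phi Sy l01 (d := d).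
  have /simplex2P[_ _ h2 _] := flip_simplex d Sy; apply: le_trans h2; by case: (d); lra.
have w3 : w 0 p3 = 0 by case: H => _; case: (d) => *; lra.
exists (pnt (pol d k) w).
  exists p3; rewrite bary_point_of //; split=> //.
  by apply: (mated_unpaired mateK mate_irr fvP fv_last (pol d k) p3).2; apply/mate_None.
rewrite hE /= enum_rankK bary_point_of // (over_psi Sw Sy H) Ey [RHS]surjective_pairing.
by congr pair; apply: val_inj; rewrite -/(set_val _) -/(set_val m.2); rewrite [LHS](end0 d).
Qed.
(** Two fans of L tetrahedra, and one tetrahedron for each of the (L + 2) / 2 edges. *)
Lemma cylinder_exists m : (2 * m = 4 * L + L.+2)%N ->
  exists T : face_pairing 3 m, triangulates R T (F * set_type `[a, b])%type.
Proof.
move=> Em; have <- : #|{: tet}| = m by have := card_rep; rewrite card_tet; lia.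
by exists cyl; exact: cylinder_triangulates.
Qed.
End Cylinder.

Lemma one_cell_of (G : finType) (tau : 'I_3 -> G -> G) (c0 : G) : nv tau o0 = 1%N -> nv tau o2 = 1%N ->
  forall d x, reach (dtau tau d) (fun i => i != o2) c0 x.
Proof.
move=> v0 v2 d x; have key (i : 'I_3) : nv tau i = 1%N -> reach tau (fun j => j != i) c0 x.
  rewrite /nv => /eqP/cards1P[S ES].
  have H z : vertex tau i z = S by apply/set1P; rewrite -ES; apply: imset_f; rewrite inE.
  have : x \in vertex tau i c0 by rewrite H -(H x) inE; exact: reach_refl.
  by rewrite inE.
have conv (Z : 'I_3 -> bool) : (forall i, Z i -> turn d i != o2) -> reach tau Z c0 x -> reach (dtau tau d) (fun i => i != o2) c0 x.
  move=> HZ Hr; apply: (reach_ind (P := fun c => reach (dtau tau d) (fun i => i != o2) c0 c)) Hr (reach_refl _ _ _) => i c Zi Hc.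
  apply: reach_trans Hc _; have := @reach_step G (dtau tau d) (fun i => i != o2) (turn d i) c (HZ _ Zi).
  by rewrite {2}/dtau turnK.
case: d conv => conv; [apply: conv (key o0 v0) | apply: conv (key o2 v2)] => // i.
by move: i; apply: I3P.
Qed.

Theorem cylinder_upper_bound (R : realType) (F : topologicalType) (g : nat) (a b : R) :
  (0 < g)%N -> closed_orientable_surface R g F -> a < b ->
  exists T : face_pairing 3 (10 * g - 4), triangulates R T (F * set_type `[a, b])%type.
Proof.
move=> g0 hS ab; have [G [tau [sg [q [[[tauK sgt] gq tauC tau02 _] cG v0 v2]]]]] := surface_unicellular g0 hS.
have [[_ _ _ hF bF] _] := hS.
have [c0 _] : exists c : G, c \in G by apply/card_gt0P; rewrite cG; lia.
have one := one_cell_of c0 v0 v2.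
(* [tau o0] exchanges the two orientations, so each has half of the 8 g flags. *)
have cs : #|[pred x | sg x == sg c0]| = (4 * g - 3).+1.+2.
  have : (#|[pred x | sg x == sg c0]| + #|[pred x | sg x == sg c0]| = 8 * g)%N.
    rewrite -{}cG -[RHS](cardC [pred x | sg x == sg c0]); congr addn.
    rewrite -!sum1_card [RHS](reindex_inj (inv_inj (tauK o0))); apply: eq_bigl => x.
    by rewrite !inE sgt; case: (sg x); case: (sg c0).
  lia.
(* The polygon has 4 g sides and is cut into K.+1 = 4 g - 2 triangles. *)
pose K := (4 * g - 3)%N.
have dK d i : involutive (dtau tau d i) by exact: tauK.
have dsg d i x : sg (dtau tau d i x) = ~~ sg x by exact: sgt.
have /choice[P HP] : forall d, exists P : 'rV[R]_3 -> F, continuous P /\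
    forall x y, simplex R 2 y -> P (wedge (dtau tau d) sg c0 K.+1 x y) = dq q d x y.
  by move=> d; exact: (polygon_map (dK d) (dsg d) (dtau_gempres d gq) (ltn0Sn K) (one d) cs).
have /choice[Q HQ] : forall x, exists Q : 'rV[R]_4 -> F, continuous Q /\
    forall sig w, sector sig w -> simplex R 3 w -> Q w = q (sflag tau x sig) (scoord sig w).
  by move=> x; apply: quad_map.
apply: (@cylinder_exists R F a b G tau sg q c0 K ab tauK sgt gq tauC tau02 one cs P Q
  (fun d => (HP d).1) (fun d => (HP d).2) (fun x => (HQ x).1) (fun x => (HQ x).2) hF bF).
by rewrite /K; lia.
Qed.

Theorem theorem25 (R : realType) (g : nat) (F : topologicalType) (a b : R) :
  (1 <= g)%N -> closed_orientable_surface R g F -> a < b ->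
  is_complexity R (F * set_type `[a, b])%type (10 * g - 4)%N.
Proof.
by move=> g1 hF ab; split; [exact: cylinder_upper_bound | exact: cylinder_lower_bound].
Qed.
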